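(* Let $A$ denote either $B$ or $F$, and let $N\in\mathbb{N}$. Then there exists an operator (called an extension operator) $$\mathrm{Ext}_N:\bigcup A^{s(\cdot)}_{p(\cdot),q(\cdot)}(\mathbb{R}^n_+)\longrightarrow\bigcup A^{s(\cdot)}_{p(\cdot),q(\cdot)}(\mathbb{R}^n),$$ where both unions are taken over all $p(\cdot),q(\cdot)\in C^{\log}(\mathbb{R}^n)\cap\mathcal{P}_0(\mathbb{R}^n)$ with $N^{-1}\le p^-$, $N^{-1}\le q^-$ and all $s(\cdot)\in C^{\log}(\mathbb{R}^n)$ with $s^+\le N$, such that for all such $p(\cdot),q(\cdot),s(\cdot)$: (1) the restriction $\mathrm{Ext}_N|_{A^{s(\cdot)}_{p(\cdot),q(\cdot)}(\mathbb{R}^n_+)}$ is continuous (from $A^{s(\cdot)}_{p(\cdot),q(\cdot)}(\mathbb{R}^n_+)$ into $A^{s(\cdot)}_{p(\cdot),q(\cdot)}(\mathbb{R}^n)$); (2) for any $f\in A^{s(\cdot)}_{p(\cdot),q(\cdot)}(\mathbb{R}^n_+)$, $(\mathrm{Ext}_Nf)|_{\mathbb{R}^n_+}=f$.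
   Context: For measurable $g$ on $\mathbb{R}^n$, $g^-$ and $g^+$ denote its essential infimum and supremum. $\mathcal{P}_0(\mathbb{R}^n)$ is the set of measurable $p:\mathbb{R}^n\to(0,\infty)$ with $0<p^-\le p^+<\infty$. $C^{\log}(\mathbb{R}^n)$ is the set of $p:\mathbb{R}^n\to\mathbb{R}$ for which there are $C_{\log}(p)>0$ and $p_\infty\in\mathbb{R}$ with $|p(x)-p(y)|\le C_{\log}(p)/\log(e+|x-y|^{-1})$ ($x\neq y$) and $|p(x)-p_\infty|\le C_{\log}(p)/\log(e+|x|)$. $\|f\|_{L^{p(\cdot)}}=\inf\{\lambda>0:\int(|f(x)|/\lambda)^{p(x)}dx\le1\}$. Mixed quasi-norms of sequences $\{f_j\}_{j\ge0}$ of measurable functions: $\|\{f_j\}\|_{L^{p(\cdot)}(\ell^{q(\cdot)})}=\|(\sum_j|f_j(\cdot)|^{q(\cdot)})^{1/q(\cdot)}\|_{L^{p(\cdot)}}$ and $\|\{f_j\}\|_{\ell^{q(\cdot)}(L^{p(\cdot)})}=\inf\{\mu>0:\sum_{j=0}^\infty\||f_j/\mu|^{q(\cdot)}\|_{L^{p(\cdot)/q(\cdot)}}\le1\}$. $\Phi(\mathbb{R}^n)$ is the collection of systems $\{\theta_j\}_{j\ge0}\subset\mathcal{S}(\mathbb{R}^n)$ with $\operatorname{supp}\theta_0\subset\{|x|\le2\}$, $\operatorname{supp}\theta_j\subset\{2^{j-1}\le|x|\le2^{j+1}\}$ ($j\ge1$), $\sup_{j,x}2^{j|\alpha|}|D^\alpha\theta_j(x)|<\infty$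 for every multi-index $\alpha$, and $\sum_j\theta_j\equiv1$. $\theta(D)f=\mathcal{F}^{-1}[\theta\cdot\mathcal{F}f]$. Fix $\theta\in\Phi(\mathbb{R}^n)$; $B^{s(\cdot)}_{p(\cdot),q(\cdot)}(\mathbb{R}^n)$ (resp. $F^{s(\cdot)}_{p(\cdot),q(\cdot)}(\mathbb{R}^n)$) is the set of $f\in\mathcal{S}'(\mathbb{R}^n)$ for which the quasi-norm $\|\{2^{js(\cdot)}\theta_j(D)f\}_{j\ge0}\|_{\ell^{q(\cdot)}(L^{p(\cdot)})}$ (resp. the same with $L^{p(\cdot)}(\ell^{q(\cdot)})$) is finite. $\mathbb{R}^n_+=\{(x',x_n)\in\mathbb{R}^n:x_n>0\}$. $A^{s(\cdot)}_{p(\cdot),q(\cdot)}(\mathbb{R}^n_+)$ is the set of $f\in\mathcal{D}'(\mathbb{R}^n_+)$ such that $f=g|_{\mathbb{R}^n_+}$ (restriction in the sense of $\mathcal{D}'(\mathbb{R}^n_+)$) for some $g\in A^{s(\cdot)}_{p(\cdot),q(\cdot)}(\mathbb{R}^n)$, with quasi-norm $\|f\|_{A^{s(\cdot)}_{p(\cdot),q(\cdot)}(\mathbb{R}^n_+)}=\inf\{\|g\|_{A^{s(\cdot)}_{p(\cdot),q(\cdot)}}:g\in A^{s(\cdot)}_{p(\cdot),q(\cdot)}(\mathbb{R}^n),\ f=g|_{\mathbb{R}^n_+}\}$. *)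

(* Defs.v *)
From HB Require Import structures.
From mathcomp Require Import all_boot all_order all_algebra.
From mathcomp Require Import all_classical all_reals all_analysis.
From mathcomp Require Import ess_sup_inf.
From mathcomp Require Import complex.

Set Implicit Arguments.
Unset Strict Implicit.
Unset Printing Implicit Defensive.

Import Order.TTheory GRing.Theory Num.Theory.
Import numFieldNormedType.Exports.
Local Open Scope classical_set_scope.
Local Open Scope ring_scope.

Section lebesgue_rV.
Context (R : realType).

(* The sigma-algebra generated by the coordinates is the Borel sigma-algebra. *)
Section borel_rV.
Variable n : nat.

Let coord (i : 'I_n) (x : 'rV[R]_n) : measurableTypeR R := x ord0 i.

Let rV_set0 : g_sigma_preimage coord set0.
Proof. exact: sigma_algebra0. Qed.

Let rV_setC A : g_sigma_preimage coord A -> g_sigma_preimage coord (~` A).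
Proof. exact: sigma_algebraC. Qed.

Let rV_bigcup (F : _^nat) : (forall i, g_sigma_preimage coord (F i)) ->
  g_sigma_preimage coord (\bigcup_i (F i)).
Proof. exact: sigma_algebra_bigcup. Qed.

HB.instance Definition _ := @isMeasurable.Build default_measure_display
  'rV[R]_n (g_sigma_preimage coord) rV_set0 rV_setC rV_bigcup.

Lemma measurable_coord_rV (i : 'I_n) :
  measurable_fun [set: 'rV[R]_n] (fun x : 'rV[R]_n => x ord0 i : measurableTypeR R).
Proof.
move=> _ Y mY; rewrite setTI; apply: sub_sigma_algebra => /=.
rewrite -bigcup_seq/=; exists i => /=; first by rewrite mem_index_enum.
by exists Y => //; rewrite setTI.
Qed.

Lemma measurable_fun_rV d (T : measurableType d) (f : T -> 'rV[R]_n) :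
  (forall i, measurable_fun [set: T] (fun t => f t ord0 i : measurableTypeR R)) ->
  measurable_fun [set: T] f.
Proof.
move=> mf; apply: (measurability (\big[setU/set0]_(i < n)
  preimage_set_system setT (coord i) measurable)) => // A [B].
rewrite -bigcup_seq => -[i /= _ [C mC <-{B}]] <-{A}.
by have := mf i measurableT C mC; rewrite !setTI.
Qed.

End borel_rV.

Section cons.
Variables (n : nat) (mu : {sigma_finite_measure set 'rV[R]_n -> \bar R}).

Definition cons_rV (xv : measurableTypeR R * 'rV[R]_n) : 'rV[R]_n.+1 :=
  row_mx (const_mx xv.1 : 'rV[R]_1) xv.2.

Lemma measurable_cons_rV : measurable_fun setT cons_rV.
Proof.
apply: measurable_fun_rV => i; rewrite /cons_rV.
case: (split_ordP (i : 'I_(1 + n))) => j ->.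
  rewrite [X in measurable_fun _ X](_ : _ = fst); first exact: measurable_fst.
  by apply/funext => xv; rewrite (@row_mxEl R 1 1 n) mxE.
rewrite [X in measurable_fun _ X](_ : _ =
    (fun x : 'rV[R]_n => x ord0 j : measurableTypeR R) \o snd).
  by apply: (measurableT_comp (measurable_coord_rV j)); exact: measurable_snd.
by apply/funext => xv; rewrite (@row_mxEr R 1 1 n).
Qed.

Let leb : {sigma_finite_measure set (measurableTypeR R) -> \bar R} :=
  @lebesgue_measure R.
Let m : {measure set _ -> \bar R} := product_measure1 leb mu.

Definition lebesgue_cons : set 'rV[R]_n.+1 -> \bar R :=
  pushforward (lebesgue_measure \x mu)%E cons_rV.

Let lebesgue_cons0 : lebesgue_cons set0 = 0%E.
Proof. exact: (measure0 m). Qed.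

Let lebesgue_cons_ge0 A : (0 <= lebesgue_cons A)%E.
Proof. exact: (measure_ge0 m). Qed.

Let lebesgue_cons_sigma_additive : semi_sigma_additive lebesgue_cons.
Proof.
move=> F mF tF mUF; rewrite /lebesgue_cons /pushforward preimage_bigcup.
apply: (@measure_semi_sigma_additive _ _ _ m).
- by move=> k; rewrite -[X in measurable X]setTI; exact: measurable_cons_rV.
- apply/trivIsetP => /= i j _ _ ij; rewrite -preimage_setI.
  by move/trivIsetP : tF => /(_ _ _ _ _ ij) ->//; rewrite preimage_set0.
- by rewrite -preimage_bigcup -[X in measurable X]setTI; exact: measurable_cons_rV.
Qed.

HB.instance Definition _ := isMeasure.Build _ _ _ lebesgue_cons
  lebesgue_cons0 lebesgue_cons_ge0 lebesgue_cons_sigma_additive.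

Let lebesgue_cons_sigma_finite : sigma_finite setT lebesgue_cons.
Proof.
have [F TF Foo] : sigma_finite setT m.
  have /sigma_finiteP[A [TA ndA Aoo]] := sigma_finiteT leb.
  have /sigma_finiteP[B [TB ndB Boo]] := sigma_finiteT mu.
  exists (fun k => A k `*` B k).
    rewrite -setXTT TA TB predeqE => -[x y]; split.
      move=> [/= [i _ Aix] [k _ Bky]]; exists (maxn i k) => //; split.
      - by move: x Aix; exact/subsetPset/ndA/leq_maxl.
      - by move: y Bky; exact/subsetPset/ndB/leq_maxr.
    by move=> [i _ []/= ? ?]; split; exists i.
  move=> k; have [? ?] := Aoo k; have [? ?] := Boo k.
  split; first exact: measurableX.
  by rewrite /m /= product_measure1E// lte_mul_pinfty// ge0_fin_numE.
pose head (x : 'rV[R]_n.+1) : measurableTypeR R * 'rV[R]_n :=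
  (x ord0 ord0, \row_j x ord0 (lift ord0 j)).
have headK : cancel head cons_rV.
  move=> x; apply/rowP => i; rewrite /cons_rV /head /=.
  case: (split_ordP (i : 'I_(1 + n))) => j ->.
    by rewrite (@row_mxEl R 1 1 n) mxE; congr (x _ _); apply/val_inj; rewrite /= ord1.
  by rewrite (@row_mxEr R 1 1 n) mxE; congr (x _ _); apply/val_inj.
have consK : cancel cons_rV head.
  move=> [t x]; rewrite /cons_rV /head; congr pair => /=.
    rewrite (_ : ord0 = lshift n (ord0 : 'I_1)); last exact/val_inj.
    by rewrite (@row_mxEl R 1 1 n) mxE.
  apply/rowP => j; rewrite mxE.
  rewrite (_ : lift ord0 j = rshift 1 j); last exact/val_inj.
  by rewrite (@row_mxEr R 1 1 n).
have mhead : measurable_fun setT head.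
  apply/measurable_fun_pairP; split; first exact: (measurable_coord_rV ord0).
  apply: measurable_fun_rV => j.
  rewrite [X in measurable_fun _ X](_ : _ =
    (fun x : 'rV[R]_n.+1 => x ord0 (lift ord0 j))); last first.
    by apply/funext => x; rewrite mxE.
  exact: measurable_coord_rV.
exists (fun k => head @^-1` F k).
  by rewrite -preimage_bigcup -TF preimage_setT.
move=> k; have [mF Fk] := Foo k; split.
  by rewrite -[X in measurable X]setTI; exact: mhead.
rewrite /lebesgue_cons /pushforward -comp_preimage.
by rewrite (_ : head \o cons_rV = id) //; apply/funext => x; exact: consK.
Qed.

HB.instance Definition _ := Measure_isSigmaFinite.Build _ _ _ lebesgue_cons
  lebesgue_cons_sigma_finite.

End cons.

(* Lebesgue measure on R^n: iterated product measure under R x R^n ~ R^(1+n). *)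
Fixpoint lebesgue_rV n : {sigma_finite_measure set 'rV[R]_n -> \bar R} :=
  if n is m.+1 then lebesgue_cons (lebesgue_rV m) else \d_(0 : 'rV[R]_0).

End lebesgue_rV.

Section smooth_functions.
Context (R : realType) (n : nat).
Local Notation V := 'rV[R]_n.
Local Notation C := R[i].
Local Notation normc := (@ComplexField.Normc.normc R).
Local Notation Re := (@complex.Re R).
Local Notation Im := (@complex.Im R).
Implicit Types (f g : V -> C) (a : C).

Definition partial (i : 'I_n) f : V -> C := fun x =>
  ('D_(delta_mx ord0 i) (Re \o f) x +i* 'D_(delta_mx ord0 i) (Im \o f) x)%C.

Definition iter_partial (s : seq 'I_n) f : V -> C := foldr partial f s.

(* Frechet differentiability of the real and imaginary parts. *)
Definition cdifferentiable f :=
  forall x, differentiable (Re \o f) x /\ differentiable (Im \o f) x.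

(* C^infinity: every iterated partial derivative, in any order of
   differentiation, is differentiable, hence also continuous. *)
Definition smooth f := forall s, cdifferentiable (iter_partial s f).

Definition multi_index := {ffun 'I_n -> nat}.

Definition multi_order (al : multi_index) : nat := (\sum_i al i)%N.

Definition monomial (al : multi_index) (x : V) : R := \prod_i x ord0 i ^+ al i.

(* For smooth functions the order of differentiation is immaterial. *)
Definition multi_partial (al : multi_index) f : V -> C :=
  iter_partial (flatten [seq nseq (al i) i | i <- enum 'I_n]) f.

(* Euclidean norm; the library norm `|x| on 'rV[R]_n is the sup norm. *)
Definition enorm (x : V) : R := Num.sqrt (\sum_i x ord0 i ^+ 2).

Definition supp f : set V := closure [set x | f x != 0].

Definition schwartz_function f :=
  smooth f /\ forall al be : multi_index, exists M : R, forall x : V,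
    `|monomial al x| * normc (multi_partial be f x) <= M.

Definition test_function (Om : set V) f :=
  [/\ smooth f, compact (supp f) & supp f `<=` Om].

Lemma ReE a f g : Re \o (a *: f + g) =
  (Re a *: (Re \o f) + (- Im a) *: (Im \o f)) + (Re \o g).
Proof.
apply/funext => x; rewrite /= !fctE /=.
by case: a => a b; case: (f x) => c d; case: (g x) => u v /=; rewrite -[LHS]/(a * c - b * d + u) -[(- b) *: d]/(- b * d) mulNr.
Qed.

Lemma ImE a f g : Im \o (a *: f + g) =
  (Re a *: (Im \o f) + Im a *: (Re \o f)) + (Im \o g).
Proof.
apply/funext => x; rewrite /= !fctE /=.
by case: a => a b; case: (f x) => c d; case: (g x).
Qed.

Lemma differentiable_lin3 (a b : R) (f g h : V -> R) x :
  differentiable f x -> differentiable g x -> differentiable h x ->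
  differentiable ((a *: f + b *: g) + h) x.
Proof.
move=> df dg dh; exact: (differentiableD
  (differentiableD (differentiableZ a df) (differentiableZ b dg)) dh).
Qed.

Lemma cdifferentiable_lin a f g :
  cdifferentiable f -> cdifferentiable g -> cdifferentiable (a *: f + g).
Proof.
move=> df dg x; have [rf mf] := df x; have [rg mg] := dg x.
rewrite ReE ImE; split.
  exact: (differentiable_lin3 _ _ rf mf rg).
exact: (differentiable_lin3 _ _ mf rf mg).
Qed.

Lemma derive_lin3 (a b : R) (f g h : V -> R) x v :
  differentiable f x -> differentiable g x -> differentiable h x ->
  'D_v ((a *: f + b *: g) + h) x = a * 'D_v f x + b * 'D_v g x + 'D_v h x.
Proof.
move=> /diff_derivable df /diff_derivable dg /diff_derivable dh.
have daf : derivable (a *: f) x v by exact/derivableZ/df.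
have dbg : derivable (b *: g) x v by exact/derivableZ/dg.
have dab : derivable (a *: f + b *: g) x v by exact: derivableD.
rewrite (deriveD dab (dh v)) (deriveD daf dbg).
by rewrite (deriveZ _ (df v)) (deriveZ _ (dg v)).
Qed.

Lemma partial_lin i a f g : cdifferentiable f -> cdifferentiable g ->
  partial i (a *: f + g) = a *: partial i f + partial i g.
Proof.
move=> df dg; apply/funext => x; have [rf mf] := df x; have [rg mg] := dg x.
rewrite -[RHS]/(a * partial i f x + partial i g x) /partial ReE ImE.
rewrite (derive_lin3 _ _ _ rf mf rg) (derive_lin3 _ _ _ mf rf mg).
by case: a => u v; rewrite mulNr.
Qed.

Lemma iter_partial_lin s a f g : smooth f -> smooth g ->
  iter_partial s (a *: f + g) = a *: iter_partial s f + iter_partial s g.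
Proof.
move=> sf sg; elim: s => //= i s ->.
by apply: partial_lin; [exact: sf|exact: sg].
Qed.

Lemma smooth_lin a f g : smooth f -> smooth g -> smooth (a *: f + g).
Proof.
move=> sf sg s; rewrite iter_partial_lin//.
by apply: cdifferentiable_lin; [exact: sf|exact: sg].
Qed.

Lemma iter_partial0 s : iter_partial s 0 = 0.
Proof.
elim: s => //= i s ->; apply/funext => x; rewrite /partial.
have -> : Re \o (0 : V -> C) = cst 0 by apply/funext.
have -> : Im \o (0 : V -> C) = cst 0 by apply/funext.
by rewrite derive_cst.
Qed.

Lemma smooth0 : smooth 0.
Proof. by move=> s x; rewrite iter_partial0; split; exact: differentiable_cst. Qed.

Lemma ler_normcD (y z : C) : normc (y + z) <= normc y + normc z.
Proof.
have := ler_normD y z.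
by rewrite /Num.norm/= -rmorphD/= lecR.
Qed.

Fact schwartz_function0 : schwartz_function 0.
Proof.
split=> [|al be]; first exact: smooth0.
exists 0 => x; rewrite /multi_partial iter_partial0.
by rewrite ComplexField.Normc.normc0 mulr0.
Qed.

Fact schwartz_function_lin a f g :
  schwartz_function f -> schwartz_function g -> schwartz_function (a *: f + g).
Proof.
move=> [sf bf] [sg bg]; split=> [|al be]; first exact: smooth_lin.
have [M fM] := bf al be; have [N gN] := bg al be.
exists (normc a * M + N) => x.
rewrite /multi_partial iter_partial_lin//.
apply: (@le_trans _ _ (`|monomial al x| *
   (normc a * normc (multi_partial be f x) + normc (multi_partial be g x)))).
  apply: ler_wpM2l => //; rewrite -ComplexField.Normc.normcM.
  exact: ler_normcD.
rewrite mulrDr mulrCA; apply: lerD; last exact: gN.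
apply: ler_wpM2l; last exact: fM.
by case: (a) => u v; exact: sqrtr_ge0.
Qed.

Fact test_function0 Om : test_function Om 0.
Proof.
have s0 : supp (0 : V -> C) = set0.
  rewrite /supp (_ : [set _ | _] = set0) ?closure0//.
  by apply/seteqP; split=> // x /=; rewrite eqxx.
by split; [exact: smooth0|rewrite s0; exact: compact0|rewrite s0].
Qed.

Fact test_function_lin Om a f g :
  test_function Om f -> test_function Om g -> test_function Om (a *: f + g).
Proof.
move=> [sf cf fO] [sg cg gO].
have sub : supp (a *: f + g) `<=` supp f `|` supp g.
  rewrite /supp -closureU; apply: closureS => x /= nz.
  apply: contrapT => /not_orP[/= /negP + /negP]; rewrite !negbK => /eqP fx /eqP gx.
  by move: nz; rewrite !fctE fx gx scaler0 addr0 eqxx.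
split; first exact: smooth_lin.
  apply: (subclosed_compact _ (compactU cf cg) sub); exact: closed_closure.
by move=> x /sub[/fO|/gO].
Qed.

Lemma iter_partial_out s f x : ~ supp f x -> iter_partial s f x = 0.
Proof.
have oS : open (~` supp f) by apply: closed_openC; exact: closed_closure.
elim: s x => [|i s IHs] x xf /=.
  apply/eqP; apply: contrapT => /negP fx; apply: xf; exact: subset_closure.
have nf : \forall y \near x, iter_partial s f y = 0.
  have : nbhs x (~` supp f) by exact: open_nbhs_nbhs.
  by apply: filterS => y; exact: IHs.
rewrite /partial !(@near_eq_derive _ _ _ _ (cst 0)) ?derive_cst//.
- by near=> y; rewrite /= (near nf y).
- by near=> y; rewrite /= (near nf y).
Unshelve. all: by end_near. Qed.

Lemma test_function_schwartz Om f : test_function Om f -> schwartz_function f.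
Proof.
move=> [sf cf fO]; split=> // al be.
pose h x := `|monomial al x| * normc (multi_partial be f x).
have cm : continuous (monomial al).
  rewrite /monomial; elim: (index_enum _) => [|i r IHr] x.
    rewrite (_ : (fun y => _) = cst 1); first exact: cst_continuous.
    by apply/funext => y; rewrite big_nil.
  rewrite (_ : (fun y => _) = (fun y : V => y ord0 i ^+ al i) \*
    (fun y : V => \prod_(j <- r) y ord0 j ^+ al j)); last first.
    by apply/funext => y; rewrite big_cons.
  apply: continuousM; last exact: IHr.
  apply: (@continuous_comp _ _ _ (fun y : V => y ord0 i) (fun t : R => t ^+ al i)).
    exact: coord_continuous.
  exact: exprn_continuous.
have ch : continuous h.
  move=> x; apply: (@continuousM _ _ (fun y => `|monomial al y|)
    (fun y => normc (multi_partial be f y))).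
    exact: (continuous_comp (cm x) (@norm_continuous _ R^o _)).
  have [/differentiable_continuous rf /differentiable_continuous mf] :=
    sf (flatten [seq nseq (be i) i | i <- enum 'I_n]) x.
  have sq (k : V -> R) : {for x, continuous k} -> {for x, continuous (fun y => k y ^+ 2)}.
    by move=> ck; exact: (continuous_comp ck (@exprn_continuous R 2 _)).
  rewrite (_ : (fun y => normc _) = Num.sqrt \o
    ((fun y => (Re \o multi_partial be f) y ^+ 2) \+
     (fun y => (Im \o multi_partial be f) y ^+ 2))); last first.
    by apply/funext => y /=; case: (multi_partial be f y).
  apply: continuous_comp; last exact: sqrt_continuous.
  by apply: continuousD; apply: sq.
have [M [_ hM]] := compact_bounded (continuous_compact (continuous_subspaceT ch) cf).
exists (Num.max 0 (M + 1)) => x; rewrite -/(h x).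
have [xf|xf] := pselect (supp f x).
  rewrite le_max; apply/orP; right.
  apply: le_trans (ler_norm _) _; apply: (hM (M + 1)); first by rewrite ltrDl.
  by exists x.
by rewrite /h /multi_partial iter_partial_out// ComplexField.Normc.normc0 mulr0 le_max lexx.
Qed.

End smooth_functions.

Section schwartz_space.
Context (R : realType) (n : nat).
Local Notation V := 'rV[R]_n.
Local Notation C := R[i].
Local Notation normc := (@ComplexField.Normc.normc R).

Definition schwartz_pred : {pred V -> C} := fun f => `[< schwartz_function f >].

Fact schwartz_pred_submod : submod_closed schwartz_pred.
Proof.
split; first exact/asboolP/schwartz_function0.
move=> a f g /asboolP sf /asboolP sg; exact/asboolP/schwartz_function_lin.
Qed.

HB.instance Definition _ :=
  GRing.isSubmodClosed.Build C (V -> C) schwartz_pred schwartz_pred_submod.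

Record schwartz := Schwartz {
  schwartz_fun :> V -> C ;
  schwartzP : schwartz_fun \in schwartz_pred }.

HB.instance Definition _ := [isSub for schwartz_fun].
HB.instance Definition _ := [Choice of schwartz by <:].
HB.instance Definition _ := [SubChoice_isSubLmodule of schwartz by <:].

(* f itself when f is a Schwartz function, and 0 otherwise. It is only applied
   to (inverse) Fourier transforms and products of Schwartz functions. *)
Definition to_schwartz (f : V -> C) : schwartz := insubd (0 : schwartz) f.

Definition schwartz_seminorm (k : nat) (phi : schwartz) : R :=
  sup [set r | exists al be : multi_index n, exists x : V,
    [/\ (multi_order al <= k)%N, (multi_order be <= k)%N &
        r = `|monomial al x| * normc (multi_partial be phi x)]].

(* Continuity for the topology of S(R^n), through the seminorms defining it. *)
Definition tempered (T : schwartz -> C) :=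
  scalar T /\
  exists M k, forall phi, normc (T phi) <= M * schwartz_seminorm k phi.

Variable Om : set V.

Definition testfun_pred : {pred V -> C} := fun f => `[< test_function Om f >].

Fact testfun_pred_submod : submod_closed testfun_pred.
Proof.
split; first exact/asboolP/test_function0.
move=> a f g /asboolP sf /asboolP sg; exact/asboolP/test_function_lin.
Qed.

HB.instance Definition _ :=
  GRing.isSubmodClosed.Build C (V -> C) testfun_pred testfun_pred_submod.

Record testfun := Testfun {
  testfun_fun :> V -> C ;
  testfunP : testfun_fun \in testfun_pred }.

HB.instance Definition _ := [isSub for testfun_fun].
HB.instance Definition _ := [Choice of testfun by <:].
HB.instance Definition _ := [SubChoice_isSubLmodule of testfun by <:].

Definition testfun_seminorm (k : nat) (phi : testfun) : R :=
  sup [set r | exists be : multi_index n, exists x : V,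
    (multi_order be <= k)%N /\ r = normc (multi_partial be phi x)].

(* Continuity on the test functions supported in each compact K of Om. *)
Definition distribution (T : testfun -> C) :=
  scalar T /\
  forall K : set V, compact K -> K `<=` Om ->
  exists M k, forall phi : testfun, supp phi `<=` K ->
    normc (T phi) <= M * testfun_seminorm k phi.

Fact testfun_is_schwartz (phi : testfun) : (phi : V -> C) \in schwartz_pred.
Proof. by apply/asboolP/test_function_schwartz/asboolP/(testfunP phi). Qed.

(* Test functions on Om are functions on R^n vanishing outside a compact
   subset of Om, so extension by zero is the inclusion. *)
Definition schwartz_of_testfun (phi : testfun) : schwartz :=
  Schwartz (testfun_is_schwartz phi).

Definition restrict_dist (T : schwartz -> C) : testfun -> C :=
  T \o schwartz_of_testfun.

End schwartz_space.

Arguments restrict_dist {R n} Om T.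

Section fourier_analysis.
Context (R : realType) (n : nat).
Local Notation V := 'rV[R]_n.
Local Notation C := R[i].
Local Notation normc := (@ComplexField.Normc.normc R).
Local Notation Re := (@complex.Re R).
Local Notation Im := (@complex.Im R).
Local Notation mu := (lebesgue_rV R n).

Definition cintegral (f : V -> C) : C :=
  ((\int[mu]_x Re (f x)) +i* (\int[mu]_x Im (f x)))%C.

Definition dot (x y : V) : R := \sum_i x ord0 i * y ord0 i.

Definition cis (t : R) : C := (cos t +i* sin t)%C.

(* Unitary normalisation (2 pi)^(-n/2), kernel exp(-i x.xi). *)
Definition fourier (f : V -> C) : V -> C := fun xi =>
  ((2 * pi) `^ (- (n%:R / 2)))%:C%C * cintegral (fun x => f x * cis (- dot x xi)).

Definition inverse_fourier (f : V -> C) : V -> C := fun x =>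
  ((2 * pi) `^ (- (n%:R / 2)))%:C%C * cintegral (fun xi => f xi * cis (dot x xi)).

(* <FT, phi> = <T, F phi>, <F^-1 T, phi> = <T, F^-1 phi> and
   <th T, phi> = <T, th phi>. *)
Definition fourier_dist (T : schwartz R n -> C) : schwartz R n -> C :=
  fun phi => T (to_schwartz (fourier phi)).

Definition inverse_fourier_dist (T : schwartz R n -> C) : schwartz R n -> C :=
  fun phi => T (to_schwartz (inverse_fourier phi)).

Definition mul_dist (th : schwartz R n) (T : schwartz R n -> C) :
    schwartz R n -> C :=
  fun phi => T (to_schwartz (fun x => th x * phi x)).

Definition fourier_multiplier (th : schwartz R n) (T : schwartz R n -> C) :=
  inverse_fourier_dist (mul_dist th (fourier_dist T)).

Definition represents (g : V -> C) (T : schwartz R n -> C) :=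
  [/\ continuous (Re \o g), continuous (Im \o g) &
   forall phi : schwartz R n,
     mu.-integrable setT (fun x => (normc (g x * phi x))%:E) /\
     T phi = cintegral (fun x => g x * phi x)].

(* The unique continuous function g with T phi = int g phi. For tempered T and
   compactly supported Schwartz th it exists for th(D) T, by Paley-Wiener. *)
Definition dist_fun (T : schwartz R n -> C) : V -> C :=
  xget (fun=> 0) [set g | represents g T].

Record Phi (theta : nat -> schwartz R n) : Prop := {
  Phi_supp0 : supp (theta 0%N) `<=` [set x | enorm x <= 2] ;
  Phi_supp : forall j, (1 <= j)%N ->
    supp (theta j) `<=` [set x | 2 ^+ j.-1 <= enorm x <= 2 ^+ j.+1] ;
  Phi_bound : forall al : multi_index n, exists M : R, forall j x,
    2 ^+ (j * multi_order al) * normc (multi_partial al (theta j) x) <= M ;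
  Phi_sum : forall x,
    normc (\sum_(j < k) theta j x - 1) @[k --> \oo] --> (0 : R) }.

End fourier_analysis.

Section variable_exponents.
Context (R : realType) (n : nat).
Local Notation V := 'rV[R]_n.
Local Notation C := R[i].
Local Notation normc := (@ComplexField.Normc.normc R).
Local Notation mu := (lebesgue_rV R n).
Implicit Types p q s : V -> R.

Definition P0 p :=
  [/\ measurable_fun setT p, forall x, 0 < p x,
      (0 < ess_inf mu (EFin \o p))%E & (ess_sup mu (EFin \o p) < +oo)%E].

Definition Clog p :=
  exists c pinf : R, [/\ 0 < c,
    forall x y, x != y ->
      `|p x - p y| <= c / ln (expR 1 + (enorm (x - y))^-1) &
    forall x, `|p x - pinf| <= c / ln (expR 1 + enorm x)].

Local Open Scope ereal_scope.

(* Quasi-norms take values in [0, +oo], the infimum of the empty set being +oo. *)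
Definition Lp_quasinorm p (f : V -> \bar R) : \bar R :=
  ereal_inf [set l%:E | l in [set l : R | (0 < l)%R /\
    \int[mu]_x (`|f x| * l^-1%:E) `^ p x <= 1]].

Definition Lp_lq_quasinorm p q (f : nat -> V -> C) : \bar R :=
  Lp_quasinorm p (fun x =>
    (\sum_(0 <= j <oo) (normc (f j x) `^ q x)%:E) `^ (q x)^-1).

Definition lq_Lp_quasinorm p q (f : nat -> V -> C) : \bar R :=
  ereal_inf [set m%:E | m in [set m : R | (0 < m)%R /\
    \sum_(0 <= j <oo) Lp_quasinorm (fun x => p x / q x)%R
      (fun x => ((normc (f j x) / m) `^ q x)%:E) <= 1]].

Inductive scale := Besov | Triebel_Lizorkin.

Definition dyadic_blocks (theta : nat -> schwartz R n) s
    (T : schwartz R n -> C) : nat -> V -> C :=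
  fun j x => ((2 `^ (j%:R * s x))%:C%C * dist_fun (fourier_multiplier (theta j) T) x)%R.

Definition A_quasinorm (A : scale) theta s p q (T : schwartz R n -> C) : \bar R :=
  match A with
  | Besov => lq_Lp_quasinorm p q (dyadic_blocks theta s T)
  | Triebel_Lizorkin => Lp_lq_quasinorm p q (dyadic_blocks theta s T)
  end.

Definition A_space A theta s p q : set (schwartz R n -> C) :=
  [set T | tempered T /\ A_quasinorm A theta s p q T < +oo].

End variable_exponents.

Section half_space.
Context (R : realType) (n : nat).
Local Notation C := R[i].

Definition half_space : set 'rV[R]_n.+1 := [set x | 0 < x ord0 ord_max].

Definition A_space_half A theta (s p q : 'rV[R]_n.+1 -> R) :
    set (testfun half_space -> C) :=
  [set f | distribution f /\
    exists2 g, A_space A theta s p q g & f = restrict_dist half_space g].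

Definition A_quasinorm_half A theta (s p q : 'rV[R]_n.+1 -> R)
    (f : testfun half_space -> C) : \bar R :=
  ereal_inf [set A_quasinorm A theta s p q g | g in
    [set g | A_space A theta s p q g /\ f = restrict_dist half_space g]].

End half_space.

Arguments half_space R n : clear implicits.

(* F maps X to Y and is continuous on X for the topologies whose neighbourhoods
   of a point are generated by the balls of the quasi-norms NX and NY. *)
Definition continuous_between (R : realType) (U W : zmodType)
    (X : set U) (NX : U -> \bar R) (Y : set W) (NY : W -> \bar R) (F : U -> W) :=
  (forall f, X f -> Y (F f)) /\
  forall f, X f -> forall e : R, 0 < e -> exists2 d : R, 0 < d &
    forall g, X g -> (NX (g - f)%R < d%:E)%E -> (NY (F g - F f)%R < e%:E)%E.

(* Main.v *)
(* Rychkov's extension. Let P be a Schwartz function supported in the half space {x_n > 0} with integral 1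
and all higher moments 0, and P_j its dyadic dilations. The polynomial H(u) = 3 u^2 - 2 u^3 telescopes along
the P_j under convolution, which factors the identity as the sum of phi_j * psi_j where phi_j and psi_j are
supported in the half space and, for j >= 1, have no moments. The extension of f is the sum of
psi_j * (1_{x_n > 0} (phi_j * f)): it only sees f on the half space and reproduces f there.
The dyadic blocks of the extension are controlled by Peetre maximal functions of the blocks of any tempered
representative of f, with an arbitrarily fast decay in the distance of the frequencies. These maximal
functions are bounded in the variable exponent spaces by an elementary argument: the sub-mean value property
of a dyadic block turns its r-th power into an average over shifted dyadic cells, log-Hoelder continuity makes
the exponents essentially constant where the block is neither too large nor too small, and the scales are
summed by a Hardy inequality, with weights 2^(j s) that vary slowly. Uniqueness of the extension, hence its
independence of the representative and of the exponents, follows from its locality. *)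
From HB Require Import structures.
Require Import Defs.
From mathcomp Require Import all_boot all_order all_algebra.
From mathcomp Require Import all_classical all_reals all_analysis.
From mathcomp Require Import measurable_realfun ess_sup_inf.
From mathcomp Require Import complex.
From mathcomp Require Import ring lra zify.

Set Implicit Arguments.
Unset Strict Implicit.
Unset Printing Implicit Defensive.

Import Order.TTheory GRing.Theory Num.Theory.
Import numFieldNormedType.Exports.
Local Open Scope classical_set_scope.
Local Open Scope ring_scope.

(* Why a cubic: the telescoping polynomial needs [H(0) = 0] and [H(1) = 1]; [H'(1) = 0] makes the
   cofactor of [u - v] vanish at [u = v = 1], which is all that moments see; [H'(0) = 0] keeps the
   Dirac mass out of that cofactor, so that [psi_j] is a function. The lowest degree meeting the
   four conditions is 3. All moments of [P] are prescribed because the decay rate in the frequency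
   gap is chosen after the exponents. A compactly supported [P] would then have a constant Fourier
   transform, so [P] is an infinite sum of corrections pushed to infinity. Fourier inversion is used
   only up to a nonzero constant that is never computed. In the maximal estimate, powers [X ^ p(x)]
   and [X ^ p(y)] are comparable on a cell of level [j] only if [X] lies between powers of
   [2^j (1 + |x|)]. The modular itself gives the upper bound; a small background [2^-j (1 + |x|)^-A]
   added to every block gives the lower one. The estimate is closed by absorbing a small multiple of
   the quantity to be bounded, known beforehand to be finite. *)
Create HintDb pos.
Create HintDb mble.
Create HintDb fn.
Ltac unfold_ext := idtac.
Ltac pos := lazymatch goal with
 | |- is_true (_ && _) => apply/andP; split; pos
 | |- is_true (~~ (_ == _)) => first [assumption | rewrite gt_eqF; [reflexivity | pos]]
 | |- is_true (@Order.le _ _ ?z ?x) => lazymatch z with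
  | @GRing.zero _ => first [assumption | nonneg x]
  | @GRing.one _ => leaf
  | _ => solve [apply:ltW; assumption | trivial with pos]
  end
 | |- is_true (@Order.lt _ _ ?z ?x) => lazymatch z with @GRing.zero _ => first [assumption | positive x] | _ => leaf end
 end
with leaf := solve [trivial with pos | apply:ltW; solve [assumption | trivial with pos]
 | apply:le_trans ler01 _; solve [assumption | trivial with pos]
 | apply:lt_le_trans ltr01 _; solve [assumption | trivial with pos]]
with nonneg x := lazymatch x with
 | @GRing.mul _ _ _ => first [apply:mulr_ge0; pos | leaf]
 | @GRing.add _ _ _ => first [apply:addr_ge0; pos | leaf]
 | @GRing.exp _ _ _ => first [apply:exprn_ge0; pos | exact:sqr_ge0 | leaf]
 | @GRing.inv _ _ => first [rewrite invr_ge0; pos | leaf]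
 | @Num.norm _ _ _ => exact:normr_ge0
 | @powR _ _ _ => exact:powR_ge0
 | @GRing.natmul _ (@GRing.one _) _ => exact:ler0n
 | @GRing.natmul _ _ _ => apply:mulrn_wge0; pos
 | @GRing.one _ => exact:ler01
 | @bigop.body _ _ _ _ _ => first [apply:sumr_ge0 => ? _; pos | apply:prodr_ge0 => ? _; pos]
 | @EFin _ _ => rewrite lee_fin; pos
 | _ => leaf
 end
with positive x := lazymatch x with
 | @GRing.mul _ _ _ => first [apply:mulr_gt0; pos | leaf]
 | @GRing.add _ _ _ => first [apply:ltr_wpDl; pos | apply:ltr_pwDl; pos | leaf]
 | @GRing.exp _ _ _ => first [apply:exprn_gt0; pos | leaf]
 | @GRing.inv _ _ => first [rewrite invr_gt0; pos | leaf]
 | @powR _ _ _ => first [apply:powR_gt0; pos | leaf]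
 | @GRing.natmul _ (@GRing.one _) _ => first [rewrite ltr0n; reflexivity | leaf]
 | @GRing.one _ => exact:ltr01
 | @EFin _ _ => rewrite lte_fin; pos
 | _ => leaf
 end.
Ltac mble := lazymatch goal with
 | |- measurable_fun _ (fun x => @EFin _ _) => apply/measurable_EFinP; mble
 | |- measurable_fun _ (EFin \o _) => apply/measurable_EFinP; mble
 | |- measurable_fun _ (fun x => @GRing.mul _ _ _) => first [assumption | apply:measurable_funM; mble | mleaf]
 | |- measurable_fun _ (fun x => @GRing.add _ _ (- _)) => first [assumption | apply:measurable_funB; mble | mleaf]
 | |- measurable_fun _ (fun x => @GRing.add _ _ _) => first [assumption | apply:measurable_funD; mble | mleaf]
 | |- measurable_fun _ (fun x => @GRing.exp _ _ _) => first [assumption | apply:measurable_funX; mble | mleaf]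
 | |- measurable_fun _ _ => mleaf
 end
with mleaf := solve [assumption | exact:measurable_cst | trivial with mble | eauto 4 with fn nocore].
Ltac rule := lazymatch goal with
 | |- is_true _ => fail
 | |- @eq (_ -> _) _ _ => apply/funext => ?; rewrite /=; unfold_ext; solve [reflexivity | ring]
 | |- @eq _ _ _ => fail
 | |- _ => solve [eauto 4 with fn nocore]
 end.
#[export] Hint Extern 0 (is_true (_ <= _)%N) => exact:leqnn : fn.
#[export] Hint Extern 1 (is_true (_ != _)) => pos : fn.
#[export] Hint Extern 1 (is_true (_ < _)%R) => pos : fn.
Ltac basic_done := trivial; hnf; intros; solve
 [do ![solve [trivial | apply:sym_equal; trivial] | discriminate | contradiction | split]
 | match goal with H : ~ _ |- _ => solve [case H; trivial] end].
(** From here on [//] also settles sign conditions, measurability and closure of the function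
    classes under the algebraic operations; a step closed by [//] or [by []] without further
    argument is of one of these kinds. The plain terminator is restored around some lemmas. *)
Ltac extended_done := solve [basic_done | intros; first [pos | mble | rule]].
Ltac done ::= extended_done.

Local Notation mu := (lebesgue_rV _ _).
Local Notation normc := (@ComplexField.Normc.normc _).
Local Notation Re := (@complex.Re _).
Local Notation Im := (@complex.Im _).
Local Notation meas := (measurable_fun setT).

(** * Smooth real functions on R^d and Taylor's formula *)

Section real_smooth.
Context (R : realType) (d : nat).
Local Notation V := 'rV[R]_d.
Implicit Types (f g : V -> R) (x y h : V) (s : seq 'I_d).

(* Kept opaque: unification must not unfold the limit in the derivative. *)
Fact dpart_sig : {D : 'I_d -> (V -> R) -> V -> R |
 D = fun i f x => 'D_(delta_mx ord0 i) f x}.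
by exists (fun i f x => 'D_(delta_mx ord0 i) f x). Qed.

Definition dpart := sval dpart_sig.

Lemma dpartE i f x : dpart i f x = 'D_(delta_mx ord0 i) f x.
by rewrite /dpart (svalP dpart_sig). Qed.

Definition diter s f : V -> R := foldr dpart f s.
Definition rsmth f := forall s x, differentiable (diter s f) x.

Lemma diter_cat s t f : diter (s ++ t) f = diter s (diter t f).
by rewrite /diter foldr_cat. Qed.

Lemma rsmth_diff f x : rsmth f -> differentiable f x.
by move=> sf; exact:(sf [::]). Qed.
Hint Resolve rsmth_diff : fn.

Lemma rsmth_diter s f : rsmth f -> rsmth (diter s f).
by move=> sf t x; rewrite -diter_cat. Qed.
Hint Resolve rsmth_diter : fn.

Lemma rsmth_dpart i f : rsmth f -> rsmth (dpart i f).
exact:(@rsmth_diter [:: i]). Qed.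
Hint Resolve rsmth_dpart : fn.

(** Smoothness by coinduction: it suffices to exhibit a class of differentiable functions stable
    under partial derivatives. This replaces formulas for iterated derivatives of products and
    compositions. *)
Lemma rsmth_coind (P : (V -> R) -> Prop) :
 (forall f, P f -> (forall x, differentiable f x) /\ forall i, P (dpart i f)) ->
 forall f, P f -> rsmth f.
move=> PP f Pf s; suff /PP[] : P (diter s f) by [].
by elim:s => //= i s /PP[].
Qed.

Lemma rsmth_cont f : rsmth f -> continuous f.
by move=> sf x; exact/differentiable_continuous/rsmth_diff. Qed.
Hint Resolve rsmth_cont : fn.

Lemma row_sum_delta_r h : h = \sum_i h ord0 i *: delta_mx ord0 i.
exact:row_sum_delta. Qed.

Lemma diff_dpart f x h : differentiable f x ->
 'd f x h = \sum_i h ord0 i * dpart i f x.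
move=> df; rewrite {1}[h]row_sum_delta_r linear_sum; apply:eq_bigr => i _.
by rewrite linearZ dpartE deriveE.
Qed.

Lemma dpartD i f g x : differentiable f x -> differentiable g x ->
 dpart i (f \+ g) x = dpart i f x + dpart i g x.
by move=> df dg; rewrite !dpartE deriveD//; exact:diff_derivable. Qed.

Lemma dpartZ i (a : R) f x : differentiable f x ->
 dpart i (fun y => a * f y) x = a * dpart i f x.
by move=> df; rewrite !dpartE deriveZ//; exact:diff_derivable.
Qed.

Lemma dpartM i f g x : differentiable f x -> differentiable g x ->
 dpart i (f \* g) x = dpart i f x * g x + f x * dpart i g x.
move=> df dg; rewrite !dpartE deriveM; [|exact:diff_derivable..].
by rewrite addrC; congr (_ + _); exact:mulrC.
Qed.

Lemma dpart_cst i (a : R) : dpart i (cst a) = cst 0.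
by apply/funext => x; rewrite dpartE derive_cst. Qed.

Lemma dpart_sum (I : Type) (r : seq I) i (F : I -> V -> R) x :
 (forall k, differentiable (F k) x) ->
 differentiable (fun y => \sum_(k <- r) F k y) x /\
 dpart i (fun y => \sum_(k <- r) F k y) x = \sum_(k <- r) dpart i (F k) x.
move=> dF; elim:r => [|k r [IH1 IH2]].
 rewrite (_ : (fun y => _) = cst 0) ?dpart_cst ?big_nil; last first.
  by apply/funext => y; rewrite big_nil.
 by [].
rewrite (_ : (fun y => _) = F k \+ (fun y => \sum_(k <- r) F k y)); last first.
 by apply/funext => y; rewrite big_cons.
rewrite big_cons -IH2; split; first exact:differentiableD.
by rewrite dpartD.
Qed.

Lemma rsmth_cst (a : R) : rsmth (cst a).
apply:(@rsmth_coind (fun f => exists a, f = cst a)); last by exists a.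
move=> _ [b ->]; split => [x|i]//.
by exists 0; rewrite dpart_cst.
Qed.
Hint Resolve rsmth_cst : fn.

Lemma rsmthD f g : rsmth f -> rsmth g -> rsmth (f \+ g).
move=> sf sg.
apply:(@rsmth_coind (fun k => exists f g, [/\ rsmth f, rsmth g & k = f \+ g])).
 move=> _ [u [v [su sv ->]]]; split => [x|i]; first exact:(differentiableD (rsmth_diff _ su) (rsmth_diff _ sv)).
 exists (dpart i u), (dpart i v); split => //.
 by apply/funext => x; rewrite dpartD.
by exists f, g.
Qed.
Hint Resolve rsmthD : fn.

Lemma rsmth_sum (I : Type) (r : seq I) (F : I -> V -> R) :
 (forall k, rsmth (F k)) -> rsmth (fun y => \sum_(k <- r) F k y).
move=> sF; elim:r => [|k r IH].
 rewrite (_ : (fun y => _) = cst 0)//.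
 by apply/funext => y; rewrite big_nil.
rewrite (_ : (fun y => _) = F k \+ (fun y => \sum_(k <- r) F k y)); last first.
 by apply/funext => y; rewrite big_cons.
by [].
Qed.

(** Finite sums of products of two smooth functions form a class stable under partial derivatives,
    so [rsmth_coind] applies without binomial coefficients. *)
Lemma rsmthM f g : rsmth f -> rsmth g -> rsmth (f \* g).
move=> sf sg.
apply:(@rsmth_coind (fun k => exists l : seq ((V -> R) * (V -> R)),
  List.Forall (fun z => rsmth z.1 /\ rsmth z.2) l /\
  k = fun y => \sum_(z <- l) z.1 y * z.2 y)).
 move=> _ [l [sl ->]].
 suff : (forall x, differentiable (fun y => \sum_(z <- l) z.1 y * z.2 y) x) /\
   forall i, exists l', List.Forall (fun z => rsmth z.1 /\ rsmth z.2) l' /\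
   dpart i (fun y => \sum_(z <- l) z.1 y * z.2 y) = (fun y => \sum_(z <- l') z.1 y * z.2 y) by [].
 elim:sl => [|[u v] {}l /= [su sv] sl [IH1 IH2]].
  rewrite (_ : (fun y => _) = cst 0); last by apply/funext => y; rewrite big_nil.
  split => [x|i]; first exact:differentiable_cst.
  by exists [::]; split => //; rewrite dpart_cst; apply/funext => y; rewrite big_nil.
 rewrite (_ : (fun y => _) = (u \* v) \+ (fun y => \sum_(z <- l) z.1 y * z.2 y)); last first.
  by apply/funext => y; rewrite big_cons.
 have duv x : differentiable (u \* v) x by apply:differentiableM; exact:rsmth_diff.
 split => [x|i]; first exact:differentiableD.
 have [l' [sl' E]] := IH2 i.
 exists ((dpart i u, v) :: (u, dpart i v) :: l'); split.
  by do 2 (apply:List.Forall_cons => /=; first (split => //; exact:rsmth_dpart)).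
 apply/funext => y; rewrite dpartD// E !big_cons addrA; congr (_ + _).
 by rewrite dpartM//; exact:rsmth_diff.
exists [:: (f, g)]; split; first by apply:List.Forall_cons.
by apply/funext => y; rewrite big_seq1.
Qed.
Hint Resolve rsmthM : fn.

Lemma rsmthZ (a : R) f : rsmth f -> rsmth (fun x => a * f x).
by []. Qed.
Hint Resolve rsmthZ : fn.

Lemma diterZ s (a : R) f : rsmth f -> diter s (fun x => a * f x) = fun x => a * diter s f x.
by move=> sf; elim:s => //= i s ->; apply/funext => x; rewrite dpartZ.
Qed.

Lemma diterD s f g : rsmth f -> rsmth g -> diter s (f \+ g) = diter s f \+ diter s g.
by move=> sf sg; elim:s => //= i s ->; apply/funext => x; rewrite dpartD.
Qed.

Lemma diter_sum (I : Type) (r : seq I) s (F : I -> V -> R) :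
 (forall k, rsmth (F k)) ->
 diter s (fun y => \sum_(k <- r) F k y) = fun y => \sum_(k <- r) diter s (F k) y.
move=> sF; elim:s => //= i s ->; apply/funext => x.
by have [_ ->] := dpart_sum r i (fun k => sF k s x).
Qed.

Definition aff (c : R) (v : V) : V -> V := fun x => c *: x + v.

Lemma diff_aff c v x :
 differentiable (aff c v) x /\ ('d (aff c v) x : V -> V) = (fun h => c *: h).
have H : is_diff x (c \*: (@id V)) (fun h => c *: h) by exact:is_diffZ.
have H2 := is_diffD H (is_diff_cst v x).
have E : aff c v = c \*: (@id V) + cst v by [].
rewrite E; split => //.
by rewrite (@diff_val _ _ _ _ _ _ _ H2); apply/funext => h; rewrite addr0.
Qed.

Lemma dpart_aff i c v f x : differentiable f (aff c v x) ->
 differentiable (f \o aff c v) x /\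
 dpart i (f \o aff c v) x = c * dpart i f (aff c v x).
move=> df; have [da E] := diff_aff c v x.
have dfa : differentiable (f \o aff c v) x by exact:differentiable_comp.
split => //.
have -> : dpart i (f \o aff c v) x = 'D_(c *: delta_mx ord0 i) f (aff c v x).
 suff E3 : (fun t : R => t^-1 *: (((f \o aff c v) \o shift x) (t *: delta_mx ord0 i : V) - (f \o aff c v) x)) =
  (fun t : R => t^-1 *: ((f \o shift (aff c v x)) (t *: (c *: delta_mx ord0 i) : V) - f (aff c v x))).
  by rewrite dpartE /derive E3.
 apply/funext => t /=.
 congr (_ *: (f _ - _)); rewrite /aff scalerDr addrA.
 by congr (_ + _ + _); rewrite !scalerA mulrC.
by rewrite dpartE (deriveE _ df) linearZ (deriveE _ df).
Qed.

Lemma diter_aff s c v f : rsmth f ->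
 diter s (f \o aff c v) = fun x => c ^+ size s * diter s f (aff c v x).
move=> sf; elim:s => [|i s /= ->]//.
apply/funext => x; have [d1 d2] := dpart_aff i (sf s (aff c v x)).
by rewrite (dpartZ _ _ d1) d2 exprSr mulrA.
Qed.

Lemma rsmth_aff c v f : rsmth f -> rsmth (f \o aff c v).
move=> sf s x; rewrite diter_aff//.
have [da _] := diff_aff c v x.
have dfa : differentiable (diter s f \o aff c v) x.
 by apply:differentiable_comp => //.
exact:(differentiableZ (c ^+ size s) dfa).
Qed.
Hint Resolve rsmth_aff : fn.

Definition dirder h f : V -> R := fun x => \sum_i h ord0 i * dpart i f x.

Lemma rsmth_dirder h f : rsmth f -> rsmth (dirder h f).
by move=> sf; apply:rsmth_sum => i. Qed.
Hint Resolve rsmth_dirder : fn.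

Lemma rsmth_iter_dirder h m f : rsmth f -> rsmth (iter m (dirder h) f).
by move=> sf; elim:m => //= m. Qed.
Hint Resolve rsmth_iter_dirder : fn.

Lemma is_derive_line f x h t : rsmth f ->
 is_derive t (1 : R) (fun u : R => f (x + u *: h)) (dirder h f (x + t *: h)).
move=> sf; pose l := fun u : R => x + u *: h.
have dl : is_diff t l (fun u => u *: h).
 have H : is_diff t (fun u : R => u *: h) (fun u => u *: h) by exact:is_diff_scalel.
 have H2 := is_diffD (is_diff_cst x t) H.
 split => //.
 have E : l = cst x + (fun u : R => u *: h) by [].
 by rewrite (@diff_val _ _ _ _ _ _ _ H2); apply/funext => u; rewrite add0r.
have [dl1 dl2] := dl.
have dc : differentiable (f \o l) t by exact:differentiable_comp.
have E : 'd (f \o l) t = 'd f (l t) \o 'd l t :> (R -> R) by exact:diff_comp.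
split; first exact:diff_derivable.
by rewrite (deriveE _ dc) E /= dl2 scale1r diff_dpart.
Qed.

(* Induction on M: the derivative of the M.+1-st remainder is the M-th remainder
  of the derivative. *)
Lemma taylor1 (phi : nat -> R -> R) (B : R) M :
 (forall m t, is_derive t (1 : R) (phi m) (phi m.+1 t)) ->
 (forall t, 0 <= t <= 1 -> `|phi M t| <= B) ->
 forall t, 0 <= t <= 1 ->
 `|phi 0%N t - \sum_(m < M) (m`!%:R)^-1 * phi m 0 * t ^+ m| <= B.
elim:M phi => [|M IH] phi dphi bphi t /andP[t0 t1].
 by rewrite big_ord0 subr0; apply:bphi.
pose psi u := phi 0%N u - \sum_(m < M.+1) (m`!%:R)^-1 * phi m 0 * u ^+ m.
pose dpsi u := phi 1%N u - \sum_(m < M) (m`!%:R)^-1 * phi m.+1 0 * u ^+ m.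
have dp u : is_derive u (1 : R) psi (dpsi u).
 rewrite /psi /dpsi.
 have -> : (fun u => phi 0%N u - \sum_(m < M.+1) (m`!%:R)^-1 * phi m 0 * u ^+ m) =
   phi 0%N - (horner (\poly_(m < M.+1) ((m`!%:R)^-1 * phi m 0))).
  by apply/funext => w; rewrite !fctE horner_poly.
 have Hp : is_derive u (1 : R) (horner (\poly_(m < M.+1) ((m`!%:R)^-1 * phi m 0)))
   ('D_1 (horner (\poly_(m < M.+1) ((m`!%:R)^-1 * phi m 0))) u).
  by [].
 have [H1 H2] := is_deriveB (dphi 0%N u) Hp.
 split => //.
 rewrite H2.
 congr (_ - _); rewrite -derive1E -derivE.
 rewrite (_ : deriv _ = \poly_(m < M) ((m`!%:R)^-1 * phi m.+1 0)) ?horner_poly//.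
 apply/polyP => m; rewrite coef_deriv !coef_poly ltnS; case:ifP => _; last by rewrite mul0rn.
 by rewrite factS; field.
have psi0 : psi 0 = 0.
 rewrite /psi big_ord_recl big1 ?addr0; first by rewrite mulr1 invr1 mul1r subrr.
 by move=> m _; rewrite expr0n mulr0.
have /(MVT_segment t0) : forall u, u \in `]0, t[ -> is_derive u (1 : R) psi (dpsi u) by [].
case.
 apply:continuous_subspaceT => u; apply:differentiable_continuous.
 by apply/derivable1_diffP.
move=> c; rewrite in_itv /= => /andP[c0 ct]; rewrite psi0 !subr0 -/(psi t) => ->.
rewrite normrM (ger0_norm t0).
have : `|dpsi c| <= B.
 apply:(IH (fun m => phi m.+1)) => //.
 by rewrite c0 (le_trans ct t1).
move=> H; apply:le_trans (ler_piMr _ t1) H; by [].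
Qed.

(** Restriction to the segment from [x] to [x + h]. The factorial is dropped from the remainder,
    only its order in [h] being used. *)
Lemma taylor f x h (B : R) M : rsmth f ->
 (forall t, 0 <= t <= 1 -> `|iter M (dirder h) f (x + t *: h)| <= B) ->
 `|f (x + h) - \sum_(m < M) (m`!%:R)^-1 * iter m (dirder h) f x| <= B.
move=> sf Bf.
have := @taylor1 (fun m t => iter m (dirder h) f (x + t *: h)) B M _ Bf 1.
rewrite scale1r /= => H; apply:le_trans (H _ _) => //.
- by under [in leRHS]eq_bigr do rewrite scale0r addr0 expr1n mulr1.
- by move=> m t; exact/is_derive_line/rsmth_iter_dirder.
Qed.

Lemma coord_le_norm x i : `|x ord0 i| <= `|x|.
by rewrite {2}/Num.norm /= mx_normrE; apply:(@le_bigmax _ _ _ 0 (fun ij : 'I_1 * 'I_d => `|x ij.1 ij.2|) (ord0, i)). Qed.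

Lemma dirder_sum h (I : Type) (r : seq I) (F : I -> V -> R) : (forall k, rsmth (F k)) ->
 dirder h (fun y => \sum_(k <- r) F k y) = fun y => \sum_(k <- r) dirder h (F k) y.
move=> sF; apply/funext => x; rewrite /dirder exchange_big /=; apply:eq_bigr => i _.
have [_ ->] := dpart_sum r i (fun k => rsmth_diff x (sF k)).
by rewrite mulr_sumr.
Qed.

Lemma dirderZ h (a : R) f : rsmth f -> dirder h (fun y => a * f y) = fun y => a * dirder h f y.
move=> sf; apply/funext => x; rewrite mulr_sumr; apply:eq_bigr => i _.
by rewrite (dpartZ i a (rsmth_diff x sf)) mulrCA.
Qed.

Lemma iter_dirder_sum h (I : Type) (r : seq I) m (a : I -> R) (F : I -> V -> R) :
 (forall k, rsmth (F k)) ->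
 iter m (dirder h) (fun y => \sum_(k <- r) a k * F k y) =
 fun y => \sum_(k <- r) a k * iter m (dirder h) (F k) y.
move=> sF; elim:m => //= m ->; rewrite dirder_sum//.
 apply/funext => y; apply:eq_bigr => k _; rewrite dirderZ; by [].
Qed.

Lemma iter_dirderSr h m f : rsmth f -> iter m.+1 (dirder h) f =
 fun y => \sum_i h ord0 i * iter m (dirder h) (dpart i f) y.
move=> sf; rewrite iterSr -iter_dirder_sum// => i; by [].
Qed.

Lemma iter_dirder_bnd h m f x (B : R) : rsmth f ->
 (forall s, size s = m -> `|diter s f x| <= B) ->
 `|iter m (dirder h) f x| <= (d%:R * `|h|) ^+ m * B.
elim:m f => [|m IH] f sf Bf; first by rewrite mul1r; exact:(Bf [::]).
rewrite iter_dirderSr//; apply:le_trans (ler_norm_sum _ _ _) _.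
apply:(@le_trans _ _ (\sum_(i < d) `|h| * ((d%:R * `|h|) ^+ m * B))); last first.
 by rewrite sumr_const card_ord -[leLHS]mulr_natl exprS !mulrA.
apply:ler_sum => i _; rewrite normrM; apply:ler_pM => //; first exact:coord_le_norm.
apply:IH => //.
by move=> s ss; rewrite -[diter s (dpart i f)](diter_cat s [:: i]); apply:Bf; rewrite size_cat ss addn1.
Qed.

Lemma dirder_delta i f x : dirder (delta_mx ord0 i) f x = dpart i f x.
rewrite /dirder (bigD1 i)//= big1 ?mxE ?eqxx ?mul1r ?addr0// => j ji.
by rewrite mxE (negbTE ji) mul0r.
Qed.

Lemma MVT_dpart i f x (t : R) : rsmth f -> 0 <= t ->
 exists2 c, 0 <= c <= t & f (x + t *: delta_mx ord0 i) - f x =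
  t * dpart i f (x + c *: delta_mx ord0 i).
move=> sf t0; have H u := is_derive_line x (delta_mx ord0 i) u sf.
have [|c] := MVT_segment t0 (fun u _ => H u).
 apply:continuous_subspaceT => u; apply:differentiable_continuous.
 by apply/derivable1_diffP.
rewrite in_itv /= => c0t; rewrite scale0r addr0 subr0 dirder_delta mulrC => E.
by exists c.
Qed.

(* The second difference at x is a value of either mixed derivative near x. *)
Lemma dpartC i j f : rsmth f -> dpart i (dpart j f) = dpart j (dpart i f).
move=> sf; apply/funext => x.
pose e k : V := delta_mx ord0 k.
have key k l (t : R) : 0 < t -> exists c c', [/\ 0 <= c <= t, 0 <= c' <= t &
  f (x + t *: e k + t *: e l) - f (x + t *: e k) - (f (x + t *: e l) - f x) =
  t * t * dpart l (dpart k f) (x + c *: e k + c' *: e l)].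
 move=> t0; pose g y := f (y + t *: e l) - f y.
 have sg : rsmth g.
  have -> : g = (f \o aff 1 (t *: e l)) \+ (fun y => -1 * f y).
   by apply/funext => y; rewrite /= /aff scale1r mulN1r.
  by [].
 have [c c0t E] := MVT_dpart k x sg (ltW t0).
 have [c' c0t' E'] := MVT_dpart l (x + c *: e k) (rsmth_dpart k sf) (ltW t0).
 exists c, c'; split => //; rewrite -mulrA -E'.
 move:E; rewrite /g => ->; congr (_ * _).
 have -> : (fun y => f (y + t *: e l) - f y) = (f \o aff 1 (t *: e l)) \+ (fun y => -1 * f y).
  by apply/funext => y; rewrite /= /aff scale1r mulN1r.
 rewrite dpartD//.
 have [_ ->] := dpart_aff k (rsmth_diff (aff 1 (t *: e l) (x + c *: e k)) sf).
 by rewrite (dpartZ k _ (rsmth_diff _ sf)) mul1r mulN1r /aff scale1r.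
have near_le k l (t : R) c c' : 0 <= c <= t -> 0 <= c' <= t ->
  `|x - (x + c *: e k + c' *: e l)| <= 2 * t.
 have e1 m : `|e m| <= 1.
  rewrite [leLHS]mx_normrE; apply:bigmax_le => // -[a b] _ /=.
  by rewrite mxE; case:(_ && _); rewrite ?normr1 ?normr0.
 move=> /andP[c0 ct] /andP[c0' ct'].
 rewrite -addrA opprD addrA subrr add0r normrN.
 apply:le_trans (ler_normD _ _) _; rewrite !normrZ !ger0_norm// mulrDl mul1r.
 by apply:lerD; rewrite -[t]mulr1; apply:ler_pM.
pose D1 := dpart i (dpart j f); pose D2 := dpart j (dpart i f).
have cD1 : {for x, continuous D1} by apply:rsmth_cont; do 2 apply:rsmth_dpart.
have cD2 : {for x, continuous D2} by apply:rsmth_cont; do 2 apply:rsmth_dpart.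
apply/eqP; rewrite -subr_eq0 -normr_le0; apply/ler_addgt0Pr => eps eps0; rewrite add0r.
have eps20 : 0 < eps / 2 by rewrite divr_gt0.
have /cvgrPdist_lt/(_ _ eps20)/nbhs_ballP[r1 /= r10 H1] := cD1.
have /cvgrPdist_lt/(_ _ eps20)/nbhs_ballP[r2 /= r20 H2] := cD2.
(* Both sample points lie within [2 t] of [x], hence inside both balls. *)
pose t := Num.min r1 r2 / 4.
have t0 : 0 < t by rewrite divr_gt0// lt_min.
have tr1 : 2 * t < r1.
 have : Num.min r1 r2 <= r1 by rewrite ge_min lexx.
 by rewrite /t; lra.
have tr2 : 2 * t < r2.
 have : Num.min r1 r2 <= r2 by rewrite ge_min lexx orbT.
 by rewrite /t; lra.
have [c1 [c1' [c1t c1t' E1]]] := key j i t t0.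
have [c2 [c2' [c2t c2t' E2]]] := key i j t t0.
have E : D1 (x + c1 *: e j + c1' *: e i) = D2 (x + c2 *: e i + c2' *: e j).
 have tt : t * t != 0 by rewrite gt_eqF.
 apply:(mulfI tt); apply:etrans (etrans (esym E1) _) E2.
 rewrite (addrAC x (t *: e j)); ring.
have B1 : `|D1 x - D1 (x + c1 *: e j + c1' *: e i)| < eps / 2.
 by apply:H1; rewrite -ball_normE; apply:le_lt_trans tr1; exact:near_le.
have B2 : `|D2 x - D2 (x + c2 *: e i + c2' *: e j)| < eps / 2.
 by apply:H2; rewrite -ball_normE; apply:le_lt_trans tr2; exact:near_le.
rewrite -/D1 -/D2; move:B1 B2; rewrite E; set z := D2 (x + _ + _) => B1 B2.
rewrite (_ : D1 x - D2 x = (D1 x - z) - (D2 x - z)); last by ring.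
apply:le_trans (ler_normB _ _) _.
by rewrite [leRHS]splitr; apply:lerD.
Qed.

Lemma diter_perm s t f : rsmth f -> perm_eq s t -> diter s f = diter t f.
move=> sf; elim:s t => [|i s IH] t; first by rewrite perm_sym => /perm_nilP ->.
move=> st; have it : i \in t by rewrite -(perm_mem st) mem_head.
have {st}/IH /= -> : perm_eq s (rem i t).
 by rewrite -(perm_cons i) (perm_trans st)// perm_to_rem.
elim:t it => //= a t IHt; rewrite inE; case:eqVneq => [->//|ia /= it].
rewrite -IHt//= dpartC; by [].
Qed.

Definition lform (l : 'I_d -> R) : V -> R := fun h => \sum_i h ord0 i * l i.

Lemma lform_is_linear l : linear (lform l).
move=> a u v; rewrite /lform scaler_sumr -big_split /=; apply:eq_bigr => i _.
by rewrite !mxE mulrDl /GRing.scale /= mulrA.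
Qed.

HB.instance Definition _ l := GRing.isLinear.Build R V R *:%R (lform l) (lform_is_linear l).

Lemma cont_lform l : continuous (lform l).
move=> x; rewrite /lform; elim:(index_enum _) => [|i r IH].
 rewrite (_ : (fun h => _) = cst 0)//.
 by apply/funext => y; rewrite big_nil.
rewrite (_ : (fun h => _) = (fun h : V => h ord0 i * l i) \+ (fun h => \sum_(i <- r) h ord0 i * l i)); last first.
 by apply/funext => y; rewrite big_cons.
apply:continuousD => //; apply:continuousM; last exact:cst_continuous.
exact:coord_continuous.
Qed.
Hint Resolve cont_lform : fn.

(** A quadratic remainder identifies the differential. This is the criterion by which integrals
    depending on a parameter are differentiated. *)
Lemma diff_quadratic f x (l : 'I_d -> R) (K : R) :
 (forall h, `|h| <= 1 -> `|f (x + h) - f x - lform l h| <= K * `|h| ^+ 2) ->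
 differentiable f x /\ forall i, dpart i f x = l i.
move=> Hq.
have small (r : R) : 0 < r -> \forall h \near (0 : V), `|h| <= r.
 move=> r0; apply/nbhs_ballP; exists r => //= y.
 by rewrite -ball_normE /= sub0r normrN => /ltW.
have E : f \o shift x = cst (f x) + lform l +o_ (0 : V) id.
 apply/eqaddoP => eps eps0; near=> h.
 have hK : `|h| * (`|K| + 1) <= eps.
  rewrite -ler_pdivlMr//.
  near: h; apply:small; rewrite divr_gt0//.
 have h1 : `|h| <= 1 by near: h; exact:small.
 rewrite [X in `|X|](_ : _ = f (x + h) - f x - lform l h); last first.
  have -> : (f \o shift x - (cst (f x) + lform l)) h = f (h + x) - (f x + lform l h) by [].
  by rewrite (addrC x h) opprD addrA.
 apply:le_trans (Hq h h1) _.
 rewrite mulrA; apply:ler_wpM2r => //; apply:le_trans hK.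
 by rewrite mulrC; apply:ler_wpM2l => //; have := ler_norm K; lra.
have D : 'd f x = lform l :> (V -> R).
 by apply:diff_unique => //; exact:cont_lform.
split.
 apply/diff_locallyP; rewrite D; split => //.
move=> i.
have df : differentiable f x.
 apply/diff_locallyP; rewrite D; split => //.
rewrite dpartE (deriveE _ df) D /lform (bigD1 i)//= big1 ?mxE ?eqxx ?mul1r ?addr0// => j ji.
by rewrite mxE (negbTE ji) mul0r.
Unshelve. all: by end_near. Qed.

Lemma rsmth_coord j : rsmth (fun x : V => x ord0 j) /\
 forall i, dpart i (fun x : V => x ord0 j) = cst (i == j)%:R.
have E (i : 'I_d) : dpart i (fun x : V => x ord0 j) = cst (i == j)%:R.
 apply/funext => x.
 have [|_ ->//] := @diff_quadratic (fun x : V => x ord0 j) x (fun i => (i == j)%:R) 0.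
 move=> h _; rewrite mul0r normr_le0 /lform mxE (bigD1 j)//= eqxx big1 ?mulr1; last first.
  by move=> k /negbTE ->; rewrite mulr0.
 by apply/eqP; ring.
split => //; apply:(@rsmth_coind (fun f => rsmth f \/ f = fun x : V => x ord0 j)); last by right.
move=> f [sf|->].
 by split=> [x|i] //; left.
split=> [x|i]; first exact:differentiable_coord.
by left; rewrite E.
Qed.

Lemma dpart_line i f x (l : R) :
 is_derive (0 : R) (1 : R) (fun t : R => f (x + t *: delta_mx ord0 i)) l -> dpart i f x = l.
move=> [_ <-]; rewrite dpartE.
suff E : (fun t : R => t^-1 *: ((f \o shift x) (t *: delta_mx ord0 i : V) - f x)) =
 (fun t : R => t^-1 *: (((fun u : R => f (x + u *: delta_mx ord0 i)) \o shift 0) (t *: (1 : R))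
   - f (x + (0 : R) *: delta_mx ord0 i))).
 by rewrite /derive E.
by apply/funext => t /=; rewrite scale0r !addr0 -[t *: 1]/(t * 1) mulr1 [_ + x]addrC.
Qed.

Section compose_line.
Variables (phi : nat -> R -> R) (g : V -> R).
Hypothesis dphi : forall m t, is_derive t (1 : R) (phi m) (phi m.+1 t).
Hypothesis sg : rsmth g.

Lemma dpart_comp i m x : differentiable (phi m \o g) x /\
 dpart i (phi m \o g) x = phi m.+1 (g x) * dpart i g x.
split.
 apply:differentiable_comp => //.
 by apply/derivable1_diffP.
apply:dpart_line.
have H := is_derive_line x (delta_mx ord0 i) 0 sg.
rewrite scale0r addr0 dirder_delta in H.
have H2 : is_derive ((fun t : R => g (x + t *: delta_mx ord0 i)) 0) (1 : R) (phi m) (phi m.+1 (g x)).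
 by rewrite scale0r addr0.
by have := is_derive1_comp H2 H.
Qed.

(** [phi m] is the [m]-th derivative of [phi 0]; finite sums of functions [phi m \o g] times smooth
    functions form a class stable under partial derivatives. *)
Lemma rsmth_comp : rsmth (phi 0%N \o g).
apply:(@rsmth_coind (fun k => exists l : seq (nat * (V -> R)),
  List.Forall (fun z => rsmth z.2) l /\
  k = fun y => \sum_(z <- l) phi z.1 (g y) * z.2 y)).
 move=> _ [l [sl ->]].
 suff : (forall x, differentiable (fun y => \sum_(z <- l) phi z.1 (g y) * z.2 y) x) /\
   forall i, exists l', List.Forall (fun z => rsmth z.2) l' /\
   dpart i (fun y => \sum_(z <- l) phi z.1 (g y) * z.2 y) =
   (fun y => \sum_(z <- l') phi z.1 (g y) * z.2 y) by [].
 elim:sl => [|[m v] {}l /= sv sl [IH1 IH2]].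
  rewrite (_ : (fun y => _) = cst 0); last by apply/funext => y; rewrite big_nil.
  split => [x|i]; first exact:differentiable_cst.
  by exists [::]; split => //; rewrite dpart_cst; apply/funext => y; rewrite big_nil.
 rewrite (_ : (fun y => _) = ((phi m \o g) \* v) \+ (fun y => \sum_(z <- l) phi z.1 (g y) * z.2 y)); last first.
  by apply/funext => y; rewrite big_cons.
 have du i x := dpart_comp i m x.
 have du' x : differentiable (phi m \o g) x.
  apply:differentiable_comp; first exact:rsmth_diff.
  by apply/derivable1_diffP; have [] := dphi m (g x).
 have duv x : differentiable ((phi m \o g) \* v) x by apply:differentiableM.
 split => [x|i]; first exact:differentiableD.
 have [l' [sl' E]] := IH2 i.
 exists ((m.+1, dpart i g \* v) :: (m, dpart i v) :: l'); split.
  apply:List.Forall_cons => /=; first by apply:rsmthM => //; exact:rsmth_dpart.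
  by apply:List.Forall_cons => //=; exact:rsmth_dpart.
 apply/funext => y; rewrite dpartD// E !big_cons addrA; congr (_ + _).
 rewrite dpartM//; have [_ ->] := du i y.
 by rewrite /= mulrA.
exists [:: (0%N, cst 1)]; split; first by apply:List.Forall_cons => //; exact:rsmth_cst.
by apply/funext => y; rewrite big_seq1 mulr1.
Qed.

End compose_line.

Lemma rsmth_lform l : rsmth (lform l) /\ forall i, dpart i (lform l) = cst (l i).
have E : lform l = fun y => \sum_j (l j * y ord0 j).
 by apply/funext => y; apply:eq_bigr => j _; rewrite mulrC.
have sc j := (rsmth_coord j).1.
split; first by rewrite E; apply:rsmth_sum => j; by [].
move=> i; apply/funext => x; rewrite E.
have [_ ->] := dpart_sum (index_enum 'I_d) i (fun j => rsmth_diff x (rsmthZ (l j) (sc j))).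
rewrite (bigD1 i)//= big1 => [|j ji].
 by rewrite (dpartZ _ _ (rsmth_diff x (sc i))) (rsmth_coord i).2 eqxx mulr1 addr0.
by rewrite (dpartZ _ _ (rsmth_diff x (sc j))) (rsmth_coord j).2 eq_sym (negbTE ji) mulr0.
Qed.

Lemma rsmth_trig l :
 [/\ rsmth (cos \o lform l), rsmth (sin \o lform l),
  forall i, dpart i (cos \o lform l) = (fun x => - l i * sin (lform l x)) &
  forall i, dpart i (sin \o lform l) = (fun x => l i * cos (lform l x))].
have [sl dl] := rsmth_lform l.
(* The towers of derivatives of cosine and sine: parity selects the function, the half of the order
   its sign. *)
pose c m t := if odd m then (-1) ^+ (m.+1)./2 * sin t else (-1) ^+ m./2 * cos t : R.
pose s m t := if odd m then (-1) ^+ m./2 * cos t else (-1) ^+ m./2 * sin t : R.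
have dc m t : is_derive t (1 : R) (c m) (c m.+1 t).
 rewrite /c /=; case:(odd m) (odd_double_half m) => /= E.
  have H := is_deriveZ ((-1) ^+ (uphalf m)) (is_derive_sin t).
  by [].
 have H := is_deriveZ ((-1) ^+ m./2) (is_derive_cos t).
 by apply:(is_derive_eq H); rewrite /GRing.scale /= exprS; ring.
have ds m t : is_derive t (1 : R) (s m) (s m.+1 t).
 rewrite /s /=; case:(odd m) (odd_double_half m) => /= E.
  have H := is_deriveZ ((-1) ^+ m./2) (is_derive_cos t).
  by apply:(is_derive_eq H); rewrite /GRing.scale -{2}E /= doubleK exprS; ring.
 have H := is_deriveZ ((-1) ^+ m./2) (is_derive_sin t).
 by apply:(is_derive_eq H); rewrite -{2}E uphalf_double.
have c0 : c 0%N = cos by apply/funext => t; rewrite /c /= mul1r.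
have s0 : s 0%N = sin by apply/funext => t; rewrite /s /= mul1r.
have c1 t : c 1%N t = - sin t by rewrite /c mulN1r.
have s1 t : s 1%N t = cos t by rewrite /s mul1r.
split; [by rewrite -c0; exact:rsmth_comp|by rewrite -s0; exact:rsmth_comp|..].
 move=> i; apply/funext => x; have [_] := dpart_comp dc sl i 0 x.
 by rewrite c0 c1 dl => ->; rewrite mulrC mulrN mulNr.
move=> i; apply/funext => x; have [_] := dpart_comp ds sl i 0 x.
by rewrite s0 s1 dl => ->; rewrite mulrC.
Qed.

End real_smooth.
Ltac unfold_ext ::= rewrite /aff ?addr0 ?scale1r.
Hint Resolve rsmth_diff rsmth_diter rsmth_dpart rsmth_cont rsmth_cst rsmthD rsmthM rsmthZ rsmth_aff rsmth_dirder rsmth_iter_dirder cont_lform : fn.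

(** * Lebesgue measure on R^n: Tonelli and affine changes of variables *)

Section lebesgue_rV_theory.
Context (R : realType).
Local Notation leb := (@lebesgue_measure R).

Section cons.
Variables (n : nat) (mu : {sigma_finite_measure set 'rV[R]_n -> \bar R}).
Local Open Scope ereal_scope.

Lemma ge0_int_cons (f : 'rV[R]_n.+1 -> \bar R) : meas f ->
 (forall x, 0 <= f x) ->
 \int[lebesgue_cons mu]_x f x = \int[leb]_t \int[mu]_v f (cons_rV (t, v)).
move=> mf f0.
have E := @ge0_integral_pushforward _ _ _ _ R (@cons_rV R n) (@measurable_cons_rV R n)
 (leb \x mu) setT f measurableT mf (fun x _ => f0 x).
rewrite preimage_setT in E.
have E2 := @fubini_tonelli1 _ _ _ _ R leb mu (f \o @cons_rV R n)
 (measurableT_comp mf (@measurable_cons_rV R n)) (fun x => f0 _).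
apply:etrans (etrans E E2) => //.
Qed.
End cons.

Lemma cons_rVE n (t : R) (v : 'rV[R]_n) :
 (cons_rV (t, v) ord0 ord0 = t) * (forall i, cons_rV (t, v) ord0 (lift ord0 i) = v ord0 i).
rewrite /cons_rV; split.
 rewrite (_ : ord0 = lshift n (ord0 : 'I_1)); last exact/val_inj.
 by rewrite (@row_mxEl R 1 1 n) mxE.
move=> j; rewrite (_ : lift ord0 j = rshift 1 j); last exact/val_inj.
by rewrite (@row_mxEr R 1 1 n).
Qed.

Definition affR (c v : R) (t : measurableTypeR R) : measurableTypeR R := c * t + v.

Lemma mbl_affR c v : meas (affR c v).
by apply:measurable_funD => //. Qed.

Ltac done ::= basic_done.
(** By uniqueness of Lebesgue measure it is enough to compare the two measures on half-open
    intervals. For negative [c] the preimage is half-open on the other side, with the same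
    length. *)
Lemma ge0_int_affR (c v : R) : c != 0 -> forall f : R -> \bar R,
 meas f -> (forall x, 0 <= f x)%E ->
 (\int[leb]_t f (c * t + v)%R = (`|c|^-1)%:E * \int[leb]_t f t)%E.
move=> c0 f mf f0.
pose k : {nonneg R} := NngNum (normr_ge0 c).
pose m0 : {measure set (measurableTypeR R) -> \bar R} := mscale k (pushforward leb (affR c v)).
pose m := m0 (mbl_affR c v).
have ms (A : set R) : measurable A -> leb A = m A.
 apply:lebesgue_measure_unique => X [[x y] /= xy <-].
 rewrite /m /m0 /mscale /= /pushforward.
 have [cp|cn] := ltP 0%R c.
  have -> : affR c v @^-1` `]x, y] = `](x - v) / c, (y - v) / c]%classic.
   apply/seteqP; split => t /=; rewrite !in_itv /= /affR;
    by rewrite ltr_pdivrMr// ler_pdivlMr// ltrBlDr lerBrDr mulrC.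
  rewrite !lebesgue_measure_itv /= !lte_fin.
  rewrite ltr_pM2r ?invr_gt0// ltrBlDr subrK.
  case:ifPn => // _; last by rewrite mule0.
  by rewrite -!EFinD -EFinM gtr0_norm//; congr EFin; field.
 have {}cn : (c < 0)%R by rewrite lt_neqAle c0.
 have -> : affR c v @^-1` `]x, y] = `[(y - v) / c, (x - v) / c[%classic.
  apply/seteqP; split => t /=; rewrite !in_itv /= /affR;
   by rewrite ltr_ndivlMr// ler_ndivrMr// ltrBlDr lerBrDr [(t * c)%R]mulrC andbC.
 rewrite !lebesgue_measure_itv /= !lte_fin.
 rewrite ltr_nM2r ?invr_lt0// ltrBlDr subrK.
 case:ifPn => // _; last by rewrite mule0.
 by rewrite -!EFinD -EFinM ltr0_norm//; congr EFin; field.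
have -> : (\int[leb]_t f t = \int[m]_t f t)%E.
 by apply:eq_measure_integral => A mA _; exact:ms.
rewrite /m /m0 ge0_integral_mscale//=.
rewrite muleA -EFinM mulVf ?normr_eq0// mul1e.
have E := @ge0_integral_pushforward _ _ _ _ R (affR c v) (mbl_affR c v)
 leb setT f measurableT mf (fun x _ => f0 x).
by rewrite preimage_setT in E; rewrite E.
Qed.
Ltac done ::= extended_done.

(* Tonelli along the coordinates. *)
Lemma ge0_int_tensor n (f : 'I_n -> R -> R) :
 (forall i, meas (f i)) -> (forall i t, 0 <= f i t) ->
 (\int[lebesgue_rV R n]_x (\prod_i f i (x ord0 i))%:E = \prod_i \int[leb]_t (f i t)%:E)%E.
elim:n f => [|n IH] f mf f0.
 rewrite integral_dirac//= ?big_ord0.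
  by rewrite diracE in_setT mul1e.
 rewrite (_ : (fun x => _) = cst 1%E)//.
 by apply/funext => x; rewrite big_ord0.
have mP m (g : 'I_m -> R -> R) : (forall i, meas (g i)) ->
 meas (fun x : 'rV[R]_m => \prod_i g i (x ord0 i)).
 move=> mg; elim:(index_enum _) => [|i r IHr].
  rewrite (_ : (fun x => _) = cst 1)//.
  by apply/funext => x; rewrite big_nil.
 rewrite (_ : (fun x => _) = (fun x : 'rV[R]_m => g i (x ord0 i)) \*
   (fun x : 'rV[R]_m => \prod_(i <- r) g i (x ord0 i))); last first.
  by apply/funext => x; rewrite big_cons.
 apply:measurable_funM => //.
 by apply:(measurableT_comp (mg i)); exact:measurable_coord_rV.
rewrite [lebesgue_rV R n.+1]/= ge0_int_cons; first last.
- by [].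
- by apply/measurable_EFinP; exact:mP.
transitivity (\int[leb]_t ((f ord0 t)%:E * \prod_(i < n) \int[leb]_t (f (lift ord0 i) t)%:E))%E.
 apply:eq_integral => t _; rewrite -IH// -ge0_integralZl_EFin//; first last.
 - by apply/measurable_EFinP; exact:(mP _ (fun i => f (lift ord0 i))).
 apply:eq_integral => v _; rewrite big_ord_recl; congr (_ * _)%:E%R.
  by rewrite cons_rVE.
 by apply:eq_bigr => i _; rewrite cons_rVE.
rewrite big_ord_recl ge0_integralZr//.
- by apply:prode_ge0 => i _; apply:integral_ge0 => t _.
Qed.

Local Notation mu n := (lebesgue_rV R n).
Local Notation sq t := (1 + t ^+ 2 : R).

Lemma aff_cons n (c : R) (t : R) (v : 'rV[R]_n) (w : 'rV[R]_n.+1) :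
 aff c w (cons_rV (t, v)) =
 cons_rV ((c * t + w ord0 ord0)%R, aff c (\row_i w ord0 (lift ord0 i)) v).
apply/rowP => i; have aE m (x w' : 'rV[R]_m) k : aff c w' x ord0 k = c * x ord0 k + w' ord0 k.
 by rewrite !mxE.
rewrite aE; have [j ->|->] := unliftP ord0 i; last by rewrite !cons_rVE.
by rewrite !cons_rVE aE mxE.
Qed.

Lemma mbl_aff n (c : R) (w : 'rV[R]_n) : meas (aff c w).
apply:measurable_fun_rV => i.
rewrite (_ : (fun t => _) = (fun t : 'rV[R]_n => c * t ord0 i + w ord0 i)); last first.
 by apply/funext => t; rewrite !mxE.
by apply:measurable_funD => //; apply:measurable_funM => //; exact:measurable_coord_rV.
Qed.
Hint Resolve mbl_aff : fn.

Lemma ge0_int_aff n (c : R) (w : 'rV[R]_n) (f : 'rV[R]_n -> \bar R) : c != 0 ->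
 meas f -> (forall x, 0 <= f x)%E ->
 (\int[mu n]_x f (aff c w x) = (`|c|^-1 ^+ n)%:E * \int[mu n]_x f x)%E.
move=> c0; elim:n w f => [|n IH] w f mf f0.
 rewrite mul1e; apply:eq_integral => x _; congr (f _).
 by apply/rowP => -[].
have mfa : meas (fun x => f (aff c w x)).
 by apply:measurableT_comp => //; exact:mbl_aff.
have mS (t : R) : meas (fun v : 'rV[R]_n => f (cons_rV (t, v))).
 apply:measurableT_comp => //; apply:measurableT_comp; first exact:measurable_cons_rV.
 by [].
rewrite [lebesgue_rV R n.+1]/= !ge0_int_cons//.
under eq_integral do under eq_integral do rewrite aff_cons.
under eq_integral do rewrite (IH _ (fun v => f (cons_rV (_, v))))//.
have mI : meas (fun t : R => \int[mu n]_x f (cons_rV (t, x)))%E.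
 apply:(@measurable_fun_fubini_tonelli_F _ _ _ _ R (mu n) (f \o @cons_rV R n)).
  by apply:measurableT_comp => //; exact:measurable_cons_rV.
 by move=> tv; exact:f0.
have I0 t : (0 <= \int[mu n]_x f (cons_rV (t, x)))%E by apply:integral_ge0.
have c1 : (0 <= `|c|^-1 ^+ n)%R by rewrite exprn_ge0.
have maI : meas (fun t : R => \int[mu n]_x f (cons_rV ((c * t + w ord0 ord0)%R, x)))%E.
 by apply:(measurableT_comp mI (mbl_affR c (w ord0 ord0))).
move:mI I0 maI; set h := fun t : R => (\int[mu n]_x f (cons_rV (t, x)))%E => mI I0 maI.
apply:etrans (ge0_integralZl_EFin leb measurableT (fun t _ => I0 _) maI c1) _.
by rewrite (ge0_int_affR (w ord0 ord0) c0 mI)// muleA exprSr.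
Qed.

Lemma int_sqV : (\int[leb]_t ((sq t)^-1)%:E = pi%:E)%E.
rewrite (@ge0_symfun_integralT R (fun t => (sq t)^-1)).
- rewrite -set_itvcy (_ : (\int[_]_(x in _) _)%E = (pi / 2)%:E).
  by rewrite -EFinM; congr EFin; field.
 exact:integral0y_oneDsqr.
- by [].
- exact:continuous_oneDsqrV.
- by move=> t /=; rewrite sqrrN.
Qed.

Lemma mbl_sqV : meas (fun t : R => (sq t)^-1).
by apply:continuous_measurable_fun; exact:continuous_oneDsqrV.
Qed.

(** * Measurability of continuous functions *)

Section continuous_measurable.
Variable n : nat.
Local Notation V := 'rV[R]_n.

Definition floor_rV (m : nat) (x : V) : 'rV[int]_n := \row_i Num.floor (2 ^+ m * x ord0 i).
Definition grid (m : nat) (c : 'rV[int]_n) : V := \row_i ((c ord0 i)%:~R / 2 ^+ m).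

Lemma grid_floor m x : `|grid m (floor_rV m x) - x| <= 2^-1 ^+ m.
rewrite [leLHS]mx_normrE; apply:bigmax_le => [|[a i] _ /=].
 by [].
rewrite ord1 !mxE ler_norml; have m0 : 0 < 2 ^+ m :> R by rewrite exprn_gt0.
have := floor_itv (2 ^+ m * x ord0 i); move=> /andP[H1 H2].
apply/andP; split.
 rewrite -(ler_pM2r m0) mulrBl mulrAC -mulrA mulfV// mulr1 mulNr -exprMn mulVf// expr1n.
 by move:H2; rewrite /=; lra.
rewrite -(ler_pM2r m0) mulrBl mulrAC -mulrA mulfV// mulr1 -exprMn mulVf// expr1n.
by move:H1; lra.
Qed.

Lemma mbl_floor_rV m (P : set 'rV[int]_n) : measurable (floor_rV m @^-1` P).
have mc (c : 'rV[int]_n) : measurable (floor_rV m @^-1` [set c]).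
 rewrite (_ : _ @^-1` _ = \big[setI/setT]_(i < n)
   ((fun x : V => x ord0 i) @^-1` [set t | Num.floor (2 ^+ m * t) = c ord0 i])).
  apply:bigsetI_measurable => i _.
  rewrite -[X in measurable X]setTI; apply:measurable_coord_rV => //.
  rewrite (_ : [set t | _] = `[(c ord0 i)%:~R / 2 ^+ m, (c ord0 i + 1)%:~R / 2 ^+ m[%classic)//.
  apply/seteqP; split => t /=; have m0 : 0 < 2 ^+ m :> R by rewrite exprn_gt0.
   move=> <-; rewrite in_itv /= ler_pdivrMr// ltr_pdivlMr// [t * _]mulrC.
   exact:floor_itv.
  rewrite in_itv /= ler_pdivrMr// ltr_pdivlMr// [t * _]mulrC => /andP[H1 H2].
  apply/eqP; rewrite eq_le; apply/andP; split; last by rewrite floor_ge_int.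
  by rewrite -ltzD1 floor_lt_int.
 apply/seteqP; split => x /=.
  by move=> <-; rewrite -bigcap_seq => i _; rewrite mxE.
 rewrite -bigcap_seq => H; apply/rowP => i; rewrite mxE.
 by apply:(H i); rewrite /= mem_index_enum.
rewrite (_ : _ @^-1` _ = \bigcup_(c in P) (floor_rV m @^-1` [set c])).
 rewrite bigcup_mkcond; apply:countable_bigcupT_measurable => [|c]//.
 by case:ifP => _.
by apply/seteqP; split => [x Px|x [c Pc E]]; [exists (floor_rV m x)|rewrite /= E].
Qed.

Lemma mbl_comp_floor d (T : measurableType d) m (g : 'rV[int]_n -> T) :
 meas (g \o floor_rV m).
by move=> _ Y mY; rewrite setTI comp_preimage; exact:mbl_floor_rV. Qed.

Lemma cvg_grid x : grid m (floor_rV m x) @[m --> \oo] --> x.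
apply/cvgrPdist_le => e e0.
have : (2^-1 : R) ^+ m @[m --> \oo] --> (0 : R).
 by apply:cvg_expr; rewrite ger0_norm// invf_lt1// ltr1n.
move=> /cvgrPdist_le/(_ e e0); apply:filterS => m H.
rewrite distrC; apply:le_trans (grid_floor m x) _; apply:le_trans H.
by rewrite sub0r normrN ger0_norm.
Qed.

(** The sigma-algebra is generated by the coordinates, so [f] is reached as the pointwise limit of
    its samples on dyadic grids, each of which is constant on countably many measurable cells. *)
Lemma cont_mbl_rV (f : V -> R) : continuous f -> meas f.
move=> cf; apply:(@measurable_fun_cvg _ _ _ setT (fun m => f \o grid m \o floor_rV m)).
- by move=> m; exact:mbl_comp_floor.
- by move=> x _; apply:continuous_cvg; [exact:cf|exact:cvg_grid].
Qed.
Hint Resolve cont_mbl_rV : fn.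

End continuous_measurable.
Hint Resolve cont_mbl_rV : fn.

(** * Polynomial weights and the volume of balls *)

Section wt.
Variable n : nat.
Local Notation V := 'rV[R]_n.

Definition wt (m : nat) (x : V) : R := (1 + `|x|) ^- m.

Lemma onrm_gt0 (x : V) : 0 < 1 + `|x|.
by []. Qed.
Hint Resolve onrm_gt0 : pos.

Lemma onrm_ge1 (x : V) : 1 <= 1 + `|x|.
by rewrite lerDl. Qed.
Hint Resolve onrm_ge1 : pos.

Lemma wt_gt0 m x : 0 < wt m x.
by rewrite invr_gt0. Qed.
Hint Resolve wt_gt0 : pos.

Lemma wt_ge0 m x : 0 <= wt m x.
by []. Qed.
Hint Resolve wt_ge0 : pos.

Lemma mbl_norm_rV : meas (fun x : V => `|x|).
by apply:cont_mbl_rV; exact:norm_continuous. Qed.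

Lemma mbl_wt m : meas (wt m).
apply:cont_mbl_rV => x; rewrite /wt.
apply:(@continuousV _ _ (fun x : V => (1 + `|x|) ^+ m)).
 by [].
apply:(@continuous_comp _ _ _ (fun y : V => 1 + `|y|) (fun t : R => t ^+ m)).
 by apply:continuousD; [exact:cst_continuous|exact:norm_continuous].
exact:exprn_continuous.
Qed.
Hint Resolve mbl_wt : mble.

Lemma wt_le m k x : (k <= m)%N -> wt m x <= wt k x.
move=> km; rewrite lef_pV2 ?posrE//.
by rewrite ler_weXn2l.
Qed.

Lemma wtD m k x : wt (m + k) x = wt m x * wt k x.
by rewrite /wt exprD invfM. Qed.

Lemma wt_exp m x : wt m x * (1 + `|x|) ^+ m = 1.
by rewrite mulVf. Qed.

(** Since [|x_i| <= |x|], the weight of order [2 n] is at most the product of the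
    [1 / (1 + x_i ^ 2)], whose integral is [pi ^ n]. This fixes the order [W = d.*2] used for
    convergence everywhere. *)
Lemma int_wt_lty m : (n.*2 <= m)%N ->
 (\int[mu n]_x (wt m x)%:E < +oo)%E.
move=> nm.
apply:(@le_lt_trans _ _ (\int[mu n]_x (\prod_i (sq (x ord0 i))^-1)%:E)%E).
 apply:ge0_le_integral => //.
 - apply/measurable_EFinP; elim:(index_enum _) => [|i r IHr].
   rewrite (_ : (fun x => _) = cst 1)//.
   by apply/funext => x; rewrite big_nil.
  rewrite (_ : (fun x => _) = (fun x : 'rV[R]_n => (sq (x ord0 i))^-1) \*
    (fun x : 'rV[R]_n => \prod_(i <- r) (sq (x ord0 i))^-1)); last first.
   by apply/funext => x; rewrite big_cons.
  apply:measurable_funM => //.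
  by apply:(measurableT_comp mbl_sqV); exact:measurable_coord_rV.
 - move=> x _; rewrite lee_fin.
  apply:le_trans (wt_le _ nm) _; rewrite /wt -mul2n exprM -exprVn.
  have -> : (1 + `|x|) ^- 2 ^+ n = \prod_(i < n) (1 + `|x|) ^- 2 by rewrite prodr_const card_ord.
  apply:ler_prod => i _.
  apply/andP; split => //.
  rewrite lef_pV2 ?posrE//; last first.
  have := coord_le_norm x i; rewrite sqrrD expr1n mul1r.
  move=> H; apply:lerD.
   by rewrite lerDl.
  by rewrite -[x ord0 i ^+ 2]ger0_norm// normrX ler_pXn2r ?nnegrE.
rewrite (ge0_int_tensor (fun _ => mbl_sqV))//.
by rewrite (eq_bigr (fun=> pi%:E)) => [|i _]; [rewrite prodEFin ltry|exact:int_sqV].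
Qed.

Lemma integrable_wt m : (n.*2 <= m)%N -> (mu n).-integrable setT (EFin \o wt m).
move=> nm; apply/integrableP; split => //.
apply:le_lt_trans (int_wt_lty nm).
apply:ge0_le_integral => //.
- by apply:measurableT_comp => //.
- by move=> x _ /=; rewrite ger0_norm.
Qed.

Definition wt_mass (m : nat) : R := fine (\int[mu n]_x (wt m x)%:E).

Lemma int_wtE m : (n.*2 <= m)%N ->
 (\int[mu n]_x (wt m x)%:E = (wt_mass m)%:E)%E.
move=> nm; rewrite fineK// ge0_fin_numE; first exact:int_wt_lty.
by apply:integral_ge0 => x _.
Qed.

Lemma wt_mass_ge0 m : 0 <= wt_mass m.
by rewrite fine_ge0// integral_ge0// => x _. Qed.
Hint Resolve wt_mass_ge0 : pos.

(* Peetre's inequality *)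
Lemma wt_shift m (x y : V) : wt m x <= (1 + `|x - y|) ^+ m * wt m y.
rewrite /wt mulrC ler_pdivlMl//.
rewrite ler_pdivrMr// -exprMn.
apply:lerXn2r; rewrite ?nnegrE//.
have : `|y| <= `|x - y| + `|x|.
 by rewrite -{1}[y](subKr x) (le_trans (ler_normB _ _))// addrC.
have := normr_ge0 (x - y); have := normr_ge0 x.
move: `|x - y| `|x| `|y| => a b c; nra.
Qed.

Definition unit_cube : set V := [set x | forall i, 0 <= x ord0 i < 1].

Lemma mbl_unit_cube : measurable unit_cube.
rewrite (_ : unit_cube = \big[setI/setT]_(i < n) ((fun x : V => x ord0 i) @^-1` `[0, 1[%classic)).
 apply:bigsetI_measurable => i _; rewrite -[X in measurable X]setTI.
 by apply:measurable_coord_rV => //.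
apply/seteqP; split => x; rewrite -bigcap_seq.
 by move=> H i _ /=; rewrite in_itv /=.
by move=> H i; have := H i; rewrite /= mem_index_enum; exact.
Qed.

Lemma leb_unit_cube : mu n unit_cube = 1%E.
have := @integral_indic _ _ R (mu n) setT measurableT unit_cube mbl_unit_cube.
rewrite setIT => <-.
transitivity (\int[mu n]_x (\prod_i (\1_(`[0, 1[%classic : set R) (x ord0 i) : R))%:E)%E.
 apply:eq_integral => x _; congr EFin; rewrite indicE.
 have [xi|xi] := pselect (unit_cube x).
  rewrite mem_set// big1// => i _; rewrite indicE mem_set//=; exact:xi.
 rewrite memNset//; move/existsNP : xi => [i xi].
 by rewrite (bigD1 i)//= indicE memNset ?mul0r//=.
rewrite (ge0_int_tensor (f := fun _ => \1_(`[0, 1[%classic : set R))).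
- rewrite big1// => i _; rewrite integral_indic//= setIT.
 by rewrite lebesgue_measure_itv lte_fin ltr01 sube0.
- by [].
- by [].
Qed.

Lemma ball_rVE (x : V) r : ball x r = [set y | `|x - y| < r].
by rewrite -ball_normE. Qed.

Lemma mbl_ball_rV (x : V) r : measurable (ball x r).
rewrite ball_rVE -[X in measurable X]setTI.
have mf : meas (fun y : V => `|x - y|).
 apply:cont_mbl_rV => y.
 apply:(@continuous_comp _ _ _ (fun y : V => x - y) (fun z : V => `|z|)); last exact:norm_continuous.
 by apply:continuousB => //; exact:cst_continuous.
rewrite (_ : [set y | _] = (fun y : V => `|x - y|) @^-1` `]-oo, r[%classic).
 by apply:mf => //.
by [].
Qed.

Lemma leb_ball (x : V) r : 0 < r -> mu n (ball x r) = ((r ^+ n)%:E * mu n (ball (0%R : V) 1%R))%E.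
move=> r0; have r0' : r^-1 != 0 by rewrite gt_eqF.
rewrite -[in LHS](setIT (ball x r)) -(@integral_indic _ _ R _ setT)//; last exact:mbl_ball_rV.
rewrite -[X in (_ * mu n X)%E](setIT (ball 0 1)) -(@integral_indic _ _ R _ setT)//; last exact:mbl_ball_rV.
have := @ge0_int_aff n r^-1 (- (r^-1 *: x)) (fun y => (\1_(ball (0 : V) 1) y)%:E) r0'.
rewrite normfV (gtr0_norm r0) invrK => <-//.
- apply:eq_integral => y _; congr EFin; rewrite !indicE; congr ((nat_of_bool _)%:R); apply/idP/idP.
  rewrite !inE !ball_rVE /aff /= => H.
  rewrite sub0r normrN -scalerBr normrZ gtr0_norm// mulrC ltr_pdivrMr// mul1r.
  by rewrite distrC.
 rewrite !inE !ball_rVE /aff /=.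
 by rewrite sub0r normrN -scalerBr normrZ gtr0_norm// mulrC ltr_pdivrMr// mul1r distrC.
- by apply/measurable_EFinP/measurable_indic; exact:mbl_ball_rV.
Qed.

(** The ball of radius 2 around 0 contains the unit cube; scaling does the rest. *)
Lemma leb_ball_gt0 (x : V) r : 0 < r -> (0 < mu n (ball x r))%E.
move=> r0; rewrite leb_ball//.
have -> : mu n (ball (0 : V) 1) = ((2^-1 ^+ n)%:E * mu n (ball (0%R : V) 2%R))%E.
 rewrite (leb_ball 0 (r := 2))// muleA -EFinM -exprMn mulVf// expr1n mul1e//.
rewrite mule_gt0//.
rewrite mule_gt0//.
apply:(@lt_le_trans _ _ (mu n unit_cube)); first by rewrite leb_unit_cube.
apply:le_measure; rewrite ?inE; [exact:mbl_unit_cube|exact:mbl_ball_rV|].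
move=> y yc; rewrite ball_rVE /= sub0r normrN (@le_lt_trans _ _ 1) ?ltr1n//.
rewrite [leLHS]mx_normrE; apply:bigmax_le => // -[a i] _ /=; rewrite ord1.
by have /andP[y0 y1] := yc i; rewrite ger0_norm.
Qed.

Definition ball_vol : R := fine (mu n (ball (0 : V) 1)).

Lemma leb_ballE (x : V) r : 0 < r -> mu n (ball x r) = (r ^+ n * ball_vol)%:E.
move=> r0; rewrite leb_ball// EFinM fineK// ge0_fin_numE//.
apply:(@le_lt_trans _ _ (\int[mu n]_y ((2 ^+ n.*2)%:E * (wt n.*2 y)%:E)))%E.
 rewrite -(setIT (ball 0 1)) -(@integral_indic _ _ R _ setT)//; last exact:mbl_ball_rV.
 apply:ge0_le_integral => //.
 - by apply/measurable_EFinP/measurable_indic; exact:mbl_ball_rV.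
 - by apply:measurable_funeM.
 - move=> y _; rewrite lee_fin indicE.
  case:(boolP (y \in _)) => [|_]; last by rewrite mulr_ge0.
  rewrite inE ball_rVE /= sub0r normrN => y1.
  rewrite ler_pdivlMr// mul1r.
  apply:lerXn2r; rewrite ?nnegrE//.
  by move:y1; lra.
rewrite ge0_integralZl_EFin//.
- by rewrite int_wtE// ltry.
Qed.

End wt.
Hint Resolve onrm_gt0 onrm_ge1 wt_gt0 wt_ge0 wt_mass_ge0 : pos.
Hint Resolve mbl_wt : mble.

End lebesgue_rV_theory.
Hint Resolve mbl_aff cont_mbl_rV : fn.
Hint Resolve onrm_gt0 onrm_ge1 wt_gt0 wt_ge0 wt_mass_ge0 : pos.
Hint Resolve mbl_wt : mble.

(** * Integrals of real functions on R^d *)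

Section real_integral.
Context (R : realType) (d : nat).
Local Notation V := 'rV[R]_d.
Local Notation W := (d.*2).
Implicit Types (f g : V -> R) (x y h : V).

Definition rint f := mu.-integrable setT (EFin \o f).

Lemma rint_mbl f : rint f -> meas f.
by move=> /integrableP[/measurable_EFinP]. Qed.
Hint Resolve rint_mbl : fn.

Lemma rint_dom f g : meas f -> (forall x, `|f x| <= g x) -> rint g -> rint f.
move=> mf fg ig; apply:(le_integrable _ _ _ ig) => //.
by move=> x _; rewrite lee_fin (le_trans (fg x))// ler_norm.
Qed.

Lemma rintD f g : rint f -> rint g -> rint (fun x => f x + g x).
exact:integrableD. Qed.
Hint Resolve rintD : fn.

Lemma rintB f g : rint f -> rint g -> rint (fun x => f x - g x).
exact:integrableB. Qed.
Hint Resolve rintB : fn.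

Lemma rintZ (a : R) f : rint f -> rint (fun x => a * f x).
exact:integrableZl. Qed.
Hint Resolve rintZ : fn.

Lemma rint0 : rint (cst 0).
exact:integrable0. Qed.
Hint Resolve rint0 : fn.

Lemma rint_sum (I : Type) (r : seq I) (F : I -> V -> R) : (forall i, rint (F i)) ->
 rint (fun x => \sum_(i <- r) F i x).
move=> H; elim:r => [|i r IH].
 rewrite (_ : (fun x => _) = cst 0); first exact:rint0.
 by apply/funext => x; rewrite big_nil.
rewrite (_ : (fun x => _) = fun x => F i x + \sum_(i <- r) F i x); last first.
 by apply/funext => x; rewrite big_cons.
exact:rintD.
Qed.
Hint Resolve rint_sum : fn.

Lemma RintD f g : rint f -> rint g -> \int[mu]_x (f x + g x) = \int[mu]_x f x + \int[mu]_x g x.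
exact:RintegralD. Qed.

Lemma RintB f g : rint f -> rint g -> \int[mu]_x (f x - g x) = \int[mu]_x f x - \int[mu]_x g x.
exact:RintegralB. Qed.

Lemma RintZ (a : R) f : rint f -> \int[mu]_x (a * f x) = a * \int[mu]_x f x.
by move=> H; rewrite RintegralZl. Qed.

Lemma Rint_cst0 : \int[lebesgue_rV R d]_x (0 : R) = 0.
by rewrite /Rintegral integral0. Qed.

Lemma Rint_sum (I : Type) (r : seq I) (F : I -> V -> R) : (forall i, rint (F i)) ->
 \int[mu]_x (\sum_(i <- r) F i x) = \sum_(i <- r) \int[mu]_x F i x.
move=> H; elim:r => [|i r IH].
 by rewrite big_nil -[RHS]Rint_cst0; apply:eq_Rintegral => x _; rewrite big_nil.
rewrite big_cons -IH -RintD//; last exact:rint_sum.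
by apply:eq_Rintegral => x _; rewrite big_cons.
Qed.

Lemma Rint_le f g : rint f -> rint g -> (forall x, f x <= g x) ->
 \int[mu]_x f x <= \int[mu]_x g x.
by move=> *; apply:le_Rintegral. Qed.

Lemma Rint_norm_le f g : meas f -> rint g -> (forall x, `|f x| <= g x) ->
 `|\int[mu]_x f x| <= \int[mu]_x g x.
move=> mf ig fg; have if_ := rint_dom mf fg ig.
rewrite ler_norml; apply/andP; split; last first.
 by apply:Rint_le => // x; exact:le_trans (ler_norm _) (fg x).
rewrite -mulN1r -RintZ//; apply:Rint_le => //; first exact:rintZ.
by move=> x; rewrite mulN1r lerNl (le_trans _ (fg x))// -normrN ler_norm.
Qed.

Lemma rint_wt m : (W <= m)%N -> rint (wt m).
exact:integrable_wt. Qed.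
Hint Resolve rint_wt : fn.

(** The standard form of domination: a pointwise bound by a weight yields integrability ([.1]) and
    the size of the integral ([.2]) together. *)
Lemma Rint_dom m A f : (W <= m)%N -> meas f ->
 (forall x, `|f x| <= A * wt m x) ->
 rint f /\ `|\int[mu]_x f x| <= A * wt_mass R d m.
move=> Wm mf bf; have iw := rintZ A (rint_wt Wm); split; first exact:rint_dom iw.
by apply:le_trans (Rint_norm_le mf iw bf) _; rewrite RintZ//; exact:rint_wt.
Qed.

Lemma rint_aff f (c : R) (w : V) : c != 0 -> rint f -> rint (f \o aff c w).
move=> c0 /integrableP[mf fi]; apply/integrableP; split.
 by apply/measurable_EFinP; apply:measurableT_comp (mbl_aff c w); exact/measurable_EFinP.
have := @ge0_int_aff R d c w (fun x => `|(f x)%:E|%E) c0.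
rewrite /= => -> //; last by apply/(measurable_EFinP setT (fun x => `|f x|)); apply:measurableT_comp => //; exact/measurable_EFinP.
by rewrite lte_mul_pinfty.
Qed.
Hint Resolve rint_aff : fn.

Lemma Rint_aff f (c : R) (w : V) : c != 0 -> rint f ->
 \int[mu]_x f (aff c w x) = `|c|^-1 ^+ d * \int[mu]_x f x.
move=> c0 if_; have mf := rint_mbl if_; rewrite /Rintegral.
have mfp : meas ((EFin \o f)^\+)%E by apply:measurable_funepos; by [].
have mfn : meas ((EFin \o f)^\-)%E by apply:measurable_funeneg; by [].
have E1 := @ge0_int_aff R d c w _ c0 mfp (fun x => funepos_ge0 _ x).
have E2 := @ge0_int_aff R d c w _ c0 mfn (fun x => funeneg_ge0 _ x).
have fp := integrable_pos_fin_num measurableT if_; have fn := integrable_neg_fin_num measurableT if_.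
rewrite [in RHS]integralE.
transitivity (fine (\int[mu]_x (EFin \o f)^\+ (aff c w x) - \int[mu]_x (EFin \o f)^\- (aff c w x))%E).
 rewrite [in LHS]integralE.
 by congr (fine (_ - _)%E); apply:eq_integral => x _; rewrite ?funeposE ?funenegE.
rewrite E1 E2 -(fineK fp) -(fineK fn); exact/esym/mulrBr.
Qed.

Lemma Rint_transl f (w : V) : rint f -> \int[mu]_x f (x + w) = \int[mu]_x f x.
move=> H; transitivity (\int[mu]_x f (aff 1 w x)).
 by apply:eq_Rintegral => x _; rewrite /aff scale1r.
by rewrite Rint_aff// normr1 invr1 expr1n mul1r.
Qed.

Lemma Rint_refl f (w : V) : rint f -> \int[mu]_x f (w - x) = \int[mu]_x f x.
move=> H; transitivity (\int[mu]_x f (aff (-1) w x)).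
 by apply:eq_Rintegral => x _; rewrite /aff scaleN1r addrC.
by rewrite Rint_aff// normrN normr1 invr1 expr1n mul1r.
Qed.

Lemma mbl_subV : meas (fun xy : V * V => xy.1 - xy.2).
apply:measurable_fun_rV => i; rewrite (_ : (fun t => _) = fun t : V * V => t.1 ord0 i - t.2 ord0 i); last first.
 by apply/funext => t; rewrite !mxE.
apply:measurable_funB; apply:(measurableT_comp (measurable_coord_rV i)) => //.
Qed.

Section fubini.
Variables (F : V -> V -> R) (a b : V -> R).
Hypothesis mF : meas (fun xy : V * V => F xy.1 xy.2).
Hypothesis Fab : forall x y, `|F x y| <= a x * b y.
Hypothesis ia : rint a.
Hypothesis ib : rint b.

Let iF : (mu \x mu)%E.-integrable setT (EFin \o (fun xy : V * V => F xy.1 xy.2)).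
apply/integrable12ltyP => //.
have ma := rint_mbl ia; have mb := rint_mbl ib.
apply:(@le_lt_trans _ _ (\int[mu]_x \int[mu]_y (`|a x|%:E * `|b y|%:E))%E).
 apply:ge0_le_integral => //.
 - by move=> x _; exact:integral_ge0.
 - apply:(@measurable_fun_fubini_tonelli_F _ _ _ _ R mu (fun xy : V * V => `|(F xy.1 xy.2)%:E|%E)) => //.
  by apply/(measurable_EFinP setT (fun xy : V * V => `|F xy.1 xy.2|)); apply:measurableT_comp.
 - apply:(@measurable_fun_fubini_tonelli_F _ _ _ _ R mu (fun xy : V * V => `|a xy.1|%:E * `|b xy.2|%:E)%E) => //.
  apply/measurable_EFinP; apply:measurable_funM; apply:measurableT_comp => //.
   by apply:(measurableT_comp ma).
  by apply:(measurableT_comp mb).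
 - move=> x _; apply:ge0_le_integral => //.
  + apply/(measurable_EFinP setT (fun y => `|F x y|)); apply:measurableT_comp => //.
   exact:(measurableT_comp mF (measurable_pair1 x)).
  + by apply/measurable_EFinP/measurable_funM => //; apply:measurableT_comp.
  + move=> y _; rewrite lee_fin -normrM.
   exact:le_trans (Fab x y) (ler_norm _).
have ib' : (\int[mu]_y `|b y|%:E < +oo)%E by case/integrableP : ib.
have ia' : (\int[mu]_y `|a y|%:E < +oo)%E by case/integrableP : ia.
have b0 : (0 <= \int[mu]_y `|b y|%:E)%E by apply:integral_ge0.
rewrite (eq_integral (fun x => (\int[mu]_y `|b y|%:E) * `|a x|%:E)%E); last first.
 move=> x _; rewrite ge0_integralZl_EFin//; first by rewrite muleC.
 by apply/measurable_EFinP; apply:measurableT_comp.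
rewrite ge0_integralZl//; last by apply/measurable_EFinP; apply:measurableT_comp.
rewrite -(fineK (x := \int[mu]_y `|b y|%:E)) ?ge0_fin_numE// lte_mul_pinfty//.
by rewrite fineK ?ge0_fin_numE.
Qed.

Let aF x : rint (F x).
apply:(@rint_dom _ (fun y => a x * b y)); [|exact:Fab|exact:rintZ].
exact:(measurableT_comp mF (measurable_pair1 x)).
Qed.

Let aF' y : rint (F^~ y).
apply:(@rint_dom _ (fun x => b y * a x)); [|by move=> x; rewrite mulrC; exact:Fab|exact:rintZ].
exact:(measurableT_comp mF (measurable_pair2 y)).
Qed.

Lemma Rint_fubini : \int[mu]_x \int[mu]_y F x y = \int[mu]_y \int[mu]_x F x y.
rewrite /Rintegral.
rewrite (eq_integral (fun x => \int[mu]_y (F x y)%:E)%E); last first.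
 by move=> x _; rewrite fineK//; exact:(integrable_fin_num _ (aF x)).
rewrite [in RHS](eq_integral (fun y => \int[mu]_x (F x y)%:E)%E); last first.
 by move=> y _; rewrite fineK//; exact:(integrable_fin_num _ (aF' y)).
by congr fine; exact:(Fubini iF).
Qed.

End fubini.

End real_integral.
Hint Resolve rint_mbl rintD rintB rintZ rint0 rint_sum rint_wt rint_aff : fn.

(** * Real Schwartz functions, convolution, cosine and sine transforms *)

Section real_schwartz.
Context (R : realType) (d : nat).
Local Notation V := 'rV[R]_d.
Local Notation W := (d.*2).
Implicit Types (f g : V -> R) (x y h : V) (s : seq 'I_d).

(** One order [k] counts both the decay and the derivatives, as in [schwartz_seminorm]. Words [s] of
    indices stand for derivatives in place of multi-indices. *)
Definition rbnd k f (B : R) :=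
 forall s x, (size s <= k)%N -> (1 + `|x|) ^+ k * `|diter s f x| <= B.

Definition rsch f := rsmth f /\ forall k, exists B, rbnd k f B.

Lemma onrmX_ge1 k x : 1 <= (1 + `|x|) ^+ k.
exact/exprn_ege1/onrm_ge1. Qed.

Lemma onrmX_gt0 k x : 0 < (1 + `|x|) ^+ k.
by []. Qed.
Hint Resolve onrmX_gt0 : pos.

Lemma rbnd_ge0 k f B : rbnd k f B -> 0 <= B.
by move=> /(_ [::] 0 isT); apply:le_trans. Qed.

Lemma rbnd_le k k' f B B' : (k' <= k)%N -> B <= B' -> rbnd k f B -> rbnd k' f B'.
move=> kk' BB' Hf s x sk; apply:le_trans (le_trans (Hf s x (leq_trans sk kk')) BB').
by apply:ler_wpM2r => //; rewrite ler_weXn2l.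
Qed.

Lemma rbnd_wt k f B s x : rbnd k f B -> (size s <= k)%N -> `|diter s f x| <= B * wt k x.
by move=> Hf sk; rewrite ler_pdivlMr// mulrC; exact:Hf. Qed.

Lemma rbnd_wt0 k f B x : rbnd k f B -> `|f x| <= B * wt k x.
by move=> Hf; exact:(rbnd_wt (s := [::]) x Hf). Qed.

Lemma wt_rbnd k f B : (forall s x, (size s <= k)%N -> `|diter s f x| <= B * wt k x) -> rbnd k f B.
by move=> Hf s x sk; rewrite mulrC -ler_pdivlMr//; exact:Hf. Qed.

Lemma rbnd_sup k f B s x : rbnd k f B -> (size s <= k)%N -> `|diter s f x| <= B.
move=> Hf sk; apply:le_trans (Hf s x sk).
by rewrite ler_peMl// onrmX_ge1.
Qed.

Lemma rbnd_dpart k f B i : rbnd k.+1 f B -> rbnd k (dpart i f) B.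
move=> Hf s x sk; rewrite -[diter s _](diter_cat s [:: i]).
apply:le_trans (Hf (s ++ [:: i]) x _); last by rewrite size_cat addn1.
by apply:ler_wpM2r => //; rewrite ler_weXn2l.
Qed.

Lemma rbnd_diter k f B s : rbnd (k + size s) f B -> rbnd k (diter s f) B.
elim:s k => [|i s IH] k /=; first by rewrite addn0.
by rewrite addnS -addSn => /IH/(@rbnd_dpart _ _ _ i).
Qed.

Lemma rbndD k f g A B : rsmth f -> rsmth g -> rbnd k f A -> rbnd k g B -> rbnd k (f \+ g) (A + B).
move=> sf sg Hf Hg s x sk; rewrite diterD//=.
apply:le_trans (ler_wpM2l _ (ler_normD _ _)) _ => //.
by rewrite mulrDr; apply:lerD; [exact:Hf|exact:Hg].
Qed.

Lemma rbndZ k f (a A : R) : rsmth f -> rbnd k f A -> rbnd k (fun x => a * f x) (`|a| * A).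
move=> sf Hf s x sk; rewrite diterZ//= normrM mulrCA.
by apply:ler_wpM2l => //; exact:Hf.
Qed.

Lemma leibniz s f g x (A B : R) : rsmth f -> rsmth g ->
 (forall t, (size t <= size s)%N -> `|diter t f x| <= A) ->
 (forall t, (size t <= size s)%N -> `|diter t g x| <= B) ->
 `|diter s (f \* g) x| <= 2 ^+ size s * (A * B).
elim/last_ind: s f g => [|s i IH] f g sf sg HA HB.
 rewrite mul1r normrM; apply:ler_pM => //; [exact:(HA [::])|exact:(HB [::])].
rewrite -cats1 diter_cat size_cat addn1 /=.
have -> : dpart i (f \* g) = (dpart i f \* g) \+ (f \* dpart i g).
 by apply/funext => y; rewrite dpartM.
have si := rsmth_dpart i.
rewrite diterD//.
rewrite size_rcons in HA HB.
have up u C : (forall t, (size t <= (size s).+1)%N -> `|diter t u x| <= C) ->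
 forall t, (size t <= size s)%N -> `|diter t u x| <= C.
 by move=> H t ts; apply:H; exact:leqW.
have upd u C : (forall t, (size t <= (size s).+1)%N -> `|diter t u x| <= C) ->
 forall t, (size t <= size s)%N -> `|diter t (dpart i u) x| <= C.
 move=> H t ts; rewrite -[diter t _](diter_cat t [:: i]); apply:H.
 by rewrite size_cat addn1.
apply:le_trans (ler_normD _ _) _; rewrite exprS -mulrA mulrDl mul1r.
apply:lerD; apply:IH; by [exact:si|exact:up|exact:upd|].
Qed.

(** A factor growing like [(1 + |x|) ^ k'] costs [k'] orders of decay of the other one. *)
Lemma rbndM k k' f g A B : rsmth f -> rsmth g -> rbnd (k + k') f A ->
 (forall s x, (size s <= k)%N -> `|diter s g x| <= B * (1 + `|x|) ^+ k') ->
 rbnd k (f \* g) (2 ^+ k * (A * B)).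
move=> sf sg Hf Hg s x sk.
have A0 := rbnd_ge0 Hf.
have B0 : 0 <= B.
 by have := le_trans (normr_ge0 _) (Hg [::] x isT); rewrite pmulr_lge0.
have w0 := wt_ge0 (k + k') x.
have H : `|diter s (f \* g) x| <= 2 ^+ size s * ((A * wt (k + k') x) * (B * (1 + `|x|) ^+ k')).
 apply:leibniz => // t ts; [apply:(rbnd_wt x Hf)|apply:Hg]; last exact:leq_trans sk.
 by rewrite (leq_trans ts)// (leq_trans sk)// leq_addr.
apply:le_trans (ler_wpM2l (ltW (onrmX_gt0 k x)) H) _.
rewrite mulrCA; apply:ler_pM; rewrite//.
- by rewrite ler_weXn2l// ler1n.
- rewrite [leLHS](_ : _ = A * B * ((wt k x * (1 + `|x|) ^+ k) * (wt k' x * (1 + `|x|) ^+ k'))).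
  by rewrite !wt_exp !mulr1.
 by rewrite wtD; ring.
Qed.

Lemma rbnd_coord k f B i : rsmth f -> rbnd k.+1 f B ->
 rbnd k (fun x => x ord0 i * f x) (2 ^+ k * B).
move=> sf Hf; have [sc dc] := rsmth_coord R i.
have -> : (fun x => x ord0 i * f x) = f \* (fun x => x ord0 i).
 by [].
rewrite -[B]mulr1; apply:(@rbndM k 1) => //; first by rewrite addn1.
have dcc t (b : R) : diter t (cst b) = cst b \/ diter t (cst b : V -> R) = cst 0.
 elim:t => [|a t [IH|IH]] /=; first (by left); by right; rewrite IH dpart_cst.
move=> s x _; rewrite mul1r expr1; have x1 := onrm_ge1 x.
case/lastP: s => [|s a]; first by rewrite (le_trans (coord_le_norm x i))// lerDr.
rewrite -cats1 diter_cat /= dc; case:(dcc s (a == i)%:R) => ->.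
 by apply:le_trans x1; case:(a == i); rewrite ?normr1 ?normr0.
by apply:le_trans x1; rewrite normr0.
Qed.

Lemma rbnd_aff k f B (c : R) (v : V) : c != 0 -> rsmth f -> rbnd k f B ->
 rbnd k (f \o aff c v) (((1 + `|c|) * (1 + `|c|^-1) * (1 + `|v|)) ^+ k * B).
move=> c0 sf Hf s x sk; have B0 := rbnd_ge0 Hf; rewrite diter_aff// normrM normrX.
have H1 : `|c| ^+ size s <= (1 + `|c|) ^+ k.
 apply:(@le_trans _ _ ((1 + `|c|) ^+ size s)); first by rewrite lerXn2r ?nnegrE// lerDr.
 by rewrite ler_weXn2l// lerDl.
have H2 : 1 + `|x| <= (1 + `|c|^-1) * (1 + `|v|) * (1 + `|aff c v x|).
 have : `|c| * `|x| <= `|aff c v x| + `|v|.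
  by rewrite -normrZ -{1}[c *: x](addrK v) ler_normB.
 have c1 : 0 < `|c|^-1 by rewrite invr_gt0 normr_gt0.
 move=> /(ler_wpM2l (ltW c1)); rewrite mulKf ?normr_eq0//.
 have := normr_ge0 v; have := normr_ge0 (aff c v x); have := ltW c1.
 move: `|c|^-1 `|v| `|aff c v x| `|x| => a b e z a0 e0 b0 H.
 have := mulr_ge0 a0 e0; have := mulr_ge0 a0 b0; have := mulr_ge0 e0 b0.
 by have := mulr_ge0 (mulr_ge0 a0 b0) e0; lra.
have {}H2 : (1 + `|x|) ^+ k <= ((1 + `|c|^-1) * (1 + `|v|)) ^+ k * (1 + `|aff c v x|) ^+ k.
 by rewrite -exprMn; apply:lerXn2r H2; rewrite nnegrE.
rewrite -(mulrA (1 + `|c|)) [(1 + `|c|) * _]mulrC exprMn -mulrA.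
apply:(@le_trans _ _ ((((1 + `|c|^-1) * (1 + `|v|)) ^+ k * (1 + `|aff c v x|) ^+ k) *
  ((1 + `|c|) ^+ k * `|diter s f (aff c v x)|))).
 apply:ler_pM => //; exact:ler_wpM2r.
rewrite -mulrA; apply:ler_wpM2l => //.
rewrite mulrCA; apply:ler_wpM2l => //.
exact:Hf.
Qed.

Lemma rsch_smth f : rsch f -> rsmth f. by case. Qed.
Hint Resolve rsch_smth : fn.

Lemma rschD f g : rsch f -> rsch g -> rsch (f \+ g).
move=> [sf bf] [sg bg]; split=> [|k]//.
by have [A Af] := bf k; have [B Bg] := bg k; exists (A + B); exact:rbndD.
Qed.
Hint Resolve rschD : fn.

Lemma rschZ (a : R) f : rsch f -> rsch (fun x => a * f x).
move=> [sf bf]; split=> [|k]//.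
by have [A Af] := bf k; exists (`|a| * A); exact:rbndZ.
Qed.
Hint Resolve rschZ : fn.

Lemma rschM f g : rsch f -> rsch g -> rsch (f \* g).
move=> [sf bf] [sg bg]; split=> [|k]//.
have [A Af] := bf k; have [B Bg] := bg k; exists (2 ^+ k * (A * B)).
apply:(@rbndM k 0) => //; first by rewrite addn0.
by move=> s x sk; rewrite mulr1; exact:rbnd_sup Bg sk.
Qed.
Hint Resolve rschM : fn.

Lemma rsch_dpart i f : rsch f -> rsch (dpart i f).
move=> [sf bf]; split=> [|k]//.
by have [A Af] := bf k.+1; exists A; exact:rbnd_dpart.
Qed.
Hint Resolve rsch_dpart : fn.

Lemma rsch_diter s f : rsch f -> rsch (diter s f).
by move=> sf; elim:s => //= i s. Qed.
Hint Resolve rsch_diter : fn.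

Lemma rsch_coord i f : rsch f -> rsch (fun x => x ord0 i * f x).
move=> [sf bf]; split=> [|k].
 by apply:rsmthM => //; exact:(rsmth_coord R i).1.
by have [A Af] := bf k.+1; exists (2 ^+ k * A); exact:rbnd_coord.
Qed.
Hint Resolve rsch_coord : fn.

Lemma rsch_aff (c : R) (v : V) f : c != 0 -> rsch f -> rsch (f \o aff c v).
move=> c0 [sf bf]; split=> [|k]//.
by have [A Af] := bf k; exists (((1 + `|c|) * (1 + `|c|^-1) * (1 + `|v|)) ^+ k * A); exact:rbnd_aff.
Qed.
Hint Resolve rsch_aff : fn.

Lemma rsmth_mbl f : rsmth f -> meas f.
by []. Qed.
Hint Resolve rsmth_mbl : fn.

Lemma rsch_mbl f : rsch f -> meas f.
by []. Qed.
Hint Resolve rsch_mbl : fn.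

Lemma rsch_rint f : rsch f -> rint f.
move=> [sf bf]; have [A Af] := bf W.
have [] // := @Rint_dom R d W A f (leqnn _) (rsmth_mbl sf).
by move=> x; exact:rbnd_wt0.
Qed.
Hint Resolve rsch_rint : fn.

(* Differentiation under the integral sign, by a second order Taylor expansion. *)
Section param_int.
Variable g : V -> V -> R.
Hypothesis sg : forall y, rsmth (g^~ y).
Hypothesis mg : forall s x, meas (fun y => diter s (g^~ y) x).
Hypothesis bg : forall k, exists A : R, forall s x y, (size s <= k)%N ->
 `|diter s (g^~ y) x| <= A * wt W y.

Let ig s x : rint (fun y => diter s (g^~ y) x).
have [A HA] := bg (size s).
by apply:(Rint_dom (A := A) (leqnn W) (mg s x) _).1 => y; exact:HA.
Qed.

Let step s x : differentiable (fun x => \int[mu]_y diter s (g^~ y) x) x /\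
 forall i, dpart i (fun x => \int[mu]_y diter s (g^~ y) x) x = \int[mu]_y diter (i :: s) (g^~ y) x.
have [A HA] := bg (size s).+2.
have A0 : 0 <= A.
 by have := le_trans (normr_ge0 _) (HA [::] x 0 isT); rewrite pmulr_lge0// wt_gt0.
apply:(@diff_quadratic _ _ _ _ _ ((d%:R ^+ 2 * A) * wt_mass R d W)) => h _.
have -> : lform (fun i => \int[mu]_y diter (i :: s) (g^~ y) x) h =
 \int[mu]_y (\sum_i h ord0 i * diter (i :: s) (g^~ y) x).
 rewrite Rint_sum => [|i]; last exact/rintZ/ig.
 by apply:eq_bigr => i _; rewrite RintZ.
have iS : rint (fun y => \sum_i h ord0 i * diter (i :: s) (g^~ y) x).
 by apply:rint_sum => i; exact/rintZ/ig.
rewrite -RintB//; rewrite -RintB//; [|by apply:rintB; exact:ig].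
rewrite mulrAC; apply:(Rint_dom (leqnn W) _ _).2 => [|y].
 by [].
have := @taylor R d (diter s (g^~ y)) x h ((d%:R * `|h|) ^+ 2 * (A * wt W y)) 2
 (rsmth_diter s (sg y)).
rewrite big_ord_recl big_ord1 /= invr1 !mul1r opprD addrA.
rewrite [dirder h _ x]/dirder exprMn => H.
rewrite (_ : _ * _ * _ = d%:R ^+ 2 * `|h| ^+ 2 * (A * wt W y)); last by ring.
apply:H => t _; have := @iter_dirder_bnd R d h 2 (diter s (g^~ y)) (x + t *: h) (A * wt W y)
 (rsmth_diter s (sg y)).
rewrite exprMn; apply => u su; rewrite -diter_cat; apply:HA.
by rewrite size_cat su.
Qed.

Lemma param_int : rsmth (fun x => \int[mu]_y g x y) /\
 forall s x, diter s (fun x => \int[mu]_y g x y) x = \int[mu]_y diter s (g^~ y) x.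
have E s : diter s (fun x => \int[mu]_y g x y) = fun x => \int[mu]_y diter s (g^~ y) x.
 elim:s => //= i s ->; apply/funext => x; exact:(step s x).2.
by split=> [s x|s x]; rewrite E//; exact:(step s x).1.
Qed.

End param_int.

Definition rconv f g : V -> R := fun x => \int[mu]_y (f (x - y) * g y).

Lemma rsch_shift y f : rsch f -> rsch (fun x => f (x - y)).
move=> sf; rewrite (_ : (fun x => _) = f \o aff 1 (- y))//.
Qed.
Hint Resolve rsch_shift : fn.

Lemma diter_shift s y f : rsmth f -> diter s (fun x => f (x - y)) = fun x => diter s f (x - y).
move=> sf; rewrite (_ : (fun x => _) = f \o aff 1 (- y)); last first.
 by [].
by rewrite diter_aff//; apply/funext => x; rewrite expr1n mul1r /aff scale1r.
Qed.

Lemma rsmth_shift y f : rsmth f -> rsmth (fun x => f (x - y)).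
move=> sf; rewrite (_ : (fun x => _) = f \o aff 1 (- y))//.
Qed.
Hint Resolve rsmth_shift : fn.

Lemma mbl_subr x f : meas f -> meas (fun y => f (x - y)).
move=> mf; rewrite (_ : (fun y => _) = f \o aff (-1) x); last first.
 by apply/funext => y; rewrite /= /aff scaleN1r addrC.
by apply:measurableT_comp => //; exact:mbl_aff.
Qed.
Hint Resolve mbl_subr : fn.

Lemma onrm_sub x y : 1 + `|x| <= (1 + `|x - y|) * (1 + `|y|).
have : `|x| <= `|x - y| + `|y| by rewrite -{1}[x](subrK y) ler_normD.
have := mulr_ge0 (normr_ge0 (x - y)) (normr_ge0 y).
by move: `|x| `|x - y| `|y| => a b c; lra.
Qed.

Lemma wt_conv k x y : wt k (x - y) * wt k y <= wt k x.
rewrite -invfM lef_pV2 ?posrE//.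
by rewrite -exprMn; apply:lerXn2r (onrm_sub x y); rewrite nnegrE.
Qed.

Section rconv.
Variables (f g : V -> R) (B : R).
Hypothesis sf : rsmth f.
Hypothesis bf : forall k, exists A : R, forall s x, (size s <= k)%N -> `|diter s f x| <= A.
Hypothesis mg : meas g.
Hypothesis bg : forall y, `|g y| <= B * wt W y.

Let E s y : diter s (fun x => f (x - y) * g y) = fun x => diter s f (x - y) * g y.
rewrite (_ : (fun x => _) = (fun x => g y * f (x - y)))//.
rewrite diterZ//.
by rewrite diter_shift.
Qed.

Lemma rconv_smth : rsmth (rconv f g) /\ forall s, diter s (rconv f g) = rconv (diter s f) g.
have [|||sG dG] := @param_int (fun x y => f (x - y) * g y).
- move=> y; rewrite (_ : (fun x => _) = (fun x => g y * f (x - y)))//.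
- move=> s x; rewrite (_ : (fun y => _) = fun y => diter s f (x - y) * g y); last first.
  by apply/funext => y; rewrite E.
 by [].
- move=> k; have [A HA] := bf k; exists (A * B) => s x y sk; rewrite E normrM -mulrA.
 by apply:ler_pM => //; exact:HA.
split=> // s; apply/funext => x; rewrite dG; apply:eq_Rintegral => y _.
by rewrite E.
Qed.

Lemma rint_conv x : rint (fun y => f (x - y) * g y).
have [A HA] := bf 0; apply:(Rint_dom (A := A * B) (leqnn W) _ _).1 => [|y].
 by [].
by rewrite normrM -mulrA; apply:ler_pM => //; exact:(HA [::]).
Qed.

End rconv.

(** By [wt_conv] the product of two weights of order [k] is at most the weight at [x]; the remaining
    [W] orders of [g] make the integral converge. *)
Lemma rconv_bnd k f g (A B : R) x : meas f -> meas g ->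
 (forall y, `|f y| <= A * wt k y) -> (forall y, `|g y| <= B * wt (k + W) y) ->
 `|rconv f g x| <= A * B * wt_mass R d W * wt k x.
move=> mf mg bf bg; rewrite mulrAC.
apply:(Rint_dom (leqnn W) _ _).2 => [|y].
 by [].
rewrite normrM; apply:le_trans (ler_pM _ _ (bf _) (bg _)) _ => //.
rewrite wtD (_ : _ * _ * _ = A * B * wt W y * (wt k (x - y) * wt k y)); last by ring.
rewrite [leRHS](_ : _ = A * B * wt W y * wt k x); last by ring.
apply:ler_wpM2l; last exact:wt_conv.
rewrite !mulr_ge0 ?wt_ge0//.
 by have := le_trans (normr_ge0 _) (bf 0); rewrite pmulr_lge0// wt_gt0.
by have := le_trans (normr_ge0 _) (bg 0); rewrite pmulr_lge0// wt_gt0.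
Qed.

Lemma rsch_sup f : rsch f ->
 forall k, exists A : R, forall s x, (size s <= k)%N -> `|diter s f x| <= A.
move=> [sf bf] k; have [A HA] := bf k; exists A => s x sk; exact:rbnd_sup HA sk.
Qed.

Lemma rconv_sch f g : rsch f -> rsch g ->
 rsch (rconv f g) /\ forall s, diter s (rconv f g) = rconv (diter s f) g.
move=> Hf Hg; have [sf bf] := Hf; have [sg bg] := Hg.
have mg := rsmth_mbl sg; have [B HB] := bg W.
have [sc dc] := rconv_smth sf (rsch_sup Hf) mg (fun y => rbnd_wt0 y HB).
split=> //; split=> // k.
have [A HA] := bf k; have [B' HB'] := bg (k + W)%N.
exists (A * B' * wt_mass R d W); apply:wt_rbnd => s x sk.
rewrite dc; apply:rconv_bnd => //.
- by move=> y; exact:rbnd_wt HA sk.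
- by move=> y; exact:rbnd_wt0 HB'.
Qed.
Hint Extern 2 (rsch (rconv _ _)) => apply:(proj1 (rconv_sch _ _)) : fn.

Lemma rint_rconv f g x : rsch f -> rsch g -> rint (fun y => f (x - y) * g y).
move=> Hf Hg; have [sg bg] := Hg; have [B HB] := bg W.
apply:(rint_conv (B := B)) => //; [exact:rsch_sup|].
by move=> y; exact:rbnd_wt0 HB.
Qed.
Hint Resolve rint_rconv : fn.

Lemma rconvC f g : rsch f -> rsch g -> rconv f g = rconv g f.
move=> Hf Hg; apply/funext => x; rewrite /rconv -(Rint_refl x (rint_rconv x Hf Hg)).
by apply:eq_Rintegral => y _; rewrite subKr mulrC.
Qed.

(** By translation invariance, [t] times this integral is, up to sign, the integral of the first
    order Taylor remainder for the step [t] along the axis, which is [O(t ^ 2)]; divide by [t]. *)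
Lemma Rint_dpart0 i f : rsch f -> \int[mu]_x dpart i f x = 0.
move=> Hf; have [sf bf] := Hf; have [A HA] := bf W.+2.
have A0 := rbnd_ge0 HA.
pose C := d%:R ^+ 2 * A * 2 ^+ W * wt_mass R d W.
have C0 : 0 <= C by rewrite !mulr_ge0 ?wt_mass_ge0.
have key (t : R) : 0 < t <= 1 -> `|\int[mu]_x dpart i f x| <= t * C.
 move=> /andP[t0 t1]; rewrite -(ler_pM2l t0) -{1}(gtr0_norm t0) -normrM.
 have i1 := rsch_rint (rsch_dpart i Hf).
 have sft := rsch_shift (- (t *: delta_mx ord0 i)) Hf.
 have i2 := rsch_rint sft; have i3 := rsch_rint Hf.
 have E0 : \int[mu]_x f (x - (- (t *: delta_mx ord0 i))) - \int[mu]_x f x = 0.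
  by under eq_Rintegral do rewrite opprK; rewrite Rint_transl// subrr.
 rewrite -normrN -[X in `|X|]add0r -E0 -RintZ// -RintB// -RintB; [|exact:rintB|exact:rintZ].
 rewrite /C [leRHS](_ : _ = (t ^+ 2 * d%:R ^+ 2 * A * 2 ^+ W) * wt_mass R d W); last by ring.
 apply:(Rint_dom (leqnn W) _ _).2 => [|x].
  by [].
 have nt : `|t *: delta_mx ord0 i : V| <= t.
  rewrite normrZ (gtr0_norm t0) -[leRHS]mulr1 ler_pM2l// [leLHS]mx_normrE.
  by apply:bigmax_le => // -[a b] _; rewrite mxE; case:(_ && _); rewrite ?normr1 ?normr0.
 have := @taylor R d f x (t *: delta_mx ord0 i) (t ^+ 2 * d%:R ^+ 2 * A * 2 ^+ W * wt W x) 2 sf.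
 rewrite big_ord_recl big_ord1 /= invr1 !mul1r opprD addrA opprK.
 have -> : dirder (t *: delta_mx ord0 i) f x = t * dpart i f x.
  rewrite -dirder_delta mulr_sumr; apply:eq_bigr => j _.
  by rewrite !mxE mulrA.
 apply=> u /andP[u0 u1].
 apply:le_trans (@iter_dirder_bnd R d (t *: delta_mx ord0 i) 2 f _ (A * 2 ^+ W * wt W x) sf _) _.
  move=> s s2; have := rbnd_wt (x + u *: (t *: delta_mx ord0 i)) (rbnd_le (leqW (leqnSn W)) (lexx A) (rbnd_le (leqnn _) (lexx A) HA)).
  move=> _; have := rbnd_wt (s := s) (x + u *: (t *: delta_mx ord0 i)) HA.
  rewrite s2 => /(_ isT)/le_trans; apply; rewrite -mulrA ler_wpM2l//.
  apply:le_trans (wt_le _ (leqW (leqnSn W))) _.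
  apply:le_trans (wt_shift W _ x) _; apply:ler_wpM2r; first exact:wt_ge0.
  apply:lerXn2r; rewrite ?nnegrE//.
  rewrite addrAC subrr add0r normrZ (ger0_norm u0).
  have : u * `|t *: delta_mx ord0 i : V| <= 1.
   by rewrite -[leRHS]mulr1; apply:ler_pM => //; exact:le_trans nt t1.
  lra.
 rewrite [leRHS](_ : _ = (t * d%:R) ^+ 2 * (A * 2 ^+ W * wt W x)); last by ring.
 apply:ler_wpM2r; first by rewrite !mulr_ge0 ?wt_ge0.
 apply:lerXn2r; rewrite ?nnegrE//.
 by rewrite mulrC ler_wpM2r.
apply/eqP; rewrite -normr_le0; apply/ler_addgt0Pr => e e0; rewrite add0r.
pose t := Num.min 1 (e / (C + 1)).
have t0 : 0 < t by rewrite lt_min ltr01 divr_gt0.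
apply:le_trans (key t _) _; first by rewrite t0 ge_min lexx.
apply:(@le_trans _ _ (e / (C + 1) * C)).
 by rewrite ler_wpM2r// ge_min lexx orbT.
rewrite mulrAC ler_pdivrMr; rewrite//; lra.
Qed.

Definition trig (b : bool) : R -> R := if b then sin else cos.
(** The sign produced by [m] derivatives of the sine ([b = true]) or the cosine; the parity
    [b (+) odd m] tells which of the two remains. *)
Fixpoint trig_sign (b : bool) (m : nat) : R :=
 if m is m'.+1 then trig_sign b m' * (if b (+) odd m' then 1 else -1) else 1.

Lemma trig_le1 b t : `|trig b t| <= 1.
by case:b; rewrite ler_norml ?sin_geN1 ?sin_le1 ?cos_geN1 ?cos_le1. Qed.

Lemma trig_sign1 b m : `|trig_sign b m| = 1.
by elim:m => [|m IH]; rewrite ?normr1// normrM IH mul1r; case:ifP; rewrite ?normrN normr1. Qed.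

Lemma rsmth_trigl b (l : 'I_d -> R) : rsmth (trig b \o lform l).
by have [H1 H2 _ _] := rsmth_trig l; case:b. Qed.
Hint Resolve rsmth_trigl : fn.

Lemma dpart_trig i b (l : 'I_d -> R) :
 dpart i (trig b \o lform l) = fun x => (if b then 1 else -1) * l i * trig (~~ b) (lform l x).
have [_ _ H3 H4] := rsmth_trig l; case:b => /=; first by rewrite H4; apply/funext => x; rewrite mul1r.
by rewrite H3; apply/funext => x; rewrite mulN1r.
Qed.

Lemma diter_trig s b (l : 'I_d -> R) : diter s (trig b \o lform l) =
 fun x => trig_sign b (size s) * (\prod_(i <- s) l i) * trig (b (+) odd (size s)) (lform l x).
elim:s => [|i s IH] /=; first by apply/funext => x; rewrite big_nil !mul1r addbF.
rewrite IH; apply/funext => x.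
rewrite (dpartZ i _ (rsmth_diff x (rsmth_trigl (b (+) odd (size s)) l))) dpart_trig big_cons addbN.
by case:(b (+) _) => /=; ring.
Qed.

Lemma lformC (x y : V) : lform (x ord0) y = lform (y ord0) x.
by apply:eq_bigr => i _; rewrite mulrC. Qed.

(** The Fourier transform is handled as two real transforms, the cosine ([b = false]) and the sine
    one, without normalising factor. *)
Definition rfour b f : V -> R := fun xi => \int[mu]_x (f x * trig b (lform (x ord0) xi)).
Definition rmono s f : V -> R := fun x => (\prod_(i <- s) x ord0 i) * f x.

Lemma rmonoS i s f : rmono (i :: s) f = fun x => x ord0 i * rmono s f x.
by apply/funext => x; rewrite /rmono big_cons mulrA. Qed.

Lemma rmono0 f : rmono [::] f = f.
by apply/funext => x; rewrite /rmono big_nil mul1r. Qed.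

Lemma rsch_mono s f : rsch f -> rsch (rmono s f).
move=> Hf; elim:s => [|i s IH]; first by rewrite rmono0.
by rewrite rmonoS.
Qed.
Hint Resolve rsch_mono : fn.

Lemma rbnd_mono k s f B : rsch f -> rbnd (k + size s) f B ->
 rbnd k (rmono s f) (2 ^+ ((k + size s) * size s) * B).
move=> Hf; elim:s k => [|i s IH] k.
 by rewrite addn0 muln0 mul1r rmono0.
rewrite /= addnS -addSn => HB; have B0 := rbnd_ge0 HB.
rewrite rmonoS; apply:rbnd_le (leqnn k) _ (rbnd_coord i (rsch_smth (rsch_mono s Hf)) (IH _ HB)).
rewrite mulrA -exprD; apply:ler_wpM2r => //; rewrite ler_weXn2l ?ler1n//.
by rewrite mulnS leq_add2r leqW// leq_addr.
Qed.

Lemma prod_coord_le s x : `|\prod_(i <- s) x ord0 i| <= (1 + `|x|) ^+ size s.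
elim:s => [|i s IH]; first by rewrite big_nil normr1.
rewrite big_cons normrM exprS; apply:ler_pM => //.
by rewrite (le_trans (coord_le_norm x i))// lerDr.
Qed.

Lemma mbl_trig b xi : meas (fun x => trig b (lform (x ord0) xi)).
rewrite (_ : (fun x => _) = trig b \o lform (xi ord0)); last by apply/funext => x; rewrite lformC.
by [].
Qed.
Hint Resolve mbl_trig : mble.

Lemma rint_four b f xi : rint f -> rint (fun x => f x * trig b (lform (x ord0) xi)).
move=> Hf; apply:(@rint_dom _ _ _ (fun x => `|f x|)).
- by apply:measurable_funM (mbl_trig b xi); exact:rint_mbl.
- by move=> x; rewrite normrM -[leRHS]mulr1; apply:ler_wpM2l => //; exact:trig_le1.
- exact:(integrable_norm Hf).
Qed.
Hint Resolve rint_four : fn.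

Lemma rfour_smth b f : rsch f -> rsmth (rfour b f) /\
 forall s, diter s (rfour b f) = fun xi => trig_sign b (size s) * rfour (b (+) odd (size s)) (rmono s f) xi.
move=> Hf; have E s x : diter s (fun xi => f x * trig b (lform (x ord0) xi)) =
  fun xi => trig_sign b (size s) * (rmono s f x * trig (b (+) odd (size s)) (lform (x ord0) xi)).
 rewrite (diterZ s (f x) (rsmth_trigl b (x ord0))) diter_trig.
 by apply/funext => xi; rewrite /rmono; ring.
have [|||sG dG] := @param_int (fun xi x => f x * trig b (lform (x ord0) xi)).
- by [].
- move=> s xi; rewrite (_ : (fun y => _) = fun x => trig_sign b (size s) *
  (rmono s f x * trig (b (+) odd (size s)) (lform (x ord0) xi))); last first.
  by apply/funext => x; rewrite E.
 apply:measurable_funM => //; apply:measurable_funM (mbl_trig _ xi).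
- move=> k; have [B HB] := Hf.2 (W + k)%N; exists B => s xi x sk; rewrite E.
 rewrite normrM trig_sign1 mul1r normrM -[leRHS]mulr1.
 apply:ler_pM => //; last exact:trig_le1.
 rewrite normrM mulrC.
 apply:le_trans (ler_pM _ _ (rbnd_wt0 x HB) (prod_coord_le s x)) _ => //.
 rewrite wtD -2!mulrA; apply:ler_wpM2l; first exact:rbnd_ge0 HB.
 rewrite -[leRHS]mulr1; apply:ler_wpM2l; first exact:wt_ge0.
 rewrite -[leRHS](wt_exp k x); apply:ler_wpM2l; first exact:wt_ge0.
 by rewrite ler_weXn2l.
split=> // s; apply/funext => xi; rewrite dG -RintZ.
 by apply:eq_Rintegral => x _; rewrite E.
exact/rint_four/rsch_rint/rsch_mono.
Qed.

Lemma rsch_trig b (l : 'I_d -> R) f : rsch f -> rsch (f \* (trig b \o lform l)).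
move=> [sf bf]; split=> [|k]//.
have [B HB] := bf k; pose L := \sum_i `|l i| + 1.
have L1 : 1 <= L by rewrite lerDr.
exists (2 ^+ k * (B * L ^+ k)); apply:(@rbndM k 0) => //; [by rewrite addn0|].
move=> s x sk; rewrite mulr1 diter_trig normrM -[leRHS]mulr1.
apply:ler_pM => //; last exact:trig_le1.
rewrite normrM trig_sign1 mul1r; apply:le_trans (ler_weXn2l L1 sk).
elim:s {sk} => [|i s IH]; first by rewrite big_nil normr1.
rewrite big_cons normrM exprS; apply:ler_pM => //.
by rewrite /L (bigD1 i)//= -addrA lerDl.
Qed.
Hint Resolve rsch_trig : fn.

(** Integration by parts: [Rint_dpart0] is applied to [f] times the other trigonometric function. *)
Lemma rfour_coord (i : 'I_d) b f : rsch f -> exists2 e : R, `|e| = 1 &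
 forall xi : V, xi ord0 i * rfour b f xi = e * rfour (~~ b) (dpart i f) xi.
move=> Hf; have [sf bf] := Hf.
exists (if b then 1 else -1) => [|xi]; first by case:b; rewrite ?normrN normr1.
have := Rint_dpart0 i (rsch_trig (~~ b) (xi ord0) Hf).
have -> : dpart i (f \* (trig (~~ b) \o lform (xi ord0))) =
 fun x => dpart i f x * trig (~~ b) (lform (x ord0) xi) +
  ((if b then -1 else 1) * xi ord0 i) * (f x * trig b (lform (x ord0) xi)).
 apply/funext => x; rewrite dpartM//.
 rewrite dpart_trig /= lformC; congr (_ + _); case:(b) => /=; ring.
have if_ := rsch_rint Hf; have idf := rsch_rint (rsch_dpart i Hf).
rewrite RintD; [|exact:rint_four|by apply:rintZ; exact:rint_four].
rewrite RintZ; last exact:rint_four.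
rewrite -!/(rfour _ _ _) => /eqP; case:(b) => /eqP; move:(rfour _ _ _) (rfour _ _ _) => p q; lra.
Qed.

Lemma rfour_le b f xi (B : R) : rsch f -> rbnd W f B -> `|rfour b f xi| <= B * wt_mass R d W.
move=> Hf HB; apply:(Rint_dom (leqnn W) _ _).2 => [|x].
 by [].
rewrite normrM -[leRHS]mulr1; apply:ler_pM => //; last exact:trig_le1.
exact:rbnd_wt0.
Qed.

Lemma onrmX_le k x : (1 + `|x|) ^+ k <= 2 ^+ k * (1 + \sum_i `|x ord0 i| ^+ k).
have [x1|x1] := leP `|x| 1.
 rewrite -[leLHS]mulr1; apply:ler_pM; rewrite ?lerDl//.
 by apply:lerXn2r; rewrite ?nnegrE//; lra.
apply:(@le_trans _ _ (2 ^+ k * `|x| ^+ k)).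
 by rewrite -exprMn; apply:lerXn2r; rewrite ?nnegrE; lra.
apply:ler_wpM2l => //.
have [|[a i] /= E] := @mx_norm_neq0 _ _ _ x; first by rewrite gt_eqF// (lt_trans _ x1).
rewrite (_ : `|x| = `|x ord0 i|); last by rewrite -[LHS]/(mx_norm x) E ord1.
rewrite (bigD1 i)//=; have : 0 <= \sum_(j < d | j != i) `|x ord0 j| ^+ k => //.
lra.
Qed.

(** Powers of [xi] become derivatives of [f], derivatives in [xi] become monomials: [k] orders for
    each, and [W] more for the integral. *)
Lemma rfour_rbnd k : exists2 C : R, 0 <= C & forall b f B, rsch f ->
 rbnd (k + k + W) f B -> rbnd k (rfour b f) (C * B).
pose C0 := 2 ^+ ((W + k + k) * k) * wt_mass R d W : R.
have C00 : 0 <= C0 by rewrite mulr_ge0 ?wt_mass_ge0.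
exists (2 ^+ k * (1 + d%:R) * C0) => [|b f B Hf HB]//.
have B0 := rbnd_ge0 HB; have [_ dF] := rfour_smth b Hf.
have main m (i : 'I_d) b' (h : V -> R) (xi : V) : rsch h -> rbnd (W + m) h (2 ^+ ((W + k + k) * k) * B) ->
  `|xi ord0 i| ^+ m * `|rfour b' h xi| <= C0 * B.
 move=> Hh Hb; have : exists b'' , `|xi ord0 i| ^+ m * `|rfour b' h xi| = `|rfour b'' (diter (nseq m i) h) xi|.
  elim:m b' h Hh {Hb} => [|m IH] b' h Hh; first by exists b'; rewrite mul1r.
  have [e e1 E] := rfour_coord i b' Hh.
  have [b'' E2] := IH (~~ b') _ (rsch_dpart i Hh).
  exists b''; rewrite exprSr -mulrA -normrM E normrM e1 mul1r E2.
  by rewrite -[m.+1]addn1 nseqD diter_cat.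
 case=> b'' ->; rewrite mulrAC; apply:rfour_le => //.
 by apply:rbnd_diter; rewrite size_nseq.
move=> s xi sk; rewrite dF normrM trig_sign1 mul1r.
set h := rmono s f; have Hh : rsch h by exact:rsch_mono.
have Hb m : (m <= k)%N -> rbnd (W + m) h (2 ^+ ((W + k + k) * k) * B).
 move=> mk; have Hl : (W + m + size s <= k + k + W)%N by rewrite -addnA addnC leq_add2r leq_add.
 apply:rbnd_le (leqnn _) _ (rbnd_mono Hf (rbnd_le Hl (lexx B) HB)).
 apply:ler_wpM2r => //; rewrite ler_weXn2l ?ler1n//.
 by rewrite leq_mul// leq_add// leq_add2l.
apply:le_trans (ler_wpM2r (normr_ge0 _) (onrmX_le k xi)) _.
rewrite -!mulrA; apply:ler_wpM2l => //.
rewrite mulrDl mul1r [X in _ <= X]mulrDl mul1r; apply:lerD.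
 have := rfour_le (b (+) odd (size s)) xi Hh (rbnd_le (leq_addr 0 W) (lexx _) (Hb 0 (leq0n k))).
 by rewrite -mulrA [B * _]mulrC.
rewrite mulr_suml mulr_natl -[X in _ *+ X](card_ord d) -sumr_const; apply:ler_sum => i _.
by rewrite [leRHS]mulrA; exact:main (Hb k (leqnn k)).
Qed.

Lemma rfour_sch b f : rsch f -> rsch (rfour b f).
move=> Hf; split=> [|k]; first exact:(rfour_smth b Hf).1.
have [C _ HC] := rfour_rbnd k; have [B HB] := Hf.2 (k + k + W)%N.
by exists (C * B).
Qed.
Hint Resolve rfour_sch : fn.

Lemma mbl_trig2 b : meas (fun xy : V * V => trig b (lform (xy.1 ord0) xy.2)).
have ml : meas (fun xy : V * V => lform (xy.1 ord0) xy.2).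
 rewrite /lform; elim:(index_enum _) => [|i r IH].
  rewrite (_ : (fun xy => _) = cst 0)//.
  by apply/funext => y; rewrite big_nil.
 rewrite (_ : (fun xy => _) = (fun xy : V * V => xy.2 ord0 i * xy.1 ord0 i) \+
   (fun xy : V * V => \sum_(i <- r) xy.2 ord0 i * xy.1 ord0 i)); last first.
  by apply/funext => y; rewrite big_cons.
 apply:measurable_funD => //; apply:measurable_funM; apply:(measurableT_comp (measurable_coord_rV i)) => //.
apply:measurableT_comp ml; apply:continuous_measurable_fun.
by case:b; [exact:continuous_sin|exact:continuous_cos].
Qed.

Lemma rfour_mult b f g : rsch f -> rsch g ->
 \int[mu]_xi (rfour b f xi * g xi) = \int[mu]_x (f x * rfour b g x).
move=> Hf Hg; have if_ := rsch_rint Hf; have ig := rsch_rint Hg.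
transitivity (\int[mu]_xi \int[mu]_x (g xi * (f x * trig b (lform (x ord0) xi)))).
 by apply:eq_Rintegral => xi _; rewrite RintZ 1?mulrC//; exact:rint_four.
transitivity (\int[mu]_x \int[mu]_xi (g xi * (f x * trig b (lform (x ord0) xi)))).
 apply:(@Rint_fubini R d _ (fun x => `|g x|) (fun x => `|f x|)).
 - apply:measurable_funM; first exact:(measurableT_comp (rsch_mbl Hg) measurable_fst).
  apply:measurable_funM; first exact:(measurableT_comp (rsch_mbl Hf) measurable_snd).
  rewrite [X in measurable_fun _ X](_ : _ = (fun xy : V * V => trig b (lform (xy.1 ord0) xy.2))).
   exact:mbl_trig2.
  by apply/funext => xy; rewrite lformC.
 - move=> x y; rewrite normrM; apply:ler_wpM2l => //; rewrite normrM -[leRHS]mulr1.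
  by apply:ler_wpM2l => //; exact:trig_le1.
 - exact:(integrable_norm ig).
 - exact:(integrable_norm if_).
apply:eq_Rintegral => x _; rewrite -RintZ; last exact:rint_four.
by apply:eq_Rintegral => xi _; rewrite lformC; ring.
Qed.

Lemma rfour_scale b f (e : R) xi : e != 0 -> rsch f ->
 rfour b (fun x => f (e *: x)) xi = `|e|^-1 ^+ d * rfour b f (e^-1 *: xi).
move=> e0 Hf; rewrite /rfour.
have := @Rint_aff R d (fun x => f x * trig b (lform (x ord0) (e^-1 *: xi))) e 0 e0
 (rint_four _ _ (rsch_rint Hf)) => <-.
apply:eq_Rintegral => x _; rewrite /aff addr0; congr (_ * trig b _).
apply:eq_bigr => i _; rewrite !mxE; field => //.
Qed.

Lemma lipschitz_bnd f (A : R) : rsmth f -> (forall i x, `|dpart i f x| <= A) ->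
 forall x h, `|f (x + h) - f x| <= d%:R * `|h| * A.
move=> sf HA x h; have := @taylor R d f x h (d%:R * `|h| * A) 1 sf.
rewrite big_ord_recl big_ord0 /= invr1 mul1r addr0; apply=> t _.
have := @iter_dirder_bnd R d h 1 f (x + t *: h) A sf; rewrite expr1; by apply => -[|i [|]] //= _.
Qed.

(* Both sides are limits of [int rfour b f * g(e .) = int f(e .) * rfour b g] as e tends to 0. *)
Lemma rfour_swap b f g : rsch f -> rsch g ->
 g 0 * \int[mu]_xi rfour b f xi = f 0 * \int[mu]_xi rfour b g xi.
have key f' g' : rsch f' -> rsch g' -> exists2 C : R, 0 <= C & forall e : R, 0 < e ->
  `|\int[mu]_xi (rfour b f' xi * g' (e *: xi)) - g' 0 * \int[mu]_xi rfour b f' xi| <= e * C.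
 move=> Hf Hg; have HF := rfour_sch b Hf; have [A HA] := Hg.2 1%N.
 have A0 := rbnd_ge0 HA.
 have [B HB] := HF.2 W.+1; have B0 := rbnd_ge0 HB.
 exists (d%:R * A * B * wt_mass R d W) => [|e e0]; first by rewrite !mulr_ge0// wt_mass_ge0.
 have Hge : rsch (fun xi => g' (e *: xi)).
  rewrite (_ : (fun xi => _) = g' \o aff e 0)//.
 rewrite -RintZ; last exact:rsch_rint.
 have i1 := rsch_rint (rschM HF Hge); have i2 := rintZ (g' 0) (rsch_rint HF).
 rewrite -RintB// mulrA; apply:(Rint_dom (leqnn W) _ _).2 => [|x].
  by [].
 rewrite [g' 0 * _]mulrC -mulrBr normrM.
 have := lipschitz_bnd (A := A) Hg.1 (fun i x => rbnd_sup (s := [:: i]) x HA isT) 0 (e *: x).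
 rewrite add0r normrZ (gtr0_norm e0) => H.
 apply:le_trans (ler_pM _ _ (rbnd_wt0 x HB) H) _ => //.
 rewrite -addn1 wtD [leLHS](_ : _ = (e * (d%:R * A * B) * wt W x) * (wt 1 x * `|x|)); last by ring.
 rewrite -[leRHS]mulr1; apply:ler_wpM2l; first by rewrite !mulr_ge0 ?wt_ge0.
 rewrite -(wt_exp 1 x) expr1; apply:ler_wpM2l; first exact:wt_ge0.
 by rewrite lerDr.
move=> Hf Hg; have [C1 C10 H1] := key _ _ Hf Hg; have [C2 C20 H2] := key _ _ Hg Hf.
have E (e : R) : 0 < e -> \int[mu]_xi (rfour b f xi * g (e *: xi)) = \int[mu]_xi (rfour b g xi * f (e *: xi)).
 move=> e0; have en : e != 0 by rewrite gt_eqF.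
 have Hge : rsch (fun xi => g (e *: xi)).
  rewrite (_ : (fun xi => _) = g \o aff e 0)//.
 rewrite rfour_mult//.
 have Hfe : rsch (fun xi => f (e *: xi)).
  rewrite (_ : (fun xi => _) = f \o aff e 0)//.
 have i1 := rsch_rint (rschM Hf (rfour_sch b Hge)).
 have := Rint_aff 0 en i1; rewrite (gtr0_norm e0) => E1.
 have ed : e^-1 ^+ d != 0 by rewrite expf_neq0.
 apply:(mulfI ed); rewrite -E1 -RintZ; last exact:rsch_rint (rschM (rfour_sch b Hg) Hfe).
 apply:eq_Rintegral => x _; rewrite /= /aff addr0 rfour_scale// (gtr0_norm e0).
 by rewrite scalerA mulVf// scale1r; ring.
apply/eqP; rewrite -subr_eq0 -normr_le0; apply/ler_addgt0Pr => r r0; rewrite add0r.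
pose e := r / (C1 + C2 + 1); have e0 : 0 < e by rewrite divr_gt0.
have := H1 e e0; have := H2 e e0; rewrite (E e e0).
set I := \int[mu]_xi (_ * _); set a := g 0 * _; set b' := f 0 * _ => H3 H4.
rewrite (_ : a - b' = (I - b') - (I - a)); last by ring.
apply:le_trans (ler_normB _ _) _; apply:le_trans (lerD H3 H4) _.
rewrite -mulrDr mulrAC ler_pdivrMr//; apply:ler_wpM2l => //.
first [by rewrite lerDl | by rewrite addrC lerDl | lra].
Qed.

Lemma Rint_rfour_sin f : rsch f -> \int[mu]_xi rfour true f xi = 0.
move=> Hf; have HF := rsch_rint (rfour_sch true Hf).
have := Rint_refl 0 HF.
have -> : \int[mu]_xi rfour true f (0 - xi) = \int[mu]_xi (-1 * rfour true f xi).
 apply:eq_Rintegral => xi _; rewrite sub0r -RintZ; last exact/rint_four/rsch_rint.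
 apply:eq_Rintegral => x _; rewrite mulN1r -mulrN -sinN; congr (_ * sin _).
 by rewrite -sumrN; apply:eq_bigr => i _; rewrite !mxE mulNr.
by rewrite RintZ// => E; apply/eqP; move:E; move:(\int[mu]_xi _) => z; rewrite mulN1r => /eqP; rewrite eq_sym -addr_eq0 -mulr2n mulrn_eq0.
Qed.

Lemma Rint_gt0 f (x0 : V) : continuous f -> rint f -> (forall x, 0 <= f x) -> 0 < f x0 ->
 0 < \int[mu]_x f x.
move=> cf if_ f0 fx0; have e0 : 0 < f x0 / 2 by rewrite divr_gt0.
have /cvgrPdist_lt/(_ _ e0)/nbhs_ballP[r /= r0 Hr] := cf x0.
have ib : rint (\1_(ball x0 r) : V -> R).
 apply/integrableP; split; first by apply/measurable_EFinP/measurable_indic; exact:mbl_ball_rV.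
 rewrite (eq_integral (fun x => (\1_(ball x0 r) x)%:E)); last by move=> x _ /=; rewrite ger0_norm.
 rewrite integral_indic//; last exact:mbl_ball_rV.
 by have := ltry (r ^+ d * ball_vol R d); rewrite -(leb_ballE x0 r0) setIT.
have vb : \int[mu]_x (\1_(ball x0 r) x) = r ^+ d * ball_vol R d.
 rewrite /Rintegral integral_indic//; last exact:mbl_ball_rV.
 by transitivity (fine (r ^+ d * ball_vol R d)%:E) => //; congr fine; rewrite setIT; exact:leb_ballE.
have v0 : 0 < r ^+ d * ball_vol R d.
 by rewrite -lte_fin -(leb_ballE x0 r0) leb_ball_gt0.
apply:(@lt_le_trans _ _ (\int[mu]_x (f x0 / 2 * \1_(ball x0 r) x))).
 by rewrite RintZ// vb.
apply:Rint_le => //; first exact:rintZ.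
move=> x; rewrite indicE; case:(boolP (x \in _)) => [|_]; last by rewrite mulr0.
rewrite inE mulr1 => /Hr; rewrite ltr_norml => /andP[_]; move:(f x0) (f x) => a b; lra.
Qed.

(* If [c = 0], then [rfour false f] has integral 0 for every [f]; by translation so does its product with
  any cosine, whence [int (rfour false f)^2 = int f * rfour false (rfour false f) = 0]. *)
Lemma rfour_inv0 g : rsch g -> g 0 = 1 ->
 exists2 c : R, c != 0 & forall f, rsch f -> \int[mu]_xi rfour false f xi = c * f 0.
move=> Hg g0; exists (\int[mu]_xi rfour false g xi); last first.
 by move=> f Hf; rewrite mulrC -rfour_swap// g0 mul1r.
apply/eqP => c0; pose h := g \* g; pose F := rfour false h.
have Hh : rsch h by exact:rschM.
have ih := rsch_rint Hh.
have HF : rsch F by exact:rfour_sch.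
have z f : rsch f -> \int[mu]_xi rfour false f xi = 0.
 by move=> Hf; rewrite -[LHS]mul1r -g0 rfour_swap// c0 mulr0.
have linD (a b : R) (x y xi : V) : lform ((a *: x + b *: y) ord0) xi = a * lform (x ord0) xi + b * lform (y ord0) xi :> R.
 by rewrite /lform !mulr_sumr -big_split; apply:eq_bigr => i _; rewrite !mxE mulrDr !(mulrCA (xi _ _)).
have sh y xi : rfour false (fun t => h (t - y)) xi =
  cos (lform (y ord0) xi) * F xi - sin (lform (y ord0) xi) * rfour true h xi.
 rewrite /rfour -(Rint_transl y (rint_four false xi (rsch_rint (rsch_shift y Hh)))).
 rewrite -!RintZ -?RintB; try (try apply:rintZ; exact:rint_four).
 apply:eq_Rintegral => x _; rewrite addrK /= -[x]scale1r -[y]scale1r linD !mul1r cosD !scale1r; ring.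
have FF x : rfour false F x = 0.
 have hs y : rsch (rfour false (fun t => h (t - y))) by exact/rfour_sch/rsch_shift.
 (* Averaging over the translations by [x] and by [- x] removes the sine term. *)
 have E : rfour false F x = 2^-1 * (\int[mu]_xi rfour false (fun t => h (t - x)) xi + \int[mu]_xi rfour false (fun t => h (t - - x)) xi).
  rewrite -RintD -?RintZ; try by [exact:rsch_rint|apply:rintD; exact:rsch_rint].
  apply:eq_Rintegral => xi _; rewrite !sh lformC.
  have := linD (-1) 0 x 0 xi; rewrite scale0r addr0 mul0r addr0 scaleN1r mulN1r => ->.
  by rewrite cosN sinN /=; move:(cos _) (sin _) (F xi) (rfour true _ _) => *; field.
 by rewrite E !z ?addr0 ?mulr0//; exact:rsch_shift.
have F0 : 0 < F 0.
 rewrite (_ : F 0 = \int[mu]_x h x); last first.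
  apply:eq_Rintegral => x _; have := linD 0 0 0 0 x; rewrite scale0r addr0 !mul0r addr0 lformC => -> /=.
  by rewrite cos0 mulr1.
 apply:(Rint_gt0 (x0 := 0) (rsmth_cont Hh.1) ih) => [x|]; first by rewrite /h /= -expr2 sqr_ge0.
 by rewrite /h /= g0 mulr1.
have HFF := rschM HF HF.
have := Rint_gt0 (x0 := 0) (rsmth_cont HFF.1) (rsch_rint HFF) _ (mulr_gt0 F0 F0).
rewrite [X in _ -> is_true (0 < X)](rfour_mult false Hh HF) (_ : (fun x => _) = cst 0); last first.
 by apply/funext => x; rewrite FF mulr0.
by rewrite Rintegral_cst// mul0r ltxx => /(_ (fun x => sqr_ge0 (F x))).
Qed.

End real_schwartz.
Hint Resolve onrmX_gt0 : pos.
Hint Resolve rsch_smth rschD rschZ rschM rsch_dpart rsch_diter rsch_coord rsch_aff rsmth_mbl rsch_mbl rsch_rint rsch_shift rsmth_shift mbl_subr rint_rconv rsmth_trigl rsch_mono rint_four rsch_trig rfour_sch : fn.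
Hint Extern 2 (rsch (rconv _ _)) => apply:(proj1 (rconv_sch _ _)) : fn.
Hint Resolve mbl_trig : mble.

(** * Complex Schwartz functions and the seminorms of tempered distributions *)

Section complex_schwartz.
Context (R : realType) (d : nat).
Local Notation V := 'rV[R]_d.
Local Notation C := R[i].
Local Notation S := (schwartz R d).
Implicit Types (f g : V -> C) (s : seq 'I_d).

Lemma cReM (z w : C) : Re (z * w) = Re z * Re w - Im z * Im w.
by case:z => a b; case:w. Qed.
Lemma cImM (z w : C) : Im (z * w) = Re z * Im w + Im z * Re w.
by case:z => a b; case:w. Qed.
Lemma cReD (z w : C) : Re (z + w) = Re z + Re w.
by case:z => a b; case:w. Qed.
Lemma cImD (z w : C) : Im (z + w) = Im z + Im w.
by case:z => a b; case:w. Qed.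
Lemma ceqP (z w : C) : Re z = Re w -> Im z = Im w -> z = w.
by case:z => a b; case:w => c e /= -> ->. Qed.

Lemma normc_ge0 (z : C) : 0 <= normc z.
by case:z => a b; exact:sqrtr_ge0. Qed.
Hint Resolve normc_ge0 : pos.

Lemma Re_le_normc (z : C) : `|Re z| <= normc z.
by case:z => a b; rewrite -sqrtr_sqr ler_sqrt// lerDl. Qed.

Lemma Im_le_normc (z : C) : `|Im z| <= normc z.
by case:z => a b; rewrite -sqrtr_sqr ler_sqrt// lerDr. Qed.

Lemma normc_le (z : C) : normc z <= `|Re z| + `|Im z|.
case:z => a b /=; rewrite -[leRHS]ger0_norm// -sqrtr_sqr ler_wsqrtr//.
rewrite sqrrD !real_normK ?num_real// -addrA lerD2l lerDr//.
Qed.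

Lemma Re_iter_part s f : Re \o iter_partial s f = diter s (Re \o f).
by elim:s => //= i s <-; apply/funext => x; rewrite dpartE. Qed.

Lemma Im_iter_part s f : Im \o iter_partial s f = diter s (Im \o f).
by elim:s => //= i s <-; apply/funext => x; rewrite dpartE. Qed.

Lemma smthP f : smooth f <-> rsmth (Re \o f) /\ rsmth (Im \o f).
split=> [sf|[s1 s2] s x]; last by rewrite Re_iter_part Im_iter_part.
by split=> s x; [rewrite -Re_iter_part|rewrite -Im_iter_part]; have [] := sf s x.
Qed.

Definition csch f := rsch (Re \o f) /\ rsch (Im \o f).

Lemma Re_iter_partE s f x : Re (iter_partial s f x) = diter s (Re \o f) x.
by rewrite -Re_iter_part. Qed.
Lemma Im_iter_partE s f x : Im (iter_partial s f x) = diter s (Im \o f) x.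
by rewrite -Im_iter_part. Qed.

Definition mseq (al : multi_index d) : seq 'I_d := flatten [seq nseq (al i) i | i <- enum 'I_d].

Lemma count_mseq al i : count_mem i (mseq al) = al i.
rewrite count_flatten -map_comp sumnE big_map.
rewrite (eq_bigr (fun j => if j == i then al i else 0%N)) => [|j _]; last first.
 by rewrite /= count_nseq /=; case:eqP => [->|]; rewrite ?mul1n.
by rewrite -big_mkcond big_enum_cond (big_pred1 i).
Qed.

Lemma size_mseq al : size (mseq al) = multi_order al.
rewrite size_flatten /shape -map_comp sumnE big_map big_enum.
by apply:eq_bigr => i _; rewrite /= size_nseq.
Qed.

Lemma perm_mseq s : perm_eq s (mseq [ffun i => count_mem i s]).
by rewrite /perm_eq; apply/allP => i _; rewrite /= count_mseq ffunE. Qed.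

Lemma monomial_le al (x : V) : `|monomial al x| <= (1 + `|x|) ^+ multi_order al.
rewrite normr_prod -prodrXr; apply:ler_prod => i _.
rewrite normr_ge0 normrX; apply:lerXn2r; rewrite ?nnegrE//.
by rewrite (le_trans (coord_le_norm x i))// lerDr.
Qed.

Lemma onrmX_le_monomial k (x : V) (a M : R) : 0 <= a ->
 (forall al : multi_index d, (multi_order al <= k)%N -> `|monomial al x| * a <= M) ->
 (1 + `|x|) ^+ k * a <= 2 ^+ k * (1 + d%:R) * M.
move=> a0 HM; apply:le_trans (ler_wpM2r a0 (onrmX_le k x)) _.
rewrite -!mulrA; apply:ler_wpM2l => //.
rewrite mulrDl mulrDl !mul1r; apply:lerD.
 have := HM [ffun=> 0%N]; rewrite /multi_order /monomial big1; last by move=> i _; rewrite ffunE.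
 by rewrite big1 ?normr1 ?mul1r; [exact|move=> i _; rewrite ffunE].
rewrite mulr_suml mulr_natl -[X in _ *+ X](card_ord d) -sumr_const; apply:ler_sum => i _.
have := HM [ffun j => if j == i then k else 0%N]; rewrite /multi_order /monomial.
rewrite (bigD1 i)//= big1; last by move=> j /negbTE ji; rewrite ffunE ji.
rewrite (bigD1 i)//= big1; last by move=> j /negbTE ji; rewrite ffunE ji.
by rewrite ffunE eqxx addn0 mulr1 normrX; apply.
Qed.

Lemma rsch_parts f : smooth f -> (forall k, exists B : R, forall s x, (size s <= k)%N ->
 (1 + `|x|) ^+ k * normc (iter_partial s f x) <= B) -> csch f.
move=> /smthP[s1 s2] Hk; split; split=> // k; have [B HB] := Hk k; exists B => s x sk.
 by apply:le_trans (HB s x sk); rewrite -Re_iter_partE; apply:ler_wpM2l (Re_le_normc _).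
by apply:le_trans (HB s x sk); rewrite -Im_iter_partE; apply:ler_wpM2l (Im_le_normc _).
Qed.

Lemma iter_part_perm s t f : smooth f -> perm_eq s t -> iter_partial s f = iter_partial t f.
move=> /smthP[s1 s2] st; apply/funext => x; apply:ceqP.
 by rewrite !Re_iter_partE (diter_perm s1 st).
by rewrite !Im_iter_partE (diter_perm s2 st).
Qed.

Definition bnd k f (B : R) := rbnd k (Re \o f) B /\ rbnd k (Im \o f) B.

Lemma bnd_normc k f B s x : bnd k f B -> (size s <= k)%N ->
 (1 + `|x|) ^+ k * normc (iter_partial s f x) <= 2 * B.
move=> [H1 H2] sk; apply:le_trans (ler_wpM2l _ (normc_le _)) _ => //.
rewrite Re_iter_partE Im_iter_partE mulrDr mulr_natl mulr2n.
by apply:lerD; [exact:H1|exact:H2].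
Qed.

Lemma sch_seminorm_bnd k (phi : S) B : 0 <= B -> bnd k phi B -> schwartz_seminorm k phi <= 2 * B.
move=> B0 HB; apply:ge_sup.
 exists (`|monomial [ffun=> 0%N] (0 : V)| * normc (multi_partial [ffun=> 0%N] phi 0)).
 have z : multi_order ([ffun=> 0%N] : multi_index d) = 0%N by apply:big1 => i _; rewrite ffunE.
 by exists [ffun=> 0%N], [ffun=> 0%N], 0; rewrite !z.
move=> r [al [be [x [ak bk ->]]]].
have bk' : (size (mseq be) <= k)%N by rewrite size_mseq.
apply:le_trans (bnd_normc x HB bk'); apply:ler_wpM2r => //.
apply:le_trans (monomial_le al x) _; apply:ler_weXn2l => //; by [].
Qed.

(** The definition bounds one monomial and one derivative at a time. [onrmX_le] reduces the weight
    of order [k] to powers of single coordinates, and there are finitely many words of each length,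
    so finitely many bounds add up to one. *)
Lemma sch_csch (phi : S) : csch phi.
have /asboolP[sf Hb] := schwartzP phi; apply:rsch_parts => // k.
have H (al : multi_index d) (s : seq 'I_d) : exists M : R, forall x : V,
  `|monomial al x| * normc (iter_partial s phi x) <= M.
 have [M HM] := Hb al [ffun i => count_mem i s]; exists M => x.
 by have := HM x; rewrite /multi_partial -(iter_part_perm sf (perm_mseq s)).
have Hs (s : seq 'I_d) : exists M : R, forall x : V, (1 + `|x|) ^+ k * normc (iter_partial s phi x) <= M.
 have [M0 H0] := H [ffun=> 0%N] s.
 have /choice[M HM] : forall i : 'I_d, exists M : R, forall x : V,
   `|x ord0 i| ^+ k * normc (iter_partial s phi x) <= M.
  move=> i; have [M HM] := H [ffun j => if j == i then k else 0%N] s; exists M => x.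
  have := HM x; rewrite /monomial (bigD1 i)//= big1; last by move=> j /negbTE ji; rewrite ffunE ji.
  by rewrite ffunE eqxx mulr1 normrX.
 exists (2 ^+ k * (M0 + \sum_i M i)) => x.
 apply:le_trans (ler_wpM2r (normc_ge0 _) (onrmX_le k x)) _.
 rewrite -mulrA; apply:ler_wpM2l => //.
 rewrite mulrDl mul1r mulr_suml; apply:lerD; last by apply:ler_sum => i _; by [].
 have := H0 x; rewrite /monomial big1 ?normr1 ?mul1r// => i _; by rewrite ffunE.
have /choice[M HM] := Hs.
have B_ex m : exists B : R, 0 <= B /\ forall s x, size s = m -> (1 + `|x|) ^+ k * normc (iter_partial s phi x) <= B.
 exists (\sum_(t : m.-tuple 'I_d) `|M t|); split=> [|s x /eqP sm]//.
 rewrite (bigD1 (Tuple sm))//=; apply:le_trans (HM s x) _.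
 by apply:le_trans (ler_norm _) _; rewrite lerDl.
have /choice[B HB] := B_ex; exists (\sum_(m < k.+1) B m) => s x sk.
have sk' : (size s < k.+1)%N by [].
rewrite (bigD1 (Ordinal sk'))//=; apply:le_trans ((HB (size s)).2 s x erefl) _.
by rewrite lerDl sumr_ge0// => m _; exact:(HB m).1.
Qed.
Hint Resolve sch_csch : fn.

Lemma csch_bnd f k : csch f -> exists B : R, bnd k f B.
move=> [[_ H1] [_ H2]]; have [A HA] := H1 k; have [B HB] := H2 k; exists (Num.max A B).
by split; [apply:rbnd_le HA; rewrite ?le_max ?lexx|apply:rbnd_le HB; rewrite ?le_max ?lexx ?orbT].
Qed.

Lemma csch_function f : csch f -> schwartz_function f.
move=> Hf; have [[s1 _] [s2 _]] := Hf; split=> [|al be]; first exact/smthP.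
pose k := maxn (multi_order al) (multi_order be).
have [B HB] := csch_bnd k Hf; exists (2 * B) => x.
have bk' : (size (mseq be) <= k)%N by rewrite size_mseq leq_maxr.
apply:le_trans (bnd_normc x HB bk'); apply:ler_wpM2r => //.
apply:le_trans (monomial_le al x) _; apply:ler_weXn2l => //; exact:leq_maxl.
Qed.

Lemma to_schE f : csch f -> to_schwartz f = f :> (V -> C).
by move=> Hf; rewrite insubdK//; apply/asboolP/csch_function. Qed.

Lemma seminorm_has_sup k (phi : S) : has_ubound [set r | exists al be : multi_index d, exists x : V,
  [/\ (multi_order al <= k)%N, (multi_order be <= k)%N &
    r = `|monomial al x| * normc (multi_partial be phi x)]].
have [B HB] := csch_bnd k (sch_csch phi); exists (2 * B) => r [al [be [x [ak bk ->]]]].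
have bk' : (size (mseq be) <= k)%N by rewrite size_mseq.
apply:le_trans (bnd_normc x HB bk'); apply:ler_wpM2r => //.
apply:le_trans (monomial_le al x) _; apply:ler_weXn2l => //; by [].
Qed.

Lemma bnd_seminorm k (phi : S) : bnd k phi (2 ^+ k * (1 + d%:R) * schwartz_seminorm k phi).
have /asboolP[sf _] := schwartzP phi.
have main s x : (size s <= k)%N ->
  (1 + `|x|) ^+ k * normc (iter_partial s phi x) <= 2 ^+ k * (1 + d%:R) * schwartz_seminorm k phi.
 move=> sk; apply:onrmX_le_monomial => //.
 move=> al ak; apply:(ub_le_sup (seminorm_has_sup k phi)).
 exists al, [ffun i => count_mem i s], x; split=> //.
  rewrite -size_mseq -(perm_size (perm_mseq s))//.
 by rewrite /multi_partial -(iter_part_perm sf (perm_mseq s)).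
split=> s x sk.
 by apply:le_trans (main s x sk); rewrite -Re_iter_partE; apply:ler_wpM2l (Re_le_normc _).
by apply:le_trans (main s x sk); rewrite -Im_iter_partE; apply:ler_wpM2l (Im_le_normc _).
Qed.

Lemma temp_bnd (T : S -> C) : tempered T ->
 exists k, exists2 A : R, 0 <= A & forall (phi : S) B, bnd k phi B -> normc (T phi) <= A * B.
move=> [_ [M [k HM]]]; exists k, (`|M| * 2) => [|phi B HB]//.
have B0 := rbnd_ge0 HB.1.
apply:le_trans (HM phi) _; rewrite -mulrA.
have s0 : 0 <= schwartz_seminorm k phi.
 by have := rbnd_ge0 (bnd_seminorm k phi).1; rewrite pmulr_rge0.
apply:le_trans (ler_wpM2r s0 (ler_norm M)) _; apply:ler_wpM2l => //; exact:sch_seminorm_bnd.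
Qed.

Lemma bnd_temp (T : S -> C) : scalar T -> forall k (A : R), 0 <= A ->
 (forall (phi : S) B, bnd k phi B -> normc (T phi) <= A * B) -> tempered T.
move=> lT k A A0 H; split=> //; exists (A * (2 ^+ k * (1 + d%:R))), k => phi.
by rewrite -mulrA; apply:H; exact:bnd_seminorm.
Qed.

End complex_schwartz.
Hint Resolve normc_ge0 : pos.
Hint Resolve sch_csch : fn.

(** * Continuous functionals and convolutions *)

Section functionals.
Context (R : realType) (d : nat).
Local Notation V := 'rV[R]_d.
Local Notation W := (d.*2).
Implicit Types (f g chi K : V -> R) (x y h : V) (s : seq 'I_d) (t : (V -> R) -> R).

Lemma eqW (a b : R) : a = b -> a <= b. by move=> ->. Qed.

Definition rlin t := forall (a : R) f g, rsch f -> rsch g ->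
 t (fun x => a * f x + g x) = a * t f + t g.
Definition rtbnd k (A : R) t := forall f B, rsch f -> rbnd k f B -> `|t f| <= A * B.
Definition rtemp t := rlin t /\ exists k, exists2 A : R, 0 <= A & rtbnd k A t.
Definition tshift y f : V -> R := fun x => f (x - y).

Lemma rsch_cst0 : rsch (cst (0 : R) : V -> R).
split => //.
move=> k; exists 0 => s x _; rewrite (_ : diter s _ x = 0) ?normr0//.
elim:s x => [//|i s IH] x; rewrite /= (_ : diter s (cst 0) = cst 0); last exact/funext.
by rewrite dpartE derive_cst.
Qed.

Lemma rlin0 t : rlin t -> t (cst 0) = 0.
move=> lt; have := lt 1 _ _ rsch_cst0 rsch_cst0.
rewrite (_ : (fun x => _) = cst 0)//.
by rewrite mul1r => /eqP; rewrite -subr_eq0 opprD addNKr oppr_eq0 => /eqP.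
Qed.

Lemma rlinZ t (a : R) f : rlin t -> rsch f -> t (fun x => a * f x) = a * t f.
move=> lt Hf; have := lt a _ _ Hf rsch_cst0; rewrite rlin0// addr0 => <-.
by congr t; apply/funext => x; rewrite addr0.
Qed.

Lemma rlinD t f g : rlin t -> rsch f -> rsch g -> t (fun x => f x + g x) = t f + t g.
move=> lt Hf Hg; have := lt 1 _ _ Hf Hg; rewrite mul1r => <-.
by congr t; apply/funext => x; rewrite mul1r.
Qed.

Lemma rsch_lin (a : R) f g : rsch f -> rsch g -> rsch (fun x => a * f x + g x).
by []. Qed.
Hint Resolve rsch_lin : fn.

Lemma rlinB t f g : rlin t -> rsch f -> rsch g -> t (fun x => f x - g x) = t f - t g.
move=> lt Hf Hg; have := lt (-1) _ _ Hg Hf; rewrite mulN1r addrC => <-.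
by congr t; apply/funext => x; rewrite mulN1r addrC.
Qed.

Lemma rsch_sum (I : Type) (r : seq I) (F : I -> V -> R) : (forall i, rsch (F i)) ->
 rsch (fun x => \sum_(i <- r) F i x).
move=> H; elim:r => [|i r IH].
 rewrite (_ : (fun x => _) = cst 0); first exact:rsch_cst0.
 by apply/funext => x; rewrite big_nil.
rewrite (_ : (fun x => _) = F i \+ (fun x => \sum_(j <- r) F j x))//.
by apply/funext => x; rewrite big_cons.
Qed.
Hint Resolve rsch_sum : fn.

Lemma rlin_sum t (I : Type) (r : seq I) (F : I -> V -> R) : rlin t -> (forall i, rsch (F i)) ->
 t (fun x => \sum_(i <- r) F i x) = \sum_(i <- r) t (F i).
move=> lt H; elim:r => [|i r IH].
 by rewrite big_nil -[RHS](rlin0 lt); congr t; apply/funext => x; rewrite big_nil.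
rewrite big_cons -IH -rlinD//.
by congr t; apply/funext => x; rewrite big_cons.
Qed.

Lemma incr_bnd k f B x h : rsmth f -> rbnd k.+1 f B -> `|h| <= 1 ->
 `|f (x + h) - f x| <= d%:R * 2 ^+ k * B * `|h| * wt k x.
move=> sf HB h1; have B0 := rbnd_ge0 HB.
have := @taylor R d f x h (d%:R * 2 ^+ k * B * `|h| * wt k x) 1 sf.
rewrite big_ord_recl big_ord0 /= invr1 mul1r addr0; apply=> r /andP[r0 r1].
have := @iter_dirder_bnd R d h 1 f (x + r *: h) (B * (2 ^+ k * wt k x)) sf.
rewrite expr1 /= => H; apply:le_trans (H _) _; last by apply:eqW; ring.
move=> s ss; apply:le_trans (rbnd_wt (s := s) (x + r *: h) HB _) _; first by rewrite ss.
apply:ler_wpM2l => //; apply:(@le_trans _ _ (wt k (x + r *: h))); first exact:wt_le.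
apply:le_trans (wt_shift k (x + r *: h) x) _; apply:ler_wpM2r; first exact:wt_ge0.
apply:lerXn2r; rewrite ?nnegrE//.
rewrite [x + _]addrC addrK normrZ (ger0_norm r0).
by have := ler_pM r0 (normr_ge0 h) r1 h1; rewrite mulr1; lra.
Qed.

Lemma diter_sub s f g x : rsmth f -> rsmth g ->
 diter s (fun y => f y - g y) x = diter s f x - diter s g x.
move=> sf sg; rewrite (_ : (fun y => _) = f \+ (fun y => -1 * g y)); last first.
 by [].
by rewrite diterD ?diterZ//=; rewrite mulN1r.
Qed.

Lemma rsch_shiftV y f : rsch f -> rsch (tshift y f).
by []. Qed.
Hint Resolve rsch_shiftV : fn.

Lemma rschB f g : rsch f -> rsch g -> rsch (fun x => f x - g x).
move=> Hf Hg; rewrite (_ : (fun x => _) = (fun x => -1 * g x + f x))//.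
Qed.
Hint Resolve rschB : fn.

Lemma rbnd_shift k f B y : rsmth f -> rbnd k f B -> rbnd k (tshift y f) ((1 + `|y|) ^+ k * B).
move=> sf HB s x sk; rewrite diter_shift//; have B0 := rbnd_ge0 HB.
apply:le_trans (ler_wpM2l _ (HB s (x - y) sk)) => //.
rewrite mulrA -exprMn; apply:ler_wpM2r => //; apply:lerXn2r; rewrite ?nnegrE//.
by rewrite mulrC; exact:onrm_sub.
Qed.

Lemma rbnd_shift_sub k f B y z : rsmth f -> rbnd (k + k).+1 f B -> `|z - y| <= 1 ->
 rbnd k (fun x => tshift y f x - tshift z f x) (d%:R * 2 ^+ k * B * `|z - y| * (1 + `|y|) ^+ k).
move=> sf HB yz s x sk; have B0 := rbnd_ge0 HB.
rewrite diter_sub ?diter_shift//; try exact:rsmth_shift.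
have H1 : rbnd k.+1 (diter s f) B.
 by apply:rbnd_diter; apply:rbnd_le HB => //; rewrite leq_add2l.
have := incr_bnd (x - z) (rsmth_diter s sf) H1 yz.
have := @incr_bnd _ _ _ (x - y) (y - z) (rsmth_diter s sf) H1; rewrite distrC => /(_ yz).
rewrite (_ : x - y + (y - z) = x - z); last by rewrite addrA subrK.
move=> H _; rewrite distrC; apply:le_trans (ler_wpM2l _ H) _ => //.
rewrite mulrCA; apply:ler_wpM2l => //.
have := wt_shift k (x - y) x; rewrite addrAC subrr sub0r normrN => H2.
apply:le_trans (ler_wpM2l _ H2) _ => //.
by rewrite mulrCA [X in _ * X]mulrC wt_exp mulr1.
Qed.

(** The class to which the integrands [y -> t (tshift y K)] belong. It is described by constants
    only, so that one quadrature rule can serve all its members. *)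
Definition slow k (A : R) (v : V -> R) := [/\ meas v,
 forall y, `|v y| <= A * (1 + `|y|) ^+ k &
 forall y z, `|z - y| <= 1 -> `|v y - v z| <= A * `|z - y| * (1 + `|y|) ^+ k].

Lemma lipschitz_cont (v : V -> R) (A : R) k :
 (forall y z, `|z - y| <= 1 -> `|v y - v z| <= A * `|z - y| * (1 + `|y|) ^+ k) -> continuous v.
move=> H y; apply/(@cvgrPdist_le _ _ _ (nbhs y)) => e e0.
pose D := `|A| * (1 + `|y|) ^+ k + 1; have D0 : 0 < D by rewrite ltr_wpDl.
have : 0 < Num.min 1 (e / D) by rewrite lt_min ltr01 divr_gt0.
move=> r0; apply/nbhs_ballP; exists (Num.min 1 (e / D)) => //= z.
rewrite -ball_normE /= lt_min distrC => /andP[z1 z2].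
apply:le_trans (H y z (ltW z1)) _.
apply:le_trans (_ : `|z - y| * D <= _); last by rewrite -ler_pdivlMr.
rewrite [A * _]mulrC -mulrA; apply:ler_wpM2l => //.
apply:(@le_trans _ _ (`|A| * (1 + `|y|) ^+ k)); last by rewrite lerDl.
by apply:ler_wpM2r (ler_norm _).
Qed.

Lemma slow_cont k A v : slow k A v -> continuous v.
by case=> _ _ H; exact:lipschitz_cont H. Qed.

Lemma slow_shift t K : rtemp t -> rsch K ->
 exists k, exists2 A : R, 0 <= A & slow k A (fun y => t (tshift y K)).
move=> [lt [k [A A0 HA]]] HK; have [sK bK] := HK; have [B HB] := bK (k + k).+1.
have B0 := rbnd_ge0 HB.
pose A1 := A * (B + d%:R * 2 ^+ k * B).
have L y z : `|z - y| <= 1 -> `|t (tshift y K) - t (tshift z K)| <= A1 * `|z - y| * (1 + `|y|) ^+ k.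
 move=> yz; rewrite -(rlinB lt (rsch_shiftV y HK) (rsch_shiftV z HK)).
 apply:le_trans (HA _ _ (rschB (rsch_shiftV y HK) (rsch_shiftV z HK)) (rbnd_shift_sub sK HB yz)) _.
 rewrite -!mulrA; apply:ler_wpM2l => //; rewrite !mulrA.
 apply:ler_wpM2r => //.
 by apply:ler_wpM2r => //; rewrite lerDr.
exists k, A1; first by rewrite mulr_ge0.
split=> //; first by apply:cont_mbl_rV; exact:lipschitz_cont L.
move=> y; have HBk : rbnd k K B by apply:rbnd_le HB => //; rewrite ltnW// leq_addr.
apply:le_trans (HA _ _ (rsch_shiftV y HK) (rbnd_shift y sK HBk)) _.
rewrite -mulrA; apply:ler_wpM2l => //; rewrite mulrC; apply:ler_wpM2r => //.
by rewrite lerDl.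
Qed.

Lemma slow_rint k A v chi : slow k A v -> rsch chi -> rint (fun y => chi y * v y).
move=> [mv bv _] Hc; have [B HB] := Hc.2 (k + W)%N.
apply:(Rint_dom (A := A * B) (leqnn W) _ _).1 => [|y].
 by apply:measurable_funM => //; exact:rsch_mbl.
rewrite normrM mulrC; apply:le_trans (ler_pM _ _ (bv y) (rbnd_wt0 y HB)) _ => //.
rewrite wtD [leLHS](_ : _ = A * B * wt W y * (wt k y * (1 + `|y|) ^+ k)); last by ring.
by rewrite wt_exp mulr1.
Qed.

(** Grid cells are numbered by [pickle]; [box m N] is the union of those numbered below [N], so that
    a Riemann sum over it is finite. *)
Let cell m (n : nat) : set V := [set y | pickle (floor_rV m y) = n].
Let box m (N : nat) : set V := [set y | (pickle (floor_rV m y) < N)%N].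

Let mcell m n : measurable (cell m n).
exact:(mbl_floor_rV m (fun c => pickle c = n)). Qed.

Let mbox m N : measurable (box m N).
exact:(mbl_floor_rV m (fun c => (pickle c < N)%N)). Qed.

Lemma indic_mbl (D : set V) : measurable D -> meas (\1_D : V -> R).
by []. Qed.

Let rint_indic (D : set V) f : measurable D -> rint f -> rint (fun y => \1_D y * f y).
move=> mD if_; have ia : rint (fun y => `|f y|).
 by have := integrable_abse if_.
apply:rint_dom ia; first by apply:measurable_funM (indic_mbl mD) (rint_mbl if_).
move=> y; rewrite normrM indicE; case:(y \in D); first by rewrite normr1 mul1r.
by rewrite normr0 mul0r.
Qed.

Let tail_small m f (e : R) : 0 < e -> rint f -> (forall y, 0 <= f y) ->
 exists N, \int[mu]_y (f y - \1_(box m N) y * f y) <= e.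
move=> e0 if_ f0; pose g N y := f y - \1_(box m N) y * f y.
have mg N : meas (g N) by [].
have cg : (fun N => \int[mu]_y (g N y)%:E)%E @ \oo --> (\int[lebesgue_rV R d]_y (0 : R)%:E)%E.
 apply:(@dominated_cvg _ _ _ mu setT measurableT (fun N y => (g N y)%:E) (fun=> 0%:E) (EFin \o f)) => //.
 - move=> y _; apply:cvg_near_cst; near=> N.
  rewrite /g indicE mem_set ?mul1r ?subrr//=.
  by near: N; exact:nbhs_infty_gt.
 - move=> N y _; rewrite lee_fin /g indicE; case:(y \in _); rewrite ?mul1r ?mul0r ?subrr ?subr0 ?normr0//.
  by rewrite ger0_norm.
move:cg; rewrite (_ : \int[mu]_y (0 : R)%:E = 0)%E; last exact:integral0.
move=> /fine_cvgP[_ /cvgrPdist_le/(_ _ e0)[N _ /(_ N (leqnn N))]] /=.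
by rewrite sub0r normrN => H; exists N; apply:le_trans H; rewrite ler_norm.
Unshelve. all: by end_near. Qed.

Let wts m chi n := \int[mu]_y (\1_(cell m n) y * chi y).
Let node m n : V := if unpickle n is Some c then grid R m (c : 'rV[int]_d) else 0.

Let quad_sum m chi (v : V -> R) N : rint chi ->
 rint (fun y => \1_(box m N) y * chi y * v (grid R m (floor_rV m y))) /\
 \int[mu]_y (\1_(box m N) y * chi y * v (grid R m (floor_rV m y))) =
 \sum_(n < N) wts m chi n * v (node m n).
move=> ic; elim:N => [|N [IH1 IH2]].
 rewrite big_ord0; have E y : \1_(box m 0) y * chi y * v (grid R m (floor_rV m y)) = 0.
  by rewrite indicE memNset ?mul0r// => -[].
 by split; [rewrite (_ : (fun y => _) = cst 0); [exact:rint0|exact/funext]|rewrite -[RHS](Rint_cst0 R d); apply:eq_Rintegral => y _; exact:E].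
have E y : \1_(box m N.+1) y * chi y * v (grid R m (floor_rV m y)) =
  \1_(box m N) y * chi y * v (grid R m (floor_rV m y)) + v (node m N) * (\1_(cell m N) y * chi y).
 have b1 M : (y \in box m M) = (pickle (floor_rV m y) < M)%N by apply/idP/idP => [/set_mem//|h]; exact:mem_set.
 have b2 : (y \in cell m N) = (pickle (floor_rV m y) == N) by apply/idP/idP => [/set_mem/eqP//|/eqP h]; exact:mem_set.
 rewrite !indicE !b1 b2 ltnS; case:ltngtP => h /=; try by ring.
 by rewrite /node -h pickleK; ring.
have i2 := rintZ (v (node m N)) (rint_indic (mcell m N) ic).
split.
 have := rintD IH1 i2; rewrite (_ : (fun y => _) = (fun y => \1_(box m N.+1) y * chi y * v (grid R m (floor_rV m y))))//.
 by apply/funext => y.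
rewrite big_ord_recr /= -IH2 [_ * v _]mulrC -RintZ; last exact:rint_indic.
rewrite -RintD//; by apply:eq_Rintegral => y _; by [].
Qed.

(** The nodes and weights depend on [chi], [k] and [e] but not on [v]; this uniformity is what
    [exchange] rests on. Half of [e] pays for the mesh, half for the cells left out. *)
Lemma quadrature chi k (e : R) : rsch chi -> 0 < e ->
 exists N, exists w : nat -> R, exists z : nat -> V, forall v A, slow k A v ->
 `|\int[mu]_y (chi y * v y) - \sum_(n < N) w n * v (z n)| <= A * e.
move=> Hc e0; have [B HB] := Hc.2 (k + W)%N; have B0 := rbnd_ge0 HB.
have ic := rsch_rint Hc.
pose g y := `|chi y| * (1 + `|y|) ^+ k.
have mg : meas g.
 apply:measurable_funM; first by apply:measurableT_comp => //; exact:rsch_mbl.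
 apply:measurable_funX; apply:measurable_funD => //; exact:mbl_norm_rV.
have g0 y : 0 <= g y by rewrite mulr_ge0.
have ig : rint g.
 apply:(Rint_dom (A := B) (leqnn W) mg _).1 => y; rewrite ger0_norm// /g.
 apply:le_trans (ler_wpM2r _ (rbnd_wt0 y HB)) _ => //.
 by rewrite addnC wtD -!mulrA wt_exp mulr1.
pose I := \int[mu]_y g y; have I0 : 0 <= I by apply:Rintegral_ge0.
have [m Hm] : exists m, (2^-1 : R) ^+ m * (I + 1) <= e / 2.
 have : (2^-1 : R) ^+ m @[m --> \oo] --> (0 : R).
  by apply:cvg_expr; rewrite ger0_norm// invf_lt1// ltr1n.
 have e1 : 0 < e / 2 / (I + 1) by rewrite !divr_gt0.
 move=> /cvgrPdist_le/(_ _ e1)[m _ /(_ m (leqnn m))]; rewrite sub0r normrN ger0_norm//.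
 by rewrite ler_pdivlMr// => H; exists m.
have e2 : 0 < e / 2 by rewrite divr_gt0.
have [N HN] := tail_small m e2 ig g0.
exists N, (wts m chi), (node m) => v A Hv; have [mv bv lv] := Hv.
have A0 : 0 <= A by have := le_trans (normr_ge0 _) (bv 0); rewrite normr0 addr0 expr1n mulr1.
have [i1 <-] := quad_sum m v N ic.
have i2 := slow_rint Hv Hc.
rewrite -RintB//.
have i3 := rintZ (A * (2^-1) ^+ m) ig.
have i4 := rintZ A (rintB ig (rint_indic (mbox m N) ig)).
have H : `|\int[mu]_y (chi y * v y - \1_(box m N) y * chi y * v (grid R m (floor_rV m y)))|
  <= \int[mu]_y (A * 2^-1 ^+ m * g y + A * (g y - \1_(box m N) y * g y)).
 apply:Rint_norm_le => [||y]//.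
  exact:rintD.
 have gs := grid_floor m y; have gs1 : `|grid R m (floor_rV m y) - y| <= 1.
  by apply:le_trans gs _; rewrite exprn_ile1// invf_le1// ler1n.
 have := lv _ _ gs1; have := bv y; move:(v y) (v _) => a b Ha Hb.
 rewrite indicE; case:(y \in _); rewrite ?mul1r ?mul0r ?subr0 ?subrr ?mulr0 ?addr0.
  rewrite -mulrBr normrM; apply:le_trans (ler_wpM2l (normr_ge0 _) Hb) _.
  rewrite [leRHS](_ : _ = `|chi y| * (A * 2^-1 ^+ m * (1 + `|y|) ^+ k)); last by rewrite /g; ring.
  apply:ler_wpM2l => //.
  apply:ler_wpM2r => //.
  exact:ler_wpM2l.
 rewrite normrM; apply:le_trans (ler_wpM2l (normr_ge0 _) Ha) _.
 rewrite mulrCA -[leLHS]add0r lerD//; rewrite !mulr_ge0.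
apply:le_trans H _; rewrite RintD// RintZ// RintZ; last by apply:rintB ig (rint_indic (mbox m N) ig).
rewrite -mulrA -mulrDr; apply:ler_wpM2l => //; rewrite -/I.
have h0 : (0 : R) <= 2^-1 ^+ m by rewrite exprn_ge0.
by move:Hm HN h0; rewrite mulrDr mulr1; lra.
Qed.

Ltac done ::= basic_done.
(** One and the same quadrature rule approximates the integral on the right and, in the seminorm
    that controls [t], the convolution on the left. On the Riemann sum itself the identity is
    linearity. *)
Theorem exchange t chi K : rtemp t -> rsch chi -> rsch K ->
 t (rconv K chi) = \int[mu]_y (chi y * t (tshift y K)).
move=> ht Hc HK; have [lt [k [A A0 HA]]] := ht; have [sK bK] := HK.
have [B HB] := bK (k + k).+1; have B0 := rbnd_ge0 HB.
have [k1 [A1 A10 sl]] := slow_shift ht HK.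
pose A2 := B + d%:R * 2 ^+ k * B.
have A20 : 0 <= A2 by rewrite addr_ge0// !mulr_ge0.
(* The integrands behind the weighted derivatives of [rconv K chi] are slow with one constant [A2]
   for all [s] and [x], so the rule is accurate in the whole seminorm. *)
have slK s x : (size s <= k)%N -> slow k A2 (fun y => (1 + `|x|) ^+ k * diter s K (x - y)).
 move=> sk; have E y : (1 + `|x|) ^+ k * diter s K (x - y) = (1 + `|x|) ^+ k * diter s (tshift y K) x.
  by rewrite diter_shift.
 split=> [|y|y z yz].
 - apply:measurable_funM => //; apply:mbl_subr; apply:rsmth_mbl; exact:rsmth_diter.
 - have HBk : rbnd k K B by apply:rbnd_le HB => //; rewrite ltnW// ltnS leq_addr.
  rewrite E normrM ger0_norm; last exact/ltW/onrmX_gt0.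
  apply:le_trans (rbnd_shift y sK HBk x sk) _; rewrite mulrC.
  by apply:ler_wpM2r; [exact/ltW/onrmX_gt0|rewrite lerDl !mulr_ge0].
 - rewrite !E -mulrBr -diter_sub; try exact:rsmth_shift.
  rewrite normrM ger0_norm; last exact/ltW/onrmX_gt0.
  apply:le_trans (rbnd_shift_sub sK HB yz x sk) _.
  apply:ler_wpM2r; first exact/ltW/onrmX_gt0.
  by apply:ler_wpM2r => //; rewrite lerDr.
apply/eqP; rewrite -subr_eq0 -normr_le0; apply/ler_addgt0Pr => r r0; rewrite add0r.
pose D := A * A2 + A1 + 1; have D0 : 0 < D by rewrite ltr_wpDl// addr_ge0// mulr_ge0.
have e0 : 0 < r / D by rewrite divr_gt0.
have [N [w [z Hq]]] := @quadrature chi (maxn k k1) (r / D) Hc e0.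
have slow_max k' A' v : (k' <= maxn k k1)%N -> 0 <= A' -> slow k' A' v -> slow (maxn k k1) A' v.
 move=> kk A'0 [mv bv lv]; have W' y : (1 + `|y|) ^+ k' <= (1 + `|y|) ^+ maxn k k1 by rewrite ler_weXn2l// lerDl.
 split=> // [y|y z' yz]; first by apply:le_trans (bv y) _; exact:ler_wpM2l.
 by apply:le_trans (lv y z' yz) _; apply:ler_wpM2l => //; exact:mulr_ge0.
have H1 := Hq _ _ (slow_max _ _ _ (leq_maxr _ _) A10 sl).
have [Hcv dcv] := rconv_sch HK Hc.
have HS : rsch (fun x => \sum_(n < N) w n * tshift (z n) K x).
 by apply:rsch_sum => n; apply:rschZ; exact:rsch_shiftV.
have H2 : rbnd k (fun x => rconv K chi x - \sum_(n < N) w n * tshift (z n) K x) (A2 * (r / D)).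
 move=> s x sk; rewrite diter_sub; [|exact:Hcv.1|exact:HS.1].
 rewrite dcv diter_sum; last by move=> n; apply:rsmthZ; exact:rsmth_shift.
 rewrite -[(1 + `|x|) ^+ k]ger0_norm; last exact/ltW/onrmX_gt0.
 rewrite -normrM mulrBr mulr_sumr.
 apply:le_trans (Hq _ _ (slow_max _ _ _ (leq_maxl _ _) A20 (slK s x sk))).
 apply:eqW; congr (`|_ - _|).
  rewrite -RintZ; last by apply:rint_rconv => //; exact:rsch_diter.
  by apply:eq_Rintegral => y _; ring.
 apply:eq_bigr => n _; rewrite diterZ; last exact:rsmth_shift.
 by rewrite diter_shift//; ring.
have H3 := HA _ _ (rschB Hcv HS) H2.
rewrite rlinB// rlin_sum// in H3; last by move=> n; apply:rschZ; exact:rsch_shiftV.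
rewrite (eq_bigr (fun n : 'I_N => w n * t (tshift (z n) K))) in H3; last first.
 by move=> n _; rewrite rlinZ//; exact:rsch_shiftV.
move:H1 H3; set S := \sum_(n < N) _ => H1 H3.
rewrite (_ : _ - _ = (t (rconv K chi) - S) - (\int[mu]_y (chi y * t (tshift y K)) - S)); last by ring.
apply:le_trans (ler_normB _ _) _; apply:le_trans (lerD H3 H1) _.
rewrite mulrA -mulrDl mulrCA -[leRHS]mulr1; apply:ler_wpM2l; first exact:ltW.
by rewrite ler_pdivrMr// mul1r lerDl.
Qed.
Ltac done ::= extended_done.

End functionals.
Hint Resolve rsch_lin rsch_sum rsch_shiftV rschB : fn.

(** * Complex functionals through their real and imaginary parts *)

Section complex_functionals.
Context (R : realType) (d : nat).
Local Notation V := 'rV[R]_d.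
Local Notation C := R[i].
Local Notation S := (schwartz R d).
Implicit Types (f g : V -> C) (s : seq 'I_d) (T : S -> C).

Definition toC (f : V -> R) : V -> C := fun x => (f x +i* 0)%C.
Definition ev T f : C := T (to_schwartz f).

Lemma csch_toC (f : V -> R) : rsch f -> csch (toC f).
by move=> Hf; split=> //; exact:rsch_cst0. Qed.
Hint Resolve csch_toC : fn.

Lemma to_sch_lin (a : C) f g : csch f -> csch g -> csch (fun x => a * f x + g x) ->
 to_schwartz (fun x => a * f x + g x) = a *: to_schwartz f + to_schwartz g.
move=> Hf Hg Hfg; apply/val_inj; rewrite /= to_schE//.
by apply/funext => x; rewrite !to_schE.
Qed.

Lemma csch_lin (a : C) f g : csch f -> csch g -> csch (fun x => a * f x + g x).
move=> [f1 f2] [g1 g2]; split.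
 rewrite (_ : _ \o _ = fun x => Re a * Re (f x) + ((- Im a) * Im (f x) + Re (g x))).
  by [].
 by apply/funext => x; rewrite /= cReD cReM; ring.
rewrite (_ : _ \o _ = fun x => Re a * Im (f x) + (Im a * Re (f x) + Im (g x))).
 by [].
by apply/funext => x; rewrite /= cImD cImM; ring.
Qed.
Hint Resolve csch_lin : fn.

Lemma ev_lin T (a : C) f g : scalar T -> csch f -> csch g ->
 ev T (fun x => a * f x + g x) = a * ev T f + ev T g.
by move=> lT Hf Hg; rewrite /ev to_sch_lin//; exact:lT.
Qed.

(** A complex-linear functional is determined by its values on real functions; the real
    ([b = false]) and imaginary parts of these are real functionals, to which the preceding theory
    applies. *)
Definition tpart (b : bool) T : (V -> R) -> R := fun h => (if b then Im else Re) (ev T (toC h)).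
Arguments tpart : simpl never.

Lemma rbnd_cst0 k : rbnd k (cst 0 : V -> R) 0.
move=> s x _; rewrite (_ : diter s _ x = 0) ?normr0//.
elim:s x => [//|i s IH] x; rewrite /= (_ : diter s (cst 0) = cst 0); last exact/funext.
by rewrite dpartE derive_cst.
Qed.

Lemma tpart_temp T b : tempered T -> rtemp (tpart b T).
move=> tT; have [lT _] := tT; split.
 move=> a f g Hf Hg; rewrite /tpart (_ : toC _ = fun x => a%:C%C * toC f x + toC g x); last first.
  by apply/funext => x; apply:ceqP; rewrite /=; ring.
 rewrite ev_lin//; try exact:csch_toC.
 by case:b; rewrite ?cReD ?cImD ?cReM ?cImM /=; ring.
have [k [A A0 HA]] := temp_bnd tT; exists k, A => // f B Hf HB.
have H : bnd k (to_schwartz (toC f)) B.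
 rewrite to_schE//.
 by split=> //; exact:rbnd_le (leqnn k) (rbnd_ge0 HB) (@rbnd_cst0 k).
by rewrite /tpart; case:b; apply:le_trans (HA _ _ H); rewrite ?Re_le_normc ?Im_le_normc.
Qed.
Hint Resolve tpart_temp : fn.

Lemma ev_parts T f : scalar T -> csch f ->
 ev T f = ((tpart false T (Re \o f) - tpart true T (Im \o f)) +i*
      (tpart true T (Re \o f) + tpart false T (Im \o f)))%C.
move=> lT [f1 f2].
have {1}-> : f = fun x => 'i%C * toC (Im \o f) x + toC (Re \o f) x.
 by apply/funext => x; apply:ceqP; rewrite /=; ring.
rewrite ev_lin//; try exact:csch_toC.
rewrite /tpart; move:(ev T _) (ev T _) => z w.
by apply:ceqP; rewrite ?cReD ?cImD ?cReM ?cImM /=; ring.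
Qed.

(** The complex-linear extension of [t1 + i t2]; by [ev_parts] it rebuilds a functional from its
    [tpart]s. *)
Definition ofparts (t1 t2 : (V -> R) -> R) : S -> C := fun phi =>
 ((t1 (Re \o phi) - t2 (Im \o phi)) +i* (t2 (Re \o phi) + t1 (Im \o phi)))%C.

Lemma ofparts_temp t1 t2 : rtemp t1 -> rtemp t2 -> tempered (ofparts t1 t2).
move=> [l1 [k1 [A1 A10 H1]]] [l2 [k2 [A2 A20 H2]]].
have sc : scalar (ofparts t1 t2).
 move=> a phi psi; have [p1 p2] := sch_csch phi; have [q1 q2] := sch_csch psi.
 rewrite /ofparts.
 have -> : Re \o (a *: phi + psi) = fun x => Re a * Re (phi x) + ((- Im a) * Im (phi x) + Re (psi x)).
  apply/funext => x; rewrite /= cReD cReM; ring.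
 have -> : Im \o (a *: phi + psi) = fun x => Re a * Im (phi x) + (Im a * Re (phi x) + Im (psi x)).
  apply/funext => x; rewrite /= cImD cImM; ring.
 have rl (t : (V -> R) -> R) (b c : R) (f g h : V -> R) : rlin t -> rsch f -> rsch g -> rsch h ->
   t (fun x => b * f x + (c * g x + h x)) = b * t f + (c * t g + t h).
  by move=> lt Hf Hg Hh; rewrite ?lt.
 rewrite (rl t1 _ _ _ _ _ l1 p1 p2 q1) (rl t2 _ _ _ _ _ l2 p1 p2 q1).
 rewrite (rl t1 _ _ _ _ _ l1 p2 p1 q2) (rl t2 _ _ _ _ _ l2 p2 p1 q2).
 by apply:ceqP; rewrite ?cReD ?cImD ?cReM ?cImM /=; rewrite -?[Im \o phi]/(fun x => Im (phi x)); ring.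
apply:(bnd_temp sc (k := maxn k1 k2) (A := 2 * (A1 + A2))) => //.
move=> phi B [B1 B2]; have [p1 p2] := sch_csch phi.
have b1 (f : V -> R) : rsch f -> rbnd (maxn k1 k2) f B -> `|t1 f| <= A1 * B.
 by move=> Hf HB; apply:H1 => //; apply:rbnd_le HB; rewrite ?leq_maxl.
have b2 (f : V -> R) : rsch f -> rbnd (maxn k1 k2) f B -> `|t2 f| <= A2 * B.
 by move=> Hf HB; apply:H2 => //; apply:rbnd_le HB; rewrite ?leq_maxr.
apply:le_trans (normc_le _) _; rewrite /=.
apply:le_trans (lerD (ler_normB _ _) (ler_normD _ _)) _.
have := b1 _ p1 B1; have := b1 _ p2 B2; have := b2 _ p1 B1; have := b2 _ p2 B2.
by lra.
Qed.
Hint Resolve ofparts_temp : fn.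

Definition cshift (y : V) f : V -> C := fun x => f (x - y).

Lemma csch_shift y f : csch f -> csch (cshift y f).
by move=> [f1 f2]; split; [exact:rsch_shiftV y _ f1|exact:rsch_shiftV y _ f2]. Qed.
Hint Resolve csch_shift : fn.

Definition cconv K chi : V -> C := fun x =>
 ((rconv (Re \o K) (Re \o chi) x - rconv (Im \o K) (Im \o chi) x) +i*
  (rconv (Re \o K) (Im \o chi) x + rconv (Im \o K) (Re \o chi) x))%C.

Lemma cconv_sch K chi : csch K -> csch chi -> csch (cconv K chi).
move=> [K1 K2] [c1 c2]; split.
 exact:rschB (rconv_sch K1 c1).1 (rconv_sch K2 c2).1.
exact:rschD (rconv_sch K1 c2).1 (rconv_sch K2 c1).1.
Qed.
Hint Resolve cconv_sch : fn.

Definition crint f := rint (Re \o f) /\ rint (Im \o f).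

Lemma cconvE K chi x : csch K -> csch chi ->
 crint (fun y => K (x - y) * chi y) /\ cconv K chi x = cintegral (fun y => K (x - y) * chi y).
move=> [K1 K2] [c1 c2].
have i11 := rint_rconv x K1 c1; have i22 := rint_rconv x K2 c2.
have i12 := rint_rconv x K1 c2; have i21 := rint_rconv x K2 c1.
have E1 : Re \o (fun y => K (x - y) * chi y) = fun y => (Re \o K) (x - y) * (Re \o chi) y - (Im \o K) (x - y) * (Im \o chi) y.
 by apply/funext => y; rewrite /= cReM.
have E2 : Im \o (fun y => K (x - y) * chi y) = fun y => (Re \o K) (x - y) * (Im \o chi) y + (Im \o K) (x - y) * (Re \o chi) y.
 by apply/funext => y; rewrite /= cImM.
split; first by split; rewrite ?E1 ?E2; [exact:rintB|exact:rintD].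
rewrite /cconv; congr (_ +i* _)%C.
 by rewrite -[X in Rintegral _ _ X]/(Re \o (fun y => K (x - y) * chi y)) E1 RintB.
by rewrite -[X in Rintegral _ _ X]/(Im \o (fun y => K (x - y) * chi y)) E2 RintD.
Qed.

Theorem cexchange T chi K : tempered T -> csch chi -> csch K ->
 crint (fun y => chi y * ev T (cshift y K)) /\
 ev T (cconv K chi) = cintegral (fun y => chi y * ev T (cshift y K)).
move=> tT Hc HK; have [c1 c2] := Hc; have [K1 K2] := HK; have [lT _] := tT.
have tp b := tpart_temp b tT.
have lp b : rlin (tpart b T) by case:(tp b).
have ir b K' chi' : rsch K' -> rsch chi' -> rint (fun y => chi' y * tpart b T (tshift y K')).
 by move=> HK' Hc'; have [k [A A0 sl]] := slow_shift (tp b) HK'; exact:slow_rint sl Hc'.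
pose J b K' chi' := fun y => chi' y * tpart b T (tshift y K').
pose I b K' chi' := \int[mu]_y J b K' chi' y.
have E1 : Re \o (fun y => chi y * ev T (cshift y K)) = fun y =>
  (J false (Re \o K) (Re \o chi) y - J true (Im \o K) (Re \o chi) y) -
  (J true (Re \o K) (Im \o chi) y + J false (Im \o K) (Im \o chi) y).
 apply/funext => y; rewrite /= cReM ev_parts//.
 by rewrite /J /=; set a := tpart false T _; set b := tpart true T _; set a' := tpart true T _; set b' := tpart false T _; ring.
have E2 : Im \o (fun y => chi y * ev T (cshift y K)) = fun y =>
  (J false (Re \o K) (Im \o chi) y - J true (Im \o K) (Im \o chi) y) +
  (J true (Re \o K) (Re \o chi) y + J false (Im \o K) (Re \o chi) y).
 apply/funext => y; rewrite /= cImM ev_parts//.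
 by rewrite /J /=; set a := tpart false T _; set b := tpart true T _; set a' := tpart true T _; set b' := tpart false T _; ring.
have iJ b K' chi' : rsch K' -> rsch chi' -> rint (J b K' chi') by exact:ir.
have ex b K' chi' : rsch K' -> rsch chi' -> tpart b T (rconv K' chi') = I b K' chi'.
 by move=> *; apply:exchange.
split.
 by split; rewrite ?E1 ?E2; [apply:rintB|apply:rintD]; (apply:rintB || apply:rintD); exact:iJ.
rewrite ev_parts//.
rewrite /cintegral -[X in (Rintegral _ _ X +i* _)%C]/(Re \o (fun y => chi y * ev T (cshift y K))) E1.
rewrite -[X in (_ +i* Rintegral _ _ X)%C]/(Im \o (fun y => chi y * ev T (cshift y K))) E2.
have Q1 (f1 f2 f3 f4 : V -> R) : rint f1 -> rint f2 -> rint f3 -> rint f4 ->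
  \int[mu]_y ((f1 y - f2 y) - (f3 y + f4 y)) =
  (\int[mu]_y f1 y - \int[mu]_y f2 y) - (\int[mu]_y f3 y + \int[mu]_y f4 y).
 by move=> H1 H2 H3 H4; rewrite (RintB (rintB H1 H2) (rintD H3 H4)) (RintB H1 H2) (RintD H3 H4).
have Q2 (f1 f2 f3 f4 : V -> R) : rint f1 -> rint f2 -> rint f3 -> rint f4 ->
  \int[mu]_y ((f1 y - f2 y) + (f3 y + f4 y)) =
  (\int[mu]_y f1 y - \int[mu]_y f2 y) + (\int[mu]_y f3 y + \int[mu]_y f4 y).
 by move=> H1 H2 H3 H4; rewrite (RintD (rintB H1 H2) (rintD H3 H4)) (RintB H1 H2) (RintD H3 H4).
rewrite Q1; try exact:iJ.
rewrite Q2; try exact:iJ.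
have F1 b : tpart b T (Re \o cconv K chi) = I b (Re \o K) (Re \o chi) - I b (Im \o K) (Im \o chi).
 rewrite -!ex// -rlinB//.
have F2 b : tpart b T (Im \o cconv K chi) = I b (Re \o K) (Im \o chi) + I b (Im \o K) (Re \o chi).
 rewrite -!ex// -rlinD//.
by rewrite !F1 !F2 -!/(I _ _ _); congr (_ +i* _)%C; ring.
Qed.

Lemma cint_eq f g : f =1 g -> cintegral f = cintegral g.
by move=> /funext ->. Qed.

Lemma crintZ (c : C) f : crint f -> crint (fun x => c * f x).
move=> [i1 i2]; split.
 by rewrite (_ : _ \o _ = fun x => Re c * Re (f x) - Im c * Im (f x)); [apply:rintB; exact:rintZ|apply/funext => x; rewrite /= cReM].
by rewrite (_ : _ \o _ = fun x => Re c * Im (f x) + Im c * Re (f x)); [apply:rintD; exact:rintZ|apply/funext => x; rewrite /= cImM].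
Qed.
Hint Resolve crintZ : fn.

Lemma cintZ (c : C) f : crint f -> cintegral (fun x => c * f x) = c * cintegral f.
move=> [i1 i2]; apply:ceqP; rewrite ?cReM ?cImM /=.
 have E x : Re (c * f x) = Re c * Re (f x) - Im c * Im (f x) by rewrite cReM.
 by under eq_Rintegral do rewrite E; rewrite RintB ?RintZ//; exact:rintZ.
have E x : Im (c * f x) = Re c * Im (f x) + Im c * Re (f x) by rewrite cImM.
by under eq_Rintegral do rewrite E; rewrite RintD ?RintZ//; exact:rintZ.
Qed.

Lemma cint_fubini (F : V -> V -> C) (a b : V -> R) :
 meas (fun xy : V * V => Re (F xy.1 xy.2)) ->
 meas (fun xy : V * V => Im (F xy.1 xy.2)) ->
 (forall x y, normc (F x y) <= a x * b y) -> rint a -> rint b ->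
 cintegral (fun x => cintegral (F x)) = cintegral (fun y => cintegral (fun x => F x y)).
move=> m1 m2 H ia ib; apply:ceqP => /=.
 by apply:(Rint_fubini m1 _ ia ib) => x y; exact:le_trans (Re_le_normc _) (H x y).
by apply:(Rint_fubini m2 _ ia ib) => x y; exact:le_trans (Im_le_normc _) (H x y).
Qed.

Lemma crint_normc f : crint f -> rint (fun x => normc (f x)).
move=> [i1 i2]; have m1 := rint_mbl i1; have m2 := rint_mbl i2.
have mn : meas (fun x => normc (f x)).
 rewrite (_ : (fun x => _) = @Num.sqrt R \o (fun x => Re (f x) ^+ 2 + Im (f x) ^+ 2)); last first.
  by apply/funext => x /=; case:(f x).
 apply:measurableT_comp; first by apply:continuous_measurable_fun; exact:sqrt_continuous.
 by [].
apply:rint_dom (rintD (integrable_norm i1) (integrable_norm i2)) => // x.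
by rewrite ger0_norm ?normc_ge0//; exact:normc_le.
Qed.
Hint Resolve crint_normc : fn.

Lemma normc_cint f : crint f -> normc (cintegral f) <= 2 * \int[mu]_x normc (f x).
move=> cf; have [i1 i2] := cf; have ni := crint_normc cf.
apply:le_trans (normc_le _) _; rewrite /= mulrDl !mul1r.
by apply:lerD; apply:Rint_norm_le => // x; rewrite ?Re_le_normc ?Im_le_normc.
Qed.

End complex_functionals.
Hint Resolve csch_toC csch_lin tpart_temp ofparts_temp csch_shift cconv_sch crintZ crint_normc : fn.

(** * Fourier transform and Fourier multipliers *)

Section fourier_layer.
Context (R : realType) (d : nat).
Local Notation V := 'rV[R]_d.
Local Notation C := R[i].
Local Notation S := (schwartz R d).
Implicit Types (f g : V -> C) (s : seq 'I_d) (T : S -> C).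

Definition cmeas d' (X : measurableType d') (F : X -> C) :=
 meas (Re \o F) /\ meas (Im \o F).

Lemma cmeasM d' (X : measurableType d') (F G : X -> C) : cmeas F -> cmeas G -> cmeas (fun x => F x * G x).
move=> [F1 F2] [G1 G2]; split.
 rewrite (_ : _ \o _ = (fun x => (Re \o F) x * (Re \o G) x - (Im \o F) x * (Im \o G) x)).
  by [].
 by apply/funext => x /=; rewrite cReM.
rewrite (_ : _ \o _ = (fun x => (Re \o F) x * (Im \o G) x + (Im \o F) x * (Re \o G) x)).
 by [].
by apply/funext => x /=; rewrite cImM.
Qed.

Lemma cmeas_sch f : csch f -> cmeas f.
by move=> [f1 f2]; split; exact:rsch_mbl. Qed.

Definition c0 : R := (2 * pi) `^ (- (d%:R / 2)).

Lemma c0_gt0 : 0 < c0.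
by rewrite powR_gt0// mulr_gt0// pi_gt0. Qed.
Hint Resolve c0_gt0 : pos.

Lemma c0C_neq0 : c0%:C%C != 0 :> C.
by apply/eqP => /(congr1 Re) /eqP; rewrite gt_eqF. Qed.

Lemma dotE (x y : V) : dot x y = lform (x ord0) y.
by apply:eq_bigr => i _; rewrite mulrC. Qed.

Lemma dotC (x y : V) : dot x y = dot y x.
by apply:eq_bigr => i _; rewrite mulrC. Qed.

Lemma dotDl (x y z : V) : dot (x + y) z = dot x z + dot y z.
by rewrite -big_split; apply:eq_bigr => i _; rewrite mxE mulrDl. Qed.

Lemma dotNl (x y : V) : dot (- x) y = - dot x y.
by rewrite -sumrN; apply:eq_bigr => i _; rewrite mxE mulNr. Qed.

Lemma cisD (a b : R) : cis (a + b) = cis a * cis b :> C.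
by apply:ceqP; rewrite /= ?cosD ?sinD; ring. Qed.

Lemma normc_cis (a : R) : normc (cis a) = 1.
by rewrite /= cos2Dsin2 sqrtr1. Qed.

Lemma normcM (z w : C) : normc (z * w) = normc z * normc w.
exact:ComplexField.Normc.normcM. Qed.

(** The Fourier integral with kernel [exp(i e x.xi)] and no normalisation, assembled from real
    transforms; [e = -1] gives the direct transform and [e = 1] the inverse one. *)
Definition fparts (e : R) f : V -> C := fun xi =>
 ((rfour false (Re \o f) xi - e * rfour true (Im \o f) xi) +i*
  (rfour false (Im \o f) xi + e * rfour true (Re \o f) xi))%C.

Lemma crint_sch f : csch f -> crint f.
by move=> [f1 f2]; split; exact:rsch_rint. Qed.
Hint Resolve crint_sch : fn.

Lemma fpartsE f (e : R) xi : e = 1 \/ e = -1 -> csch f ->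
 crint (fun x => f x * cis (e * dot x xi)) /\
 cintegral (fun x => f x * cis (e * dot x xi)) = fparts e f xi.
move=> He [f1 f2].
have [Hc Hs] : (forall t : R, cos (e * t) = cos t) /\ (forall t : R, sin (e * t) = e * sin t).
 by case:He => ->; split=> t; rewrite ?mul1r ?mulN1r ?cosN ?sinN.
have i1 b := rint_four b xi (rsch_rint f1); have i2 b := rint_four b xi (rsch_rint f2).
have E1 : Re \o (fun x => f x * cis (e * dot x xi)) = fun x =>
  Re (f x) * trig false (lform (x ord0) xi) - e * (Im (f x) * trig true (lform (x ord0) xi)).
 by apply/funext => x; rewrite /= cReM /= Hc Hs dotE; ring.
have E2 : Im \o (fun x => f x * cis (e * dot x xi)) = fun x =>
  Im (f x) * trig false (lform (x ord0) xi) + e * (Re (f x) * trig true (lform (x ord0) xi)).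
 by apply/funext => x; rewrite /= cImM /= Hc Hs dotE; ring.
split.
 split; first by rewrite E1; exact:rintB (i1 false) (rintZ e (i2 true)).
 by rewrite E2; exact:rintD (i2 false) (rintZ e (i1 true)).
rewrite /cintegral -[X in (Rintegral _ _ X +i* _)%C]/(Re \o (fun x => f x * cis (e * dot x xi))) E1.
rewrite -[X in (_ +i* Rintegral _ _ X)%C]/(Im \o (fun x => f x * cis (e * dot x xi))) E2.
rewrite (RintB (i1 false) (rintZ e (i2 true))) (RintD (i2 false) (rintZ e (i1 true))).
by rewrite (RintZ e (i2 true)) (RintZ e (i1 true)).
Qed.

Lemma fparts_sch e f : csch f -> csch (fparts e f).
move=> [f1 f2]; split.
 by apply:rschB.
by apply:rschD.
Qed.

Lemma fourierE f : csch f -> fourier f = fun xi => c0%:C%C * fparts (-1) f xi.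
move=> Hf; apply/funext => xi; rewrite -/c0; congr (_ * _).
rewrite -(fpartsE xi _ Hf).2; last by right.
by apply:cint_eq => x; rewrite mulN1r.
Qed.

Lemma inverse_fourierE f : csch f -> inverse_fourier f = fun xi => c0%:C%C * fparts 1 f xi.
move=> Hf; apply/funext => xi; rewrite -/c0; congr (_ * _).
rewrite -(fpartsE xi _ Hf).2; last by left.
by apply:cint_eq => x; rewrite mul1r dotC.
Qed.

Lemma cschZ (a : C) f : csch f -> csch (fun x => a * f x).
move=> Hf; have := csch_lin a Hf (csch_toC (@rsch_cst0 R d)).
by rewrite (_ : (fun x => _) = (fun x => a * f x)).
Qed.
Hint Resolve cschZ : fn.

Lemma cschM f g : csch f -> csch g -> csch (fun x => f x * g x).
move=> [f1 f2] [g1 g2]; split.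
 rewrite (_ : _ \o _ = fun x => ((Re \o f) \* (Re \o g)) x - ((Im \o f) \* (Im \o g)) x).
  by [].
 by apply/funext => x /=; rewrite cReM.
rewrite (_ : _ \o _ = ((Re \o f) \* (Im \o g)) \+ ((Im \o f) \* (Re \o g)))//.
by apply/funext => x /=; rewrite cImM.
Qed.
Hint Resolve cschM : fn.

Lemma csch_fourier f : csch f -> csch (fourier f).
by move=> Hf; rewrite fourierE//; apply:cschZ; exact:fparts_sch. Qed.
Hint Resolve csch_fourier : fn.

Lemma csch_inverse_fourier f : csch f -> csch (inverse_fourier f).
by move=> Hf; rewrite inverse_fourierE//; apply:cschZ; exact:fparts_sch. Qed.
Hint Resolve csch_inverse_fourier : fn.

(** The convolution kernel of the transposed multiplier, the one that acts on test functions. Hence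
    the direct transform, where the kernel of [th(D)] itself would have the inverse one. *)
Definition kern (th : V -> C) : V -> C := fun z => c0%:C%C * fourier th z.

Ltac done ::= basic_done.
Lemma csch_kern th : csch th -> csch (kern th).
by move=> Hf; apply:cschZ; exact:csch_fourier. Qed.
Ltac done ::= extended_done.
Hint Resolve csch_kern : fn.

Lemma cmeas_cis2 : cmeas (fun xy : V * V => cis (dot xy.1 xy.2)).
have E (xy : V * V) : dot xy.1 xy.2 = lform (xy.1 ord0) xy.2 by exact:dotE.
split; [rewrite (_ : _ \o _ = fun xy : V * V => trig false (lform (xy.1 ord0) xy.2))|
    rewrite (_ : _ \o _ = fun xy : V * V => trig true (lform (xy.1 ord0) xy.2))]; try exact:mbl_trig2.
 by apply/funext => xy /=; rewrite E.
by apply/funext => xy /=; rewrite E.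
Qed.

Lemma cmeas_fst f : cmeas f -> cmeas (fun xy : V * V => f xy.1).
by move=> [f1 f2]; split; [exact:(measurableT_comp f1 measurable_fst)|exact:(measurableT_comp f2 measurable_fst)]. Qed.

Lemma cmeas_snd f : cmeas f -> cmeas (fun xy : V * V => f xy.2).
by move=> [f1 f2]; split; [exact:(measurableT_comp f1 measurable_snd)|exact:(measurableT_comp f2 measurable_snd)]. Qed.

Lemma fourier_conv th phi : csch th -> csch phi ->
 fourier (fun xi => th xi * inverse_fourier phi xi) = cconv (kern th) phi.
move=> Ht Hp; apply/funext => y; rewrite (cconvE y (csch_kern Ht) Hp).2.
pose th' xi := th xi * cis (-1 * dot xi y).
have [it' _] := fpartsE y (or_intror erefl) Ht.
have nt : rint (fun x => normc (th x)) by apply:crint_normc; by [].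
have np : rint (fun x => normc (phi x)) by apply:crint_normc; by [].
pose G xi x := (th' xi * phi x) * cis (dot xi x).
have mG : cmeas (fun xy : V * V => G xy.1 xy.2).
 apply:cmeasM cmeas_cis2; apply:(@cmeasM _ _ (fun xy : V * V => th' xy.1) (fun xy : V * V => phi xy.2)).
  by apply:cmeas_fst; case:it' => i1 i2; split; exact:rint_mbl.
 by apply:cmeas_snd; exact:cmeas_sch.
have bG xi x : normc (G xi x) <= normc (th xi) * normc (phi x).
 by rewrite !normcM !normc_cis !mulr1.
have FB := cint_fubini mG.1 mG.2 bG nt np.
have i1 xi : crint (fun x => phi x * cis (1 * dot x xi)) by exact:(fpartsE xi (or_introl erefl) Hp).1.
have i2 x : crint (fun xi => th xi * cis (-1 * dot xi (y - x))) by exact:(fpartsE _ (or_intror erefl) Ht).1.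
have cn : c0%:C%C != 0 :> C by exact:c0C_neq0.
have GE xi : cintegral (G xi) = (c0%:C%C)^-1 * (th xi * inverse_fourier phi xi * cis (-1 * dot xi y)).
 have -> : cintegral (G xi) = th' xi * cintegral (fun x => phi x * cis (1 * dot x xi)).
  by rewrite -(cintZ (th' xi) (i1 xi)); apply:cint_eq => x; rewrite /G mul1r [dot x xi]dotC mulrA.
 rewrite /inverse_fourier -/c0 /th'.
 have -> : cintegral (fun x => phi x * cis (dot xi x)) = cintegral (fun x => phi x * cis (1 * dot x xi)).
  by apply:cint_eq => x; rewrite mul1r dotC.
 by move:(cintegral _) => I; field.
have iG0 := (fpartsE y (or_intror erefl) (cschM Ht (csch_inverse_fourier Hp))).1.
have iG : crint (fun xi => cintegral (G xi)).
 by rewrite (funext GE); exact:crintZ.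
transitivity ((c0%:C * c0%:C)%C * cintegral (fun xi => cintegral (G xi))).
 rewrite (cint_eq GE) (cintZ _ iG0) /fourier -/c0.
 have -> : cintegral (fun x => th x * inverse_fourier phi x * cis (- dot x y)) =
   cintegral (fun x => th x * inverse_fourier phi x * cis (-1 * dot x y)) by apply:cint_eq => x; rewrite mulN1r.
 by move:(cintegral _) => I; field.
have i2' x : crint (fun xi => th xi * cis (- dot xi (y - x))).
 by have := i2 x; congr crint; apply/funext => xi; rewrite mulN1r.
have E x : cintegral (fun xi => G xi x) = phi x * cintegral (fun xi => th xi * cis (- dot xi (y - x))).
 rewrite -(cintZ (phi x) (i2' x)); apply:cint_eq => xi; rewrite /G /th' mulN1r.
 have -> : - dot xi (y - x) = - dot xi y + dot xi x.
  by rewrite dotC dotDl dotNl opprD opprK [dot y xi]dotC [dot x xi]dotC.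
 by rewrite cisD; move:(th xi) (phi x) (cis _) (cis _) => t1 t2 t3 t4; ring.
have E' x : kern th (y - x) * phi x = (c0%:C * c0%:C)%C * cintegral (fun xi => G xi x).
 rewrite E /kern /fourier; move:(cintegral _) (phi x) => I t; ring.
have iE : crint (fun x => cintegral (fun xi => G xi x)).
 have := crintZ ((c0%:C * c0%:C)%C^-1) (cconvE y (csch_kern Ht) Hp).1.
 by congr crint; apply/funext => x; rewrite E'; move:(cintegral _) => I; field; exact:cn.
rewrite FB (cint_eq E'); exact/esym/cintZ.
Qed.

Lemma cint_transl f (w : V) : crint f -> cintegral (fun x => f (x + w)) = cintegral f.
move=> [i1 i2]; apply:ceqP => /=; [exact:(Rint_transl w i1)|exact:(Rint_transl w i2)].
Qed.

(** * Fourier inversion up to a constant *)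

Section inversion.
Variable c : R.
Hypothesis c_inv : forall f : V -> R, rsch f -> \int[mu]_xi rfour false f xi = c * f 0.

Lemma cint_fparts e f : csch f -> cintegral (fparts e f) = c%:C%C * f 0.
move=> [f1 f2]; have r b (h : V -> R) : rsch h -> rint (rfour b h).
 by move=> Hh; apply:rsch_rint.
apply:ceqP; rewrite ?cReM ?cImM /=.
 rewrite (RintB (r false _ f1) (rintZ e (r true _ f2))) (RintZ e (r true _ f2)) c_inv//.
 by rewrite Rint_rfour_sin//=; ring.
rewrite (RintD (r false _ f2) (rintZ e (r true _ f1))) (RintZ e (r true _ f1)) c_inv//.
by rewrite Rint_rfour_sin//=; ring.
Qed.

Lemma fparts_shift e f xi y : e = 1 \/ e = -1 -> csch f ->
 fparts e f xi * cis (- e * dot y xi) = fparts e (cshift (- y) f) xi.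
move=> He Hf; rewrite -(fpartsE xi He Hf).2 -(fpartsE xi He (csch_shift (- y) Hf)).2.
rewrite -(cint_transl y (fpartsE xi He Hf).1) mulrC -cintZ; last first.
 have := (fpartsE xi He (csch_shift (- y) Hf)).1 => /(crintZ (cis (e * dot y xi))).
 congr crint; apply/funext => x; rewrite /cshift opprK dotDl mulrDr cisD; ring.
apply:cint_eq => x; rewrite /cshift opprK dotDl mulrDr cisD mulrCA -[RHS]mulr1 -mulrA; congr (_ * _).
by rewrite mulrCA -cisD -mulrDl addNr mul0r /cis cos0 sin0.
Qed.

(** The direct and inverse transforms compose to this multiple of the identity. Its value is left
    uncomputed; all representation formulas below carry it along. *)
Definition cinv : R := c0 ^+ 2 * c.

Lemma fpartsZ e (a : R) f xi : e = 1 \/ e = -1 -> csch f ->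
 fparts e (fun x => a%:C%C * f x) xi = a%:C%C * fparts e f xi.
move=> He Hf; rewrite -(fpartsE xi He (cschZ _ Hf)).2 -(fpartsE xi He Hf).2.
rewrite -cintZ; last exact:(fpartsE xi He Hf).1.
by apply:cint_eq => x; rewrite mulrA.
Qed.

Lemma fparts_inv e f y : e = 1 \/ e = -1 -> csch f ->
 fparts (- e) (fparts e f) y = c%:C%C * f y.
move=> He Hf; have He' : - e = 1 \/ - e = -1 by case:He => ->; rewrite ?opprK; [right|left].
rewrite -(fpartsE y He' (fparts_sch e Hf)).2.
have -> : cintegral (fun x => fparts e f x * cis (- e * dot x y)) = cintegral (fparts e (cshift (- y) f)).
 by apply:cint_eq => x; rewrite -fparts_shift// dotC.
rewrite cint_fparts//.
by rewrite /cshift opprK add0r.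
Qed.

Lemma fourierK f : csch f -> fourier (inverse_fourier f) = fun x => cinv%:C%C * f x.
move=> Hf; rewrite fourierE//.
apply/funext => x; rewrite inverse_fourierE// fpartsZ; [|by right|exact:fparts_sch].
rewrite fparts_inv//; [|by left].
by rewrite /cinv; ring.
Qed.

Ltac done ::= basic_done.
Lemma inverse_fourierK f : csch f -> inverse_fourier (fourier f) = fun x => cinv%:C%C * f x.
move=> Hf; rewrite inverse_fourierE; last exact:csch_fourier.
apply/funext => x; rewrite fourierE// fpartsZ; [|by left|exact:fparts_sch].
have H := fparts_inv x (or_intror erefl) Hf; rewrite opprK in H; rewrite H.
by rewrite /cinv !rmorphM /=; ring.
Qed.
Ltac done ::= extended_done.

End inversion.

(** * The continuous function representing a Fourier multiplier *)

Section representation.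
Variable bump : V -> R.
Hypothesis bump_sch : rsch bump.
Hypothesis bump_ge0 : forall x, 0 <= bump x.
Hypothesis bump0 : bump 0 = 1.
Hypothesis bump_supp : forall x, bump x != 0 -> `|x| <= 2.

(** If [h] were positive at a point, its integral against a narrow bump there would be positive; the
    same for [- h]. *)
Lemma cont_eq0 (h : V -> R) : continuous h ->
 (forall f : V -> R, rsch f -> rint (fun x => h x * f x) /\ \int[mu]_x (h x * f x) = 0) ->
 forall x, h x = 0.
move=> ch H x0; have key (h' : V -> R) : continuous h' ->
  (forall f : V -> R, rsch f -> rint (fun x => h' x * f x) /\ \int[mu]_x (h' x * f x) = 0) -> ~ 0 < h' x0.
 move=> ch' H' h0.
 have /cvgrPdist_lt/(_ _ h0)/nbhs_ballP[r /= r0 Hr] := ch' x0.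
 (* The support of the scaled bump has radius [2 e], less than [r]. *)
 pose e := r / 4; have e0 : 0 < e by rewrite divr_gt0.
 pose f := bump \o aff e^-1 (- e^-1 *: x0).
 have Hf : rsch f by apply:rsch_aff => //; rewrite gt_eqF.
 have fE x : f x = bump (e^-1 *: (x - x0)).
  by rewrite /f scalerBr scaleNr.
 have [i1 i2] := H' f Hf.
 have : 0 < \int[mu]_x (h' x * f x).
  apply:(Rint_gt0 (x0 := x0)) => // [x|x|].
  - by apply:(@continuousM _ _ h' f); [exact:ch'|exact:(rsmth_cont Hf.1)].
  - rewrite fE; have [->|b0] := eqVneq (bump (e^-1 *: (x - x0))) 0; first by rewrite mulr0.
   apply:mulr_ge0 => //; have := bump_supp b0; rewrite normrZ gtr0_norm// ler_pdivrMl// => H2.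
   have := Hr x; rewrite -ball_normE /= => H3.
   have : `|x0 - x| < r by rewrite distrC; apply:le_lt_trans H2 _; rewrite /e; lra.
   by move=> /H3; rewrite ltr_norml => /andP[_]; lra.
  - by rewrite fE subrr scaler0 bump0.
 by rewrite i2 ltxx.
have := key h ch H; have := key (fun x => - h x).
have cN : continuous (fun x => - h x) by move=> x; apply:continuousN; exact:ch.
have HN (f : V -> R) : rsch f -> rint (fun x => - h x * f x) /\ \int[mu]_x (- h x * f x) = 0.
 move=> /H[i1 i2]; have E : (fun x => - h x * f x) = fun x => -1 * (h x * f x) by apply/funext => x; ring.
 by rewrite E; split; [exact:rintZ|rewrite RintZ// i2 mulr0].
move=> /(_ cN HN); rewrite oppr_gt0 => /negP h1 /negP h2.
by apply/eqP; rewrite eq_le !leNgt h2.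
Qed.

Ltac done ::= basic_done.
Lemma represents_unique T g1 g2 : represents g1 T -> represents g2 T -> g1 = g2.
move=> [r1 i1 H1] [r2 i2 H2].
have part (u : C -> R) : (forall z w, u (z - w) = u z - u w) -> (forall z (a : R), u (z * (a +i* 0)%C) = u z * a) ->
  (forall z, `|u z| <= normc z) -> (forall g, u (cintegral g) = \int[mu]_x u (g x)) ->
  continuous (u \o g1) -> continuous (u \o g2) -> forall x, u (g1 x) = u (g2 x).
 move=> uB uM un ui c1 c2.
 have ir g (f : V -> R) : continuous (u \o g) -> rsch f ->
   mu.-integrable setT (fun x => (normc (g x * to_schwartz (toC f) x))%:E) -> rint (fun x => u (g x) * f x).
  move=> cg Hf ig; apply:rint_dom (ig) => [|x].
   apply:measurable_funM; last exact:rsch_mbl.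
   exact:cont_mbl_rV cg.
  by rewrite to_schE; [rewrite -uM; exact:un|exact:csch_toC].
 have H x : u (g1 x) - u (g2 x) = 0.
  apply:(@cont_eq0 (fun x => u (g1 x) - u (g2 x))) => [y|f Hf].
   by apply:(@continuousB _ _ _ (u \o g1) (u \o g2)); [exact:c1|exact:c2].
  have [j1 e1] := H1 (to_schwartz (toC f)); have [j2 e2] := H2 (to_schwartz (toC f)).
  have k1 := ir _ _ c1 Hf j1; have k2 := ir _ _ c2 Hf j2.
  have E : (fun x => (u (g1 x) - u (g2 x)) * f x) = fun x => u (g1 x) * f x - u (g2 x) * f x.
   by apply/funext => y; rewrite mulrBl.
  rewrite E; split; first exact:rintB.
  rewrite RintB//; apply/eqP; rewrite subr_eq0; apply/eqP.
  have F g : u (cintegral (fun x => g x * to_schwartz (toC f) x)) = \int[mu]_x (u (g x) * f x).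
   by rewrite ui; apply:eq_Rintegral => y _; rewrite to_schE ?uM//; exact:csch_toC.
  by rewrite -!F -e1 -e2.
 by move=> x; apply/eqP; rewrite -subr_eq0 H.
apply/funext => x; apply:ceqP; apply:part => //.
- by move=> [a b] [a' b'].
- by move=> z a; rewrite cReM /= mulr0 subr0.
- exact:Re_le_normc.
- by move=> [a b] [a' b'].
- by move=> z a; rewrite cImM /= mulr0 add0r.
- exact:Im_le_normc.
Qed.
Ltac done ::= extended_done.

Lemma ev_shift_cont T K : tempered T -> csch K ->
 exists k, exists2 A : R, 0 <= A & slow k A (fun y => Re (ev T (cshift y K))) /\ slow k A (fun y => Im (ev T (cshift y K))).
move=> tT [K1 K2]; have [lT _] := tT.
have sl b K' : rsch K' -> exists k, exists2 A : R, 0 <= A & slow k A (fun y => tpart b T (tshift y K')).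
 by move=> HK; exact:slow_shift (tpart_temp b tT) HK.
have slmax k k' (A A' : R) (v : V -> R) : (k <= k')%N -> A <= A' -> 0 <= A -> slow k A v -> slow k' A' v.
 move=> kk AA A0 [mv bv lv]; split=> // [y|y z yz].
  apply:le_trans (bv y) _; apply:ler_pM => //.
  by rewrite ler_weXn2l.
 apply:le_trans (lv y z yz) _; rewrite -!mulrA; apply:ler_pM => //.
 by apply:ler_wpM2l => //; rewrite ler_weXn2l.
have slD k (A A' : R) (v v' : V -> R) : slow k A v -> slow k A' v' -> slow k (A + A') (fun y => v y + v' y).
 move=> [mv bv lv] [mv' bv' lv']; split=> [|y|y z yz].
 - by [].
 - by rewrite mulrDl; apply:le_trans (ler_normD _ _) _; exact:lerD.
 - rewrite [X in `|X|](_ : _ = (v y - v z) + (v' y - v' z)); last by ring.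
  by rewrite !mulrDl; apply:le_trans (ler_normD _ _) _; apply:lerD; [exact:lv|exact:lv'].
have slN k (A : R) (v : V -> R) : slow k A v -> slow k A (fun y => - v y).
 move=> [mv bv lv]; split=> [|y|y z yz]; first exact:measurableT_comp.
  by rewrite normrN.
 by rewrite -opprD normrN; exact:lv.
have [k1 [A1 A10 S1]] := sl false _ K1; have [k2 [A2 A20 S2]] := sl true _ K2.
have [k3 [A3 A30 S3]] := sl true _ K1; have [k4 [A4 A40 S4]] := sl false _ K2.
pose k := maxn (maxn k1 k2) (maxn k3 k4); pose A := A1 + A2 + A3 + A4.
have ss1 : slow k A (fun y => tpart false T (tshift y (Re \o K))).
 by apply:slmax S1 => //; [rewrite !leq_max leqnn|rewrite /A -!addrA lerDl].
have ss2 : slow k A (fun y => tpart true T (tshift y (Im \o K))).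
 apply:slmax S2 => //; first by rewrite !leq_max leqnn ?orbT.
 by rewrite /A; move:A10 A30 A40; lra.
have ss3 : slow k A (fun y => tpart true T (tshift y (Re \o K))).
 apply:slmax S3 => //; first by rewrite !leq_max leqnn ?orbT.
 by rewrite /A; move:A10 A20 A40; lra.
have ss4 : slow k A (fun y => tpart false T (tshift y (Im \o K))).
 apply:slmax S4 => //; first by rewrite !leq_max leqnn ?orbT.
 by rewrite /A; move:A10 A20 A30; lra.
exists k, (A + A); first by rewrite !addr_ge0.
have E y : ev T (cshift y K) = ((tpart false T (tshift y (Re \o K)) - tpart true T (tshift y (Im \o K))) +i*
      (tpart true T (tshift y (Re \o K)) + tpart false T (tshift y (Im \o K))))%C.
 by rewrite ev_parts//; apply:csch_shift.
split; under eq_fun do rewrite E; by [].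
Qed.

(** The function [y -> T (K(. - y))] represents the multiplier by [fourier_conv] and [cexchange];
    uniqueness makes it the one selected by [xget]. *)
Lemma dist_funE (th : S) T : tempered T ->
 dist_fun (fourier_multiplier th T) = fun y => ev T (cshift y (kern th)).
move=> tT; suff rep : represents (fun y => ev T (cshift y (kern th))) (fourier_multiplier th T).
 by apply:xget_unique => // g Hg; exact:represents_unique Hg rep.
have Ht := sch_csch th.
have HK := csch_kern Ht.
have [k [A A0 [S1 S2]]] := ev_shift_cont tT HK.
split; [exact:slow_cont S1|exact:slow_cont S2|move=> phi].
have Hp := sch_csch phi.
have [i1 i2] := cexchange tT Hp HK.
split.
 have := crint_normc i1; congr (integrable _ _ _); apply/funext => x /=.
 by rewrite mulrC.
rewrite (cint_eq (g := fun y => phi y * ev T (cshift y (kern th)))) -?i2; last by move=> x; rewrite mulrC.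
rewrite /ev; congr (T (to_schwartz _)).
rewrite -fourier_conv//.
rewrite to_schE; first by rewrite to_schE.
by [].
Qed.

End representation.

End fourier_layer.
Hint Resolve c0_gt0 : pos.
Hint Resolve crint_sch cschZ cschM csch_fourier csch_inverse_fourier csch_kern : fn.

(** * Almost orthogonality of dilated kernels *)

Section almost_orthogonality.
Context (R : realType) (d : nat).
Local Notation V := 'rV[R]_d.
Local Notation W := (d.*2).
Implicit Types (f g chi K b k : V -> R) (x y h : V) (s : seq 'I_d) (t : (V -> R) -> R).

Definition dil (e : R) f : V -> R := fun x => e ^+ d * f (e *: x).
Definition zero_mom k := forall s, \int[mu]_y rmono s k y = 0.

Lemma rsch_dilation (e : R) f : e != 0 -> rsch f -> rsch (fun x => f (e *: x)).
move=> e0 Hf; rewrite (_ : (fun x => _) = f \o aff e 0)//.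
Qed.

Lemma rsch_dil (e : R) f : e != 0 -> rsch f -> rsch (dil e f).
by move=> e0 Hf; apply:rschZ; exact:rsch_dilation. Qed.
Hint Resolve rsch_dil : fn.

Lemma dil1 f : dil 1 f = f.
by apply/funext => x; rewrite /dil expr1n mul1r scale1r. Qed.

Lemma dil_dil (a e : R) f : dil a (dil e f) = dil (a * e) f.
by apply/funext => x; rewrite /dil mulrA -exprMn scalerA [e * a]mulrC. Qed.

Lemma Rint_dil (e : R) (F : V -> V -> R) f : 0 < e -> rint (fun y => F y (e^-1 *: y)) ->
 \int[mu]_y (e ^+ d * F (e *: y) y) = \int[mu]_y F y (e^-1 *: y).
move=> e0 iF; have en : e != 0 by rewrite gt_eqF.
have := Rint_aff 0 en iF => H.
transitivity (\int[mu]_y (e ^+ d * (fun y => F y (e^-1 *: y)) (aff e 0 y))).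
 by apply:eq_Rintegral => y _; rewrite /aff addr0 scalerA mulVf// scale1r.
rewrite RintZ; last by have := rint_aff 0 en iF.
by rewrite H mulrA -exprMn gtr0_norm// mulfV// expr1n mul1r.
Qed.

Lemma rconv_dilE (e : R) b k x : 0 < e -> rsch b -> rsch k ->
 rint (fun y => b (x - e^-1 *: y) * k y) /\ rconv b (dil e k) x = \int[mu]_y (b (x - e^-1 *: y) * k y).
move=> e0 Hb Hk; have en : e != 0 by rewrite gt_eqF.
have H : rint (fun y => b (x - e^-1 *: y) * k y).
 have := rint_rconv x Hb (rsch_dil en Hk) => /(rint_aff 0 (invr_neq0 en)) /(rintZ (e^-1 ^+ d)).
 congr rint; apply/funext => y; rewrite /= /aff addr0 /dil scalerA mulfV// scale1r mulrCA mulrA mulrA.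
 by rewrite -[_ * e^-1 ^+ d * _]mulrA -exprMn mulVf// expr1n mulr1.
split=> //; rewrite -(Rint_dil (F := fun y z => b (x - z) * k y) b e0 H).
by apply:eq_Rintegral => y _; rewrite mulrCA.
Qed.

(** A derivative in the direction [c y] is a polynomial in [y] whose coefficients depend on [x], so
    only moments of [k] are integrated. The monomial [rmono s] makes the induction go through. *)
Lemma iter_dirder_mom (c : R) m b k x s : rsmth b -> rsch k -> zero_mom k ->
 rint (fun y => iter m (dirder (c *: y)) b x * rmono s k y) /\
 \int[mu]_y (iter m (dirder (c *: y)) b x * rmono s k y) = 0.
move=> + Hk zk; elim:m b s => [|m IH] b s sb /=.
 have H := rsch_rint (rsch_mono s Hk).
 by split; [exact:rintZ|rewrite RintZ// zk mulr0].
have E y : iter m.+1 (dirder (c *: y)) b x * rmono s k y =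
  \sum_i c * (iter m (dirder (c *: y)) (dpart i b) x * rmono (i :: s) k y).
 rewrite iter_dirderSr// mulr_suml; apply:eq_bigr => i _.
 by rewrite rmonoS mxE; ring.
have H i := IH _ (i :: s) (rsmth_dpart i sb).
under eq_fun do rewrite E.
have ri i : rint (fun y => c * (iter m (dirder (c *: y)) (dpart i b) x * rmono (i :: s) k y)).
 by apply:rintZ; case:(H i).
split; first exact:rint_sum.
rewrite Rint_sum// big1// => i _; rewrite RintZ; first by rewrite (H i).2 mulr0.
by case:(H i).
Qed.

(* Cancellation against the Taylor polynomial of [b], whose coefficients are moments of [k]. *)
Lemma rconv_dil_bnd (e B K : R) L M b k x : 1 <= e -> rsch b -> rsch k ->
 (L <= M)%N -> (L = 0%N \/ zero_mom k) -> rbnd M b B ->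
 (forall y, `|k y| <= K * wt (M + M + W) y) ->
 `|rconv b (dil e k) x| <= (e^-1 ^+ L * (d%:R ^+ L * B * K * wt_mass R d W)) * wt M x.
move=> e1 Hb Hk LM H0 HB HK; have e0 : 0 < e by apply:lt_le_trans e1.
have [sb bb] := Hb; have B0 := rbnd_ge0 HB.
have K0 : 0 <= K.
 by have := le_trans (normr_ge0 _) (HK 0); rewrite pmulr_lge0// wt_gt0.
have [i1 ->] := rconv_dilE x e0 Hb Hk.
have ei1 : e^-1 <= 1 by rewrite invf_le1.
pose P y := \sum_(m < L) (m`!%:R)^-1 * iter m (dirder (- e^-1 *: y)) b x.
have [iP IP] : rint (fun y => P y * k y) /\ \int[mu]_y (P y * k y) = 0.
 case:H0 => [L0|zk].
  have E y : P y * k y = 0 by rewrite /P L0 big_ord0 mul0r.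
  by rewrite (_ : (fun y => _) = cst 0); [split; [exact:rint0|exact:Rint_cst0]|exact/funext].
 have E y : P y * k y = \sum_(m < L) (m`!%:R)^-1 * (iter m (dirder (- e^-1 *: y)) b x * rmono [::] k y).
  by rewrite mulr_suml; apply:eq_bigr => m _; rewrite rmono0 mulrA.
 rewrite (funext E).
 have H (m : 'I_L) := iter_dirder_mom (- e^-1) m x [::] sb Hk zk.
 have ri (m : 'I_L) : rint (fun y => (m`!%:R)^-1 * (iter m (dirder (- e^-1 *: y)) b x * rmono [::] k y)).
  by apply:rintZ; case:(H m).
 split; first exact:rint_sum.
 by rewrite Rint_sum// big1// => m _; rewrite RintZ; [rewrite (H m).2 mulr0|case:(H m)].
rewrite -[X in `|X|]subr0 -IP -RintB//.
apply:le_trans ((Rint_dom (A := e^-1 ^+ L * (d%:R ^+ L * B * K) * wt M x) (leqnn W) _ _).2) _ => [|y|].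
- by [].
- rewrite -mulrBl normrM.
 have Hh : `|- e^-1 *: y| = e^-1 * `|y| by rewrite normrZ normrN ger0_norm.
 have T := @taylor R d b x (- e^-1 *: y) ((d%:R * (e^-1 * `|y|)) ^+ L * (B * ((1 + `|y|) ^+ M * wt M x))) L sb.
 have {}T : `|b (x - e^-1 *: y) - P y| <= (d%:R * (e^-1 * `|y|)) ^+ L * (B * ((1 + `|y|) ^+ M * wt M x)).
  rewrite -scaleNr; apply:T => r /andP[r0 r1]; rewrite -Hh; apply:iter_dirder_bnd => // s ss.
  apply:le_trans (rbnd_wt (s := s) _ HB _) _; first by rewrite ss.
  apply:ler_wpM2l => //; apply:le_trans (wt_shift M _ x) _; apply:ler_wpM2r; first exact:wt_ge0.
  apply:lerXn2r; rewrite ?nnegrE// lerD2l [x + _]addrC addrK normrZ (ger0_norm r0) Hh.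
  by rewrite mulrA ler_piMl// mulr_ile1.
 apply:le_trans (ler_pM _ _ T (HK y)) _ => //.
 have yL : `|y| ^+ L <= (1 + `|y|) ^+ M.
  apply:le_trans (_ : (1 + `|y|) ^+ L <= _); first by rewrite lerXn2r ?nnegrE// lerDr.
  by rewrite ler_weXn2l.
 rewrite !exprMn !wtD.
 rewrite [leLHS](_ : _ = (e^-1 ^+ L * (d%:R ^+ L * B * K) * wt M x * wt W y) * (`|y| ^+ L * wt M y) * (wt M y * (1 + `|y|) ^+ M)); last by ring.
 rewrite wt_exp mulr1 -[leRHS]mulr1; apply:ler_wpM2l.
  by rewrite !mulr_ge0 ?wt_ge0.
 by rewrite -(wt_exp M y) mulrC; apply:ler_wpM2l => //; exact:wt_ge0.
- by apply:eqW; ring.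
Qed.

Lemma rbnd_rconv_dil M L k (K : R) : (L <= M)%N -> rsch k -> (L = 0%N \/ zero_mom k) ->
 (forall y, `|k y| <= K * wt (M + M + W) y) -> forall (e B : R) b, 1 <= e -> rsch b -> rbnd (M + M) b B ->
 rbnd M (rconv b (dil e k)) (e^-1 ^+ L * (d%:R ^+ L * B * K * wt_mass R d W)).
move=> LM Hk H0 HK e B b e1 Hb HB.
have en : e != 0 by rewrite gt_eqF.
have [_ dc] := rconv_sch Hb (rsch_dil en Hk).
apply:wt_rbnd => s x sM; rewrite dc; apply:rconv_dil_bnd => //.
by apply:rbnd_diter; apply:rbnd_le HB => //; rewrite leq_add2l.
Qed.

Lemma rconv_dil_dil (a e : R) f k : 0 < a -> 0 < e -> rsch f -> rsch k ->
 rconv (dil a f) (dil e k) = dil a (rconv f (dil (e / a) k)).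
move=> a0 e0 Hf Hk; apply/funext => x; have an : a != 0 by rewrite gt_eqF. have ean : e / a != 0 by rewrite mulf_neq0.
have Hk' := rsch_dil ean Hk.
have H := rint_rconv (a *: x) Hf Hk'.
have := Rint_aff 0 an H; rewrite gtr0_norm// => E.
transitivity (\int[mu]_y (a ^+ d * a ^+ d * (f (a *: x - aff a 0 y) * dil (e / a) k (aff a 0 y)))).
 apply:eq_Rintegral => y _; rewrite /aff addr0 /dil scalerBr scalerA divfK// expr_div_n.
 by field.
rewrite RintZ; last exact:(rint_aff 0 an H).
by rewrite E -mulrA (mulrA (a ^+ d) (a^-1 ^+ d)) -exprMn mulfV// expr1n mul1r.
Qed.

Definition scl l0 (K : nat -> V -> R) := [/\ forall l, rsch (K l),
 forall M, exists B : R, forall l, rbnd M (dil (2 ^+ l)^-1 (K l)) B &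
 forall l, (l0 <= l)%N -> zero_mom (K l)].

Lemma expr2_gt0 l : 0 < (2 : R) ^+ l. by []. Qed.
Hint Resolve expr2_gt0 : pos.
Lemma expr2_ge1 l : 1 <= (2 : R) ^+ l. by rewrite exprn_ege1// ler1n. Qed.
Hint Resolve expr2_ge1 : pos.
Lemma expr2_neq0 l : (2 : R) ^+ l != 0. by []. Qed.

Lemma mom_dil (e : R) f s : 0 < e -> rsch f ->
 \int[mu]_y rmono s (dil e f) y = e^-1 ^+ size s * \int[mu]_y rmono s f y.
move=> e0 Hf; have en : e != 0 by rewrite gt_eqF.
have Hm := rsch_rint (rsch_mono s Hf).
have := Rint_aff 0 en Hm; rewrite gtr0_norm// => E.
have {}E : \int[mu]_y rmono s f y = e ^+ d * \int[mu]_y rmono s f (aff e 0 y).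
 by rewrite E mulrA -exprMn mulfV// expr1n mul1r.
rewrite E -RintZ; last exact:rint_aff.
rewrite -RintZ; last by apply:rintZ; exact:rint_aff.
apply:eq_Rintegral => y _; rewrite /rmono /dil /aff addr0.
suff -> : \prod_(i <- s) y ord0 i = e^-1 ^+ size s * \prod_(i <- s) (e *: y) ord0 i by ring.
elim:s {Hm E} => [|i s IH]; first by rewrite !big_nil mulr1.
by rewrite !big_cons IH mxE exprS; field.
Qed.

Lemma zero_mom_dil (e : R) f : 0 < e -> rsch f -> zero_mom f -> zero_mom (dil e f).
by move=> e0 Hf z s; rewrite mom_dil// z mulr0. Qed.
Hint Resolve zero_mom_dil : fn.

Lemma dilKV (e : R) f : e != 0 -> dil e (dil e^-1 f) = f.
by move=> e0; rewrite dil_dil mulfV// dil1. Qed.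

Lemma scl_unit l0 (K : nat -> V -> R) l : scl l0 K ->
 [/\ rsch (dil (2 ^+ l)^-1 (K l)), dil (2 ^+ l) (dil (2 ^+ l)^-1 (K l)) = K l &
  (l0 <= l)%N -> zero_mom (dil (2 ^+ l)^-1 (K l))].
move=> [H _ z]; split => //.
 by rewrite dilKV.
Qed.

Lemma scl_rconv l0 (K : nat -> V -> R) M L : scl l0 K -> (L <= M)%N -> exists2 C : R, 0 <= C &
 forall l b B, rsch b -> rbnd (M + M) b B ->
 rbnd M (rconv b (K l)) (2^-1 ^+ (l * L) * (C * B)).
move=> sK LM; have [_ bk _] := sK; have [D HD] := bk (M + M + W)%N; have D0 := rbnd_ge0 (HD 0%N).
(* Below level [l0] there is no cancellation; the factor [2 ^+ (l0 * L)] makes up for the missing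
   decay. *)
pose C := 2 ^+ (l0 * L) * ((1 + d%:R) ^+ L * D * wt_mass R d W).
have C0 : 0 <= C by rewrite !mulr_ge0 ?wt_mass_ge0.
exists C => // l b B Hb HB.
have B0 := rbnd_ge0 HB; have [Hk EK zk] := scl_unit l sK.
rewrite -{1}EK.
have ky y : `|dil (2 ^+ l)^-1 (K l) y| <= D * wt (M + M + W) y by apply:rbnd_wt0; by [].
have dl : 1 <= (1 + d%:R : R) ^+ L by rewrite exprn_ege1// lerDl.
have m0 := wt_mass_ge0 R d W.
case:(leqP l0 l) => ll.
 apply:rbnd_le (rbnd_rconv_dil LM Hk (or_intror (zk ll)) ky (expr2_ge1 l) Hb HB) => //.
 rewrite -exprVn -exprM; apply:ler_wpM2l => //.
 rewrite /C [leRHS](_ : _ = 2 ^+ (l0 * L) * ((1 + d%:R) ^+ L * (B * D * wt_mass R d W))); last by ring.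
 apply:le_trans (ler_peMl _ (expr2_ge1 _)) => //.
 rewrite -!mulrA; apply:ler_wpM2r => //.
 by apply:lerXn2r; rewrite ?nnegrE// lerDr.
apply:rbnd_le (rbnd_rconv_dil (leq0n M) Hk (or_introl erefl) ky (expr2_ge1 l) Hb HB) => //.
rewrite !mul1r /C.
rewrite [leRHS](_ : _ = (2^-1 ^+ (l * L) * 2 ^+ (l0 * L)) * ((1 + d%:R) ^+ L * (B * D * wt_mass R d W))); last by ring.
apply:le_trans (ler_peMl _ dl) _ => //.
apply:ler_peMl => //.
rewrite exprVn mulrC ler_pdivlMr// mul1r ler_weXn2l ?ler1n//.
by rewrite leq_mul2r ltnW ?orbT.
Qed.

Lemma geom_tail (u : nat -> R) (D l : R) : (forall m, `|u m| <= D * 2^-1 ^+ m) ->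
 (fun J => \sum_(m < J) u m) @ \oo --> l -> forall J, `|l - \sum_(m < J) u m| <= 2 * D * 2^-1 ^+ J.
move=> Hu Hl J.
have D0 : 0 <= D by have := le_trans (normr_ge0 _) (Hu 0%N); rewrite mulr1.
have H n : `|\sum_(m < J + n) u m - \sum_(m < J) u m| <= 2 * D * (2^-1 ^+ J - 2^-1 ^+ (J + n)).
 elim:n => [|n IH]; first by rewrite addn0 !subrr normr0.
 rewrite addnS big_ord_recr /= addrAC; apply:le_trans (ler_normD _ _) _.
 apply:le_trans (lerD IH (Hu _)) _; rewrite exprS; move:(_ ^+ J) (_ ^+ (J + n)) => a b.
 by apply:eqW; field.
apply/ler_addgt0Pr => e e0; move/cvgrPdist_le : Hl => /(_ _ e0)[N _ /(_ (J + N)%N (leq_addl _ _))] HN.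
rewrite (_ : l - _ = (l - \sum_(m < J + N) u m) + (\sum_(m < J + N) u m - \sum_(m < J) u m)); last by ring.
apply:le_trans (ler_normD _ _) _; rewrite addrC; apply:lerD => //.
apply:le_trans (H N) _; apply:ler_wpM2l => //.
by rewrite gerBl.
Qed.

(** One order of vanishing moments gives the [l]-th term of the pointwise reproducing formula a
    factor [2 ^- l] in the seminorm controlling [t]; so the formula converges geometrically there
    and [t] may be applied term by term. *)
Lemma scl_temp t l0 (K : nat -> V -> R) (c : R) chi : rtemp t -> scl l0 K -> rsch chi ->
 (forall b, rsch b -> forall x, (fun J => \sum_(l < J) rconv b (K l) x) @ \oo --> c * b x) ->
 exists D : R, forall J, `|c * t chi - \sum_(l < J) t (rconv chi (K l))| <= D * 2^-1 ^+ J.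
move=> [lt [k0 [A A0 HA]]] Hk Hc Hcv.
have [Hkl _ _] := Hk.
have [C C0 HC] := scl_rconv Hk (ltn0Sn k0).
have [B HB] := Hc.2 (k0.+1 + k0.+1)%N; have B0 := rbnd_ge0 HB.
have Hb l := HC l chi B Hc HB.
exists (A * (2 * (C * B))) => J.
have Hr l := (rconv_sch Hc (Hkl l)).1.
have HS : rsch (fun x => \sum_(l < J) rconv chi (K l) x) by exact:rsch_sum.
have HcS := rschZ c Hc.
have HR : rbnd k0 (fun x => c * chi x - \sum_(l < J) rconv chi (K l) x) (2 * (C * B) * 2^-1 ^+ J).
 apply:wt_rbnd => s x sk.
 rewrite diter_sub//.
 rewrite diterZ//.
 rewrite diter_sum//.
 under eq_bigr do rewrite (rconv_sch Hc (Hkl _)).2.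
 have Hu l : `|rconv (diter s chi) (K l) x| <= C * B * wt k0 x * 2^-1 ^+ l.
  rewrite -(rconv_sch Hc (Hkl l)).2.
  apply:le_trans (rbnd_wt x (Hb l) (leqW sk)) _; rewrite muln1.
  rewrite [leRHS](_ : _ = 2^-1 ^+ l * (C * B) * wt k0 x); last by ring.
  by apply:ler_wpM2l => //; exact:wt_le.
 apply:le_trans (geom_tail Hu (Hcv _ (rsch_diter s Hc) x) J) _.
 by apply:eqW; ring.
have := HA _ _ (rschB HcS HS) HR.
rewrite rlinB// rlinZ// rlin_sum// => H; apply:le_trans H _.
by apply:eqW; ring.
Qed.

(** The polynomial weight at scale [2 ^- l], normalised in [L^1]. *)
Definition eta M l x : R := (2 ^+ l) ^+ d * wt M (2 ^+ l *: x).

Lemma wt_scale M j l x : (j <= l)%N -> wt M (2 ^+ j *: x) <= (2 ^+ (l - j)) ^+ M * wt M ((2 : R) ^+ l *: x).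
move=> jl; rewrite /wt -ler_pdivrMr//.
rewrite invrK mulrC ler_pdivrMr// -exprMn.
apply:lerXn2r; rewrite ?nnegrE//.
rewrite mulrDr mulr1 !normrZ !ger0_norm// mulrA -exprD subnK//.
by rewrite lerD2r.
Qed.

(** The distance [|j - l|], written with truncated subtractions. *)
Definition gap (j l : nat) : nat := ((j - l) + (l - j))%N.

(** The coarser kernel is smooth at the scale of the finer one, which has no moments. Passing from
    the weight at a coarse scale to [eta M l] costs [2 ^ (gap * M)], whence [L' = L + M]. *)
Lemma almost_orth l1 l2 (K1 K2 : nat -> V -> R) L M : scl l1 K1 -> scl l2 K2 ->
 exists2 C : R, 0 <= C & forall j l x, `|rconv (K1 j) (K2 l) x| <= C * 2^-1 ^+ (gap j l * L) * eta M l x.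
pose L' := (L + M)%N => s1 s2.
have key l0 (K K' : nat -> V -> R) : (forall N, exists B : R, forall j, rbnd N (dil (2 ^+ j)^-1 (K j)) B) ->
  (forall j, rsch (K j)) -> scl l0 K' ->
  exists2 C : R, 0 <= C & forall j l x, (j <= l)%N ->
   `|rconv (K j) (K' l) x| <= C * 2^-1 ^+ ((l - j) * L') * ((2 ^+ j) ^+ d * wt L' (2 ^+ j *: x)).
 move=> bK sK sK'; have [_ bK' _] := sK'.
 have [B HB] := bK L'; have B0 := rbnd_ge0 (HB 0%N).
 have [D HD] := bK' (L' + L' + W)%N; have D0 := rbnd_ge0 (HD 0%N).
 pose E := (1 + d%:R) ^+ L' * B * D * wt_mass R d W.
 have m0 := wt_mass_ge0 R d W.
 have dl : 1 <= (1 + d%:R : R) ^+ L' by rewrite exprn_ege1// lerDl.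
 have E0 : 0 <= E by rewrite !mulr_ge0.
 exists (2 ^+ (l0 * L') * E) => [|j l x jl]//.
 have [Hk' e2 zk'] := scl_unit l sK'.
 have Hk : rsch (dil (2 ^+ j)^-1 (K j)) by apply:rsch_dil => //; rewrite expr2_neq0.
 rewrite -e2 -{1}(dilKV (K j) (expr2_neq0 j)) rconv_dil_dil//.
 rewrite -expfB_cond 1?{1}/dil; last by rewrite pnatr_eq0.
 rewrite normrM ger0_norm// mulrCA; apply:ler_wpM2l => //.
 have ky y : `|dil (2 ^+ l)^-1 (K' l) y| <= D * wt (L' + L' + W) y by apply:rbnd_wt0; by [].
 have Bj := HB j; case:(leqP l0 l) => ll.
  apply:le_trans (rconv_dil_bnd _ (expr2_ge1 (l - j)) Hk Hk' (leqnn L') (or_intror (zk' ll)) Bj ky) _.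
  apply:ler_wpM2r; first exact:wt_ge0.
  rewrite -exprVn -exprM mulrC; apply:ler_wpM2r => //.
  apply:le_trans (ler_peMl E0 (expr2_ge1 (l0 * L'))); rewrite /E -!mulrA; apply:ler_wpM2r => //.
  by apply:lerXn2r; rewrite ?nnegrE// lerDr.
 apply:le_trans (rconv_dil_bnd _ (expr2_ge1 (l - j)) Hk Hk' (leq0n L') (or_introl erefl) Bj ky) _.
 apply:ler_wpM2r; first exact:wt_ge0.
 rewrite !mul1r mulrAC.
 apply:le_trans (ler_peMl _ dl) _ => //.
 rewrite -!mulrA [leRHS](_ : _ = 2 ^+ (l0 * L') * 2^-1 ^+ ((l - j) * L') * E); last by rewrite /E; ring.
 rewrite [leLHS](_ : _ = E); last by rewrite /E; ring.
 apply:ler_peMl => //; rewrite exprVn ler_pdivlMr// mul1r ler_weXn2l ?ler1n//.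
 by rewrite leq_mul2r; apply/orP; right; apply:leq_trans (leq_subr _ _) (ltnW ll).
have [H1 b1 _] := s1; have [H2 b2 _] := s2.
have [C1 C10 HC1] := key _ _ _ b1 H1 s2; have [C2 C20 HC2] := key _ _ _ b2 H2 s1.
exists (C1 + C2) => [|j l x]//.
have i0 (r : nat) : 0 <= (2^-1 : R) ^+ r by rewrite exprn_ge0.
have e0 : 0 <= eta M l x by rewrite mulr_ge0 ?wt_ge0.
case:(leqP j l) => jl.
 apply:le_trans (HC1 j l x jl) _; rewrite /gap (eqP (jl : j - l == 0)%N) add0n.
 apply:(@le_trans _ _ (C1 * 2^-1 ^+ ((l - j) * L) * eta M l x)); last first.
  by apply:ler_wpM2r => //; apply:ler_wpM2r => //; rewrite lerDl.
 rewrite -!mulrA; apply:ler_wpM2l => //.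
 rewrite /L' mulnDr exprD -mulrA; apply:ler_wpM2l => //; rewrite mulrCA; apply:ler_pM => //.
 - by rewrite mulr_ge0 ?wt_ge0.
 - by rewrite lerXn2r ?nnegrE// ler_weXn2l// ler1n.
 - apply:le_trans (ler_wpM2l (i0 _) (wt_le _ (leq_addl L M))) _.
  apply:le_trans (ler_wpM2l (i0 _) (wt_scale M x jl)) _.
  by rewrite mulrA exprVn -exprM mulVf ?mul1r.
rewrite rconvC//; apply:le_trans (HC2 l j x (ltnW jl)) _; rewrite /gap (eqP (ltnW jl : l - j == 0)%N) addn0.
apply:(@le_trans _ _ (C2 * 2^-1 ^+ ((j - l) * L) * eta M l x)); last first.
 by apply:ler_wpM2r => //; apply:ler_wpM2r => //; rewrite lerDr.
apply:ler_pM => //.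
- by rewrite mulr_ge0 ?wt_ge0.
- apply:ler_wpM2l => //; rewrite !exprVn lef_pV2 ?posrE// ler_weXn2l ?ler1n// leq_mul2l leq_addr orbT//.
- by apply:ler_wpM2l => //; apply:wt_le; exact:leq_addl.
Qed.

End almost_orthogonality.
Hint Resolve rsch_dil zero_mom_dil : fn.
Hint Resolve expr2_gt0 expr2_ge1 : pos.

(** * Kernels given on the frequency side *)

Section frequency_families.
Context (R : realType) (d : nat).
Local Notation V := 'rV[R]_d.
Local Notation W := (d.*2).
Implicit Types (f g : V -> R) (x y : V) (s : seq 'I_d).

Ltac done ::= basic_done.
Lemma diter_open (U : set V) f s x : (forall y, U y -> \forall z \near y, U z) -> (forall y, U y -> f y = 0) -> U x -> diter s f x = 0.
move=> oU fU; elim:s x => [|i s IH] x Ux; first exact:fU.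
rewrite /= dpartE (near_eq_derive (g := cst 0)); first by rewrite derive_cst.
by apply:filterS (oU _ Ux) => y Uy; exact:IH.
Qed.
Ltac done ::= extended_done.

Lemma near_norm (A : set R) (y : V) : open A -> A `|y| -> \forall z \near y, A `|z|.
by move=> oA Ay; apply:(@norm_continuous _ _ y). Qed.

Lemma diter_out (r : R) f s x : (forall y, r < `|y| -> f y = 0) -> r < `|x| -> diter s f x = 0.
move=> H; apply:(@diter_open [set y | r < `|y|]) => //.
by move=> y; exact:(@near_norm [set u : R | r < u] y (@open_gt _ r)).
Qed.

Lemma uniform_seq_bnd (P : seq 'I_d -> R -> Prop) : (forall s a b, a <= b -> P s a -> P s b) ->
 (forall s, exists M, P s M) -> forall k, exists M, forall s, (size s <= k)%N -> P s M.
move=> mono + k; elim:k P mono => [|k IH] P mono H.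
 by have [M HM] := H [::]; exists M => -[|].
have H' i : exists M, forall s, (size s <= k)%N -> P (i :: s) M.
 by [].
have [M HM] := choice H'; have [M0 HM0] := H [::].
exists (`|M0| + \sum_i `|M i|) => -[_|i s].
 apply:mono HM0; apply:le_trans (ler_norm _) _.
 by rewrite lerDl.
rewrite ltnS => sk; apply:mono (HM i s sk); apply:le_trans (ler_norm _) _.
rewrite (bigD1 i)//= addrCA lerDl//.
Qed.

(** The frequency counterpart of [scl]. The last clause, flatness at the origin, is what becomes the
    absence of moments. *)
Definition freqfam (r : R) l0 (h : nat -> V -> R) := [/\ forall l, rsch (h l),
 forall l x, r * 2 ^+ l < `|x| -> h l x = 0,
 forall k, exists M, forall s l x, (size s <= k)%N -> (2 ^+ l) ^+ size s * `|diter s (h l) x| <= M &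
 forall l s, (l0 <= l)%N -> diter s (h l) 0 = 0].

Lemma rfour_mom s b f : rsch f -> exists2 e : R, `|e| = 1 & exists b',
 forall xi, rmono s (rfour b f) xi = e * rfour b' (diter s f) xi.
move=> Hf; elim:s => [|i s [e e1 [b' H]]].
 by exists 1; rewrite ?normr1//; exists b => xi; rewrite rmono0 mul1r.
have [e' e'1 H'] := rfour_coord i b' (rsch_diter s Hf).
exists (e * e'); first by rewrite normrM e'1 mulr1.
by exists (~~ b') => xi; rewrite rmonoS H mulrCA H' mulrA.
Qed.

Lemma sclZ l0 (a : R) (K : nat -> V -> R) : scl l0 K -> scl l0 (fun l x => a * K l x).
move=> [H1 H2 H3]; split=> [l|M|l ll s].
- by [].
- have [B HB] := H2 M; exists (`|a| * B) => l; rewrite (_ : dil _ _ = fun x => a * dil (2 ^+ l)^-1 (K l) x).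
  apply:rbndZ => //; apply:(proj1 (rsch_dil _ (H1 l))).
 by apply/funext => x; rewrite mulrCA.
- have E y : rmono s (fun x => a * K l x) y = a * rmono s (K l) y by rewrite mulrCA.
 under eq_Rintegral do rewrite E.
 by rewrite RintZ ?H3 ?mulr0//; apply:rsch_rint.
Qed.
Hint Resolve sclZ : fn.

Lemma sclD l0 (K K' : nat -> V -> R) : scl l0 K -> scl l0 K' -> scl l0 (fun l x => K l x + K' l x).
move=> [H1 H2 H3] [H1' H2' H3']; split=> [l|M|l ll s].
- by [].
- have [B HB] := H2 M; have [B' HB'] := H2' M; exists (B + B') => l.
 rewrite (_ : dil _ _ = dil (2 ^+ l)^-1 (K l) \+ dil (2 ^+ l)^-1 (K' l)).
  by apply:rbndD => //.
 by apply/funext => x; rewrite /dil mulrDr.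
- have E y : rmono s (fun x => K l x + K' l x) y = rmono s (K l) y + rmono s (K' l) y by rewrite /rmono mulrDr.
 under eq_Rintegral do rewrite E.
 by rewrite RintD ?H3 ?H3' ?addr0//; apply:rsch_rint.
Qed.
Hint Resolve sclD : fn.

Section scaled_fourier.
Variable c : R.
Hypothesis c_inv : forall f, rsch f -> \int[mu]_xi rfour false f xi = c * f 0.

Ltac done ::= basic_done.
(** Dilation turns the scaled bounds into uniform ones. A moment of the transform is, up to sign,
    the integral of the transform of a derivative: zero for the sine, and for the cosine a multiple
    of that derivative at 0. *)
Lemma freqfam_scl r l0 h b : 0 <= r -> freqfam r l0 h -> scl l0 (fun l => rfour b (h l)).
move=> r0 [H1 H2 H3 H4]; split=> [l|M|l ll s]; first exact:rfour_sch.
- have [C C0 HC] := rfour_rbnd R d M; set k := (M + M + W)%N in HC.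
 have [B HB] := H3 k; exists (C * ((1 + r) ^+ k * `|B|)) => l.
 have e0 : 0 < (2 : R) ^+ l by exact:expr2_gt0.
 have en : (2 : R) ^+ l != 0 by rewrite gt_eqF.
 rewrite (_ : dil _ _ = rfour b (fun x => h l (2 ^+ l *: x))); last first.
  by apply/funext => xi; rewrite rfour_scale// /dil gtr0_norm.
 apply:HC; first exact:rsch_dilation.
 move=> s x sk; have E : (fun x => h l (2 ^+ l *: x)) = h l \o aff (2 ^+ l) 0.
  by apply/funext => y; rewrite /= /aff addr0.
 rewrite E diter_aff; last by case:(H1 l).
 rewrite /aff addr0 normrM normrX ger0_norm; last exact:ltW.
 have [xr|xr] := ltP r `|x|.
  rewrite (diter_out (r := r * 2 ^+ l)) ?normr0 ?mulr0; first by rewrite mulr_ge0// exprn_ge0// addr_ge0.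
   exact:H2.
  by rewrite normrZ gtr0_norm// mulrC ltr_pM2l.
 apply:ler_pM.
 - by rewrite exprn_ge0// addr_ge0.
 - by rewrite mulr_ge0// exprn_ge0// ltW.
 - by apply:lerXn2r; rewrite ?nnegrE ?addr_ge0// lerD2l.
 - by apply:le_trans (HB s l _ sk) (ler_norm _).
- have [e e1 [b' E]] := rfour_mom s b (H1 l).
 have Hd := rsch_diter s (H1 l).
 under eq_Rintegral do rewrite E.
 rewrite RintZ; last by apply:rsch_rint; exact:rfour_sch.
 case:b' {E}; first by rewrite Rint_rfour_sin ?mulr0.
 by rewrite c_inv// H4// !mulr0.
Qed.
Ltac done ::= extended_done.

End scaled_fourier.

End frequency_families.
Hint Resolve sclZ sclD : fn.

(** * The dyadic resolution of unity and its windows *)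

Section resolution_of_unity.
Context (R : realType) (d : nat) (theta : nat -> schwartz R d) (theta_Phi : Phi theta).
Local Notation V := 'rV[R]_d.
Local Notation C := R[i].
Local Notation S := (schwartz R d).
Implicit Types (x y : V) (s : seq 'I_d) (T : S -> C).

Lemma norm_le_enorm x : `|x| <= enorm x.
rewrite [leLHS]mx_normrE; apply:bigmax_le => [|[a i] _ /=]; first exact:sqrtr_ge0.
rewrite ord1 -sqrtr_sqr ler_sqrt//.
by rewrite (bigD1 i)//= lerDl sumr_ge0// => j _; exact:sqr_ge0.
Qed.

Lemma enorm_le x : enorm x <= (1 + d%:R) * `|x|.
rewrite -[leRHS]ger0_norm// -sqrtr_sqr; rewrite ler_sqrt//.
apply:(@le_trans _ _ (\sum_(i < d) `|x| ^+ 2)).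
 by apply:ler_sum => i _; rewrite -real_normK ?num_real// lerXn2r ?nnegrE// coord_le_norm.
rewrite sumr_const card_ord exprMn -[_ *+ d]mulr_natl; apply:ler_wpM2r => //.
by have : 0 <= (d%:R : R) by []; nra.
Qed.

Lemma theta_in j x : theta j x != 0 -> (0 < j)%N -> 2 ^+ j.-1 <= enorm x.
move=> tx j0; have := Phi_supp theta_Phi j0 (t := x).
by move=> H; have /andP[] : 2 ^+ j.-1 <= enorm x <= 2 ^+ j.+1 by apply:H; exact:subset_closure.
Qed.

Lemma theta_out j x : theta j x != 0 -> enorm x <= 2 ^+ j.+1.
case:j => [|j] tx; first by rewrite expr1; apply:(Phi_supp0 theta_Phi); exact:subset_closure.
have /andP[] : 2 ^+ j <= enorm x <= 2 ^+ j.+2 by apply:(Phi_supp theta_Phi (ltn0Sn j)); exact:subset_closure.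
by [].
Qed.

Lemma theta_eq0_in j x : (0 < j)%N -> enorm x < 2 ^+ j.-1 -> theta j x = 0.
by move=> j0 xj; apply/eqP/negPn/negP => /theta_in/(_ j0); rewrite leNgt xj. Qed.

Lemma theta_eq0_out j x : 2 ^+ j.+1 < enorm x -> theta j x = 0.
by move=> xj; apply/eqP/negPn/negP => /theta_out; rewrite leNgt xj. Qed.

(** The terms from [J] on vanish at [x], so the limit in [Phi_sum] is already attained. *)
Lemma theta_sum1 J x : (0 < J)%N -> enorm x < 2 ^+ J.-1 -> \sum_(j < J) theta j x = 1.
move=> J0 xJ; have H n : \sum_(j < J + n) theta j x = \sum_(j < J) theta j x.
 elim:n => [|n IH]; first by rewrite addn0.
 rewrite addnS big_ord_recr /= theta_eq0_in ?addr0//; first by rewrite ltn_addr.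
 apply:lt_le_trans xJ _; rewrite ler_weXn2l ?ler1n//.
 by lia.
apply/eqP; rewrite -subr_eq0; apply/eqP/(@ComplexField.Normc.eq0_normc).
apply/eqP; rewrite -normr_le0; apply/ler_addgt0Pr => e e0; rewrite add0r.
have /cvgrPdist_le/(_ _ e0)[N _ /(_ (J + N)%N (leq_addl _ _))] := Phi_sum theta_Phi x.
by rewrite H sub0r normrN.
Qed.

Lemma theta0_0 : theta 0%N 0 = 1.
have := @theta_sum1 1 0 isT; rewrite big_ord_recl big_ord0 addr0; apply.
rewrite /enorm big1 ?sqrtr0// => i _; by rewrite mxE expr0n.
Qed.

(** [|theta_0| ^ 2]: a nonnegative, compactly supported Schwartz function with value 1 at the
    origin. It supplies every cutoff and every test bump of the proof. *)
Definition bump x : R := Re (theta 0%N x) ^+ 2 + Im (theta 0%N x) ^+ 2.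

Lemma bump_sch : rsch bump.
have [H1 H2] := sch_csch (theta 0%N).
rewrite (_ : bump = ((Re \o theta 0%N) \* (Re \o theta 0%N)) \+ ((Im \o theta 0%N) \* (Im \o theta 0%N)))//.
Qed.
Hint Resolve bump_sch : fn.

Lemma bump_ge0 x : 0 <= bump x. by rewrite addr_ge0. Qed.
Hint Resolve bump_ge0 : pos.

Lemma bump0 : bump 0 = 1. by rewrite /bump theta0_0 expr1n expr0n addr0. Qed.

Lemma bump_supp x : bump x != 0 -> `|x| <= 2.
move=> bx; apply:le_trans (norm_le_enorm x) _; rewrite -[X in _ <= X]expr1; apply:theta_out.
by apply:contra bx => /eqP t0; rewrite /bump t0 expr0n addr0.
Qed.

Lemma inv_constant : exists2 c : R, c != 0 &
 forall f : V -> R, rsch f -> \int[mu]_xi rfour false f xi = c * f 0.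
exact:rfour_inv0 bump_sch bump0. Qed.

Lemma theta_deriv k : exists M : R, forall s j x, (size s <= k)%N ->
 (2 ^+ j) ^+ size s * normc (iter_partial s (theta j) x) <= M.
suff H s : exists M : R, forall j x, (2 ^+ j) ^+ size s * normc (iter_partial s (theta j) x) <= M.
 have [M HM] := uniform_seq_bnd (fun s a b ab (H : forall j x, _ <= a) j x => le_trans (H j x) ab) H k.
 by exists M => s j x sk; exact:HM.
pose al : multi_index d := [ffun i => count_mem i s].
have [M HM] := Phi_bound theta_Phi al; exists M => j x.
have /asboolP[sf _] := schwartzP (theta j).
rewrite (iter_part_perm sf (perm_mseq s)) -exprM.
by rewrite (perm_size (perm_mseq s)) size_mseq; exact:HM.
Qed.

Definition thpart (b : bool) j : V -> R := (if b then Im else Re) \o theta j.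

Lemma thpart_sch b j : rsch (thpart b j).
by have [H1 H2] := sch_csch (theta j); case:b. Qed.
Hint Resolve thpart_sch : fn.

Lemma thpart_deriv k : exists M : R, forall b s j x, (size s <= k)%N ->
 (2 ^+ j) ^+ size s * `|diter s (thpart b j) x| <= M.
have [M HM] := theta_deriv k; exists M => b s j x sk; apply:le_trans (HM s j x sk).
apply:ler_wpM2l => //.
by case:b; rewrite -?Re_iter_partE -?Im_iter_partE ?Re_le_normc ?Im_le_normc.
Qed.

Lemma thpart_out b j x : 2 ^+ j.+1 < `|x| -> thpart b j x = 0.
move=> xj; rewrite /thpart /= theta_eq0_out ?(lt_le_trans xj) ?norm_le_enorm//.
by case:b.
Qed.

Lemma thpart_0 b j s : (0 < j)%N -> diter s (thpart b j) 0 = 0.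
move=> j0; pose r : R := 2 ^+ j.-1 / (1 + d%:R).
apply:(@diter_open R d [set y | `|y| < r]) => /=.
- by move=> y; exact:(@near_norm R d [set u : R | u < r] y (@open_lt _ r)).
- move=> y; rewrite ltr_pdivlMr// mulrC => yr.
 rewrite /thpart /= theta_eq0_in//; first by case:b.
 exact:le_lt_trans (enorm_le y) yr.
- by rewrite normr0 divr_gt0.
Qed.

Lemma theta_freqfam b : freqfam 2 1 (thpart b).
split=> [l|l x|k|l s l0]//.
- by rewrite -exprS; exact:thpart_out.
- by have [M HM] := thpart_deriv k; exists M => s l x; exact:HM.
- exact:thpart_0.
Qed.

(* The win sum_(|m - l| <= 2) theta_m, equal to 1 on the support of theta_l. *)
Definition dly_theta m : V -> C := if (m < 2)%N then cst 0 else theta (m - 2).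
Definition win l : V -> C := fun x => \sum_(i < 5) dly_theta (l + i) x.
Definition dly_part (b : bool) m : V -> R := if (m < 2)%N then cst 0 else thpart b (m - 2).
Definition win_part (b : bool) l : V -> R := fun x => \sum_(i < 5) dly_part b (l + i) x.

Lemma dly_part_sch b m : rsch (dly_part b m).
by rewrite /dly_part; case:ifP => _ //; exact:rsch_cst0. Qed.

Lemma win_partE b l : (if b then Im else Re) \o win l = win_part b l.
apply/funext => x; rewrite /win /win_part /=.
have E i : (if b then Im else Re) (dly_theta i x) = dly_part b i x.
 by rewrite /dly_theta /dly_part; case:(i < 2)%N; case:b.
rewrite !big_ord_recl !big_ord0 -!E.
by case:b {E}; rewrite ?cImD ?cReD.
Qed.

Lemma win_sch l : csch (win l).
have H b : rsch (win_part b l) by apply:rsch_sum => i; exact:dly_part_sch.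
by split; [have := win_partE false l|have := win_partE true l] => ->.
Qed.
Hint Resolve win_sch : fn.

Lemma win_freqfam b : freqfam 8 3 (win_part b).
split=> [l|l x|k|l s l3].
- by apply:rsch_sum => i; exact:dly_part_sch.
- move=> xl; rewrite /win_part big1// => i _; rewrite /dly_part; case:ltnP => // li.
 apply:thpart_out; apply:le_lt_trans xl.
 have -> : (8 : R) * 2 ^+ l = 2 ^+ l.+3 by rewrite !exprS; ring.
 by rewrite ler_weXn2l ?ler1n; have := ltn_ord i; lia.
- have [M HM] := thpart_deriv k; have M0 : 0 <= M.
  by apply:le_trans (HM true [::] 0%N 0 (leq0n k)).
 exists (\sum_(i < 5) (2 ^+ 2) ^+ k * M) => s l x sk.
 have dp b' m : (2 ^+ m) ^+ size s * `|diter s (dly_part b' m) x| <= (2 ^+ 2) ^+ k * M.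
  rewrite /dly_part; case:ltnP => m2.
   rewrite (diter_open (U := setT)) ?normr0 ?mulr0//.
   by move=> y _; exact:filterT.
  rewrite -{1}(subnKC m2) exprD exprMn -mulrA; apply:ler_pM; rewrite//.
  - by rewrite ler_weXn2l.
  - exact:HM.
 rewrite diter_sum; last by move=> i; case:(dly_part_sch b (l + i)).
 apply:le_trans (ler_wpM2l _ (ler_norm_sum _ _ _)) _ => //.
 rewrite mulr_sumr; apply:ler_sum => i _; apply:le_trans (dp b (l + i)%N).
 by apply:ler_wpM2r => //; rewrite lerXn2r ?nnegrE// ler_weXn2l ?ler1n// leq_addr.
- rewrite diter_sum; last by move=> i; case:(dly_part_sch b (l + i)).
 rewrite big1// => i _; rewrite ifF; last by apply/negbTE; rewrite -leqNgt; lia.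
 by apply:thpart_0; lia.
Qed.

Lemma win1 l x : theta l x != 0 -> win l x = 1.
move=> tx; have xo := theta_out tx.
(* [dly_theta] delays the indices by 2, so that the window from [l - 2] to [l + 2] is a sum over
   [l + i] with [i < 5], without negative indices. *)
have H n : \sum_(i < n) dly_theta (l + i) x = \sum_(m < l + n) dly_theta m x - \sum_(m < l) dly_theta m x.
 elim:n => [|n IH]; first by rewrite big_ord0 addn0 subrr.
 by rewrite addnS !big_ord_recr IH addrAC.
have E n : \sum_(m < n.+2) dly_theta m x = \sum_(m < n) theta m x.
 elim:n => [|n IH]; first by rewrite big_ord0 !big_ord_recl big_ord0 !addr0.
 by rewrite [LHS]big_ord_recr [RHS]big_ord_recr -IH /dly_theta subn2.
rewrite /win H (_ : (l + 5 = l.+3.+2)%N); last by lia.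
rewrite E theta_sum1//; last by apply:le_lt_trans xo _; rewrite ltr_eXn2l ?ltr1n.
rewrite big1 ?subr0// => -[m ml] _ /=; rewrite /dly_theta; case:ltnP => // m2.
apply:theta_eq0_out; apply:lt_le_trans (theta_in tx _); last by lia.
by rewrite ltr_eXn2l ?ltr1n; lia.
Qed.

Lemma win_mul l x : theta l x * win l x = theta l x.
by have [->|/win1 ->] := eqVneq (theta l x) 0; rewrite ?mul0r ?mulr1.
Qed.

End resolution_of_unity.
Hint Resolve bump_sch thpart_sch win_sch : fn.
Hint Resolve bump_ge0 : pos.

(** * Littlewood-Paley blocks of a tempered functional *)

Section kernels.
Context (R : realType) (d : nat) (theta : nat -> schwartz R d) (theta_Phi : Phi theta).
Local Notation V := 'rV[R]_d.
Local Notation C := R[i].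
Local Notation W := (d.*2).
Local Notation S := (schwartz R d).
Implicit Types (x y : V) (s : seq 'I_d) (T : S -> C).

Variable c : R.
Hypothesis c_inv : forall f : V -> R, rsch f -> \int[mu]_xi rfour false f xi = c * f 0.
Local Notation ci := (cinv d c).

Definition cpart (b : bool) (f : V -> C) : V -> R := (if b then Im else Re) \o f.

Lemma kern_parts (th : V -> C) : csch th ->
 cpart false (kern th) = (fun z => (c0 R d ^+ 2) * (rfour false (cpart false th) z + rfour true (cpart true th) z)) /\
 cpart true (kern th) = (fun z => (c0 R d ^+ 2) * (rfour false (cpart true th) z + (-1) * rfour true (cpart false th) z)).
move=> Ht; split; apply/funext => z.
 by rewrite -[LHS]/(Re ((c0 R d)%:C%C * fourier th z)) fourierE// /=; ring.
by rewrite -[LHS]/(Im ((c0 R d)%:C%C * fourier th z)) fourierE// /=; ring.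
Qed.

Lemma kern_scl r l0 (h : nat -> V -> C) : 0 <= r -> (forall l, csch (h l)) ->
 (forall b, freqfam r l0 (fun l => cpart b (h l))) ->
 forall b, scl l0 (fun l => cpart b (kern (h l))).
move=> r0 Hh Hf b.
have sf b1 b2 := freqfam_scl c_inv b1 r0 (Hf b2).
case:b.
 under eq_fun do rewrite (kern_parts (Hh _)).2.
 by [].
under eq_fun do rewrite (kern_parts (Hh _)).1.
by [].
Qed.

Ltac done ::= basic_done.
Lemma theta_kern_scl b : scl 1 (fun l => cpart b (kern (theta l))).
apply:(@kern_scl 2) => // [l|b']; first exact:sch_csch.
exact:theta_freqfam.
Qed.
Ltac done ::= extended_done.
Hint Resolve theta_kern_scl : fn.

Ltac done ::= basic_done.
Lemma win_kern_scl b : scl 3 (fun l => cpart b (kern (win theta l))).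
apply:(@kern_scl 8) => // [l|b']; first exact:win_sch.
rewrite (_ : (fun l => _) = win_part theta b'); first exact:win_freqfam.
by apply/funext => l; exact:win_partE.
Qed.
Ltac done ::= extended_done.
Hint Resolve win_kern_scl : fn.

Lemma cintD (f g : V -> C) : crint f -> crint g ->
 crint (fun x => f x + g x) /\ cintegral (fun x => f x + g x) = cintegral f + cintegral g.
move=> [f1 f2] [g1 g2].
have E1 : Re \o (fun x => f x + g x) = fun x => (Re \o f) x + (Re \o g) x by apply/funext => x /=; rewrite cReD.
have E2 : Im \o (fun x => f x + g x) = fun x => (Im \o f) x + (Im \o g) x by apply/funext => x /=; rewrite cImD.
split; first by split; rewrite ?E1 ?E2; exact:rintD.
rewrite /cintegral -[X in (Rintegral _ _ X +i* _)%C]/(Re \o (fun x => f x + g x)) E1.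
rewrite -[X in (_ +i* Rintegral _ _ X)%C]/(Im \o (fun x => f x + g x)) E2.
by rewrite (RintD f1 g1) (RintD f2 g2).
Qed.

Lemma normcD (z w : C) : normc (z + w) <= normc z + normc w.
exact:le_normcD. Qed.

Lemma normcr (a : R) : normc (a%:C%C) = `|a|.
by rewrite /= expr0n addr0 sqrtr_sqr. Qed.

Lemma normcN (z : C) : normc (- z) = normc z.
by case:z => a b; rewrite /= !sqrrN. Qed.

Lemma theta_bnd : exists2 M : R, 0 <= M & forall j x, normc (theta j x) <= M.
have [M HM] := theta_deriv theta_Phi 0; have H j x : normc (theta j x) <= M.
 by have := HM [::] j x isT; rewrite mul1r.
by exists M => //; apply:le_trans (H 0%N 0).
Qed.

(** The partial sum is 1 on a ball of radius of order [2 ^ J]; beyond it, the crude bound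
    [(1 + M) * 2 ^ J] is outweighed by two orders of decay of [g], which give [2 ^- (2 J)]. *)
Lemma part_sum_defect (g : V -> C) : csch g -> exists D : R, forall J xi,
 normc ((\sum_(l < J) theta l xi - 1) * g xi) <= D * 2^-1 ^+ J * wt W xi.
move=> Hg; have [M M0 HM] := theta_bnd; have [B HB] := csch_bnd W.+2 Hg.
have B0 := rbnd_ge0 HB.1.
pose a : R := 4 * (1 + d%:R) ^+ 2; have a0 : 0 <= a by rewrite mulr_ge0.
exists ((1 + M) * (a * (2 * B))) => J xi; rewrite normcM.
have wg : normc (g xi) <= 2 * B * wt W.+2 xi.
 have := bnd_normc (s := [::]) xi HB isT; rewrite /= mulrC => H.
 by rewrite ler_pdivlMr.
have S : normc (\sum_(l < J) theta l xi - 1) <= (1 + M) * 2 ^+ J.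
 have H n : normc (\sum_(l < n) theta l xi) <= M * n%:R.
  elim:n => [|n IH]; first by rewrite big_ord0 ComplexField.Normc.normc0.
  rewrite big_ord_recr /=; apply:le_trans (normcD _ _) _; rewrite -addn1 natrD mulrDr mulr1.
  exact:lerD.
 apply:le_trans (normcD _ _) _; rewrite normcN normcr normr1.
 apply:le_trans (lerD (H J) (lexx 1)) _; rewrite addrC mulrDl mul1r; apply:lerD; first exact:expr2_ge1.
 by apply:ler_wpM2l => //; rewrite -natrX ler_nat ltnW// ltn_expl.
have n0 := normc_ge0 (g xi); have w0 := wt_ge0 W xi.
have p0 : 0 < (2 : R) ^+ J by exact:expr2_gt0.
have w2 : wt 2 xi * (2 ^+ J) ^+ 2 <= a \/ \sum_(l < J) theta l xi = 1.
 case:J {S} p0 => [|J] p0.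
  left; rewrite expr1n mulr1; apply:le_trans (_ : 1 <= _).
   by rewrite -(wt_exp 2 xi) ler_peMr ?wt_ge0 ?onrmX_ge1.
  by rewrite /a; have : 0 <= (d%:R : R) by []; nra.
 have [xJ|xJ] := ltP (enorm xi) (2 ^+ J); first by right; apply:theta_sum1.
 left; have := le_trans xJ (enorm_le xi) => H.
 rewrite mulrC ler_pdivrMr// /a [2 ^+ J.+1]exprS !exprMn.
 rewrite [X in X * _ <= _](_ : _ = 4); last by ring.
 rewrite -mulrA; apply:ler_wpM2l => //; rewrite -exprMn lerXn2r ?nnegrE//.
 by apply:le_trans H _; apply:ler_wpM2l => //; rewrite lerDr.
case:w2 => [w2|->]; last first.
 rewrite subrr ComplexField.Normc.normc0 mul0r//.
apply:le_trans (ler_pM (normc_ge0 _) n0 S wg) _.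
rewrite -(addn2 W) wtD exprVn.
rewrite [leLHS](_ : _ = (1 + M) * (2 * B) * wt W xi * (2 ^- J) * (wt 2 xi * (2 ^+ J) ^+ 2)); last first.
 by field.
apply:le_trans (ler_wpM2l _ w2) _ => //.
by apply:eqW; ring.
Qed.

Ltac done ::= basic_done.
Lemma theta_repr (b : V -> R) x : rsch b -> exists D : R, forall J,
 normc (\sum_(l < J) cconv (kern (theta l)) (toC b) x - (ci * b x)%:C%C) <= D * 2^-1 ^+ J.
move=> Hb; have Hcb := csch_toC Hb; pose g := inverse_fourier (toC b).
have Hg : csch g by exact:csch_inverse_fourier.
have [D HD] := part_sum_defect Hg.
have D0 : 0 <= D.
 have := le_trans (normc_ge0 _) (HD 0%N 0); rewrite expr0 mulr1 pmulr_lge0//; exact:wt_gt0.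
pose h J xi := (\sum_(l < J) theta l xi - 1) * g xi * cis (- dot xi x).
have Ig (f : V -> C) : csch f -> crint (fun xi => f xi * cis (- dot xi x)).
 by move=> Hf; have := (fpartsE x (or_intror erefl) Hf).1; congr crint; apply/funext => xi; rewrite mulN1r.
have main J : crint (h J) /\ \sum_(l < J) fourier (fun xi => theta l xi * g xi) x - fourier g x =
  (c0 R d)%:C%C * cintegral (h J).
 elim:J => [|J [IH1 IH2]].
  have E xi : h 0%N xi = - 1 * (g xi * cis (- dot xi x)) by rewrite /h big_ord0 sub0r -mulrA.
  rewrite big_ord0 sub0r (funext E); split; first exact/crintZ/Ig.
  by rewrite (cintZ (-1) (Ig _ Hg)) /fourier mulN1r mulrN.
 have HJ := Ig _ (cschM (sch_csch (theta J)) Hg).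
 have E xi : h J.+1 xi = h J xi + theta J xi * g xi * cis (- dot xi x).
  by rewrite /h big_ord_recr /=; ring.
 have [i1 i2] := cintD IH1 HJ.
 rewrite (funext E); split; first exact:i1.
 have FJ : fourier (fun xi => theta J xi * g xi) x =
  (c0 R d)%:C%C * cintegral (fun xi => theta J xi * g xi * cis (- dot xi x)) by [].
 by rewrite i2 mulrDr -IH2 -FJ big_ord_recr /=; ring.
have Fg : fourier g x = (ci * b x)%:C%C.
 by rewrite /g (fourierK c_inv Hcb); apply:ceqP; rewrite ?(cReM, cImM) /=; ring.
exists (c0 R d * (2 * (D * wt_mass R d W))) => J.
rewrite (eq_bigr (fun l : 'I_J => fourier (fun xi => theta l xi * g xi) x)); last first.
 by move=> l _; rewrite fourier_conv//; exact:sch_csch.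
rewrite -Fg (main J).2 normcM normcr gtr0_norm ?c0_gt0// -mulrA; apply:ler_wpM2l; first exact/ltW/c0_gt0.
apply:le_trans (normc_cint (main J).1) _; rewrite -mulrA; apply:ler_wpM2l => //.
have mh := rint_mbl (crint_normc (main J).1).
have := (Rint_dom (A := D * 2^-1 ^+ J) (leqnn W) mh _).2 => H.
apply:le_trans (ler_norm _) _; apply:le_trans (H _) _; last by apply:eqW; ring.
move=> xi; rewrite ger0_norm ?normc_ge0// /h normcM normc_cis mulr1; exact:HD.
Qed.
Ltac done ::= extended_done.

Lemma theta_repr_part (b : V -> R) x e : rsch b ->
 (fun J => \sum_(l < J) rconv b (cpart e (kern (theta l))) x) @ \oo --> (if e then 0 else ci) * b x.
move=> Hb; have [D HD] := theta_repr x Hb.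
have D0 : 0 <= D by have := le_trans (normc_ge0 _) (HD 0%N); rewrite mulr1.
have r0 (f : V -> R) y : rconv f (cst 0) y = 0.
 by rewrite -[RHS](Rint_cst0 R d); apply:eq_Rintegral => z _; rewrite mulr0.
have key J : `|(if e then 0 else ci) * b x - \sum_(l < J) rconv b (cpart e (kern (theta l))) x| <= D * 2^-1 ^+ J.
 apply:le_trans (HD J); rewrite distrC.
 have E : \sum_(l < J) rconv b (cpart e (kern (theta l))) x - (if e then 0 else ci) * b x =
   (if e then Im else Re) (\sum_(l < J) cconv (kern (theta l)) (toC b) x - (ci * b x)%:C%C).
  have E1 n : (if e then Im else Re) (\sum_(l < n) cconv (kern (theta l)) (toC b) x) =
    \sum_(l < n) rconv b (cpart e (kern (theta l))) x.
   elim:n => [|n IH]; first by rewrite !big_ord0; case:e.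
   have [K1 K2] := csch_kern (sch_csch (theta n)).
   rewrite !big_ord_recr /= -IH rconvC//; last by case:(e).
   by case:e {IH}; rewrite ?cImD ?cReD /= r0 ?add0r ?subr0.
  by rewrite -E1; case:e {E1}; rewrite ?cImD ?cReD ?mul0r.
 by rewrite E; case:e {E}; [exact:Im_le_normc|exact:Re_le_normc].
apply/cvgrPdist_le => r r1.
have : (fun J => D * 2^-1 ^+ J) @ \oo --> D * 0.
 by apply:cvgMr; apply:cvg_expr; rewrite ger0_norm// invf_lt1// ltr1n.
rewrite mulr0 => /cvgrPdist_le/(_ _ r1)[N _ HN]; exists N => // J /HN.
rewrite sub0r normrN ger0_norm//.
by move=> H; exact:le_trans (key J) H.
Qed.

Lemma ev_cconv_parts T l (f : V -> R) : tempered T -> rsch f ->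
 let A e := cpart e (kern (theta l)) in
 Re (ev T (cconv (kern (theta l)) (toC f))) = tpart false T (rconv f (A false)) - tpart true T (rconv f (A true)) /\
 Im (ev T (cconv (kern (theta l)) (toC f))) = tpart true T (rconv f (A false)) + tpart false T (rconv f (A true)).
move=> [lT _] Hf A; have HK := csch_kern (sch_csch (theta l)); have [K1 K2] := HK.
have r0 (h : V -> R) y : rconv h (cst 0) y = 0.
 by rewrite -[RHS](Rint_cst0 R d); apply:eq_Rintegral => z _; rewrite mulr0.
have E1 : Re \o cconv (kern (theta l)) (toC f) = rconv f (A false).
 apply/funext => x /=; rewrite r0 subr0 rconvC//.
have E2 : Im \o cconv (kern (theta l)) (toC f) = rconv f (A true).
 apply/funext => x /=; rewrite r0 add0r rconvC//.
rewrite ev_parts//.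
by rewrite E1 E2.
Qed.

(** A functional is controlled by the sum of its blocks. The real parts of the kernels reproduce
    [ci] times the function and the imaginary parts reproduce 0, so the two expansions can be
    recombined into complex blocks. *)
Lemma fnl_bnd T (f : V -> R) (w : nat -> R) (B : R) e : tempered T -> rsch f ->
 (forall l, normc (ev T (cconv (kern (theta l)) (toC f))) <= w l) -> (forall J, \sum_(l < J) w l <= B) ->
 `|ci| * `|tpart e T f| <= B.
move=> tT Hf Hw HB.
have rep e' b := scl_temp (tpart_temp b tT) (theta_kern_scl e') Hf
 (fun h Hh x => @theta_repr_part h x e' Hh).
have [D1 H1] := rep false e; have [D2 H2] := rep true (~~ e).
rewrite -normrM; apply/ler_addgt0Pr => r r0.
have : (fun J => (`|D1| + `|D2|) * 2^-1 ^+ J) @ \oo --> (`|D1| + `|D2|) * 0.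
 by apply:cvgMr; apply:cvg_expr; rewrite ger0_norm ?invr_ge0// invf_lt1// ltr1n.
rewrite mulr0 => /cvgrPdist_le/(_ _ r0)[J _ /(_ J (leqnn J))] /=.
rewrite sub0r normrN ger0_norm; last by rewrite mulr_ge0 ?addr_ge0// exprn_ge0// invr_ge0.
move=> HJ; have := H1 J; have := H2 J; rewrite mul0r sub0r normrN => G2 G1.
have hJ : 0 <= (2^-1 : R) ^+ J by rewrite exprn_ge0// invr_ge0.
have {}G1 := le_trans G1 (ler_wpM2r hJ (ler_norm D1)).
have {}G2 := le_trans G2 (ler_wpM2r hJ (ler_norm D2)).
(* The sign with which the two real expansions combine into the imaginary or the real part of a
   block. *)
pose sg : R := if e then 1 else -1.
have E : \sum_(l < J) (if e then Im else Re) (ev T (cconv (kern (theta l)) (toC f))) =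
  \sum_(l < J) tpart e T (rconv f (cpart false (kern (theta l)))) +
  sg * \sum_(l < J) tpart (~~ e) T (rconv f (cpart true (kern (theta l)))).
 rewrite mulr_sumr -big_split /=; apply:eq_bigr => l _; have [E1 E2] := ev_cconv_parts l tT Hf.
 by rewrite /sg; case:e {rep H1 H2 G1 G2 HJ sg}; rewrite ?E1 ?E2 ?mul1r ?mulN1r.
have sB : `|\sum_(l < J) (if e then Im else Re) (ev T (cconv (kern (theta l)) (toC f)))| <= B.
 apply:le_trans (ler_norm_sum _ _ _) _; apply:le_trans (HB J); apply:ler_sum => l _.
 apply:le_trans (Hw l); case:(e); [exact:Im_le_normc|exact:Re_le_normc].
have sg1 : `|sg| = 1 by rewrite /sg; case:(e); rewrite ?normrN normr1.
move:E sB G1 G2 HJ; set s0 := \sum_(l < J) _; set s1 := \sum_(l < J) _; set s2 := \sum_(l < J) _.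
move=> E sB G1 G2 HJ.
rewrite (_ : ci * _ = (ci * tpart e T f - s1) + (s0 - sg * s2)); last by rewrite E; ring.
apply:le_trans (ler_normD _ _) _; apply:le_trans (lerD G1 (ler_normB _ _)) _.
rewrite normrM sg1 mul1r; move:HJ; rewrite mulrDl.
move:G2 sB; move:(`|D1| * _) (`|D2| * _) `|s0| `|s2| => a1 a2 a3 a4; clear; lra.
Qed.

Lemma evZ T (a : C) (f : V -> C) : tempered T -> csch f -> ev T (fun x => a * f x) = a * ev T f.
move=> [lT _] Hf; have H0 := csch_toC (@rsch_cst0 R d).
have := ev_lin a lT Hf H0.
have -> : (fun x => a * f x + toC (cst 0) x) = (fun x => a * f x) by apply/funext => x; exact:addr0.
move=> ->; have := ev_lin 1 lT H0 H0.
have -> : (fun x => 1 * toC (cst 0) x + toC (cst 0) x) = toC (cst 0) :> (V -> C).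
 by [].
by rewrite mul1r => /eqP; rewrite eq_sym -subr_eq0 addrK => /eqP ->; rewrite addr0.
Qed.

Lemma fourierZ (a : R) (f : V -> C) : csch f -> fourier (fun x => a%:C%C * f x) = fun x => a%:C%C * fourier f x.
move=> Hf; rewrite !fourierE//.
by apply/funext => x; rewrite fpartsZ//; [ring|right].
Qed.

Lemma inverse_fourierZ (a : R) (f : V -> C) : csch f ->
 inverse_fourier (fun x => a%:C%C * f x) = fun x => a%:C%C * inverse_fourier f x.
move=> Hf; rewrite !inverse_fourierE//.
by apply/funext => x; rewrite fpartsZ//; [ring|left].
Qed.

Lemma win_cconv l (f : V -> C) : csch f ->
 cconv (kern (theta l)) (cconv (kern (win theta l)) f) = fun x => ci%:C%C * cconv (kern (theta l)) f x.
move=> Hf; have Ht := sch_csch (theta l); have Hw := win_sch theta l.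
have Hi := csch_inverse_fourier Hf; have Hwi := cschM Hw Hi.
rewrite -(fourier_conv Hw Hf) -(fourier_conv Ht (csch_fourier Hwi)) -(fourier_conv Ht Hf).
rewrite (inverse_fourierK c_inv Hwi) -fourierZ//.
congr fourier; apply/funext => x; rewrite -{2}(win_mul theta_Phi l x); ring.
Qed.

Lemma win_kern l :
 cconv (kern (theta l)) (kern (win theta l)) = fun x => ci%:C%C * kern (theta l) x.
have Ht := sch_csch (theta l); have Hw := win_sch theta l.
have HF := csch_fourier Hw.
rewrite -(fourier_conv Ht (csch_kern Hw)) (inverse_fourierZ _ HF).
rewrite (inverse_fourierK c_inv Hw).
transitivity (fourier (fun x => ci%:C%C * ((c0 R d)%:C%C * theta l x))).
 by congr fourier; apply/funext => x; rewrite -{2}(win_mul theta_Phi l x); ring.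
rewrite (fourierZ _ (cschZ _ Ht)) (fourierZ _ Ht); by [].
Qed.

Definition block T l : V -> C := fun z => ev T (cshift z (kern (theta l))).

(** Since the window is 1 on the support of [theta l], it can be inserted for free; [T] then enters
    through its block of level [l] alone. *)
Lemma block_repr T l (f : V -> C) : tempered T -> csch f ->
 crint (fun z => cconv (kern (win theta l)) f z * block T l z) /\
 ci%:C%C * ev T (cconv (kern (theta l)) f) =
 cintegral (fun z => cconv (kern (win theta l)) f z * block T l z).
move=> tT Hf; have HK := csch_kern (sch_csch (theta l)).
have Hw := cconv_sch (csch_kern (win_sch theta l)) Hf.
have [i1 i2] := cexchange tT Hw HK; split=> //.
by rewrite -(evZ _ tT (cconv_sch HK Hf)) -i2 win_cconv.
Qed.

Lemma rconv_shift (K L : V -> R) x z : rsch K -> rsch L -> rconv K (tshift x L) z = rconv K L (z - x).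
move=> HK HL; rewrite /rconv -(Rint_transl x (rint_rconv z HK (rsch_shiftV x HL))).
by apply:eq_Rintegral => y _; rewrite /tshift addrK opprD [- y - x]addrC addrA.
Qed.

Ltac done ::= basic_done.
Lemma block_reproduces T l x : tempered T ->
 crint (fun z => kern (win theta l) (z - x) * block T l z) /\
 ci%:C%C * block T l x = cintegral (fun z => kern (win theta l) (z - x) * block T l z).
move=> tT; have HK := csch_kern (sch_csch (theta l)).
have Hw := csch_kern (win_sch theta l).
have [i1 i2] := cexchange tT (csch_shift x Hw) HK; split=> //.
rewrite -i2 /block -(evZ _ tT (csch_shift x HK)).
congr (ev T); apply/funext => z; rewrite [LHS]/(ci%:C%C * kern (theta l) (z - x)).
rewrite -[LHS]/((fun x => ci%:C%C * kern (theta l) x) (z - x)) -win_kern.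
have [K1 K2] := HK; have [w1 w2] := Hw.
by rewrite /cconv -!rconv_shift.
Qed.
Ltac done ::= extended_done.

End kernels.
Hint Resolve theta_kern_scl win_kern_scl : fn.

(** * A kernel supported in the half space with prescribed moments *)

Section moment_construction.
Context (R : realType) (n : nat).
Local Notation d := n.+1.
Local Notation V := 'rV[R]_d.
Local Notation W := (d.*2).
Implicit Types (f g : V -> R) (x y : V) (s t : seq 'I_d).

Definition lastc x : R := x ord0 ord_max.
Definition usupp f := forall x, lastc x <= 0 -> f x = 0.
(** The moments of the Dirac mass at 0. *)
Definition unit_mom f := forall s, \int[mu]_y rmono s f y = (nilp s)%:R.

Lemma rmono_perm s t f : perm_eq s t -> rmono s f = rmono t f.
by move=> st; apply/funext => x; rewrite /rmono (perm_big _ st). Qed.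

Lemma Rint_rmono_dpart i s f : rsch f ->
 \int[mu]_y rmono s (dpart i f) y = - (count_mem i s)%:R * \int[mu]_y rmono (rem i s) f y.
move=> Hf.
have Hs := rsch_mono s Hf.
have D : dpart i (rmono s f) = fun y => rmono s (dpart i f) y + (count_mem i s)%:R * rmono (rem i s) f y.
 elim:s {Hs} => [|j s IH].
  by rewrite !rmono0; apply/funext => y; rewrite mul0r addr0.
 have Hs := rsch_mono s Hf.
 rewrite !rmonoS.
 have -> : dpart i (fun x => x ord0 j * rmono s f x) = fun x => (i == j)%:R * rmono s f x + x ord0 j * dpart i (rmono s f) x.
  apply/funext => x; rewrite -[fun _ => _]/((fun z : V => z ord0 j) \* rmono s f).
  have [c1 c2] := rsmth_coord R j.
  by rewrite dpartM//; rewrite c2.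
 rewrite IH; apply/funext => x; rewrite /=; have [->|ij] := eqVneq j i.
  rewrite natrD -[true%:R]/(1 : R); case:(boolP (i \in s)) => si.
   have E : rmono s f x = x ord0 i * rmono (rem i s) f x by rewrite (rmono_perm f (perm_to_rem si)) rmonoS.
   by rewrite E; ring.
  by rewrite (count_memPn si); ring.
 by rewrite add0n -[false%:R]/(0 : R) rmonoS; ring.
have := Rint_dpart0 i Hs; rewrite D RintD; last 2 first.
- by apply:rsch_rint.
- by apply:rintZ; apply:rsch_rint.
rewrite RintZ; last by apply:rsch_rint; by [].
by move=> /eqP; rewrite addr_eq0 => /eqP ->; rewrite mulNr.
Qed.

Section step.
Variable chi : V -> R.
Hypothesis chi_sch : rsch chi.
Hypothesis chi_supp : forall x, lastc x < 2 -> chi x = 0.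
Hypothesis chi_int : \int[mu]_y chi y != 0.

(** Up to sign, the factorial of the multi-index of [s] times the integral of [chi]: the moment
    along [s] of the derivative of [chi] along [s]. *)
Fixpoint pairing s : R := if s is i :: s' then - (count_mem i s)%:R * pairing s' else \int[mu]_y chi y.

Lemma pairing_neq0 s : pairing s != 0.
by elim:s => [//|i s IH] /=; rewrite mulf_neq0// oppr_eq0 eqxx.
Qed.

Lemma Rint_rmono_diter t s : (size s <= size t)%N ->
 \int[mu]_y rmono s (diter t chi) y = (perm_eq s t)%:R * pairing t.
elim:t s => [|i t IH] s.
 by rewrite leqn0 size_eq0 => /eqP ->; rewrite rmono0 mul1r.
move=> st; rewrite [diter _ _]/(dpart i (diter t chi)) Rint_rmono_dpart//.
case:(boolP (i \in s)) => si; last first.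
 rewrite (count_memPn si) oppr0 mul0r; case:(boolP (perm_eq s (i :: t))) => [/perm_mem/(_ i)|_]; last by rewrite mul0r.
 by rewrite (negbTE si) mem_head.
have ps : perm_eq s (i :: t) = perm_eq (rem i s) t.
 by rewrite (permPl (perm_to_rem si)) perm_cons.
rewrite IH; last by rewrite size_rem// -ltnS prednK// -has_predT; apply/hasP; exists i.
rewrite ps; case:(boolP (perm_eq _ _)) => [p|]; last by rewrite !mul0r mulr0.
rewrite !mul1r /= eqxx; congr (- _%:R * _).
by rewrite (permP (perm_to_rem si)) /= eqxx (permP p).
Qed.

(** Derivatives of [chi] of order [N] have no moments below order [N] and a diagonal moment matrix
    at order [N], which is solved for [a]. A large dilation then makes the function small and pushes
    its support away from 0, at unchanged moments of order [N]. *)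
Lemma mom_step N (a : seq 'I_d -> R) : (forall s t, perm_eq s t -> a s = a t) ->
 exists h, [/\ rsch h, usupp h, forall x, `|x| < N%:R -> h x = 0, rbnd N h (2^-1 ^+ N) &
  (forall s, (size s < N)%N -> \int[mu]_y rmono s h y = 0) /\
  (forall s, size s = N -> \int[mu]_y rmono s h y = a s)].
move=> Ha.
(* Tuples with the same letters give the same derivative; [cl t] counts them. *)
pose cl (t : N.-tuple 'I_d) := #|[pred t' : N.-tuple 'I_d | perm_eq t' t]|.
have cl0 (t : N.-tuple 'I_d) : (cl t)%:R != 0 :> R.
 by rewrite pnatr_eq0 -lt0n; apply/card_gt0P; exists t; rewrite inE.
pose co (t : N.-tuple 'I_d) := a t / (pairing t * (cl t)%:R).
pose g x := \sum_(t : N.-tuple 'I_d) co t * diter t chi x.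
have Hg : rsch g by apply:rsch_sum => t; by [].
have ig s : \int[mu]_y rmono s g y = \sum_(t : N.-tuple 'I_d) co t * \int[mu]_y rmono s (diter t chi) y.
 transitivity (\int[mu]_y \sum_(t : N.-tuple 'I_d) co t * rmono s (diter t chi) y).
  by apply:eq_Rintegral => y _; rewrite /rmono mulr_sumr; apply:eq_bigr => t _; ring.
 have ri (t : N.-tuple 'I_d) : rint (rmono s (diter t chi)) by apply:rsch_rint; by [].
 by rewrite Rint_sum => [|t]; [apply:eq_bigr => t _; rewrite RintZ|exact:rintZ].
have g_lt s : (size s < N)%N -> \int[mu]_y rmono s g y = 0.
 move=> sN; rewrite ig big1// => t _; rewrite Rint_rmono_diter ?size_tuple 1?ltnW//.
 case:(boolP (perm_eq s t)) => [/perm_size|_]; last by rewrite mul0r mulr0.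
 by rewrite size_tuple => e; rewrite e ltnn in sN.
have g_eq s : size s = N -> \int[mu]_y rmono s g y = a s.
 move=> sN; pose s' : N.-tuple 'I_d := tcast sN (in_tuple s).
 have s'E : s' = s :> seq _ by rewrite val_tcast.
 rewrite ig (eq_bigr (fun t : N.-tuple 'I_d => if t \in [pred t' : N.-tuple 'I_d | perm_eq t' s'] then a s / (cl s')%:R else 0)).
  by rewrite -big_mkcond sumr_const -[_ *+ _]mulr_natr divfK.
 move=> t _; rewrite Rint_rmono_diter ?size_tuple ?sN// inE s'E perm_sym.
 case:(boolP (perm_eq t s)) => ts; last by rewrite mul0r mulr0.
 have -> : cl s' = cl t.
  by apply:eq_card => t'; rewrite !inE s'E; rewrite -(permPr ts).
 by rewrite /co (Ha _ _ ts) mul1r; field; rewrite cl0 pairing_neq0.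
have g_supp x : lastc x < 2 -> g x = 0.
 move=> x2; rewrite /g big1// => t _; rewrite (@diter_open R d [set y | lastc y < 2]) ?mulr0//.
 move=> y y2; have := @coord_continuous R 1 d ord0 ord_max y => /(_ [set u | u < 2]); apply.
 exact:open_nbhs_nbhs (conj (@open_lt _ 2) y2).
have [B HB] := Hg.2 N; have B0 := rbnd_ge0 HB.
(* [N] clears the ball of radius [N]; [B * 2 ^+ N] produces the bound [2 ^- N], because in dimension
   at least one the normalisation of [dil] leaves a factor [lam ^- 1] over. *)
pose lam : R := 1 + N%:R + B * 2 ^+ N.
have lam1 : 1 <= lam by rewrite /lam -addrA lerDl.
have lamN : N%:R <= lam by rewrite /lam addrAC addrC lerDl.
pose h0 x := lam^-1 ^+ N * g x.
have mh s : \int[mu]_y rmono s (dil lam^-1 h0) y = lam ^+ size s * (lam^-1 ^+ N * \int[mu]_y rmono s g y).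
 rewrite mom_dil// invrK; congr (_ * _).
 have E y : rmono s h0 y = lam^-1 ^+ N * rmono s g y by rewrite mulrCA.
 under eq_Rintegral do rewrite E.
 by rewrite RintZ//; apply:rsch_rint.
have hs x : lastc (lam^-1 *: x) < 2 -> dil lam^-1 h0 x = 0.
 by move=> H; rewrite /dil /h0 g_supp// !mulr0.
exists (dil lam^-1 h0); split => //.
- move=> x x0; apply:hs; rewrite /lastc mxE; apply:le_lt_trans (ltr0n R 2).
 by rewrite mulr_ge0_le0.
- move=> x xN; apply:hs; apply:le_lt_trans (ler_norm _) _; apply:le_lt_trans (coord_le_norm _ _) _.
 rewrite normrZ gtr0_norm// ltr_pdivrMl//; apply:lt_le_trans (lt_le_trans xN lamN) _.
 by rewrite ler_peMr ?ltW// ltr1n.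
- move=> s x sN.
 have E : dil lam^-1 h0 = fun x => (lam^-1 ^+ d * lam^-1 ^+ N) * (g \o aff lam^-1 0) x.
  by apply/funext => y; rewrite /dil /= /aff addr0 mulrA.
 rewrite E diterZ// diter_aff//.
 rewrite /aff addr0; set y := lam^-1 *: x.
 have xy : 1 + `|x| <= lam * (1 + `|y|).
  rewrite normrZ gtr0_norm// mulrDr mulr1 mulrA mulfV// mul1r.
  by rewrite lerD2r.
 have := HB s y sN => Hy.
 have li1 : lam^-1 <= 1 by rewrite invf_le1.
 apply:(@le_trans _ _ ((lam * (1 + `|y|)) ^+ N * (lam^-1 ^+ d * lam^-1 ^+ N * `|diter s g y|))).
  apply:ler_pM => //.
   apply:lerXn2r => //; rewrite nnegrE//.
  have c0 : 0 <= lam^-1 ^+ d * lam^-1 ^+ N by apply:mulr_ge0; by [].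
  rewrite normrM (ger0_norm c0); apply:ler_wpM2l => //.
  by rewrite normrM ler_piMl// ger0_norm// exprn_ile1.
 rewrite exprMn [leLHS](_ : _ = (lam * lam^-1) ^+ N * lam^-1 ^+ d * ((1 + `|y|) ^+ N * `|diter s g y|)); last by rewrite exprMn; ring.
 rewrite mulfV// expr1n mul1r.
 apply:le_trans (ler_wpM2l _ Hy) _ => //.
 apply:(@le_trans _ _ (lam^-1 * B)).
  by apply:ler_wpM2r => //; rewrite exprS ler_piMr// exprn_ile1.
 rewrite ler_pdivrMl// exprVn ler_pdivlMr//.
 by rewrite lerDr.
- split=> s sN; rewrite mh; first by rewrite g_lt ?mulr0.
 by rewrite g_eq// sN mulrA -exprMn mulfV ?gt_eqF// expr1n mul1r.
Qed.

(** The premise stands under the existential so that a choice exists for every [f], and [approx] can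
    be defined before it is known to be Schwartz. *)
Lemma exists_step N f : exists h, rsch f ->
 [/\ rsch h, usupp h, forall x, `|x| < N%:R -> h x = 0, rbnd N h (2^-1 ^+ N) &
  (forall s, (size s < N)%N -> \int[mu]_y rmono s h y = 0) /\
  (forall s, size s = N -> \int[mu]_y rmono s h y = (nilp s)%:R - \int[mu]_y rmono s f y)].
have [s t st|h Hh] := @mom_step N (fun s => (nilp s)%:R - \int[mu]_y rmono s f y).
 by rewrite (rmono_perm f st) /nilp (perm_size st).
by exists h.
Qed.

Definition increment N f := sval (cid (exists_step N f)).
Fixpoint approx N : V -> R := if N is m.+1 then fun x => approx m x + increment m (approx m) x else cst 0.

Lemma incrP N : rsch (approx N) ->
 let h := increment N (approx N) in
 [/\ rsch h, usupp h, forall x, `|x| < N%:R -> h x = 0, rbnd N h (2^-1 ^+ N) &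
  (forall s, (size s < N)%N -> \int[mu]_y rmono s h y = 0) /\
  (forall s, size s = N -> \int[mu]_y rmono s h y = (nilp s)%:R - \int[mu]_y rmono s (approx N) y)].
by move=> H; exact:(svalP (cid (exists_step N (approx N))) H). Qed.

Lemma approx_sch N : rsch (approx N).
elim:N => [|N IH]; first exact:rsch_cst0.
by apply:rschD => //; have [] := incrP IH.
Qed.
Hint Resolve approx_sch : fn.

Local Notation incr N := (increment N (approx N)).
Let inP N := incrP (approx_sch N).

Lemma approx_supp N : usupp (approx N).
elim:N => [//|N IH] x x0 /=; rewrite IH//; by have [_ ->] := inP N; rewrite ?addr0.
Qed.

Ltac done ::= basic_done.
Lemma approx_mom N s : (size s < N)%N -> \int[mu]_y rmono s (approx N) y = (nilp s)%:R.
elim:N => [//|N IH]; rewrite ltnS => sN; have [Hh _ _ _ [h1 h2]] := inP N.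
have E y : rmono s (approx N.+1) y = rmono s (approx N) y + rmono s (incr N) y by rewrite /rmono mulrDr.
under eq_Rintegral do rewrite E.
have ri f : rsch f -> rint (rmono s f) by move=> Hf; apply:rsch_rint; exact:rsch_mono.
rewrite RintD; [|apply:ri; exact:approx_sch|exact:ri].
move:sN; rewrite leq_eqVlt => /orP[/eqP sN|sN]; first by rewrite h2// addrC subrK.
by rewrite h1// addr0 IH.
Qed.
Ltac done ::= extended_done.

(** The infinite sum of the increments. Increment [N] vanishes on [|x| < N], so at each point a
    partial sum has the right value. *)
Definition kerP x : R := approx (Num.truncn `|x|).+1 x.

Lemma approx_stable N m x : `|x| < N%:R -> (N <= m)%N -> approx m x = approx N x.
move=> xN /subnKC <-; elim:(m - N)%N => [|k IH]; first by rewrite addn0.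
rewrite addnS /=; have [_ _ ->] := inP (N + k); first by rewrite addr0.
by apply:lt_le_trans xN _; rewrite ler_nat leq_addr.
Qed.

Lemma kerP_eq N x : `|x| < N%:R -> kerP x = approx N x.
move=> xN; rewrite /kerP; have H : `|x| < (Num.truncn `|x|).+1%:R by exact:truncnS_gt.
by case:(leqP N (Num.truncn `|x|).+1) => h; [exact:approx_stable|rewrite -(approx_stable H (ltnW h))].
Qed.

Ltac done ::= basic_done.
Lemma diter_kerP N s x : `|x| < N%:R -> diter s kerP x = diter s (approx N) x.
elim:s x => [|i s IH] x xN; first exact:kerP_eq.
rewrite /= !dpartE; apply:near_eq_derive.
have := @near_norm R d [set u | u < N%:R] x (@open_lt _ _) xN.
by apply:filterS => y yN; exact:IH.
Qed.
Ltac done ::= extended_done.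

Lemma kerP_supp : usupp kerP.
by move=> x; exact:approx_supp. Qed.

Lemma approx_tail k m x s : (size s <= k)%N -> (k <= m)%N ->
 `|diter s (approx m) x - diter s (approx k) x| <= 2 * (2^-1 ^+ k - 2^-1 ^+ m) * wt k x.
move=> sk /subnKC <-; elim:(m - k)%N => [|j IH].
 by rewrite addn0 !subrr normr0 mulr0 mul0r.
have [Hh _ _ Hb _] := inP (k + j).
rewrite addnS [approx _]/(approx (k + j) \+ incr (k + j)) diterD /=//.
rewrite addrAC; apply:le_trans (ler_normD _ _) _.
have h1 : `|diter s (incr (k + j)) x| <= 2^-1 ^+ (k + j) * wt k x.
 apply:le_trans (rbnd_wt x Hb (leq_trans sk (leq_addr _ _))) _.
 by apply:ler_wpM2l => //; rewrite wt_le// leq_addr.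
apply:le_trans (lerD IH h1) _; rewrite exprS -mulrDl; apply:ler_wpM2r; first exact:wt_ge0.
by move:(_ ^+ k) (_ ^+ (k + j)) => u v; apply:eqW; field.
Qed.

Lemma kerP_tail k x s : (size s <= k)%N ->
 `|diter s kerP x - diter s (approx k) x| <= 2 * 2^-1 ^+ k * wt k x.
move=> sk; pose N := (k + (Num.truncn `|x|).+1)%N.
have xN : `|x| < N%:R by apply:lt_le_trans (truncnS_gt _) _; rewrite ler_nat leq_addl.
rewrite (diter_kerP s xN); apply:le_trans (approx_tail x sk (leq_addr _ _)) _.
apply:ler_wpM2r; first exact:wt_ge0.
by apply:ler_wpM2l => //; rewrite gerBl.
Qed.

Lemma kerP_sch : rsch kerP.
split=> [s x|k].
 pose N := (Num.truncn (`|x| + 1)).+1.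
 have xN : `|x| + 1 < N%:R by exact:truncnS_gt.
 pose g := diter s (approx N).
 have Hg : rsch g by apply:rsch_diter; by [].
 have [B HB] := Hg.2 2%N; have B0 := rbnd_ge0 HB.
 apply:(proj1 (@diff_quadratic R d _ x (fun i => dpart i g x) (d%:R ^+ 2 * B) _)) => h h1.
 have xhN : `|x + h| < N%:R by apply:le_lt_trans xN; apply:le_trans (ler_normD _ _) _; rewrite lerD2l.
 rewrite !(@diter_kerP N) -/g//; last by apply:le_lt_trans xN; rewrite lerDl.
 have := @taylor R d g x h ((d%:R * `|h|) ^+ 2 * B) 2 Hg.1.
 rewrite 2!big_ord_recl big_ord0 /= !invr1 !mul1r addr0 opprD addrA exprMn mulrAC; apply=> r _.
 rewrite [leRHS](_ : _ = (d%:R * `|h|) ^+ 2 * B); last by rewrite exprMn; ring.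
 apply:(@iter_dirder_bnd R d h 2 g _ B Hg.1) => s' s'2.
 by apply:rbnd_sup HB _; rewrite s'2.
have [B HB] := (approx_sch k).2 k; exists (B + 2 * 2^-1 ^+ k).
apply:wt_rbnd => s x sk; rewrite -[diter s kerP x](subrK (diter s (approx k) x)) addrC mulrDl.
apply:le_trans (ler_normD _ _) _; apply:lerD; last exact:kerP_tail.
exact:rbnd_wt HB sk.
Qed.
Hint Resolve kerP_sch : fn.

Lemma kerP_mom : unit_mom kerP.
move=> s; apply/eqP; rewrite -subr_eq0 -normr_le0; apply/ler_addgt0Pr => e e0; rewrite add0r.
have : (fun k => 2 * wt_mass R d W * 2^-1 ^+ k) @ \oo --> 2 * wt_mass R d W * 0.
 by apply:cvgMr; apply:cvg_expr; rewrite ger0_norm// invf_lt1// ltr1n.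
rewrite mulr0 => /cvgrPdist_le/(_ _ e0)[k0 _ Hk0].
pose k := (k0 + (size s + W).+1)%N.
have {Hk0} := Hk0 k (leq_addr _ _) => /=; rewrite sub0r normrN ger0_norm; last first.
 by rewrite !mulr_ge0 ?wt_mass_ge0.
apply:le_trans; have sk : (size s < k)%N by rewrite /k; lia.
rewrite -(approx_mom sk).
have ri f : rsch f -> rint (rmono s f) by move=> Hf; apply:rsch_rint; by [].
have r1 := ri _ kerP_sch; have r2 := ri _ (approx_sch k).
rewrite -RintB// mulrAC.
apply:(Rint_dom (leqnn W) _ _).2 => [|x]//.
rewrite -mulrBr normrM.
apply:le_trans (ler_pM _ _ (prod_coord_le s x) (kerP_tail (s := [::]) x (leq0n k))) _ => //.
rewrite mulrCA; apply:ler_wpM2l => //.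
apply:le_trans (_ : (1 + `|x|) ^+ size s * wt (size s + W) x <= _).
 by apply:ler_wpM2l => //; rewrite wt_le; lia.
by rewrite wtD mulrA [_ * wt (size s) x]mulrC wt_exp mul1r.
Qed.

End step.
Hint Resolve approx_sch kerP_sch : fn.

End moment_construction.
Hint Resolve approx_sch kerP_sch : fn.

(** * Convolution algebra and moments *)

Section convolution_algebra.
Context (R : realType) (d : nat).
Local Notation V := 'rV[R]_d.
Local Notation W := (d.*2).
Implicit Types (f g h : V -> R) (x y : V) (s : seq 'I_d).

Lemma rconv_linl (a : R) f g h : rsch f -> rsch g -> rsch h ->
 rconv (fun x => a * f x + g x) h = fun x => a * rconv f h x + rconv g h x.
move=> Hf Hg Hh; apply/funext => x; have i1 := rint_rconv x Hf Hh; have i2 := rint_rconv x Hg Hh.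
rewrite /rconv -RintZ// -RintD//; last exact:rintZ.
by apply:eq_Rintegral => y _; ring.
Qed.

Lemma rconv_linr (a : R) f g h : rsch f -> rsch g -> rsch h ->
 rconv f (fun x => a * g x + h x) = fun x => a * rconv f g x + rconv f h x.
by move=> Hf Hg Hh; rewrite rconvC ?rconv_linl//rconvC ?[rconv f h]rconvC.
Qed.

Lemma rconvA f g h : rsch f -> rsch g -> rsch h ->
 rconv f (rconv g h) = rconv (rconv f g) h.
move=> Hf Hg Hh; apply/funext => x; have [A HA] := rsch_sup Hg 0.
have mf := rsch_mbl Hf; have mg := rsch_mbl Hg; have mh := rsch_mbl Hh.
have ifx : rint (fun y => f (x - y)).
 have n1 : (-1 : R) != 0 by rewrite oppr_eq0.
 have := rint_aff x n1 (rsch_rint Hf); congr rint.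
 by apply/funext => y; rewrite /= /aff scaleN1r addrC.
rewrite /rconv.
transitivity (\int[mu]_y \int[mu]_z (f (x - y) * (g (y - z) * h z))).
 by apply:eq_Rintegral => y _; rewrite RintZ//; exact:rint_rconv.
rewrite (@Rint_fubini R d _ (fun y => `|f (x - y)|) (fun z => `|A| * `|h z|)).
- apply:eq_Rintegral => z _.
 rewrite [RHS]mulrC.
 have ri := rint_rconv (x - z) Hf Hg.
 rewrite -(Rint_transl (- z) ri) -RintZ; last first.
  have := rint_aff (- z) (oner_neq0 _) ri; congr rint.
  by [].
 apply:eq_Rintegral => y _; rewrite opprB addrA subrK; ring.
- apply:measurable_funM; first by apply:(measurableT_comp (mbl_subr x mf)); by [].
 apply:measurable_funM; last exact:(measurableT_comp mh measurable_snd).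
 by apply:(@measurableT_comp _ _ _ _ _ _ g _ (fun xy : V * V => xy.1 - xy.2)) => //; exact:mbl_subV.
- move=> y z; rewrite !normrM; apply:ler_wpM2l => //; apply:ler_wpM2r => //.
 exact:le_trans (HA [::] _ isT) (ler_norm _).
- exact:(integrable_norm ifx).
- by apply:rintZ; exact:(integrable_norm (rsch_rint Hh)).
Qed.

Lemma Rint_rconv f g : rsch f -> rsch g ->
 \int[mu]_x rconv f g x = \int[mu]_x f x * \int[mu]_x g x.
move=> Hf Hg; have [A HA] := rsch_sup Hf 0.
have mf := rsch_mbl Hf; have mg := rsch_mbl Hg.
have [B HB] := Hf.2 W; have [D HD] := Hg.2 (W + W)%N.
have B0 := rbnd_ge0 HB; have D0 := rbnd_ge0 HD.
transitivity (\int[mu]_x \int[mu]_y (f (x - y) * g y)) => //.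
rewrite (@Rint_fubini R d _ (fun x => B * wt W x) (fun y => D * wt W y)).
- transitivity (\int[mu]_y ((\int[mu]_x f x) * g y)); last by rewrite RintZ//; exact:rsch_rint.
 apply:eq_Rintegral => y _; rewrite -(Rint_transl (- y) (rsch_rint Hf)) mulrC.
 rewrite -RintZ; last first.
  have := rint_aff (- y) (oner_neq0 _) (rsch_rint Hf); congr rint.
  by [].
 by apply:eq_Rintegral => x _; rewrite mulrC.
- apply:measurable_funM; last exact:(measurableT_comp mg measurable_snd).
 by apply:(@measurableT_comp _ _ _ _ _ _ f _ (fun xy : V * V => xy.1 - xy.2)) => //; exact:mbl_subV.
- move=> x y; rewrite normrM.
 apply:le_trans (ler_pM _ _ (rbnd_wt0 (x - y) HB) (rbnd_wt0 y HD)) _ => //.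
 rewrite wtD [leLHS](_ : _ = B * D * wt W y * (wt W (x - y) * wt W y)); last by ring.
 rewrite [leRHS](_ : _ = B * D * wt W y * wt W x); last by ring.
 by apply:ler_wpM2l; [rewrite !mulr_ge0 ?wt_ge0|exact:wt_conv].
- by apply:rintZ; exact:rint_wt.
- by apply:rintZ; exact:rint_wt.
Qed.

(** Multiplication by a coordinate is a derivation of the convolution product, by [x = (x - y) + y].
    The words [u] and [v] record the coordinates already distributed to the factors. *)
Lemma rmono_rconv s u v f g : rsch f -> rsch g -> (~~ nilp s || ~~ nilp u || ~~ nilp v) ->
 (forall w, ~~ nilp w -> \int[mu]_x rmono w f x = 0) -> (forall w, ~~ nilp w -> \int[mu]_x rmono w g x = 0) ->
 \int[mu]_x rmono s (rconv (rmono u f) (rmono v g)) x = 0.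
move=> Hf Hg + zf zg; elim:s u v => [|i s IH] u v /= suv.
 rewrite rmono0 Rint_rconv//.
 by case/orP: suv => H; [rewrite zf ?mul0r|rewrite zg ?mulr0].
have E x : rmono (i :: s) (rconv (rmono u f) (rmono v g)) x =
  rmono s (rconv (rmono (i :: u) f) (rmono v g)) x + rmono s (rconv (rmono u f) (rmono (i :: v) g)) x.
 have H : x ord0 i * rconv (rmono u f) (rmono v g) x =
   rconv (rmono (i :: u) f) (rmono v g) x + rconv (rmono u f) (rmono (i :: v) g) x.
  rewrite /rconv -RintD; [|exact:rint_rconv (rsch_mono _ Hf) (rsch_mono _ Hg)..].
  rewrite -RintZ; last exact:rint_rconv (rsch_mono _ Hf) (rsch_mono _ Hg).
  by apply:eq_Rintegral => y _; rewrite !rmonoS !mxE; ring.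
 by rewrite rmonoS mulrCA H mulrDr.
have ri u' v' : rint (rmono s (rconv (rmono u' f) (rmono v' g))).
 apply:rsch_rint; apply:rsch_mono => //.
under eq_Rintegral do rewrite E.
by rewrite RintD// !IH ?addr0//= ?orbT.
Qed.

Lemma dil_lin (e a : R) f g : dil e (fun x => a * f x + g x) = fun x => a * dil e f x + dil e g x.
by apply/funext => x; rewrite /dil; ring. Qed.

Lemma dil_rconv (e : R) f g : 0 < e -> rsch f -> rsch g ->
 dil e (rconv f g) = rconv (dil e f) (dil e g).
by move=> e0 Hf Hg; rewrite rconv_dil_dil// mulfV// dil1. Qed.

Definition scale_pair (K0 K1 : V -> R) j : V -> R := if j is i.+1 then dil (2 ^+ i.+1) K1 else K0.

Lemma scl_pair K0 K1 : rsch K0 -> rsch K1 -> zero_mom K1 -> scl 1 (scale_pair K0 K1).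
move=> H0 H1 z; split=> [[|j]|M|[//|j] _ /=].
- by [].
- by [].
- have [A HA] := H0.2 M; have [B HB] := H1.2 M; exists (Num.max A B) => -[|j] /=.
  by rewrite invr1 dil1; apply:rbnd_le HA; rewrite // le_max lexx.
 rewrite dil_dil mulVf// dil1; apply:rbnd_le HB => //.
 by rewrite le_max lexx orbT.
- by [].
Qed.
Hint Resolve scl_pair : fn.

Lemma approximate_identity f Q x : rsch f -> rsch Q -> \int[mu]_y Q y = 1 ->
 (fun J => rconv f (dil (2 ^+ J) Q) x) @ \oo --> f x.
move=> Hf HQ Q1; have [A HA] := rsch_sup Hf 1; have [B HB] := HQ.2 W.+1.
have A0 : 0 <= A by apply:le_trans (HA [::] 0 isT).
have B0 := rbnd_ge0 HB.
pose D := d%:R * A * B * wt_mass R d W.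
have D0 : 0 <= D by rewrite !mulr_ge0 ?wt_mass_ge0.
have key J : `|f x - rconv f (dil (2 ^+ J) Q) x| <= D * 2^-1 ^+ J.
 have e0 := expr2_gt0 R J; have [i1 ->] := rconv_dilE x e0 Hf HQ.
 have iQ := rintZ (f x) (rsch_rint HQ).
 have E : f x = \int[mu]_y (f x * Q y) by rewrite RintZ ?Q1 ?mulr1//; exact:rsch_rint.
 rewrite [X in `|X - _|]E -RintB//.
 rewrite [leRHS](_ : _ = d%:R * A * B * 2^-1 ^+ J * wt_mass R d W); last by rewrite /D; ring.
 apply:(Rint_dom (leqnn W) _ _).2 => [|y].
  by [].
 rewrite -mulrBl normrM distrC.
 have := lipschitz_bnd (A := A) Hf.1 (fun i x => HA [:: i] x isT) x (- ((2 ^+ J)^-1 *: y)).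
 rewrite normrN normrZ gtr0_norm// => H.
 apply:le_trans (ler_pM _ _ H (rbnd_wt0 y HB)) _ => //.
 rewrite -(addn1 W) wtD exprVn.
 rewrite [leLHS](_ : _ = d%:R * A * B * 2 ^- J * wt W y * (wt 1 y * `|y|)); last by ring.
 apply:ler_piMr; first by rewrite !mulr_ge0 ?invr_ge0.
 by rewrite -(wt_exp 1 y); apply:ler_wpM2l; [exact:wt_ge0|rewrite lerDr].
apply/cvgrPdist_le => r r1.
have : (fun J => D * 2^-1 ^+ J) @ \oo --> D * 0.
 by apply:cvgMr; apply:cvg_expr; rewrite ger0_norm// invf_lt1// ltr1n.
rewrite mulr0 => /cvgrPdist_le/(_ _ r1)[N _ HN]; exists N => // J /HN.
rewrite sub0r normrN ger0_norm//.
by move=> H; exact:le_trans (key J) H.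
Qed.

End convolution_algebra.
Hint Resolve scl_pair : fn.

(** * The telescoping factorisation of the identity *)

Section resolution.
Context (R : realType) (n : nat).
Local Notation d := n.+1.
Local Notation V := 'rV[R]_d.
Implicit Types (f g : V -> R) (x y : V) (s : seq 'I_d).

Variable P : V -> R.
Hypothesis P_sch : rsch P.
Hypothesis P_supp : usupp P.
Hypothesis P_mom : unit_mom P.

Lemma usupp_lin (a : R) f g : usupp f -> usupp g -> usupp (fun x => a * f x + g x).
by move=> Hf Hg x x0; rewrite Hf// Hg// mulr0 addr0. Qed.
Hint Resolve usupp_lin : fn.

Lemma usupp_dil (e : R) f : 0 < e -> usupp f -> usupp (dil e f).
by move=> e0 Hf x x0; rewrite /dil Hf ?mulr0// /lastc mxE pmulr_rle0. Qed.
Hint Resolve usupp_dil : fn.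

Lemma usupp_rconv f g : usupp f -> usupp g -> usupp (rconv f g).
move=> Hf Hg x x0; rewrite -[RHS](Rint_cst0 R d); apply:eq_Rintegral => y _.
have [y0|y0] := leP (lastc y) 0; first by rewrite Hg ?mulr0.
by rewrite Hf ?mul0r//; move:x0 y0; rewrite /lastc !mxE; lra.
Qed.
Hint Resolve usupp_rconv : fn.

Let e2 : 0 < (2 : R)^-1. by []. Qed.
Let en2 : (2 : R)^-1 != 0. by []. Qed.
Let P' := dil 2^-1 P.
Let HP' : rsch P'. by []. Qed.
Let SP' : usupp P'. by []. Qed.

Let mom_nil f : unit_mom f -> forall w, ~~ nilp w -> \int[mu]_x rmono w f x = 0.
by move=> H w /negbTE wn; rewrite H wn. Qed.

Ltac done ::= basic_done.
Lemma unit_mom_rconv f g : rsch f -> rsch g -> unit_mom f -> unit_mom g ->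
 unit_mom (rconv f g).
move=> Hf Hg mf mg s; have := @rmono_rconv R d s [::] [::] f g Hf Hg; rewrite !rmono0 => H.
case:(boolP (nilp s)) => [/nilP -> |sn]; last first.
 by rewrite H ?sn//; exact:mom_nil.
by rewrite rmono0 Rint_rconv//; have := mf [::]; have := mg [::]; rewrite !rmono0 => -> ->; rewrite mulr1.
Qed.
Ltac done ::= extended_done.

Let mP' : unit_mom P'.
move=> s; rewrite mom_dil// P_mom; case:(boolP (nilp s)) => [/nilP ->|_]; last by rewrite mulr0.
by rewrite mulr1.
Qed.

Let PP := rconv P P.
Let PP' := rconv P P'.
Let P'P' := rconv P' P'.
Let HPP : rsch PP. exact:(rconv_sch P_sch P_sch).1. Qed.
Let HPP' : rsch PP'. exact:(rconv_sch P_sch HP').1. Qed.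
Let HP'P' : rsch P'P'. exact:(rconv_sch HP' HP').1. Qed.

Definition phi1 : V -> R := fun x => -1 * dil 2^-1 P x + P x.
Definition psi0 : V -> R := fun x => (-2) * rconv P P x + (2 * P x + P x).
(** The cofactor of [P - dil 2^-1 P] in the telescoping of [cubic], spelt as nested sums [c f + g]
    to fit the linearity lemmas. Its moments vanish because three unit masses times [-2] cancel two
    times 3. *)
Definition psi1 : V -> R := fun x =>
 (-2) * rconv P P x + ((-2) * rconv P (dil 2^-1 P) x + ((-2) * rconv (dil 2^-1 P) (dil 2^-1 P) x +
 (3 * P x + (2 * dil 2^-1 P x + dil 2^-1 P x)))).

Lemma phi1_sch : rsch phi1. by []. Qed.
Lemma psi0_sch : rsch psi0.
by []. Qed.
Lemma psi1_sch : rsch psi1.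
by do 4 (apply:rsch_lin => //); exact:rsch_lin. Qed.
Lemma psi1_supp : usupp psi1.
by do 3 (apply:usupp_lin; first exact:usupp_rconv). Qed.

Let mom_lin s (a : R) f g : rsch f -> rsch g ->
 \int[mu]_y rmono s (fun x => a * f x + g x) y = a * \int[mu]_y rmono s f y + \int[mu]_y rmono s g y.
move=> Hf Hg; have ri h : rsch h -> rint (rmono s h) by move=> Hh; apply:rsch_rint; by [].
rewrite -RintZ; last exact:ri.
by rewrite -RintD; [apply:eq_Rintegral => y _; rewrite /rmono; ring|apply:rintZ; exact:ri|exact:ri].
Qed.

Let S1 : rsch (fun x => 2 * P' x + P' x). by []. Qed.
Let S2 : rsch (fun x => 3 * P x + (2 * P' x + P' x)). by []. Qed.
Let S3 : rsch (fun x => (-2) * P'P' x + (3 * P x + (2 * P' x + P' x))).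
by []. Qed.
Let S4 : rsch (fun x => (-2) * PP' x + ((-2) * P'P' x + (3 * P x + (2 * P' x + P' x)))).
by []. Qed.

Lemma phi1_mom : zero_mom phi1.
by move=> s; rewrite mom_lin// mP' P_mom; ring. Qed.

Lemma psi1_mom : zero_mom psi1.
move=> s; rewrite (mom_lin s (-2) HPP S4) (mom_lin s (-2) HPP' S3) (mom_lin s (-2) HP'P' S2).
rewrite (mom_lin s 3 P_sch S1) (mom_lin s 2 HP' HP') !unit_mom_rconv// mP' P_mom; ring.
Qed.

Definition phi := scale_pair P phi1.
Definition psi := scale_pair psi0 psi1.

Lemma phi_scl : scl 1 phi. exact:scl_pair P_sch phi1_sch phi1_mom. Qed.
Lemma psi_scl : scl 1 psi. exact:scl_pair psi0_sch psi1_sch psi1_mom. Qed.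

Lemma phi_supp j : usupp (phi j).
by case:j => [|j]. Qed.
Hint Resolve phi_supp : fn.

Lemma psi_supp j : usupp (psi j).
by case:j => [|j] //; apply:usupp_dil psi1_supp. Qed.
Hint Resolve psi_supp : fn.

(* H(u) = 3 u^2 - 2 u^3 telescopes: (a - b)(3 (a + b) - 2 (a^2 + a b + b^2)) = H(a) - H(b). *)
Definition cubic : V -> R := fun x => (-2) * rconv P (rconv P P) x + (2 * rconv P P x + rconv P P x).

Lemma cubic_sch : rsch cubic.
by [].
Qed.

Lemma cubic_mass : \int[mu]_y cubic y = 1.
have := mom_lin [::] (-2) (rconv_sch P_sch HPP).1 (rsch_lin 2 HPP HPP).
rewrite !rmono0 => ->; have := mom_lin [::] 2 HPP HPP; rewrite !rmono0 => ->.
have m1 : unit_mom PP by exact:unit_mom_rconv.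
have := m1 [::]; have := unit_mom_rconv P_sch HPP P_mom m1 [::].
by rewrite !rmono0 => -> -> /=; lra.
Qed.

Lemma phi_psi0 : rconv (phi 0) (psi 0) = cubic.
rewrite /= rconv_linr//.
by rewrite rconv_linr.
Qed.

Let six (f : V -> R) : rsch f -> rconv f psi1 = fun x =>
 (-2) * rconv f PP x + ((-2) * rconv f PP' x + ((-2) * rconv f P'P' x +
 (3 * rconv f P x + (2 * rconv f P' x + rconv f P' x)))).
move=> Hf; rewrite (rconv_linr (-2) Hf HPP S4) (rconv_linr (-2) Hf HPP' S3) (rconv_linr (-2) Hf HP'P' S2).
by rewrite (rconv_linr 3 Hf P_sch S1) (rconv_linr 2 Hf HP' HP').
Qed.

Ltac done ::= basic_done.
Lemma phi1_psi1 : rconv phi1 psi1 = fun x => -1 * dil 2^-1 cubic x + cubic x.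
rewrite /phi1 rconv_linl//; last exact:psi1_sch.
rewrite !six// /cubic dil_lin dil_lin !dil_rconv//.
apply/funext => x; rewrite -/P' -/PP -/PP' -/P'P'.
have -> : rconv P' PP = rconv P PP' by rewrite (rconvA HP' P_sch P_sch) (rconvC HP' P_sch) (rconvC HPP' P_sch).
have -> : rconv P' PP' = rconv P P'P'.
 by rewrite (rconvA HP' P_sch HP') (rconvC HP' P_sch) -(rconvA P_sch HP' HP').
have -> : rconv P' P = PP' by rewrite rconvC.
move:(rconv P PP' x) (rconv P P'P' x) (rconv P' P'P' x) (rconv P PP x) (PP x) (PP' x) (P'P' x).
by move=> a1 a2 a3 a4 a5 a6 a7; ring.
Qed.

Lemma phi_psiS j : rconv (phi j.+1) (psi j.+1) = fun x => -1 * dil (2 ^+ j) cubic x + dil (2 ^+ j.+1) cubic x.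
have e0 : 0 < (2 : R) ^+ j.+1 by exact:expr2_gt0.
rewrite /phi /psi /= -dil_rconv//; [|exact:phi1_sch|exact:psi1_sch].
rewrite phi1_psi1 dil_lin dil_dil; apply/funext => x; congr (_ * dil _ _ _ + _).
by rewrite exprS mulrAC mulfV// mul1r.
Qed.

Lemma phi_psi_scl : scl 1 (fun j => rconv (phi j) (psi j)).
have z : zero_mom (fun x => -1 * dil 2^-1 cubic x + cubic x).
 have Hc := cubic_sch; have Hc' : rsch (dil 2^-1 cubic) by exact:rsch_dil.
 have mc : unit_mom cubic.
  move=> s; rewrite mom_lin; [|exact:(rconv_sch P_sch HPP).1|exact:rsch_lin].
  by rewrite mom_lin// !unit_mom_rconv//; [ring|exact:unit_mom_rconv].
 move=> s; rewrite mom_lin// mom_dil// mc; case:(boolP (nilp s)) => [/nilP ->|_]; last by rewrite -[false%:R]/(0 : R); ring.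
 by rewrite -[true%:R]/(1 : R) expr0; ring.
have H : rsch (fun x => -1 * dil 2^-1 cubic x + cubic x).
 by apply:rsch_lin cubic_sch; apply:rsch_dil => //; exact:cubic_sch.
have := scl_pair cubic_sch H z; congr scl; apply/funext => -[|j] /=.
 by rewrite -phi_psi0.
rewrite phi_psiS dil_lin dil_dil; apply/funext => x; congr (_ * dil _ _ _ + _).
by rewrite exprS mulrAC mulfV// mul1r.
Qed.
Ltac done ::= extended_done.

Lemma phi_psi_repr f x : rsch f ->
 (fun J => \sum_(j < J) rconv f (rconv (phi j) (psi j)) x) @ \oo --> 1 * f x.
move=> Hf; rewrite mul1r -(cvg_shiftS (fun J => \sum_(j < J) rconv f (rconv (phi j) (psi j)) x)) /=.
have -> : (fun J => \sum_(j < J.+1) rconv f (rconv (phi j) (psi j)) x) = fun J => rconv f (dil (2 ^+ J) cubic) x.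
 apply/funext => J; elim:J => [|J IH].
  by rewrite big_ord_recl big_ord0 addr0 phi_psi0 dil1.
 have Hd j : rsch (dil (2 ^+ j) cubic) by apply:rsch_dil.
 rewrite big_ord_recr /= IH phi_psiS (rconv_linr (-1) Hf (Hd J) (Hd J.+1)).
 by move:(rconv _ _ x) (rconv _ _ x) => a b; ring.
exact:approximate_identity cubic_sch cubic_mass.
Qed.

End resolution.
Hint Resolve usupp_lin usupp_dil usupp_rconv phi_supp psi_supp : fn.

Lemma geom_cvg (R : realType) (u : nat -> R) (D : R) : (forall m, `|u m| <= D * 2^-1 ^+ m) ->
 cvgn (fun J => \sum_(m < J) u m).
move=> Hu; have -> : (fun J => \sum_(m < J) u m) = series u by apply/funext => J; rewrite /series /= big_mkord.
apply:normed_cvg; apply:(series_le_cvg (v_ := geometric D 2^-1)) => //.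
- by move=> m; exact:normr_ge0.
- by move=> m; apply:le_trans (Hu m).
- by apply:is_cvg_geometric_series; rewrite ger0_norm// invf_lt1// ltr1n.
Qed.

Lemma lim_le_bnd (R : realType) (u : nat -> R) (l B : R) : u @ \oo --> l -> (forall J, `|u J| <= B) -> `|l| <= B.
move=> ul H; apply/ler_addgt0Pr => e e0; move/cvgrPdist_le : ul => /(_ _ e0)[N _ /(_ N (leqnn N))] HN.
rewrite -(subrK (u N) l) addrC; apply:le_trans (ler_normD _ _) _; exact:lerD.
Qed.

(** * The extension operator on functionals *)

Section extension_operator.
Context (R : realType) (n : nat).
Local Notation d := n.+1.
Local Notation V := 'rV[R]_d.
Local Notation W := (d.*2).
Local Notation Om := (half_space R n).
Implicit Types (f g chi : V -> R) (x y : V) (s : seq 'I_d) (t : (V -> R) -> R).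

Variable P : V -> R.
Hypothesis P_sch : rsch P.
Hypothesis P_supp : usupp P.
Hypothesis P_mom : unit_mom P.

Local Notation phi := (phi P).
Local Notation psi := (psi P).
Let phi_sc := phi_scl P_sch P_mom.
Let psi_sc := psi_scl P_sch P_mom.
Let phiS j : rsch (phi j). by case:phi_sc. Qed.
Let psiS j : rsch (psi j). by case:psi_sc. Qed.

Definition half : V -> R := \1_Om.

Lemma mbl_half_space : measurable Om.
have := @measurable_coord_rV R d ord_max measurableT _ (measurable_itv `]0, +oo[) => /=.
rewrite setTI; congr measurable; apply/seteqP; split=> x; rewrite /= in_itv andbT//.
Qed.

Lemma halfE y : half y = (0 < lastc y)%R%:R.
rewrite /half; congr (_%:R); congr nat_of_bool; apply/idP/idP => [/set_mem //|H]; exact:mem_set.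
Qed.

Lemma half_le1 y : `|half y| <= 1.
by rewrite halfE; case:ltP; rewrite ?normr1 ?normr0. Qed.

(** The [j]-th term of the extension, paired with [chi] and with the kernels moved onto the test
    function. For [y] in the half space [tshift y (phi j)] vanishes outside it, so [t] is read only
    there. *)
Definition ext_term t j chi := \int[mu]_y (half y * (rconv (psi j) chi y * t (tshift y (phi j)))).
Definition extension t chi := limn (fun J => \sum_(j < J) ext_term t j chi).

Lemma rint_half f : rint f -> rint (fun y => half y * f y).
move=> if_; apply:rint_dom (integrable_norm if_) => [|y].
 by apply:measurable_funM (rint_mbl if_); exact:(indic_mbl mbl_half_space).
by rewrite normrM ler_piMl// half_le1.
Qed.
Hint Resolve rint_half : fn.

Lemma rint_term t j chi : rtemp t -> rsch chi ->
 rint (fun y => rconv (psi j) chi y * t (tshift y (phi j))).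
move=> ht Hc; have [k [A A0 sl]] := slow_shift ht (phiS j).
exact:slow_rint sl (rconv_sch (psiS j) Hc).1.
Qed.
Hint Resolve rint_term : fn.

Lemma rbnd_dil k f (B e : R) : 1 <= e -> rsmth f -> rbnd k f B ->
 rbnd k (dil e f) (4 ^+ k * e ^+ (k + d) * B).
move=> e1 sf HB; have B0 := rbnd_ge0 HB; have e0 : 0 < e by apply:lt_le_trans e1.
have en : e != 0 by rewrite gt_eqF.
have sa : rsmth (f \o aff e 0) by exact:rsmth_aff.
have -> : dil e f = fun x => e ^+ d * (f \o aff e 0) x by apply/funext => x; rewrite /= /aff addr0.
have := rbndZ (e ^+ d) sa (rbnd_aff 0 en sf HB); apply:rbnd_le => //.
rewrite normrX (gtr0_norm e0) normr0 addr0 mulr1 exprD.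
rewrite [leRHS](_ : _ = e ^+ d * ((4 * e) ^+ k * B)); last by rewrite exprMn; ring.
apply:ler_wpM2l => //.
apply:ler_wpM2r => //; apply:lerXn2r; rewrite ?nnegrE//.
- have ei : e^-1 <= 1 by rewrite invf_le1.
 by nra.
Qed.

Lemma fnl_shift_bnd t : rtemp t -> exists k, exists2 C : R, 0 <= C &
 forall j y, `|t (tshift y (phi j))| <= C * (2 ^+ j) ^+ (k + d) * (1 + `|y|) ^+ k.
move=> [lt [k [A A0 HA]]]; have [_ bk _] := phi_sc; have [B HB] := bk k; have B0 := rbnd_ge0 (HB 0%N).
exists k, (A * (4 ^+ k * B)) => //.
move=> j y; have [H1 E _] := scl_unit j phi_sc.
have H2 := rbnd_dil (expr2_ge1 R j) H1.1 (HB j); rewrite E in H2.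
apply:le_trans (HA _ _ (rsch_shiftV y (phiS j)) (rbnd_shift y (phiS j).1 H2)) _.
by apply:eqW; ring.
Qed.

Lemma ext_term_bnd t : rtemp t -> exists M, exists2 C : R, 0 <= C & forall chi B j,
 rsch chi -> rbnd M chi B -> `|ext_term t j chi| <= C * B * 2^-1 ^+ j.
move=> ht; have [k [C C0 HC]] := fnl_shift_bnd ht.
(* On translates of [phi j] the functional may grow like [2 ^ (j (k + d))]; one more order of
   cancellation of [psi j] leaves [2 ^- j]. *)
pose L := (k + d).+1; pose M := (k + W + L)%N.
have [D D0 HD] := scl_rconv psi_sc (leq_addl (k + W) L : (L <= M)%N).
exists (M + M)%N, (C * D * wt_mass R d W); first by rewrite !mulr_ge0 ?wt_mass_ge0.
move=> chi B j Hc HB; have B0 := rbnd_ge0 HB.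
have ri := rint_half (rint_term j ht Hc).
have H := HD j chi B Hc HB; rewrite rconvC// in H.
rewrite [leRHS](_ : _ = C * D * B * 2^-1 ^+ j * wt_mass R d W); last by ring.
apply:(Rint_dom (leqnn W) (rint_mbl ri) _).2 => y.
rewrite normrM; apply:le_trans (ler_piMl _ (half_le1 y)) _ => //.
rewrite normrM; apply:le_trans (ler_pM _ _ (rbnd_wt0 y H) (HC j y)) _ => //.
have w1 : wt M y <= wt W y * wt k y by rewrite -wtD wt_le; lia.
apply:le_trans (_ : 2^-1 ^+ (j * L) * (D * B) * (wt W y * wt k y) * (C * 2 ^+ j ^+ (k + d) * (1 + `|y|) ^+ k) <= _).
 apply:ler_wpM2r => //.
 by apply:ler_wpM2l => //.
rewrite [leLHS](_ : _ = C * D * B * (2^-1 ^+ (j * L) * 2 ^+ j ^+ (k + d)) * wt W y * (wt k y * (1 + `|y|) ^+ k)); last by ring.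
have -> : 2^-1 ^+ (j * L) * 2 ^+ j ^+ (k + d) = 2^-1 ^+ j :> R.
 by rewrite mulnS exprD -exprM -mulrA -exprMn mulVf// expr1n mulr1.
by rewrite wt_exp mulr1.
Qed.

Lemma ext_cvg t chi : rtemp t -> rsch chi ->
 (fun J => \sum_(j < J) ext_term t j chi) @ \oo --> extension t chi.
move=> ht Hc; have [M [C C0 HC]] := ext_term_bnd ht; have [B HB] := Hc.2 M.
exact:(geom_cvg (fun m => HC chi B m Hc HB)).
Qed.

Lemma ext_temp t : rtemp t -> rtemp (extension t).
move=> ht; split=> [a f g Hf Hg|].
 have H := ext_cvg ht (rsch_lin a Hf Hg).
 apply/esym/(cvg_unique _ _ H) => //.
 have E : (fun J => \sum_(j < J) ext_term t j (fun x => a * f x + g x)) =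
   (fun J => a * (\sum_(j < J) ext_term t j f) + \sum_(j < J) ext_term t j g).
  apply/funext => J; rewrite mulr_sumr -big_split; apply:eq_bigr => j _ /=.
  rewrite /ext_term rconv_linr// -RintZ; last exact:rint_half (rint_term j ht Hf).
  rewrite -RintD; last 2 first.
   by apply:rintZ; exact:rint_half (rint_term j ht Hf).
   exact:rint_half (rint_term j ht Hg).
  by apply:eq_Rintegral => y _; ring.
 rewrite E; apply:cvgD; last exact:ext_cvg.
 by apply:cvgMr; exact:ext_cvg.
have [M [C C0 HC]] := ext_term_bnd ht; exists M, (C * 2) => //.
move=> chi B Hc HB; apply:(lim_le_bnd (ext_cvg ht Hc)) => J.
have B0 := rbnd_ge0 HB.
apply:le_trans (ler_norm_sum _ _ _) _.
suff H m : \sum_(j < m) `|ext_term t j chi| <= C * 2 * B * (1 - 2^-1 ^+ m).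
 apply:le_trans (H J) _; rewrite ler_piMr//.
elim:m => [|m IHm]; first by rewrite big_ord0 subrr.
rewrite big_ord_recr; apply:le_trans (lerD IHm (HC chi B m Hc HB)) _.
by rewrite exprS; apply:eqW; field.
Qed.
Hint Resolve ext_temp : fn.

Ltac done ::= basic_done.
(** [tshift y (phi j)] vanishes below the height [lastc y > 0], so it is enough that the functionals
    agree on functions supported at a positive distance from the boundary. *)
Lemma ext_local t t' : (forall f (e : R), rsch f -> 0 < e -> (forall x, lastc x < e -> f x = 0) -> t f = t' f) ->
 extension t = extension t'.
move=> H; apply/funext => chi.
suff E : (fun J => \sum_(j < J) ext_term t j chi) = (fun J => \sum_(j < J) ext_term t' j chi) by rewrite /extension E.
apply/funext => J; apply:eq_bigr => j _.
apply:eq_Rintegral => y _; rewrite halfE; case:ltP => y0; last by rewrite !mul0r.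
rewrite (H (tshift y (phi j)) (lastc y))// => [|x xy]; first exact:rsch_shiftV.
rewrite /tshift phi_supp//.
by rewrite /lastc !mxE; move:xy; rewrite /lastc; lra.
Qed.
Ltac done ::= extended_done.

(** If [chi] lives in the half space, so does [rconv (psi j) chi], and the indicator is invisible;
    what remains is the reproducing formula of [phi] and [psi]. *)
Lemma ext_upper t chi : rtemp t -> rsch chi -> usupp chi -> extension t chi = t chi.
move=> ht Hc Sc; apply/(cvg_unique _ (ext_cvg ht Hc)) => //.
have [D HD] := scl_temp ht (phi_psi_scl P_sch P_mom) Hc
 (fun b Hb x => @phi_psi_repr R n P P_sch P_mom b x Hb).
have E : (fun J => \sum_(j < J) ext_term t j chi) = fun J => \sum_(j < J) t (rconv chi (rconv (phi j) (psi j))).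
 apply/funext => J; apply:eq_bigr => j _; rewrite /ext_term.
 rewrite (rconvC Hc (rconv_sch (phiS j) (psiS j)).1) -(rconvA (phiS j) (psiS j) Hc) (exchange ht (rconv_sch (psiS j) Hc).1 (phiS j)).
 apply:eq_Rintegral => y _; rewrite halfE; case:ltP => y0; first by rewrite mul1r.
 by rewrite usupp_rconv ?mul0r.
rewrite E; apply/cvgrPdist_le => r r1.
have : (fun J => D * 2^-1 ^+ J) @ \oo --> D * 0.
 by apply:cvgMr; apply:cvg_expr; rewrite ger0_norm// invf_lt1// ltr1n.
rewrite mulr0 => /cvgrPdist_le/(_ _ r1)[N _ HN]; exists N => // J /HN; rewrite sub0r normrN => H.
by have := HD J; rewrite mul1r => /le_trans; apply; apply:le_trans (ler_norm _) H.
Qed.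

Section cutoff.
Variable bump : V -> R.
Hypothesis bump_sch : rsch bump.
Hypothesis bump0 : bump 0 = 1.

(** The cut-off functions tend to [f] in the seminorm of [t] at rate [e]: the function
    [1 - bump (e x)] and its derivatives are [O(e (1 + |x|))]. *)
Lemma cutoff_temp t f : rtemp t -> rsch f ->
 (forall e : R, 0 < e -> t (fun x => f x * bump (e *: x)) = 0) -> t f = 0.
move=> [lt [k [A A0 HA]]] Hf H0; have [B HB] := Hf.2 k.+1; have B0 := rbnd_ge0 HB.
have [D HD] := rsch_sup bump_sch k.+1.
have D0 : 0 <= D by apply:le_trans (HD [::] 0 isT).
pose C := A * (2 ^+ k * (B * (d%:R * D + D))).
have C0 : 0 <= C by rewrite /C.
suff key (e : R) : 0 < e -> e <= 1 -> `|t f| <= C * e.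
 apply/eqP; rewrite -normr_le0; apply/ler_addgt0Pr => r r0; rewrite add0r.
 pose e := Num.min 1 (r / (C + 1)).
 have e0 : 0 < e by rewrite lt_min ltr01 divr_gt0.
 apply:le_trans (key e e0 _) _; first by rewrite ge_min lexx.
 apply:le_trans (_ : (C + 1) * (r / (C + 1)) <= _); last by rewrite mulrC divfK.
 by apply:ler_pM => //; [rewrite lerDl|rewrite ge_min lexx orbT].
move=> e0 e1; have en : e != 0 by rewrite gt_eqF.
pose g x := 1 - bump (e *: x).
have Hbe := rsch_dilation en bump_sch.
have sg : rsmth g.
 have -> : g = (cst 1 \+ (fun x => -1 * bump (e *: x))) by apply/funext => x; rewrite /= mulN1r.
 by [].
have dg s x : (size s <= k)%N -> `|diter s g x| <= e * (d%:R * D + D) * (1 + `|x|).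
 move=> sk; have x1 : 1 <= 1 + `|x| by rewrite lerDl.
 case:s sk => [|i s] sk.
  rewrite [diter _ _ _](_ : _ = bump 0 - bump (e *: x)); last by rewrite bump0.
  have := lipschitz_bnd (A := D) bump_sch.1 (fun i y => HD [:: i] y isT) 0 (e *: x).
  rewrite add0r distrC normrZ (gtr0_norm e0) => /le_trans; apply.
  rewrite [leLHS](_ : _ = e * (d%:R * D) * `|x|); last by ring.
  apply:ler_pM => //.
   by apply:ler_wpM2l => //; rewrite lerDl.
  by rewrite lerDr.
 have E1 : dpart i g = fun x => -1 * dpart i (fun x => bump (e *: x)) x.
  apply/funext => z; have -> : g = (cst 1 \+ (fun x => -1 * bump (e *: x))) by apply/funext => y; rewrite /= mulN1r.
  rewrite -[X in dpart i X z]/((cst 1 : V -> R) \+ (fun x => -1 * bump (e *: x))).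
  have dd := rsmthZ (-1) Hbe.1.
  have := diterD [:: i] (rsmth_cst (1 : R)) dd => /= ->.
  have := diterZ [:: i] (-1) Hbe.1 => /= ->.
  by rewrite [dpart i (cst 1) z](_ : _ = 0) ?add0r// dpartE derive_cst.
 have -> : diter (i :: s) g x = -1 * diter (rcons s i) (fun x => bump (e *: x)) x.
  have -> : diter (i :: s) g = diter (rcons s i) g by apply:diter_perm => //; rewrite perm_sym perm_rcons.
  rewrite -cats1 !diter_cat /= E1 diterZ//.
 have Eb : (fun x => bump (e *: x)) = bump \o aff e 0 by apply/funext => y; rewrite /= /aff addr0.
 rewrite mulN1r normrN Eb diter_aff//.
 rewrite normrM normrX (gtr0_norm e0) size_rcons.
 apply:le_trans (_ : e * (d%:R * D + D) <= _); last by rewrite ler_peMr.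
 apply:ler_pM => //.
  by rewrite exprS ler_piMr ?exprn_ile1.
 apply:le_trans (HD _ _ _) _; first by rewrite size_rcons leqW.
 by rewrite lerDr.
have HR : rbnd k (f \* g) (2 ^+ k * (B * (d%:R * D + D)) * e).
 move=> s x sk.
 have := leibniz (A := B * wt k.+1 x) (B := e * (d%:R * D + D) * (1 + `|x|)) Hf.1 sg
  (fun u us => rbnd_wt x HB (leqW (leq_trans us sk))) (fun u us => dg u x (leq_trans us sk)).
 move=> H; apply:le_trans (ler_wpM2l (ltW (onrmX_gt0 k x)) H) _.
 have w : (1 + `|x|) ^+ k * wt k.+1 x * (1 + `|x|) = 1.
  by rewrite mulrAC -exprSr mulrC wt_exp.
 rewrite [leLHS](_ : _ = 2 ^+ size s * (B * (d%:R * D + D)) * e * ((1 + `|x|) ^+ k * wt k.+1 x * (1 + `|x|))); last by ring.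
 rewrite w mulr1; apply:ler_wpM2r => //.
 apply:ler_wpM2r => //.
 by rewrite ler_weXn2l ?ler1n.
have Hfb : rsch (fun x => f x * bump (e *: x)) by exact:rschM.
have E : f \* g = fun x => f x - f x * bump (e *: x) by apply/funext => x; rewrite /= mulrBr mulr1.
have := HA _ _ (_ : rsch (f \* g)) HR; rewrite E => /(_ (rschB Hf Hfb)).
by rewrite rlinB// H0// subr0 -!mulrA.
Qed.

End cutoff.

End extension_operator.
Hint Resolve rint_half rint_term ext_temp : fn.

(** * Peetre weights and sums over scales *)

Section peetre_weights.
Context (R : realType) (d : nat).
Local Notation V := 'rV[R]_d.
Local Notation W := (d.*2).
Implicit Types (x y z : V).

Definition nrm l x : R := 1 + `|(2 : R) ^+ l *: x|.

Lemma nrm_ge1 l x : 1 <= nrm l x. exact:onrm_ge1. Qed.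
Hint Resolve nrm_ge1 : pos.
Lemma nrm_ge0 l x : 0 <= nrm l x. by []. Qed.
Hint Resolve nrm_ge0 : pos.
Lemma nrmN l x : nrm l (- x) = nrm l x. by rewrite /nrm scalerN normrN. Qed.

Lemma nrm_tri l x y z : nrm l (x - z) <= nrm l (x - y) * nrm l (y - z).
have := @onrm_sub R d (2 ^+ l *: (x - z)) (2 ^+ l *: (y - z)).
by rewrite -scalerBr opprB addrA subrK.
Qed.

Lemma nrm_gap k l x : nrm l x <= 2 ^+ gap k l * nrm k x.
rewrite mulrDr mulr1; apply:lerD => //; rewrite !normrZ !ger0_norm// mulrA -exprD.
by apply:ler_wpM2r => //; rewrite ler_weXn2l ?ler1n /gap; lia.
Qed.

Lemma eta_nrm a M l x : eta (a + M) l x * nrm l x ^+ a = eta M l x.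
by rewrite /eta addnC wtD -!mulrA wt_exp mulr1. Qed.

Lemma eta_ge0 M l x : 0 <= eta M l x.
by rewrite mulr_ge0 ?wt_ge0. Qed.
Hint Resolve eta_ge0 : pos.

Lemma eta_int l x : rint (fun y => eta W l (y - x)) /\ \int[mu]_y eta W l (y - x) = wt_mass R d W.
have e0 := expr2_gt0 R l; have en : (2 : R) ^+ l != 0 by rewrite gt_eqF.
have E y : eta W l (y - x) = (2 ^+ l) ^+ d * (wt W \o aff (2 ^+ l) (- (2 ^+ l *: x))) y.
 by rewrite /eta scalerBr.
have ia := rint_aff (- (2 ^+ l *: x)) en (@rint_wt R d W (leqnn W)).
rewrite (funext E); split; first exact:rintZ.
rewrite RintZ// (Rint_aff (- (2 ^+ l *: x)) en (@rint_wt R d W (leqnn W))) gtr0_norm//.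
rewrite mulrA -exprMn mulfV// expr1n mul1r; by [].
Qed.

Lemma pow2_le (A B D E : nat) : (B + E <= A + D)%N -> (2^-1 : R) ^+ A * 2 ^+ B <= 2 ^+ D * 2^-1 ^+ E.
move=> H; rewrite !exprVn mulrC ler_pdivrMr// mulrAC ler_pdivlMr//.
by rewrite -!exprD ler_weXn2l ?ler1n// [(D + A)%N]addnC.
Qed.

(** The levels below [k] contribute at most 1, those from [k] on at most 2; the induction follows
    the two geometric series. *)
Lemma gap_sum k J : \sum_(j < J) (2^-1 : R) ^+ gap j k <= 3.
have i1 (r : nat) : (2^-1 : R) ^+ r <= 1 by rewrite exprn_ile1// invf_le1// ler1n.
suff H : \sum_(j < J) (2^-1 : R) ^+ gap j k <= if (J <= k)%N then 2^-1 ^+ (k - J) else 3 - 2 * 2^-1 ^+ (J - k).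
 apply:le_trans H _; case:ifP => _; last by rewrite gerBl.
 by apply:le_trans (i1 _) _; rewrite ler1n.
elim:J => [|J IH]; first by rewrite big_ord0.
rewrite big_ord_recr /=; apply:le_trans (lerD IH (lexx _)) _.
case:(ltngtP J k) => Jk.
- have -> : gap J k = (k - J)%N by rewrite /gap; lia.
 have -> : (k - J = (k - J.+1).+1)%N by lia.
 by rewrite exprS; move:(_ ^+ _) => u; lra.
- have -> : gap J k = (J - k)%N by rewrite /gap; lia.
 have -> : (J.+1 - k = (J - k).+1)%N by lia.
 by rewrite exprS; move:(_ ^+ _) => u; lra.
- rewrite Jk /gap subnn subSnn; lra.
Qed.

Lemma gap_triangle j k l : (gap k l <= gap j k + gap j l)%N.
rewrite /gap; lia. Qed.

Lemma gapC j k : gap j k = gap k j. by rewrite /gap addnC. Qed.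

End peetre_weights.
Hint Resolve nrm_ge1 nrm_ge0 eta_ge0 : pos.

(** * Blocks of the extension in terms of blocks of the functional *)

Section block_estimate.
Context (R : realType) (n : nat).
Local Notation d := n.+1.
Local Notation V := 'rV[R]_d.
Local Notation C := R[i].
Local Notation W := (d.*2).
Local Notation S := (schwartz R d).
Context (theta : nat -> S) (theta_Phi : Phi theta).
Implicit Types (x y z : V) (T : S -> C).

Variable c : R.
Hypothesis c_neq0 : c != 0.
Hypothesis c_inv : forall f : V -> R, rsch f -> \int[mu]_xi rfour false f xi = c * f 0.
Local Notation ci := (cinv d c).

Variable P : V -> R.
Hypothesis P_sch : rsch P.
Hypothesis P_supp : usupp P.
Hypothesis P_mom : unit_mom P.

Local Notation phi := (phi P).
Local Notation psi := (psi P).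
Let phi_sc := phi_scl P_sch P_mom.
Let psi_sc := psi_scl P_sch P_mom.
Let phiS j : rsch (phi j). by case:phi_sc. Qed.
Let psiS j : rsch (psi j). by case:psi_sc. Qed.

Lemma ci_neq0 : 0 < `|ci|.
by rewrite normr_gt0 mulf_neq0// expf_neq0// gt_eqF// c0_gt0. Qed.

Lemma normc_win a L : exists2 D : R, 0 <= D & forall j l y z,
 normc (cconv (kern (win theta l)) (toC (tshift y (phi j))) z) <= D * 2^-1 ^+ (gap j l * L) * eta (a + W) l (z - y).
have [D0 D00 H0] := almost_orth L (a + W) phi_sc (win_kern_scl theta_Phi c_inv false).
have [D1 D10 H1] := almost_orth L (a + W) phi_sc (win_kern_scl theta_Phi c_inv true).
exists (D0 + D1) => [|j l y z]//.
have [w1 w2] := csch_kern (win_sch theta l).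
have r0 (h : V -> R) u : rconv h (cst 0) u = 0.
 by rewrite -[RHS](Rint_cst0 R d); apply:eq_Rintegral => v _; rewrite mulr0.
apply:le_trans (normc_le _) _; rewrite /= !r0 subr0 add0r -[Re \o toC _]/(tshift y (phi j)).
rewrite !rconv_shift// (rconvC w1 (phiS j)) (rconvC w2 (phiS j)) !mulrDl.
by apply:lerD; [exact:H0|exact:H1].
Qed.

(** [H l] stands for the value at [x] of the Peetre maximal function of the block of level [l]. The
    triangle inequality for [nrm] moves the weight from [z] to [y], at the price of [a] orders of
    [eta]. *)
Lemma block_shift_bnd a L : exists2 D : R, 0 <= D & forall T x (H : nat -> R), tempered T ->
 (forall l z, normc (block theta T l z) <= H l * nrm l (x - z) ^+ a) ->
 forall j l y, normc (ev T (cconv (kern (theta l)) (toC (tshift y (phi j))))) <=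
  D * 2^-1 ^+ (gap j l * L) * H l * nrm l (x - y) ^+ a.
have [D D0 HD] := normc_win a L; exists (`|ci|^-1 * (2 * (D * wt_mass R d W))).
 by rewrite !mulr_ge0 ?wt_mass_ge0.
move=> T x H tT HT j l y; have c0 := ci_neq0.
have [i1 i2] := block_repr theta_Phi c_inv l tT (csch_toC (rsch_shiftV y (phiS j))).
have H0 : 0 <= H l.
 have := le_trans (normc_ge0 _) (HT l x); rewrite pmulr_lge0// exprn_gt0//.
 exact:lt_le_trans (nrm_ge1 _ _).
rewrite -!mulrA ler_pdivlMl// -normcr -normcM i2.
apply:le_trans (normc_cint i1) _; apply:ler_wpM2l => //.
have [ie Ie] := eta_int l y.
rewrite [leRHS](_ : _ = (D * 2^-1 ^+ (gap j l * L) * H l * nrm l (x - y) ^+ a) * wt_mass R d W); last by ring.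
rewrite -Ie -RintZ//; apply:Rint_le; [exact:crint_normc i1|exact:rintZ|move=> z].
rewrite normcM; apply:le_trans (ler_pM (normc_ge0 _) (normc_ge0 _) (HD j l y z) (HT l z)) _.
rewrite -(eta_nrm a W) -[nrm l (z - y)]nrmN opprB.
rewrite [leLHS](_ : _ = (D * 2^-1 ^+ (gap j l * L) * H l * eta (a + W) l (z - y)) * nrm l (x - z) ^+ a); last by ring.
rewrite [leRHS](_ : _ = (D * 2^-1 ^+ (gap j l * L) * H l * eta (a + W) l (z - y)) * (nrm l (x - y) * nrm l (y - z)) ^+ a); last by rewrite exprMn; ring.
apply:ler_wpM2l; first by rewrite !mulr_ge0 ?invr_ge0.
by apply:lerXn2r; rewrite ?nnegrE ?mulr_ge0 ?nrm_ge0//; exact:nrm_tri.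
Qed.

(** Measuring the distance at scale [k] instead of [l] costs [2 ^ (gap k l * a)], so the rate
    [a + L] is spent; the triangle inequality for [gap] leaves a loss in [gap j k]. *)
Lemma fnl_ptr_bnd a L : exists2 D : R, 0 <= D & forall T x k (H : nat -> R) (B : R) e, tempered T ->
 (forall l z, normc (block theta T l z) <= H l * nrm l (x - z) ^+ a) ->
 (forall J, \sum_(l < J) 2^-1 ^+ (gap k l * L) * H l <= B) ->
 forall j y, `|tpart e T (tshift y (phi j))| <= D * 2 ^+ (gap j k * (a + L)) * B * nrm k (x - y) ^+ a.
have [D D0 HD] := block_shift_bnd a (a + L); exists (`|ci|^-1 * D) => //.
move=> T x k H B e tT HT HB j y; have c0 := ci_neq0.
rewrite -!mulrA ler_pdivlMl// !mulrA.
have H0 l : 0 <= H l.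
 have := le_trans (normc_ge0 _) (HT l x); rewrite pmulr_lge0// exprn_gt0//.
 exact:lt_le_trans (nrm_ge1 _ _).
pose q := D * 2 ^+ (gap j k * (a + L)) * nrm k (x - y) ^+ a.
have q0 : 0 <= q by rewrite !mulr_ge0.
rewrite [leRHS](_ : _ = q * B); last by rewrite /q; ring.
have FB := fnl_bnd theta_Phi c_inv e tT (rsch_shiftV y (phiS j)) (w := fun l => q * (2^-1 ^+ (gap k l * L) * H l)) (B := q * B).
apply:FB.
 move=> l; apply:le_trans (HD T x H tT HT j l y) _.
 have nn : nrm l (x - y) ^+ a <= (2 ^+ gap k l * nrm k (x - y)) ^+ a.
  by apply:lerXn2r; rewrite ?nnegrE//; exact:nrm_gap.
 apply:le_trans (ler_wpM2l _ nn) _ => //.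
 rewrite /q exprMn -exprM.
 rewrite [leLHS](_ : _ = (D * H l * nrm k (x - y) ^+ a) * (2^-1 ^+ (gap j l * (a + L)) * 2 ^+ (gap k l * a))); last by ring.
 rewrite [leRHS](_ : _ = (D * H l * nrm k (x - y) ^+ a) * (2 ^+ (gap j k * (a + L)) * 2^-1 ^+ (gap k l * L))); last by ring.
 apply:ler_wpM2l => //.
 by apply:pow2_le; rewrite -mulnDr -mulnDl leq_mul2r [(gap j l + _)%N]addnC gap_triangle orbT.
by move=> J; rewrite -mulr_sumr; exact:ler_wpM2l.
Qed.

(** Tested against the kernel of level [k], [psi j] gains the order [(a + L).+1] in [gap j k], one
    more than [fnl_ptr_bnd] loses, and the sum over [j] converges. *)
Lemma ext_ptr_bnd a L : exists2 D : R, 0 <= D & forall T x k (H : nat -> R) (B : R) e e', tempered T ->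
 (forall l z, normc (block theta T l z) <= H l * nrm l (x - z) ^+ a) ->
 (forall J, \sum_(l < J) 2^-1 ^+ (gap k l * L) * H l <= B) ->
 `|extension P (tpart e T) (tshift x (cpart e' (kern (theta k))))| <= D * B.
have [D D0 HD] := fnl_ptr_bnd a L.
have [E0 E00 HE0] := almost_orth (a + L).+1 (a + W) psi_sc (theta_kern_scl theta_Phi c_inv false).
have [E1 E10 HE1] := almost_orth (a + L).+1 (a + W) psi_sc (theta_kern_scl theta_Phi c_inv true).
exists (3 * ((E0 + E1) * D * wt_mass R d W)) => [|T x k H B e e' tT HT HB].
 by rewrite !mulr_ge0 ?wt_mass_ge0.
have B0 : 0 <= B by have := HB 0%N; rewrite big_ord0.
have HK : rsch (cpart e' (kern (theta k))).
 by have [K1 K2] := csch_kern (sch_csch (theta k)); case:(e').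
have HKx := rsch_shiftV x HK.
have ht := tpart_temp e tT.
apply:(lim_le_bnd (ext_cvg P_sch P_mom ht HKx)) => J.
have HE j y : `|rconv (psi j) (cpart e' (kern (theta k))) y| <= (E0 + E1) * 2^-1 ^+ (gap j k * (a + L).+1) * eta (a + W) k y.
 rewrite !mulrDl; have e0 : 0 <= 2^-1 ^+ (gap j k * (a + L).+1) * eta (a + W) k y.
  by rewrite mulr_ge0 ?eta_ge0.
 case:(e'); [apply:le_trans (HE1 j k y) _; rewrite lerDr|apply:le_trans (HE0 j k y) _; rewrite lerDl];
  by rewrite -mulrA.
have term j : `|ext_term P (tpart e T) j (tshift x (cpart e' (kern (theta k))))| <=
  ((E0 + E1) * D * wt_mass R d W) * B * 2^-1 ^+ gap j k.
 have [ie Ie] := eta_int k x.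
 rewrite [leRHS](_ : _ = ((E0 + E1) * D * B * 2^-1 ^+ gap j k) * wt_mass R d W); last by ring.
 rewrite -Ie -RintZ//; apply:Rint_norm_le => //; [exact:rintZ|move=> y].
 rewrite normrM; apply:le_trans (ler_piMl _ (half_le1 y)) _ => //.
 rewrite normrM rconv_shift//.
 apply:le_trans (ler_pM (normr_ge0 _) (normr_ge0 _) (HE j (y - x)) (HD T x k H B e tT HT HB j y)) _.
 rewrite -(eta_nrm a W) -[nrm k (x - y)]nrmN opprB.
 rewrite [leLHS](_ : _ = ((E0 + E1) * D * B * eta (a + W) k (y - x) * nrm k (y - x) ^+ a) * (2^-1 ^+ (gap j k * (a + L).+1) * 2 ^+ (gap j k * (a + L)))); last by ring.
 rewrite [leRHS](_ : _ = ((E0 + E1) * D * B * eta (a + W) k (y - x) * nrm k (y - x) ^+ a) * (2 ^+ 0 * 2^-1 ^+ gap j k)); last by rewrite expr0; ring.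
 have E01 := addr_ge0 E00 E10.
 apply:ler_wpM2l.
  by apply:mulr_ge0 => //; apply:mulr_ge0 => //; exact:eta_ge0.
 by apply:pow2_le; rewrite addn0 mulnS addnC.
apply:le_trans (ler_norm_sum _ _ _) _.
pose Q := (E0 + E1) * D * wt_mass R d W * B.
apply:(@le_trans _ _ (\sum_(j < J) Q * 2^-1 ^+ gap j k)); first by apply:ler_sum => j _; by [].
have m0 := wt_mass_ge0 R d W; have E01 := addr_ge0 E00 E10.
have Q0 : 0 <= Q by rewrite /Q.
rewrite -mulr_sumr; apply:le_trans (ler_wpM2l Q0 (gap_sum R k J)) _.
by rewrite /Q; apply:eqW; ring.
Qed.

Definition extD T : S -> C := ofparts (extension P (tpart false T)) (extension P (tpart true T)).

Lemma extD_temp T : tempered T -> tempered (extD T).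
by move=> tT; apply:ofparts_temp.
Qed.
Hint Resolve extD_temp : fn.

Let sum4 (u1 u2 u3 u4 v : R) : u1 <= v -> u2 <= v -> u3 <= v -> u4 <= v -> u1 + u2 + (u3 + u4) <= 4 * v.
lra. Qed.

Ltac done ::= basic_done.
Theorem extD_block_bnd a L : exists2 D : R, 0 <= D & forall T x k (H : nat -> R) (B : R), tempered T ->
 (forall l z, normc (block theta T l z) <= H l * nrm l (x - z) ^+ a) ->
 (forall J, \sum_(l < J) 2^-1 ^+ (gap k l * L) * H l <= B) ->
 normc (block theta (extD T) k x) <= D * B.
have [D D0 HD] := ext_ptr_bnd a L; exists (4 * D) => [|T x k H B tT HT HB]; first exact:mulr_ge0.
have h e e' := HD T x k H B e e' tT HT HB.
have HK := csch_shift x (csch_kern (sch_csch (theta k))).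
rewrite /block /ev /extD /ofparts.
apply:le_trans (normc_le _) _; rewrite /=.
rewrite to_schE//.
rewrite -[Re \o _]/(tshift x (cpart false (kern (theta k)))) -[Im \o _]/(tshift x (cpart true (kern (theta k)))).
apply:le_trans (lerD (ler_normB _ _) (ler_normD _ _)) _.
rewrite -mulrA; exact:sum4.
Qed.
Ltac done ::= extended_done.

(** Taken from the reproducing formula with the window kernel. [M] is arbitrary and the block has
    polynomial growth, so the integral may be infinite for small [M]; hence the extended reals. *)
Lemma block_smean M : exists2 D : R, 0 <= D & forall T l x, tempered T ->
 ((normc (block theta T l x))%:E <= D%:E * \int[mu]_z (eta M l (z - x) * normc (block theta T l z))%:E)%E.
have key e : exists2 D : R, 0 <= D & forall l z, `|cpart e (kern (win theta l)) z| <= D * eta M l z.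
 have sc := win_kern_scl theta_Phi c_inv e; have [Hs bs _] := sc.
 have [B HB] := bs M; have B0 := rbnd_ge0 (HB 0%N); exists B => // l z.
 have := rbnd_wt0 (2 ^+ l *: z) (HB l); rewrite {1}/dil scalerA mulVf// scale1r normrM.
 rewrite ger0_norm// exprVn ler_pdivrMl//.
 by rewrite mulrCA.
have [D0 D00 H0] := key false; have [D1 D10 H1] := key true.
have c0 := ci_neq0.
exists (`|ci|^-1 * (2 * (D0 + D1))) => [|T l x tT]//.
have [i1 i2] := block_reproduces theta_Phi c_inv l x tT.
have K z : normc (kern (win theta l) (z - x)) <= (D0 + D1) * eta M l (z - x).
 apply:le_trans (normc_le _) _; rewrite mulrDl; apply:lerD; [exact:H0|exact:H1].
have ri := crint_normc i1.
have le1 : normc (block theta T l x) <= `|ci|^-1 * 2 * \int[mu]_z normc (kern (win theta l) (z - x) * block theta T l z).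
 by rewrite -mulrA ler_pdivlMl// -normcr -normcM i2; exact:normc_cint.
have gm : meas (fun z => normc (block theta T l z)).
 have [k [A A0 [S1 S2]]] := ev_shift_cont tT (csch_kern (sch_csch (theta l))).
 rewrite (_ : (fun x => _) = @Num.sqrt R \o (fun z => Re (block theta T l z) ^+ 2 + Im (block theta T l z) ^+ 2)); last first.
  by apply/funext => z /=; case:(block theta T l z).
 apply:measurableT_comp; first by apply:continuous_measurable_fun; exact:sqrt_continuous.
 by apply:measurable_funD; apply:measurable_funX; [case:S1|case:S2].
have em : meas (fun z => eta M l (z - x)).
 apply:measurable_funM => //.
 have -> : (fun z => wt M (2 ^+ l *: (z - x))) = wt M \o aff (2 ^+ l) (- (2 ^+ l *: x)).
  by apply/funext => z; rewrite scalerBr.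
 by apply:measurableT_comp; [exact:mbl_wt|exact:mbl_aff].
apply:(@le_trans _ _ ((`|ci|^-1 * 2)%:E * (\int[mu]_z (normc (kern (win theta l) (z - x) * block theta T l z))%:E))%E).
 apply:(@le_trans _ _ (`|ci|^-1 * 2 * \int[mu]_z normc (kern (win theta l) (z - x) * block theta T l z))%:E) => //.
 rewrite EFinM fineK//; exact:integrable_fin_num ri.
rewrite mulrA [(_ * (D0 + D1))%:E]EFinM -muleA; apply:lee_wpmul2l => //.
rewrite -ge0_integralZl_EFin//.
- apply:ge0_le_integral => //.
 + by move=> z _; rewrite lee_fin normc_ge0.
 + by apply/measurable_EFinP; exact:rint_mbl ri.
 + apply/measurable_EFinP; apply:measurable_funM => //; by [].
 + move=> z _; rewrite -EFinM normcM mulrA; apply:ler_wpM2r => //; exact:normc_ge0.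
- by move=> z _; rewrite lee_fin mulr_ge0 ?eta_ge0 ?normc_ge0.
Qed.

End block_estimate.
Hint Resolve extD_temp : fn.

(** * Telescoping inequalities for powers of sums *)

Section power_inequalities.
Context (R : realType).
Implicit Types (r u v b : R).

(** Young's inequality for the product [r * 1] with exponent [v]. *)
Lemma bernoulli_powR r v : 0 <= r -> 1 <= v -> 1 - r `^ v <= v * (1 - r).
move=> r0; rewrite le_eqVlt => /predU1P[<-|v1]; first by rewrite powRr1// mul1r.
have v0 : 0 < v by exact:lt_trans v1.
have iv1 : v^-1 < 1 by rewrite invf_lt1.
have q0 : 0 < 1 - v^-1 by rewrite subr_gt0.
have := @conjugate_powR R r 1 v ((1 - v^-1)^-1) r0 ler01 v0.
rewrite invr_gt0 q0 invrK mulr1 powR1 => /(_ isT).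
have -> : v^-1 + (1 - v^-1) = 1 by ring.
move=> /(_ erefl); rewrite mul1r => H.
have := ler_wpM2l (ltW v0) H; rewrite mulrDr mulrBr mulr1 mulfV// mulrC.
have -> : v * (r `^ v / v) = r `^ v by rewrite mulrC mulfVK.
by move:(r `^ v) => w; lra.
Qed.

Lemma powR_split u v : 0 < u -> u `^ v = u * u `^ (v - 1).
move=> u0; have {1}-> : v = 1 + (v - 1) by ring.
by rewrite (@powRD _ u 1 (v - 1)) ?(gt_eqF u0) ?implybT// powRr1.
Qed.

Lemma powR_step_le u b v : 0 < u -> 0 <= b -> 0 < v ->
 (u + b) `^ v - u `^ v <= Num.max 1 v * (b * (u + b) `^ (v - 1)).
move=> u0 b0 v0; set w := u + b; have w0 : 0 < w by rewrite ltr_wpDr.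
have r1 : u / w <= 1 by rewrite ler_pdivrMr// mul1r lerDl.
have -> : u `^ v = w `^ v * (u / w) `^ v.
 by rewrite -powRM// [w * _]mulrC mulfVK.
have -> : b * w `^ (v - 1) = w `^ v * (1 - u / w).
 rewrite [w `^ v]powR_split// mulrAC; congr (_ * _).
 by rewrite mulrBr [w * (u / w)]mulrC mulfVK// /w; ring.
rewrite -[X in X - _]mulr1 -mulrBr mulrCA; apply:ler_wpM2l => //.
have [v1|v1] := leP 1 v.
 exact:bernoulli_powR.
rewrite mul1r lerB//; apply:ger1_powR => //.
Qed.

Lemma powR_step_ge u b v : 0 <= u -> 0 <= b -> 0 < v -> v <= 1 ->
 b * (u + b) `^ (v - 1) <= v^-1 * ((u + b) `^ v - u `^ v).
move=> u0 b0 v0 v1; rewrite ler_pdivlMl//.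
have [b0'|bn] := eqVneq b 0; first by rewrite b0' addr0 subrr mul0r mulr0.
have b1 : 0 < b by rewrite lt_neqAle eq_sym.
set w := u + b; have w0 : 0 < w by rewrite ltr_wpDl.
have -> : u `^ v = w `^ v * (u / w) `^ v.
 by rewrite -powRM// [w * _]mulrC mulfVK.
have -> : b * w `^ (v - 1) = w `^ v * (1 - u / w).
 rewrite [w `^ v]powR_split// mulrAC; congr (_ * _).
 by rewrite mulrBr [w * (u / w)]mulrC mulfVK// /w; ring.
rewrite -[X in _ <= X - _]mulr1 -mulrBr mulrCA; apply:ler_wpM2l => //.
have iv : 1 <= v^-1 by rewrite -[leLHS]invr1 lef_pV2// posrE.
have := bernoulli_powR (powR_ge0 (u / w) v) iv.
rewrite -powRrM mulfV// powRr1// => H.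
by have := ler_wpM2l (ltW v0) H; rewrite mulrA mulfV// mul1r.
Qed.

(** A discrete form of [d(U ^ v) = v U ^ (v - 1) dU]. It trades the power of a sum over levels for
    terms each attached to one level. *)
Lemma tele_upper (u0 v : R) (b : nat -> R) J : 0 < u0 -> 0 < v -> (forall j, 0 <= b j) ->
 (u0 + \sum_(j < J) b j) `^ v <= u0 `^ v +
  Num.max 1 v * \sum_(j < J) b j * (u0 + \sum_(i < j.+1) b i) `^ (v - 1).
move=> u00 v0 b0; elim:J => [|J IH]; first by rewrite !big_ord0 mulr0 !addr0.
rewrite [X in _ <= _ + _ * X]big_ord_recr/= mulrDr addrA -lerBlDr.
apply:le_trans IH; rewrite lerBlDr -lerBlDl big_ord_recr/= addrA.
by apply:powR_step_le => //.
Qed.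

Lemma tele_lower (u0 v : R) (b e : nat -> R) J : 0 < u0 -> 0 < v -> v <= 1 ->
 (forall j, 0 <= e j) -> (forall j, e j <= b j) ->
 \sum_(j < J) e j * (u0 + \sum_(i < j.+1) b i) `^ (v - 1) <= v^-1 * (\sum_(j < J) e j) `^ v.
move=> u00 v0 v1 e0 eb; elim:J => [|J IH]; first by rewrite big_ord0.
rewrite big_ord_recr/=; apply:le_trans (lerD IH (lexx _)) _; rewrite -lerBrDl.
have s0 : 0 <= \sum_(j < J) e j by rewrite sumr_ge0.
rewrite [X in _ <= _ * X `^ _ - _]big_ord_recr/= -mulrBr.
apply:le_trans (powR_step_ge s0 (e0 J) v0 v1).
have [->|en] := eqVneq (e J) 0; first by rewrite !mul0r.
apply:ler_wpM2l => //.
have eJ : 0 < e J by rewrite lt_neqAle eq_sym en e0.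
have sJ : 0 < \sum_(j < J) e j + e J by rewrite ltr_wpDl.
have le : \sum_(j < J) e j + e J <= u0 + \sum_(i < J.+1) b i.
 rewrite big_ord_recr/= -[leLHS]add0r; apply:lerD => //.
 by apply:lerD => //; apply:ler_sum.
rewrite -[v - 1]opprB !powRN lef_pV2 ?posrE ?powR_gt0 ?(lt_le_trans sJ le)//.
by apply:ge0_ler_powR; rewrite ?nnegrE ?subr_ge0// ltW// (lt_le_trans sJ le).
Qed.

(** Only parts [e j] of the increments are summed, against powers of the full sums. For [v <= 1] the
    full sums may be replaced by those of [e], and telescoping back gives a power of the latter. For
    [v > 1], either the sum of [e] is at most [dl] times the full sum, or the full sum is at most
    [dl ^-1] times that of [e]. *)
Lemma tele_absorb (u0 v vm dl : R) (b e : nat -> R) J : 0 < u0 -> 0 < v -> 0 <= vm ->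
 v <= vm -> v^-1 <= vm -> 0 < dl -> dl <= 1 ->
 (forall j, 0 <= e j) -> (forall j, e j <= b j) ->
 \sum_(j < J) e j * (u0 + \sum_(i < j.+1) b i) `^ (v - 1) <=
  dl * (u0 + \sum_(j < J) b j) `^ v + (vm + dl^-1 `^ vm) * (\sum_(j < J) e j) `^ v.
move=> u00 v0 vm0 vvm vivm d0 d1 e0 eb.
have b0 j : 0 <= b j by exact:le_trans (e0 j) (eb j).
have [v1|/ltW v1] := leP v 1.
 apply:le_trans (tele_lower J u00 v0 v1 e0 eb) _.
 rewrite -[leLHS]add0r; apply:lerD => //.
 by apply:ler_wpM2r; rewrite//; apply:le_trans vivm _; rewrite lerDl.
set U := u0 + \sum_(j < J) b j; set E := \sum_(j < J) e j.
have U0 : 0 < U by rewrite ltr_wpDr.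
have step : \sum_(j < J) e j * (u0 + \sum_(i < j.+1) b i) `^ (v - 1) <= U `^ (v - 1) * E.
 rewrite mulr_sumr; apply:ler_sum => j _; rewrite mulrC; apply:ler_wpM2r => //.
 apply:ge0_ler_powR; rewrite ?nnegrE ?subr_ge0//.
 rewrite lerD2l [in leRHS](bigID (fun i : 'I_J => (i < j.+1)%N))/= -[leLHS]addr0.
 apply:lerD => //.
 by rewrite (big_ord_widen J (fun i => b i) (ltn_ord j)).
apply:le_trans step _.
have [le|/ltW lt] := leP E (dl * U).
 rewrite -[leLHS]addr0; apply:lerD => //.
 rewrite [U `^ v]powR_split// mulrC mulrA; apply:ler_wpM2r => //; by [].
rewrite -[leLHS]add0r; apply:lerD => //.
have E1 : 0 < E by apply:lt_le_trans lt; rewrite mulr_gt0.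
have UE : U <= dl^-1 * E by rewrite ler_pdivlMl.
apply:(@le_trans _ _ ((dl^-1 * E) `^ (v - 1) * E)).
 apply:ler_wpM2r => //; apply:ge0_ler_powR; rewrite ?nnegrE ?subr_ge0//.
rewrite powRM// -mulrA [_ * E]mulrC -powR_split//; apply:ler_wpM2r => //.
apply:(@le_trans _ _ (dl^-1 `^ vm)); last by rewrite lerDr.
by apply:ler_powR; [rewrite -[leLHS]invr1 lef_pV2// posrE|apply:le_trans vvm; rewrite gerBl].
Qed.

Lemma powR_leV (t X v : R) : 0 < v -> 0 <= t -> t `^ v <= X -> t <= X `^ v^-1.
move=> v0 t0 tX; rewrite -[t]powRr1// -(mulfV (lt0r_neq0 v0)) powRrM.
by apply:ge0_ler_powR; rewrite ?nnegrE//; exact:le_trans (powR_ge0 _ _) tX.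
Qed.

End power_inequalities.

(** * Log-Hoelder exponents and the freezing of exponents *)

Section slow_variation.
Context (R : realType) (n : nat).
Local Notation d := n.+1.
Local Notation V := 'rV[R]_d.
Implicit Types (x y z : V) (t p q : V -> R).

Definition level j x : R := 2 ^+ j * (1 + `|x|).

Lemma level_ge1 j x : 1 <= level j x.
by rewrite mulr_ege1. Qed.
Hint Resolve level_ge1 : pos.

(** Both log-Hoelder conditions in one: [ln (level j x)] is [j ln 2], which the local condition pays
    for, plus [ln (1 + |x|)], which the decay at infinity pays for. *)
Definition logcont t := exists2 c : R, 0 <= c & forall j x y,
 `|t x - t y| * ln (level j x) <= c * (1 + ln (nrm j (x - y))).

Lemma Clog_bnd t : Clog t -> exists2 K : R, 0 <= K & forall x, `|t x| <= K.
move=> [c [tinf [c0 _ H]]]; exists (c + `|tinf|) => [|x]//.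
have := H x; set l := ln _; have l1 : 1 <= l.
 rewrite -[leLHS](expRK 1) ler_ln ?posrE ?lerDl ?ltr_wpDr ?sqrtr_ge0//.
move=> h; have {}h : `|t x - tinf| <= c.
 by apply:le_trans h _; rewrite ler_pdivrMr// ler_peMr.
by rewrite -[t x](subrK tinf); apply:le_trans (ler_normD _ _) _; rewrite lerD2r.
Qed.

Let ln_e_ge1 (a : R) : 0 <= a -> 1 <= ln (expR 1 + a).
by move=> a0; rewrite -[leLHS](expRK 1) ler_ln ?posrE ?lerDl.
Qed.

Lemma Clog_logcont t : Clog t -> logcont t.
move=> [c [tinf [c0 H1 H2]]].
have ed x : 0 <= enorm x by exact:sqrtr_ge0.
have LD : 0 <= ln (1 + d%:R : R) by rewrite ln_ge0// lerDl.
have C0 : 0 <= c * 3 + c * (2 + ln (1 + d%:R)).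
 by [].
exists (c * 3 + c * (2 + ln (1 + d%:R))) => // j x y.
have n1 := nrm_ge1 j (x - y); have ln0 := ln_ge0 n1.
have [E|xy] := eqVneq x y.
 by rewrite E subrr normr0 mul0r; apply:mulr_ge0 => //; apply:addr_ge0 => //; rewrite ln_ge0// nrm_ge1.
rewrite lnM ?posrE// mulrDr [in leRHS]mulrDl [leRHS]addrC.
apply:lerD.
 have xy0 : 0 < `|x - y| by rewrite normr_gt0 subr_eq0.
 have exy : 0 < enorm (x - y) by apply:lt_le_trans xy0 (norm_le_enorm _).
 (* Write [2 ^+ j] as [2 ^+ j * |x - y|] divided by [|x - y|]; the factor [1 + d] compares the two
    norms. *)
 have le1 : ln ((2 : R) ^+ j) <= ln (nrm j (x - y)) + ln (1 + d%:R) + ln (expR 1 + (enorm (x - y))^-1).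
  rewrite -!lnM ?posrE//.
  rewrite ler_ln ?posrE//.
  apply:(@le_trans _ _ ((2 ^+ j * `|x - y|) * (1 + d%:R) * (enorm (x - y))^-1)).
   rewrite ler_pdivlMr// -mulrA; apply:ler_wpM2l => //.
   by rewrite mulrC; exact:enorm_le.
  apply:ler_pM; rewrite//.
   by apply:ler_wpM2r; rewrite// /nrm normrZ ger0_norm// lerDr.
  by rewrite lerDr.
 have h := H1 x y xy; set l := ln (expR 1 + _) in h le1; have l1 : 1 <= l by apply:ln_e_ge1; rewrite invr_ge0.
 have h' : `|t x - t y| * l <= c by rewrite -ler_pdivlMr.
 have h2 : `|t x - t y| <= c by apply:le_trans h _; rewrite ler_pdivrMr// ler_peMr.
 apply:le_trans (ler_wpM2l (normr_ge0 _) le1) _; rewrite !mulrDr.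
 have e1 := ler_wpM2r ln0 h2; have e2 := ler_wpM2r LD h2.
 have e3 : 0 <= c * ln (1 + d%:R) * ln (nrm j (x - y)) by rewrite !mulr_ge0.
 have e4 : 0 <= c * ln (nrm j (x - y)) by rewrite mulr_ge0.
 move:e1 e2 e3 e4 h' c0; clear; move:(ln (nrm j (x - y))) (ln (1 + d%:R)) l (`|t x - t y|) => a b l g; lra.
have ex (u : V) : ln (1 + `|u|) <= ln (expR 1 + enorm u).
 by rewrite ler_ln ?posrE// lerD ?norm_le_enorm// -[leLHS]expR0 ler_expR.
have tri : ln (1 + `|x|) <= ln (1 + `|y|) + ln (nrm j (x - y)).
 rewrite -lnM ?posrE//.
 rewrite ler_ln ?posrE//.
 have -> : x = y + (x - y) by rewrite addrC subrK.
 have ->: y + (x - y) - y = x - y by rewrite addrAC subrr add0r.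
 apply:le_trans (_ : (1 + `|y|) * (1 + `|x - y|) <= _).
  have := ler_normD y (x - y); have := normr_ge0 y; have := normr_ge0 (x - y).
  move:(`|y + _|) (`|y|) (`|x - y|) => a b g; nra.
 apply:ler_wpM2l => //.
 by rewrite /nrm normrZ lerD2l ler_peMl// ger0_norm.
have hx := H2 x; have hy := H2 y; set lx := ln (expR 1 + enorm x) in hx; set ly := ln (expR 1 + enorm y) in hy.
have lx1 : 1 <= lx by exact:ln_e_ge1. have ly1 : 1 <= ly by exact:ln_e_ge1.
rewrite ler_pdivlMr// in hx; rewrite ler_pdivlMr// in hy.
have L0 : 0 <= ln (1 + `|x|) by rewrite ln_ge0.
have dt : `|t x - t y| <= `|t x - tinf| + `|t y - tinf|.
 by rewrite [`|t y - _|]distrC; apply:le_trans (ler_normD _ _); rewrite addrA subrK.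
apply:le_trans (ler_wpM2r L0 dt) _; rewrite mulrDl.
have e1 : `|t x - tinf| * ln (1 + `|x|) <= c by apply:le_trans (ler_wpM2l (normr_ge0 _) (ex x)) hx.
have e2 : `|t y - tinf| <= c by apply:le_trans hy; rewrite ler_peMr.
have e3 : `|t y - tinf| * ln (1 + `|x|) <= c + c * ln (nrm j (x - y)).
 apply:le_trans (ler_wpM2l (normr_ge0 _) tri) _; rewrite mulrDr; apply:lerD.
  by apply:le_trans (ler_wpM2l (normr_ge0 _) (ex y)) hy.
 exact:ler_wpM2r.
have e4 : 0 <= c * ln (nrm j (x - y)) by rewrite mulr_ge0.
by move:e1 e3 e4 c0; clear; move:(ln (nrm j (x - y))) (ln (1 + `|x|)) (`|t x - tinf|) (`|t y - tinf|) => a b g h; lra.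
Qed.

(** The logarithm of the quotient of the powers is [(t x - t y) * ln X]. When [X] lies between
    powers of [level j x], log-Hoelder continuity bounds it, and the exponent can be moved to [y] at
    the price of a Peetre weight. *)
Lemma slow_powR t (c K A B X : R) j x y : 0 < X -> 0 <= A -> 0 <= B ->
 (forall x, `|t x| <= K) ->
 (forall j x y, `|t x - t y| * ln (level j x) <= c * (1 + ln (nrm j (x - y)))) ->
 `|ln X| <= A * ln (level j x) + B ->
 X `^ t x <= expR (A * c + (K + K) * B) * nrm j (x - y) `^ (A * c) * X `^ t y.
move=> X0 A0 B0 tK tc lX; have n0 : 0 < nrm j (x - y) by apply:lt_le_trans (nrm_ge1 _ _).
rewrite /powR !gt_eqF// -!expRD ler_expR -lerBlDr -mulrBl.
apply:le_trans (ler_norm _) _; rewrite normrM.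
apply:le_trans (ler_wpM2l (normr_ge0 _) lX) _; rewrite mulrDr mulrCA.
have h1 := ler_wpM2l A0 (tc j x y).
have h2 : `|t x - t y| * B <= (K + K) * B.
 by apply:ler_wpM2r => //; apply:le_trans (ler_normB _ _) _; apply:lerD.
apply:le_trans (lerD h1 h2) _; apply:eqW; ring.
Qed.

Lemma Clog_cont t : Clog t -> continuous t.
move=> Ct; have [c c0 tc] := Clog_logcont Ct => x; apply/(@cvgrPdist_le _ _ _ (nbhs x)) => e e0.
pose j := Num.truncn (c * 2 / (e * ln 2)).
have l2 : 0 < ln (2 : R) by rewrite ln_gt0// ltr1n.
have hj : c * 2 <= e * (ln 2 *+ j.+1).
 by rewrite -[ln 2 *+ _]mulr_natr mulrA -ler_pdivrMl// [_^-1 * _]mulrC ltW// truncnS_gt.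
apply/nbhs_ballP; exists ((2^-1 : R) ^+ j.+1) => //= y; rewrite -ball_normE /= => xy.
have n2 : nrm j.+1 (x - y) <= 2.
 rewrite /nrm normrZ ger0_norm//.
 rewrite lerD2l -ler_pdivlMl// mulr1.
 by rewrite -exprVn.
have ln2 : ln (nrm j.+1 (x - y)) <= 1.
 rewrite -[leRHS](expRK 1) ler_ln ?posrE//.
 by apply:le_trans n2 _; exact:expR_ge1Dx.
have H := tc j.+1 x y.
have low : ln (2 : R) *+ j.+1 <= ln (level j.+1 x).
 rewrite -lnXn// ler_ln ?posrE//.
 by rewrite ler_peMr.
have L0 : 0 < ln (2 : R) *+ j.+1 by rewrite pmulrn_lgt0.
rewrite -(ler_pM2r L0); apply:le_trans hj.
apply:le_trans (ler_wpM2l (normr_ge0 _) low) _; apply:le_trans H _.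
by apply:ler_wpM2l => //; rewrite lerD2l.
Qed.
Hint Resolve Clog_cont : fn.

(** By continuity a violation at one point would persist on a ball, which has positive measure. *)
Lemma ess_inf_cont t (a : R) : continuous t -> (a%:E <= ess_inf mu (EFin \o t))%E -> forall x, a <= t x.
move=> ct /ess_infP H x; rewrite leNgt; apply/negP => tx.
have tx' : 0 < a - t x by rewrite subr_gt0.
have /(@cvgrPdist_lt _ _ _ (nbhs x)) /(_ _ tx') /nbhs_ballP[r /= r0 hr] := ct x.
case:H => N [mN N0 sN].
have : (mu (ball x r) <= mu N)%E.
 apply:le_measure; rewrite ?inE//; first exact:mbl_ball_rV.
 move=> y /hr h; apply:sN => /=; rewrite lee_fin; apply/negP; rewrite -ltNge.
 move:h; rewrite ltr_norml => /andP[h _]; move:h; move:(t x) (t y) => u w; lra.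
by rewrite N0 leNgt leb_ball_gt0.
Qed.

Lemma logcont_div p q (k : R) : 0 < k -> (forall x, k <= q x) -> logcont p -> logcont q ->
 (exists K : R, forall x, `|p x| <= K) -> (exists K : R, forall x, `|q x| <= K) -> logcont (fun x => p x / q x).
move=> k0 kq [cp cp0 Hp] [cq cq0 Hq] [Kp HKp] [Kq HKq].
have Kp0 : 0 <= Kp by apply:le_trans (HKp 0). have Kq0 : 0 <= Kq by apply:le_trans (HKq 0).
exists (k ^- 2 * (Kq * cp + Kp * cq)) => [|j x y]//.
have qx0 : 0 < q x by exact:lt_le_trans (kq x). have qy0 : 0 < q y by exact:lt_le_trans (kq y).
have -> : p x / q x - p y / q y = (q x * q y)^-1 * (q y * (p x - p y) - p y * (q x - q y)).
 by field.
have L0 := ln_ge0 (level_ge1 j x).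
rewrite normrM gtr0_norm// -!mulrA.
have k2 : (q x * q y)^-1 <= k ^- 2.
 by rewrite lef_pV2 ?posrE//; apply:ler_pM.
apply:ler_pM; rewrite//.
apply:le_trans (ler_wpM2r L0 (ler_normB _ _)) _; rewrite !normrM !mulrDl -!mulrA.
by apply:lerD; apply:ler_pM.
Qed.

End slow_variation.
Hint Resolve level_ge1 : pos.
Hint Resolve Clog_cont : fn.

(** * Shifted dyadic cells *)

Section shifted_cells.
Context (R : realType) (d : nat).
Local Notation V := 'rV[R]_d.
Implicit Types (x y z : V).

Variables (D : R) (g : {ffun 'I_d -> bool}).
Hypothesis D_gt0 : 0 < D.

Definition cell j x : 'rV[int]_d :=
 floor_rV j (aff D^-1 (\row_i ((g i)%:R / 3)) x).

Lemma cellE j x i : cell j x ord0 i = Num.floor (2 ^+ j * (x ord0 i / D + (g i)%:R / 3)).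
by rewrite !mxE [x ord0 i / D]mulrC. Qed.

Lemma floor_half (u w : R) : Num.floor (2 * u) = Num.floor (2 * w) -> Num.floor u = Num.floor w.
have h (a b : R) : Num.floor (2 * a) = Num.floor (2 * b) -> (Num.floor a <= Num.floor b)%R.
 move=> E; have fa := floor_le_tmp (2 * a); have fb := floor_le_tmp (2 * b).
 rewrite floor_ge_int; have : (2 * Num.floor a <= Num.floor (2 * b))%R.
  rewrite -E floor_ge_int intrM ler_wpM2l//; exact:floor_le_tmp.
 rewrite -(ler_int R) intrM => H; have {}H := le_trans H fb.
 by rewrite -(ler_pM2l (ltr0n R 2)).
by move=> E; apply/eqP; rewrite eq_le !h.
Qed.

Lemma cell_nested i j x y : (i <= j)%N -> cell j x = cell j y -> cell i x = cell i y.
elim:j => [|j IH]; first by rewrite leqn0 => /eqP->.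
rewrite leq_eqVlt => /predU1P[->//|/IH {}IH E]; apply:IH; apply/rowP => k.
have := congr1 (fun c : 'rV[int]_d => c ord0 k) E; rewrite !cellE !exprS -!mulrA; exact:floor_half.
Qed.

Lemma cell_diam j x y : cell j x = cell j y -> `|x - y| <= D * 2^-1 ^+ j.
move=> E; rewrite [leLHS]mx_normrE; apply:bigmax_le => [|[a i] _ /=].
 by [].
rewrite ord1 !mxE; have m0 := expr2_gt0 R j.
have := congr1 (fun c : 'rV[int]_d => c ord0 i) E; rewrite !cellE => Ei.
have := floor_itv (2 ^+ j * (x ord0 i / D + (g i)%:R / 3)).
have := floor_itv (2 ^+ j * (y ord0 i / D + (g i)%:R / 3)).
rewrite -Ei intrD; move:(Num.floor _)%:~R => f /andP[y1 y2] /andP[x1 x2].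
have : `|2 ^+ j * ((x ord0 i - y ord0 i) / D)| <= 1.
 rewrite ler_norml; apply/andP; split; rewrite mulrBl mulrBr; move:x1 x2 y1 y2; rewrite !mulrDr;
 by move:(2 ^+ j * (x ord0 i / D)) (2 ^+ j * (y ord0 i / D)) (2 ^+ j * (_ / 3)) => u w v; lra.
rewrite !normrM normfV (gtr0_norm D_gt0) (gtr0_norm m0) exprVn mulrA ler_pdivrMr// mul1r.
by rewrite -ler_pdivlMl// mulrC.
Qed.

Lemma mbl_comp_cell dT (T : measurableType dT) j (h : 'rV[int]_d -> T) :
 meas (h \o cell j).
exact:(measurableT_comp (mbl_comp_floor j h) (mbl_aff _ _)). Qed.

Lemma mbl_cell j (c : 'rV[int]_d) : measurable [set x | cell j x = c].
have := @mbl_comp_cell _ bool j (fun c' => c' == c) measurableT [set true].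
rewrite setTI => /(_ I); congr measurable.
by apply/seteqP; split => x; move/eqP.
Qed.

Lemma mbl_same_cell j : measurable [set xy : V * V | cell j xy.1 = cell j xy.2].
rewrite (_ : [set _ | _] = \bigcup_(c : 'rV[int]_d) ([set x | cell j x = c] `*` [set y | cell j y = c])).
 apply:countable_bigcupT_measurable => [|c]//.
 by apply:measurableX; exact:mbl_cell.
by apply/seteqP; split => [[x y] E|[x y] [c _ [/= -> ->]]//]; exists (cell j y).
Qed.

Lemma cell_measure j y : (mu [set x | cell j x = cell j y] <= ((2 * D * 2^-1 ^+ j) ^+ d * ball_vol R d)%:E)%E.
have r0 : 0 < 2 * D * 2^-1 ^+ j by rewrite !mulr_gt0.
rewrite -(leb_ballE y r0); apply:le_measure; rewrite ?inE; [exact:mbl_cell|exact:mbl_ball_rV|].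
move=> x E; rewrite ball_rVE /= distrC; apply:le_lt_trans (cell_diam E) _.
by rewrite -mulrA ltr_pMl// ltr1n.
Qed.

(** [G] is constant up to [rho] on cells, and [E] fills a fixed proportion of each cell where [G] is
    positive. Integrate over the pairs of points of a common cell in both orders and compare. *)
Lemma cell_avg j (G : V -> R) (E : set V) (rho eps : R) : 0 <= rho -> 0 < eps ->
 meas G -> (forall x, 0 <= G x) -> measurable E ->
 (forall x y, cell j x = cell j y -> G x <= rho * G y) ->
 (forall x, 0 < G x -> ((eps * (2^-1 ^+ j) ^+ d)%:E <= mu (E `&` [set y | cell j y = cell j x]))%E) ->
 (\int[mu]_x (G x)%:E <= (eps^-1 * rho * (2 * D) ^+ d * ball_vol R d)%:E * \int[mu]_x (\1_E x * G x)%:E)%E.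
move=> rho0 eps0 mG G0 mE Grho Geps.
set S := [set xy : V * V | cell j xy.1 = cell j xy.2].
have mS : measurable S by exact:mbl_same_cell.
have m1E : meas (\1_E : V -> R) by exact:indic_mbl.
have mh : meas (fun y => \1_E y * G y) by exact:measurable_funM.
have h0 y : 0 <= \1_E y * G y by rewrite indicE.
have t0 : 0 < eps * (2^-1 ^+ j) ^+ d by rewrite mulr_gt0.
pose F (xy : V * V) : \bar R := (\1_S xy * (rho * (\1_E xy.2 * G xy.2)))%:E.
have F0 xy : (0 <= F xy)%E by rewrite lee_fin; by [].
have mF : meas F.
 apply/measurable_EFinP; apply:measurable_funM => //.
 by apply:measurable_funM => //; exact:(measurableT_comp mh measurable_snd).
have step x : ((eps * (2^-1 ^+ j) ^+ d * G x)%:E <= \int[mu]_y F (x, y))%E.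
 have [Gx|] := ltP 0 (G x); last by move=> Gx; rewrite (le_anti (introT andP (conj Gx (G0 x)))) mulr0; exact:integral_ge0.
 have mEc : measurable (E `&` [set y | cell j y = cell j x]).
  by apply:measurableI => //; exact:mbl_cell.
 apply:(@le_trans _ _ (\int[mu]_y ((G x)%:E * (\1_(E `&` [set y | cell j y = cell j x]) y)%:E))%E).
  rewrite ge0_integralZl_EFin//.
  rewrite integral_indic// setIT mulrC EFinM; apply:lee_wpmul2l => //.
  exact:Geps.
 apply:ge0_le_integral => //.
 - by move=> y _; rewrite -EFinM.
 - by apply/measurable_EFinP.
 - exact:(measurableT_comp mF (measurable_pair1 x)).
 move=> y _; rewrite lee_fin /= !indicE in_setI.
 have [yE|] := boolP (y \in E); last by rewrite !(mul0r, mulr0).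
 have [/set_mem /= xy|] := boolP (y \in _); last first.
  by rewrite mulr0.
 by rewrite (_ : (x, y) \in S) ?mulr1 ?mul1r ?Grho// inE.
have key : (\int[mu]_x (G x)%:E <= ((eps * (2^-1 ^+ j) ^+ d)^-1)%:E * (\int[mu]_x \int[mu]_y F (x, y)))%E.
 rewrite -ge0_integralZl//; first last.
 - by move=> x _; exact:integral_ge0.
 - exact:measurable_fun_fubini_tonelli_F.
 apply:ge0_le_integral => //.
 - by apply:measurable_funeM; exact:measurable_fun_fubini_tonelli_F.
 move=> x _; have := lee_wpmul2l (_ : 0 <= ((eps * (2^-1 ^+ j) ^+ d)^-1)%:E)%E (step x).
 rewrite lee_fin invr_ge0 (ltW t0) => /(_ isT); apply:le_trans.
 by rewrite -EFinM mulrA mulVf// mul1r.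
apply:le_trans key _; rewrite fubini_tonelli//.
have inner y : (\int[mu]_x F (x, y) <= ((2 * D * 2^-1 ^+ j) ^+ d * ball_vol R d * rho)%:E * (\1_E y * G y)%:E)%E.
 rewrite (_ : (fun x => F (x, y)) = (fun x => (rho * (\1_E y * G y))%:E * (\1_[set x | cell j x = cell j y] x)%:E)%E); last first.
  by apply/funext => x; rewrite /F mulrC.
 rewrite ge0_integralZl_EFin//; last by apply/measurable_EFinP; apply:measurable_indic; exact:mbl_cell.
 rewrite integral_indic//; last exact:mbl_cell.
 rewrite setIT; apply:le_trans (lee_wpmul2l _ (cell_measure j y)) _ => //.
 by rewrite lee_fin; apply:eqW; ring.
apply:(@le_trans _ _ (((eps * (2^-1 ^+ j) ^+ d)^-1)%:E * \int[mu]_y (((2 * D * 2^-1 ^+ j) ^+ d * ball_vol R d * rho)%:E * (\1_E y * G y)%:E))%E).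
 apply:lee_wpmul2l => //.
 apply:ge0_le_integral => //.
 - by move=> x _; exact:integral_ge0.
 - exact:measurable_fun_fubini_tonelli_G.
 - by apply:measurable_funeM.
have bv0 : 0 <= ball_vol R d by rewrite fine_ge0.
rewrite ge0_integralZl_EFin//; first last.
rewrite muleA -EFinM; apply:lee_wpmul2r; first by apply:integral_ge0 => x _; rewrite lee_fin.
rewrite invfM exprMn; apply:eqW.
have : (2^-1 ^+ j) ^+ d != 0 :> R by rewrite !expf_neq0.
by move:((2^-1 ^+ j) ^+ d) => u u0; field.
Qed.

End shifted_cells.

(** * Every ball lies well inside a cell of some shifted grid *)

Section cell_cover.
Context (R : realType) (d : nat).
Local Notation V := 'rV[R]_d.
Implicit Types (x y z : V).

Lemma floor_constant (u w : R) : (forall m : int, 8^-1 < `|u - m%:~R|) -> `|u - w| <= 8^-1 -> Num.floor w = Num.floor u.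
move=> H uw; apply/eqP; rewrite eq_le; apply/andP; split; rewrite leNgt; apply/negP => lt.
 have := H (Num.floor u + 1); have := floor_itv u; have := floor_le_tmp w.
 move:lt; rewrite -lezD1 -(ler_int R) => lt wf /andP[u1 u2] h.
 rewrite ltr0_norm ?subr_lt0// in h; move:uw; rewrite ler_norml => /andP[w1 w2]; move:h w1 lt wf.
 move:(Num.floor u + 1)%:~R (Num.floor w)%:~R => a b; lra.
have := H (Num.floor u); have := floor_le_tmp u; have := floor_itv w.
move:lt; rewrite -lezD1 -(ler_int R) => lt /andP[w1 w2] u1 h.
rewrite ger0_norm ?subr_ge0// in h; move:uw; rewrite ler_norml => /andP[u2 u3]; move:h u3 lt w2.
by move:(Num.floor w + 1)%:~R (Num.floor u)%:~R => a b; lra.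
Qed.

(* The grids of the two shifts 0 and 1/3 stay at distance at least 1/3 at every
  dyadic level, because 3 never divides [2 ^ j]. *)
Lemma shift_avoid j (u : R) : exists b : bool, forall m : int, 8^-1 < `|u + 2 ^+ j * (b%:R / 3) - m%:~R|.
have [H|] := pselect (forall m : int, 8^-1 < `|u - m%:~R|).
 by exists false => m; rewrite mul0r mulr0 addr0.
move=> /existsNP[m /negP]; rewrite -leNgt => um; exists true => m'; rewrite ltNge; apply/negP => um'.
have {um um'} : `|2 ^+ j - (3 * (m' - m))%:~R| < 1 :> R.
 rewrite intrM intrB; move:um um'; rewrite !ler_norml ltr_norml => /andP[a b] /andP[a' b'].
 by move:a b a' b'; move:(m%:~R) (m'%:~R) (2 ^+ j : R) => v w p /= *; apply/andP; split; lra.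
have -> : (2 : R) ^+ j = ((2 ^ j)%N : int)%:~R by rewrite -natrX.
rewrite -intrB -intr_norm -[1]/(1%:~R) ltr_int => H.
have E : Posz (2 ^ j) = (3 * (m' - m))%R by move:H; lia.
have : (3 %| 2 ^ j)%N by rewrite -[(2 ^ j)%N]/(`|Posz (2 ^ j)|%N) E abszM dvdn_mulr.
by rewrite Euclid_dvdX.
Qed.

(** The shift is chosen coordinate by coordinate so that [x] stays further than 1/8 of a side from
    the walls of its cell; 1/8 works because [1/8 + 1/8 < 1/3]. *)
Lemma cell_cover (D : R) j x : 0 < D -> exists g : {ffun 'I_d -> bool}, forall y,
 `|x - y| <= D * 2^-1 ^+ j / 8 -> cell D g j y = cell D g j x.
move=> D0; pose b i := sval (cid (shift_avoid j (2 ^+ j * (x ord0 i / D)))).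
exists [ffun i => b i] => y xy; apply/rowP => i; rewrite !cellE ffunE.
have H : forall m : int, 8^-1 < `|2 ^+ j * (x ord0 i / D) + 2 ^+ j * ((b i)%:R / 3) - m%:~R|.
 exact:(svalP (cid (shift_avoid j (2 ^+ j * (x ord0 i / D))))).
rewrite !mulrDr; apply:floor_constant => //.
rewrite opprD addrACA subrr addr0 -mulrBr -mulrBl normrM (gtr0_norm (expr2_gt0 R j)) normrM normfV (gtr0_norm D0).
have : `|x ord0 i - y ord0 i| <= D * 2^-1 ^+ j / 8.
 by apply:le_trans xy; have := coord_le_norm (x - y) i; rewrite !mxE.
rewrite mulrA ler_pdivrMr// -(ler_pM2l (expr2_gt0 R j)) => /le_trans; apply.
rewrite exprVn; apply:eqW; have := expr2_neq0 R j; move:(2 ^+ j) => p p0; field; by [].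
Qed.

End cell_cover.

(** * Points near which a large value is taken on a large set *)

Section thick_points.
Context (R : realType) (n : nat).
Local Notation d := n.+1.
Local Notation V := 'rV[R]_d.
Local Notation W := (d.*2).
Implicit Types (x y z : V) (F : V -> R).

Definition smean M (D : R) l F := forall x,
 ((F x)%:E <= D%:E * \int[mu]_z (eta M l (z - x) * F z)%:E)%E.

Local Notation m := (wt_mass R d W).

(** The three constants are such that, in [tk_point], low values, far points and the set of high
    values account for less than 1/4, 1/4 and 1/2 of [F z]. *)
Definition tk_level (D : R) : R := (4 * (D * m + 1))^-1.
Definition tk_rad (D : R) : R := 8 * (D * m + 1).
Definition tk_mass (D : R) : R := (4 * (D + 1))^-1.

Definition tk_set D l F z : set V :=
 [set y | `|z - y| <= tk_rad D * 2^-1 ^+ l /\ tk_level D * F z <= F y].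

Definition tk D l F z :=
 ((tk_mass D * (2^-1 ^+ l) ^+ d)%:E <= mu (tk_set D l F z))%E.

Lemma mbl_tk_set D l F z : meas F -> measurable (tk_set D l F z).
move=> mF; rewrite (_ : tk_set _ _ _ _ = ((fun y => `|z - y|) @^-1` `]-oo, (tk_rad D * 2^-1 ^+ l)]) `&`
  (F @^-1` `[tk_level D * F z, +oo[)); last first.
 by apply/seteqP; split => y /=; rewrite !in_itv andbT.
apply:measurableI; rewrite -[X in measurable X]setTI.
 have mf : meas (fun y : V => `|z - y|).
  apply:cont_mbl_rV => y.
  apply:(@continuous_comp _ _ _ (fun y : V => z - y) (fun z : V => `|z|)); last exact:norm_continuous.
  by apply:continuousB => //; exact:cst_continuous.
 by apply:mf => //.
by apply:mF => //.
Qed.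

Lemma mbl_eta M l x : meas (fun z => eta M l (z - x)).
apply:measurable_funM => //.
have -> : (fun z => wt M (2 ^+ l *: (z - x))) = wt M \o aff (2 ^+ l) (- (2 ^+ l *: x)).
 by apply/funext => z; rewrite scalerBr.
by apply:measurableT_comp; [exact:mbl_wt|exact:mbl_aff].
Qed.
Hint Resolve mbl_eta : mble.

Lemma eta_integral l x : (\int[mu]_y (eta W l (y - x))%:E = m%:E)%E.
have [ri E] := eta_int l x; rewrite -E fineK//.
exact:integrable_fin_num ri.
Qed.

Lemma near_sup (T : Type) (f : T -> R) (K : R) (t0 : T) : (forall t, f t <= K) -> 0 < f t0 ->
 exists t, forall u, f u <= 2 * f t.
move=> fK f0; pose E := range f.
have sE : has_sup E by split; [exists (f t0), t0|exists K => _ [t _ <-]].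
have s0 : 0 < sup E by apply:lt_le_trans f0 _; apply:ub_le_sup; [case:sE|exists t0].
have [_ [t _ <-] ht] := sup_adherent (divr_gt0 s0 (ltr0n R 2)) sE.
exists t => u; apply:(@le_trans _ _ (sup E)); first by apply:ub_le_sup; [case:sE|exists u].
by move:ht; move:(sup E) (f t) => a b; lra.
Qed.

(** Take [z] that maximises the Peetre quotient at [x] up to a factor 2. Then [F] exceeds [F z] by
    at most twice a Peetre weight, so the mean value inequality at [z] cannot be met by low values
    and far points alone: high values must fill a set of measure of order [2 ^- (l d)]. *)
Lemma tk_point a D l F x (K : R) : 0 <= D -> meas F -> (forall y, 0 < F y) ->
 smean (a + W).+1 D l F -> (forall y, F y <= K * nrm l (x - y) ^+ a) ->
 exists z, tk D l F z /\ forall y, F y * nrm l (x - z) ^+ a <= 2 * F z * nrm l (x - y) ^+ a.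
move=> D0 mF F0 sF FK; have m0 := wt_mass_ge0 R d W.
have np y : 0 < nrm l y ^+ a by rewrite exprn_gt0.
have [||z hz] := @near_sup V (fun y => F y / nrm l (x - y) ^+ a) K x.
- by move=> y; rewrite ler_pdivrMr.
- by [].
have Hz y : F y * nrm l (x - z) ^+ a <= 2 * F z * nrm l (x - y) ^+ a.
 by move:(hz y); rewrite mulrA ler_pdivrMr// mulrAC ler_pdivlMr.
exists z; split=> //.
have Fz := F0 z.
have Fle y : F y <= 2 * F z * nrm l (y - z) ^+ a.
 rewrite -(ler_pM2r (np (x - z))); apply:le_trans (Hz y) _; rewrite -!mulrA.
 rewrite !ler_pM2l// -exprMn; apply:lerXn2r; rewrite ?nnegrE//.
 by rewrite mulrC -[nrm l (y - z)]nrmN opprB; exact:nrm_tri.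
set E := tk_set D l F z.
have mE : measurable E by exact:mbl_tk_set.
have c0 : 0 < tk_level D by rewrite invr_gt0.
have r0 : 0 < tk_rad D by rewrite mulr_gt0.
have p0 := expr2_gt0 R l.
have pt y : eta (a + W).+1 l (y - z) * F y <=
  (tk_level D + 2 / tk_rad D) * F z * eta W l (y - z) + 2 * F z * (2 ^+ l) ^+ d * \1_E y.
 have e0 := eta_ge0 W l (y - z); have n1 := nrm_ge1 l (y - z).
 (* The extra order of [eta] leaves a factor [1 / nrm], which is at most [1 / tk_rad] outside the
    ball. *)
 have eW : eta (a + W).+1 l (y - z) * nrm l (y - z) ^+ a = eta W l (y - z) * (nrm l (y - z))^-1.
  have := eta_nrm (a + 1) W l (y - z); rewrite addnAC addn1 => <-.
  by rewrite addn1 exprSr mulrA mulfK.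
 have i1 : (nrm l (y - z))^-1 <= 1 by rewrite invf_le1.
 have eF : eta (a + W).+1 l (y - z) * F y <= 2 * F z * (eta W l (y - z) * (nrm l (y - z))^-1).
  by rewrite -eW mulrCA; apply:ler_wpM2l (Fle y); exact:eta_ge0.
 have t1 : 0 <= tk_level D * F z * eta W l (y - z) by exact:mulr_ge0 (mulr_ge0 (ltW c0) (ltW Fz)) e0.
 have t2 : 0 <= 2 / tk_rad D * F z * eta W l (y - z).
  by [].
 have t3 : 0 <= 2 * F z * (2 ^+ l) ^+ d * \1_E y.
  by [].
 rewrite !mulrDl.
 have [ya|] := leP `|z - y| (tk_rad D * 2^-1 ^+ l); last first.
  move=> ya; have : 2 * F z * (eta W l (y - z) * (nrm l (y - z))^-1) <= 2 / tk_rad D * F z * eta W l (y - z).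
   rewrite [leLHS](_ : _ = 2 * F z * eta W l (y - z) * (nrm l (y - z))^-1); last by ring.
   rewrite [leRHS](_ : _ = 2 * F z * eta W l (y - z) * (tk_rad D)^-1); last by ring.
   apply:ler_wpM2l => //.
   rewrite lef_pV2 ?posrE// /nrm normrZ (gtr0_norm p0).
   move:ya; rewrite exprVn ltr_pdivrMr// distrC [_ * 2 ^+ l]mulrC.
   by move:(2 ^+ l * _) => u; lra.
  by move:eF t1 t2 t3; move:(eta _ _ _ * F y) (2 * F z * (_ * _)) => *; lra.
 have [yF|] := leP (tk_level D * F z) (F y); last first.
  move=> yF; have : eta (a + W).+1 l (y - z) * F y <= tk_level D * F z * eta W l (y - z).
   rewrite mulrC; apply:ler_pM => //; [exact:eta_ge0|].
   apply:ler_wpM2l => //.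
   by apply:wt_le; rewrite leqW// leq_addl.
  by move:t2 t3; move:(eta _ _ _ * F y) => u; lra.
 have -> : \1_E y = 1 :> R by rewrite indicE mem_set.
 have : 2 * F z * (eta W l (y - z) * (nrm l (y - z))^-1) <= 2 * F z * (2 ^+ l) ^+ d.
  apply:ler_wpM2l => //.
  rewrite -[leRHS]mulr1; apply:ler_pM => //.
  rewrite -[leRHS]mulr1; apply:ler_wpM2l => //.
  by rewrite -[leRHS]invr1 lef_pV2 ?posrE// exprn_ege1.
 by move:eF t1 t2; rewrite mulr1; move:(eta _ _ _ * F y) (2 * F z * (_ * _)) => *; lra.
set q := (tk_level D + 2 / tk_rad D) * F z in pt; set q' := 2 * F z * (2 ^+ l) ^+ d in pt.
have q0 : 0 <= q by exact:mulr_ge0 (addr_ge0 (ltW c0) (divr_ge0 (ler0n _ _) (ltW r0))) (ltW Fz).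
have q1 : 0 <= q' by exact:mulr_ge0 (mulr_ge0 (ler0n _ _) (ltW Fz)) (exprn_ge0 _ (exprn_ge0 _ (ler0n _ _))).
have bound : ((F z)%:E <= D%:E * (q%:E * m%:E + q'%:E * mu E))%E.
 apply:le_trans (sF z) _; apply:lee_wpmul2l => //.
 apply:(@le_trans _ _ (\int[mu]_y (q%:E * (eta W l (y - z))%:E + q'%:E * (\1_E y)%:E))%E).
  apply:ge0_le_integral => //.
  - by move=> y _; rewrite lee_fin mulr_ge0 ?eta_ge0.
  - by apply:emeasurable_funD; apply:measurable_funeM.
  - by move=> y _; rewrite lee_fin.
 rewrite ge0_integralD//; first last.
 - by apply:measurable_funeM.
 - by move=> y _; rewrite -EFinM.
 - by apply:measurable_funeM.
 - by move=> y _; rewrite lee_fin mulr_ge0// eta_ge0.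
 rewrite !ge0_integralZl_EFin//; first last.
 - by move=> y _; rewrite lee_fin eta_ge0.
 by rewrite eta_integral integral_indic// setIT.
rewrite /tk -/E leNgt; apply/negP => lt.
have D0' : (0 <= D%:E)%E by rewrite lee_fin.
have q1' : (0 <= q'%:E)%E by rewrite lee_fin.
have : F z <= D * (q * m + q' * (tk_mass D * (2^-1 ^+ l) ^+ d)).
 rewrite -lee_fin; exact:le_trans bound (lee_wpmul2l D0' (leeD2l _ (lee_wpmul2l q1' (ltW lt)))).
rewrite /q /q' /tk_mass.
have -> : 2 * F z * (2 ^+ l) ^+ d * ((4 * (D + 1))^-1 * 2^-1 ^+ l ^+ d) = 2 * F z * (4 * (D + 1))^-1.
 have u1 : (2 ^+ l) ^+ d * (2^-1 ^+ l) ^+ d = 1 :> R by rewrite -!exprMn mulfV// !expr1n.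
 by rewrite mulrACA u1 mulr1.
apply/negP; rewrite -ltNge.
have -> : D * ((tk_level D + 2 / tk_rad D) * F z * m + 2 * F z / (4 * (D + 1))) =
  F z * (2^-1 * ((D * m) / (D * m + 1)) + 2^-1 * (D / (D + 1))).
 by rewrite /tk_level /tk_rad; field.
rewrite -[ltRHS]mulr1 ltr_pM2l//.
have h (u : R) : 0 <= u -> u / (u + 1) < 1 by move=> u0; rewrite ltr_pdivrMr// mul1r ltrDl.
have := h _ D0; have := h _ (mulr_ge0 D0 m0); lra.
Qed.

End thick_points.
Hint Resolve mbl_eta : mble.

(** * Powers of weighted sums *)

Section powR_sums.
Context (R : realType).

(** Each [a i] is at most the [v]-th root of the sum of the [v]-th powers; this covers exponents on
    both sides of 1 at once. *)
Lemma powR_sum_le (I : finType) (a w : I -> R) (v Z : R) (H : nat) : 0 < v -> v <= H%:R -> 1 <= Z ->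
 (forall i, 0 <= a i) -> (forall i, 0 <= w i) -> \sum_i w i <= Z ->
 (\sum_i w i * a i) `^ v <= Z ^+ H * \sum_i a i `^ v.
move=> v0 vH Z1 a0 w0 wZ; set S := \sum_i a i `^ v.
have S0 : 0 <= S by apply:sumr_ge0 => i _; by [].
have aS i : a i <= S `^ v^-1.
 by apply:powR_leV => //; rewrite /S (bigD1 i)//= lerDl// => k _.
have le : \sum_i w i * a i <= Z * S `^ v^-1.
 apply:(@le_trans _ _ (\sum_i w i * S `^ v^-1)); first by apply:ler_sum => i _; exact:ler_wpM2l.
 by rewrite -mulr_suml; apply:ler_wpM2r => //.
apply:(@le_trans _ _ ((Z * S `^ v^-1) `^ v)).
 by apply:ge0_ler_powR; rewrite ?nnegrE.
rewrite powRM// -powRrM mulVf// powRr1//; apply:ler_wpM2r => //.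
by rewrite -powR_mulrn//; exact:ler_powR.
Qed.

Lemma powR_exp_le (Y t : R) (H : nat) : 1 <= Y -> t <= H%:R -> Y `^ t <= Y ^+ H.
by move=> Y1 tH; rewrite -powR_mulrn//; exact:ler_powR. Qed.

Lemma ratio_powR (G s u w : R) (H : nat) : 1 <= G -> 0 < u -> 0 < w -> u <= G * w -> w <= G * u -> `|s| <= H%:R ->
 u `^ s <= G ^+ H * w `^ s.
move=> G1; have G0 : 0 < G by exact:lt_le_trans G1.
have key (u' w' s' : R) : 0 < u' -> 0 < w' -> u' <= G * w' -> 0 <= s' -> s' <= H%:R -> u' `^ s' <= G ^+ H * w' `^ s'.
 move=> u0' w0' uw' s0 sh'; apply:(@le_trans _ _ ((G * w') `^ s')).
  by apply:ge0_ler_powR => //; rewrite nnegrE.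
 by rewrite powRM//; apply:ler_wpM2r => //; exact:powR_exp_le.
move=> u0 w0 uw wu sh; have [s0|s0] := leP 0 s; first by apply:key => //; move:sh; rewrite ger0_norm.
have := key w u (- s) w0 u0 wu; rewrite oppr_ge0 (ltW s0) => /(_ isT).
move:sh; rewrite ltr0_norm// => sh /(_ sh).
rewrite !powRN => h; rewrite -[u `^ s]invrK -[w `^ s]invrK.
by rewrite ler_pdivlMr// mulrC ler_pdivrMr.
Qed.

Lemma mbl_powR2 dT (T : measurableType dT) (f g : T -> R) :
 meas f -> meas g -> meas (fun x => f x `^ g x).
move=> mf mg; rewrite /powR; apply:measurable_fun_ifT.
- exact:(measurable_fun_eqr mf (measurable_cst _)).
- rewrite [X in measurable_fun _ X](_ : _ = fun t => if g t == 0 then 1 else 0); last first.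
  by apply/funext => t; case:(g t == 0).
 by apply:measurable_fun_ifT => //; exact:(measurable_fun_eqr mg (measurable_cst _)).
- by apply:measurableT_comp => //; apply:measurable_funM => //; exact:measurableT_comp.
Qed.
Hint Resolve mbl_powR2 : fn.

End powR_sums.
Hint Resolve mbl_powR2 : fn.

(** * The vector-valued estimate for cells of a fixed relative size *)

Section peetre.
Context (R : realType) (n : nat).
Local Notation d := n.+1.
Local Notation V := 'rV[R]_d.
Local Notation W := (d.*2).
Implicit Types (x y z : V).

Variables (p q v : V -> R) (H c : nat).
Hypothesis H_gt0 : (0 < H)%N.
Hypothesis qv : forall x, q x * v x = p x.
(** All constants of an exponent are rounded up to two integers, so that orders of decay and growth
    can be expressed through [H], [c] and the dimension. *)
Definition adm (t : V -> R) := [/\ meas t, forall x, H%:R^-1 <= t x <= H%:R &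
 forall j x y, `|t x - t y| * ln (level j x) <= c%:R * (1 + ln (nrm j (x - y)))].
Hypotheses (p_adm : adm p) (q_adm : adm q) (v_adm : adm v).
(** Large enough that [wt A] to a power at least [1 / H] is still dominated by the integrable
    [wt W], and that [2 ^ (j A)] exceeds the growth of the cell maxima and of the sums of their
    powers. *)
Local Notation A := ((W * H * H).+1).

Variables (D Q0 : R) (F : nat -> V -> R).
Hypothesis D_ge0 : 0 <= D.
Hypothesis Q0_ge0 : 0 <= Q0.
Hypothesis F_mbl : forall j, meas (F j).
Hypothesis F_lower : forall j x, 2^-1 ^+ j * wt A x <= F j x.
Hypothesis F_bounded : forall j, exists K : R, forall x, F j x <= K.
Hypothesis F_modular : forall J,
 (\int[mu]_x ((\sum_(j < J) F j x `^ q x) `^ v x)%:E <= Q0%:E)%E.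

Variables (X : R) (g : {ffun 'I_d -> bool}).
Hypothesis X_ge1 : 1 <= X.
Let X_gt0 : 0 < X. by []. Qed.
Local Notation cell := (cell X g).

Let hr : R := H%:R.
Let hr_ge1 : 1 <= hr. by rewrite ler1n. Qed.
Let hr_gt0 : 0 < hr. by []. Qed.
Let tl_gt0 : 0 < tk_level n D.
by rewrite invr_gt0 mulr_gt0// ltr_wpDl// mulr_ge0// wt_mass_ge0. Qed.
Let tm_gt0 : 0 < tk_mass D.
by rewrite invr_gt0. Qed.
Let tr_gt0 : 0 < tk_rad n D.
by rewrite mulr_gt0// ltr_wpDl// mulr_ge0// wt_mass_ge0. Qed.

Let F_gt0 j x : 0 < F j x.
by apply:lt_le_trans (F_lower j x); rewrite mulr_gt0// invr_gt0. Qed.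

Let adm_gt0 t x : adm t -> 0 < t x.
by move=> [_ h _]; have /andP[+ _] := h x; apply:lt_le_trans. Qed.
Let adm_le t x : adm t -> t x <= hr.
by move=> [_ h _]; have /andP[] := h x. Qed.

Lemma single_modular j : (\int[mu]_x (F j x `^ p x)%:E <= Q0%:E)%E.
apply:le_trans (F_modular j.+1); apply:ge0_le_integral => //.
- apply/measurable_EFinP; apply:mbl_powR2 => //; by case:p_adm.
- apply/measurable_EFinP; apply:mbl_powR2; last by case:v_adm.
 by apply:measurable_sum => i; apply:mbl_powR2 => //; case:q_adm.
move=> x _; rewrite lee_fin -(qv x) powRrM.
apply:ge0_ler_powR; rewrite ?nnegrE ?(ltW (adm_gt0 x v_adm))//.
by rewrite big_ord_recr lerDr.
Qed.

Definition tk_bnd : R := (tk_level n D)^-1 * (1 + Q0 / tk_mass D) ^+ H.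
Local Notation K := tk_bnd.

Let tl_le1 : tk_level n D <= 1.
have h : 0 <= D * wt_mass R d W by rewrite mulr_ge0// wt_mass_ge0.
by rewrite invf_le1; move:h; move:(D * _) => u; lra.
Qed.

Let K_ge1 : 1 <= K.
apply:mulr_ege1; first by rewrite -[leLHS]invr1 lef_pV2 ?posrE.
by rewrite exprn_ege1// lerDl.
Qed.

Ltac done ::= basic_done.
(** A value above 1 at a thick point contributes to the modular, up to constants, at least its power
    [1 / H], the least exponent, times the measure [2 ^- (j d)]. *)
Lemma tk_upper j z : tk D j (F j) z -> F j z <= K * 2 ^+ (j * d * H).
move=> th; set Y := tk_level n D * F j z.
have Q1 : 0 <= Q0 / tk_mass D by rewrite divr_ge0// ltW.
have two1 : 1 <= (2 : R) ^+ (j * d * H) by exact:expr2_ge1.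
have YF : F j z = (tk_level n D)^-1 * Y by rewrite mulKf// gt_eqF.
rewrite YF /K -mulrA; apply:ler_wpM2l; first by rewrite invr_ge0 ltW.
have [Y1|/ltW Y1] := leP Y 1.
 by apply:le_trans Y1 _; apply:mulr_ege1 => //; rewrite exprn_ege1// lerDl.
have mE := mbl_tk_set D j z (F_mbl j).
have Y0 : 0 < Y by exact:lt_le_trans Y1.
have : ((Y `^ hr^-1 * (tk_mass D * (2^-1 ^+ j) ^+ d))%:E <= Q0%:E)%E.
 apply:le_trans (single_modular j).
 apply:(@le_trans _ _ (\int[mu]_x ((Y `^ hr^-1)%:E * (\1_(tk_set D j (F j) z) x)%:E))%E).
  rewrite ge0_integralZl_EFin ?powR_ge0//; last by apply/measurable_EFinP; exact:measurable_indic.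
  rewrite integral_indic// setIT EFinM; apply:lee_wpmul2l => //; by rewrite lee_fin powR_ge0.
 apply:ge0_le_integral => //.
 - by move=> x _; rewrite -EFinM lee_fin mulr_ge0 ?powR_ge0// indicE.
 - by apply:measurable_funeM; apply/measurable_EFinP; exact:measurable_indic.
 - by apply/measurable_EFinP; apply:mbl_powR2 => //; case:p_adm.
 move=> y _; rewrite -EFinM lee_fin indicE; have [/set_mem[_ yE]|] := boolP (y \in _); last by rewrite mulr0 powR_ge0.
 rewrite mulr1; apply:(@le_trans _ _ (Y `^ p y)).
  by apply:ler_powR => //; case:p_adm => _ h _; have /andP[] := h y.
 by apply:ge0_ler_powR; rewrite ?nnegrE ?(ltW (adm_gt0 y p_adm)) ?(ltW Y0) ?(ltW (F_gt0 _ _)).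
rewrite lee_fin mulrA -exprM exprVn ler_pdivrMr ?expr2_gt0// -ler_pdivlMr// => h.
have {}h : Y `^ hr^-1 <= (1 + Q0 / tk_mass D) * 2 ^+ (j * d).
 apply:le_trans h _; rewrite mulrAC; apply:ler_wpM2r; first by rewrite ltW// expr2_gt0.
 by rewrite lerDr.
have := ge0_ler_powR (ltW hr_gt0) _ _ h.
rewrite !nnegrE powR_ge0 mulr_ge0 ?addr_ge0// => /(_ isT isT).
by rewrite -powRrM mulVf ?gt_eqF// powRr1 ?(ltW Y0)// /hr powR_mulrn ?mulr_ge0 ?addr_ge0// exprMn -exprM.
Qed.
Ltac done ::= extended_done.

(** The neighbourhood of the thick point must lie in the cell, so that the set where [F j] is large
    belongs to that cell too. On a cell without such points the supremum of the empty set gives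
    0. *)
Definition cell_values j (ce : 'rV[int]_d) : set R :=
 [set F j z | z in [set z | tk D j (F j) z /\
   forall y, `|z - y| <= tk_rad n D * 2^-1 ^+ j -> cell j y = ce]].
Definition cell_max j x : R := sup (cell_values j (cell j x)).
Local Notation B := cell_max.

Let values_ub j ce : has_ubound (cell_values j ce).
by have [M HM] := F_bounded j; exists M => _ [z _ <-]. Qed.

Lemma cell_max_ub j x z : tk D j (F j) z ->
 (forall y, `|z - y| <= tk_rad n D * 2^-1 ^+ j -> cell j y = cell j x) -> F j z <= B j x.
by move=> tz cz; apply:ub_le_sup => //; exists z. Qed.

Lemma cell_max_ge0 j x : 0 <= B j x.
have [E|/set0P[r [z [tz cz] _]]] := eqVneq (cell_values j (cell j x)) set0.
 by rewrite /cell_max E sup0.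
by apply:le_trans (cell_max_ub tz cz).
Qed.
Hint Resolve cell_max_ge0 : pos.

Lemma cell_max_witness j x : 0 < B j x -> exists z, [/\ tk D j (F j) z,
 forall y, `|z - y| <= tk_rad n D * 2^-1 ^+ j -> cell j y = cell j x, B j x <= 2 * F j z & F j z <= B j x].
move=> B0; have [E|ne] := eqVneq (cell_values j (cell j x)) set0.
 by move:B0; rewrite /B E sup0 ltxx.
have hs : has_sup (cell_values j (cell j x)) by split=> //; exact/set0P.
have [_ [z [tz cz] <-] hz] := sup_adherent (divr_gt0 B0 (ltr0n R 2)) hs.
exists z; split=> //; last exact:cell_max_ub.
by move:hz; rewrite -/(B j x); move:(B j x) (F j z) => a b; lra.
Qed.

Lemma cell_max_cell j x y : cell j x = cell j y -> B j x = B j y.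
by rewrite /B => ->. Qed.

Lemma mbl_cell_max j : meas (B j).
exact:(@mbl_comp_cell R d X g _ (measurableTypeR R) j (fun ce => sup (cell_values j ce))). Qed.
Hint Resolve mbl_cell_max : mble.

Lemma cell_max_upper j x : B j x <= K * 2 ^+ (j * d * H).
have [B0|/ltW] := leP (B j x) 0.
 by apply:le_trans B0 _.
have [E|ne] := eqVneq (cell_values j (cell j x)) set0.
 by rewrite /B E sup0.
by move=> _; apply:ge_sup; [exact/set0P|move=> _ [z [tz _] <-]; exact:tk_upper].
Qed.

Definition good_set j : set V := [set y | tk_level n D / 2 * B j y <= F j y].
Local Notation E := good_set.

Lemma mbl_good_set j : measurable (E j).
rewrite (_ : E j = (fun y => F j y - tk_level n D / 2 * B j y) @^-1` `[0, +oo[); last first.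
 by apply/seteqP; split => y /=; rewrite in_itv /= andbT subr_ge0.
have mf : meas (fun y => F j y - tk_level n D / 2 * B j y).
 by [].
by rewrite -[X in measurable X]setTI; apply:mf => //.
Qed.

Lemma good_set_mass j x : 0 < B j x ->
 ((tk_mass D * (2^-1 ^+ j) ^+ d)%:E <= mu (E j `&` [set y | cell j y = cell j x]))%E.
move=> /cell_max_witness[z [tz cz Bz _]]; apply:le_trans tz _.
apply:le_measure; rewrite ?inE; [exact:mbl_tk_set| |].
 by apply:measurableI; [exact:mbl_good_set|exact:mbl_cell].
move=> y [yz Fy]; have yc := cz y yz; split => //.
rewrite /good_set /= (cell_max_cell yc); apply:le_trans Fy; rewrite -mulrA; apply:ler_wpM2l => //.
by rewrite ler_pdivrMl.
Qed.

Let LX : R := ln (1 + X).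
Let LX0 : 0 <= LX. by rewrite ln_ge0// lerDl. Qed.
Let lK : R := ln 2 + hr * ln K.
Let lK0 : 0 <= lK. by rewrite addr_ge0 ?mulr_ge0 ?ln_ge0// ler1n. Qed.

(** The part, free of [X], of the price for moving a power between two points of a cell. Later only
    the growth of the whole price in [X] matters, and its exponent [cell_expo] does not involve [D]
    or [Q0]. *)
Definition cell_cost0 : R := expR ((A * c)%:R + (hr + hr) * lK).
Definition cell_expo : nat := ((H + H) * A + A * c)%N.
Definition cell_cost : R := cell_cost0 * (1 + X) ^+ cell_expo.
Local Notation rho := cell_cost.

Let X1_gt0 : 0 < 1 + X. by []. Qed.

Lemma nrm_cell j x y : cell j x = cell j y -> nrm j (x - y) <= 1 + X.
move=> /(cell_diam X_gt0) h; rewrite lerD2l normrZ ger0_norm// mulrC.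
by move:h; rewrite exprVn ler_pdivlMr.
Qed.

Lemma cell_costE : rho = expR ((A * c)%:R + (hr + hr) * (A%:R * LX + lK)) * (1 + X) ^+ (A * c).
rewrite /cell_cost /cell_cost0 exprD mulrA; congr (_ * _).
have -> : (1 + X) ^+ ((H + H) * A) = expR (((H + H) * A)%:R * LX) by rewrite expRM_natl lnK.
by rewrite -expRD; congr expR; ring.
Qed.

Lemma same_cell_powR t Y j x y : adm t -> 0 < Y -> cell j x = cell j y ->
 `|ln Y| <= A%:R * ln (level j x) + (A%:R * LX + lK) -> Y `^ t x <= rho * Y `^ t y.
move=> ta Y0 xy lY; have [_ tb tc] := ta.
apply:le_trans (slow_powR y Y0 (ler0n R A) _ (fun x => _ : `|t x| <= hr) tc lY) _.
- by [].
- by move=> x'; rewrite ger0_norm ?adm_le// ltW// adm_gt0.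
apply:ler_wpM2r => //.
rewrite cell_costE -natrM; apply:ler_wpM2l => //.
rewrite powR_mulrn//; apply:lerXn2r; rewrite ?nnegrE//.
exact:nrm_cell.
Qed.

Lemma ln_level_ge j x : j%:R * ln 2 <= ln (level j x).
rewrite mulr_natl -lnXn// ler_ln ?posrE//.
by rewrite ler_peMr.
Qed.

Let ln2_ge0 : 0 <= ln (2 : R). by rewrite ln_ge0// ler1n. Qed.
Let lnK_ge0 : 0 <= ln K. exact:ln_ge0. Qed.

(** The two bounds that allow exponents to be frozen: from below the background in [F_lower], from
    above [tk_upper]. *)
Lemma ln_cell_max j x : 0 < B j x -> `|ln (B j x)| <= A%:R * ln (level j x) + (A%:R * LX + lK).
move=> B0; have L0 := ln_ge0 (level_ge1 j x); have lv := ln_level_ge j x.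
rewrite ler_norml; apply/andP; split.
 have [z [_ cz _ zB]] := cell_max_witness B0.
 have zx : cell j z = cell j x by apply:cz; rewrite subrr normr0.
 have low : (level j x) ^- A / (1 + X) ^+ A <= B j x.
  apply:le_trans zB; apply:le_trans (F_lower j z).
  rewrite ler_pdivrMr//.
  apply:(@le_trans _ _ (2^-1 ^+ j * wt A x)).
   rewrite exprMn invfM; apply:ler_wpM2r => //.
   by rewrite -exprVn exprVn exprVn lef_pV2 ?posrE// ler_eXnr ?expr2_ge1.
  rewrite -mulrA; apply:ler_wpM2l => //.
  apply:le_trans (wt_shift A x z) _; rewrite mulrC; apply:ler_wpM2l; first exact:wt_ge0.
  apply:lerXn2r; rewrite ?nnegrE//.
  apply:le_trans (nrm_cell (esym zx)); rewrite lerD2l normrZ ler_peMl// ger0_norm//.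
 have low0 : 0 < (level j x) ^- A / (1 + X) ^+ A by rewrite divr_gt0.
 have := low; rewrite -ler_ln// lnM ?posrE// !lnV ?posrE// !lnXn// -/LX.
 apply:le_trans; rewrite -[ln (level j x) *+ A]mulr_natl -[LX *+ A]mulr_natl.
 by move:lK0; move:(A%:R * _) (A%:R * _) lK => u w k; lra.
have := cell_max_upper j x; rewrite -ler_ln ?posrE// => h; apply:le_trans h _.
rewrite lnM ?posrE// lnXn// -[ln 2 *+ _]mulr_natl addrC.
have h1 : (j * d * H)%:R * ln 2 <= A%:R * ln (level j x).
 have -> : (j * d * H)%:R = (d * H)%:R * j%:R :> R by rewrite -natrM; congr (_%:R); ring.
 rewrite -mulrA; apply:ler_pM => //.
 rewrite ler_nat; apply:leqW; rewrite -mulnA; apply:leq_mul; last by rewrite leq_pmull.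
 by rewrite -addnn leq_addr.
apply:lerD => //; apply:(@le_trans _ _ lK); last by rewrite lerDr.
by rewrite -[leLHS]add0r; apply:lerD => //; rewrite ler_peMl.
Qed.

Definition cell_pow j x : R := B j x `^ q x.
Local Notation b := cell_pow.

Lemma cell_pow_ge0 j x : 0 <= b j x. exact:powR_ge0. Qed.
Hint Resolve cell_pow_ge0 : pos.

Let rho_gt0 : 0 < rho. by rewrite mulr_gt0 ?expR_gt0. Qed.

Lemma max_powR_transfer t j x y : adm t -> cell j x = cell j y -> B j x `^ t x <= rho * B j y `^ t y.
move=> ta xy; rewrite -(cell_max_cell xy).
have [B0|B0] := leP (B j x) 0.
 have -> : B j x = 0 by apply/le_anti; rewrite B0 cell_max_ge0.
 by rewrite !powR0// gt_eqF// adm_gt0.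
by apply:(same_cell_powR ta B0 xy); exact:ln_cell_max.
Qed.

(** Starting from [wt A] keeps the sum positive and bounded below by a power of [level], so that
    negative powers of it can be moved within cells. *)
Definition level_sum J x : R := wt A x + \sum_(i < J) b i x.
Local Notation U := level_sum.

Lemma level_sum_gt0 J x : 0 < U J x.
by rewrite ltr_wpDr ?wt_gt0// => i _. Qed.
Hint Resolve level_sum_gt0 : pos.

Let pow_le_rho : (1 + X) ^+ A <= rho.
rewrite -[leLHS]mul1r; apply:ler_pM => //.
 by rewrite -expR0 ler_expR.
by apply:ler_weXn2l; [rewrite lerDl|apply:leq_trans (leq_addr _ _); rewrite leq_pmull// addn_gt0 H_gt0].
Qed.

Lemma level_sum_transfer j x y : cell j x = cell j y -> U j.+1 x <= rho * U j.+1 y.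
move=> xy; rewrite mulrDr mulr_sumr; apply:lerD.
 apply:le_trans (wt_shift A x y) _; apply:ler_wpM2r; first exact:wt_ge0.
 apply:le_trans pow_le_rho; apply:lerXn2r; rewrite ?nnegrE//.
 apply:le_trans (nrm_cell xy); rewrite lerD2l normrZ ler_peMl// ger0_norm//.
apply:ler_sum => i _; apply:max_powR_transfer => //.
by apply:cell_nested xy => //; rewrite -ltnS.
Qed.

Lemma ln_level_sum j x : `|ln (U j.+1 x)| <= A%:R * ln (level j x) + (A%:R * LX + lK).
have U0 := level_sum_gt0 j.+1 x; have lv := ln_level_ge j x.
rewrite ler_norml; apply/andP; split.
 have : wt A x <= U j.+1 x by rewrite lerDl// => i _; by [].
 rewrite -ler_ln ?posrE ?wt_gt0// lnV ?posrE// lnXn//.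
 apply:le_trans; rewrite -[ln _ *+ A]mulr_natl lerN2; apply:(@le_trans _ _ (A%:R * ln (level j x))); last first.
  by rewrite lerDl.
 apply:ler_wpM2l => //; rewrite ler_ln ?posrE//.
 by rewrite ler_peMl.
have bK i : (i <= j)%N -> b i x <= (K * 2 ^+ (j * d * H)) ^+ H.
 move=> ij; apply:(@le_trans _ _ ((K * 2 ^+ (j * d * H)) `^ q x)).
  apply:ge0_ler_powR; rewrite ?nnegrE ?(ltW (adm_gt0 x q_adm))//.
  apply:le_trans (cell_max_upper i x) _; apply:ler_wpM2l => //.
  by rewrite ler_weXn2l ?ler1n// leq_mul2r leq_mul2r ij !orbT.
 by apply:powR_exp_le; [exact:mulr_ege1|exact:adm_le].
set Y := (K * 2 ^+ (j * d * H)) ^+ H in bK; have Y1 : 1 <= Y by rewrite exprn_ege1// mulr_ege1.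
have : U j.+1 x <= 2 ^+ j.+1 * Y.
 apply:(@le_trans _ _ (Y + Y *+ j.+1)).
  apply:lerD.
   apply:le_trans Y1; rewrite invf_le1//; apply:exprn_ege1; exact:onrm_ge1.
  apply:(@le_trans _ _ (\sum_(i < j.+1) Y)); last by rewrite sumr_const card_ord.
  by apply:ler_sum => i _; apply:bK; rewrite -ltnS.
 have -> : Y + Y *+ j.+1 = j.+2%:R * Y by rewrite mulr_natl.
 apply:ler_wpM2r => //.
 by rewrite -natrX ler_nat; exact:ltn_expl.
rewrite -ler_ln ?posrE// => /le_trans; apply.
rewrite lnM ?posrE// !lnXn// lnM ?posrE// lnXn//.
rewrite -[ln 2 *+ j.+1]mulr_natl -[_ *+ H]mulr_natl -[ln 2 *+ (j * d * H)]mulr_natl mulrDr -natr1 mulrDl mul1r.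
have h1 : j%:R * ln 2 + H%:R * ((j * d * H)%:R * ln 2) <= A%:R * ln (level j x).
 have -> : j%:R * ln 2 + H%:R * ((j * d * H)%:R * ln 2) = (1 + d * H * H)%:R * (j%:R * ln 2) :> R.
  by rewrite natrD; ring.
 apply:ler_pM => //.
 by rewrite ler_nat ltnS -!mulnA leq_mul2r -addnn leq_addr orbT.
have h2 : 0 <= A%:R * LX by rewrite mulr_ge0.
by move:h1 h2; rewrite /lK; move:(j%:R * ln 2) (H%:R * (_ * _)) (A%:R * ln _) (A%:R * LX) => *; lra.
Qed.

Let rho_ge1 : 1 <= rho.
by apply:le_trans pow_le_rho; rewrite exprn_ege1// lerDl. Qed.

(** The summand of [tele_upper]. It involves the levels up to [j] only, and cells are nested, so it
    is nearly constant on the cells of level [j]. *)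
Definition smd j x : R := b j x * U j.+1 x `^ (v x - 1).
Local Notation G := smd.

Let split_rho (r u w : R) : r ^+ H.+2 * (u * w) = (r * u) * (r * (r ^+ H * w)).
by rewrite !exprS; ring. Qed.

Lemma smd_transfer j x y : cell j x = cell j y -> G j x <= rho ^+ H.+2 * G j y.
move=> xy; have Ux := level_sum_gt0 j.+1 x; have Uy := level_sum_gt0 j.+1 y.
have e1 : U j.+1 x `^ (v x - 1) <= rho * U j.+1 x `^ (v y - 1).
 rewrite !powRB ?(gt_eqF Ux) ?implybT// mulrA; apply:ler_wpM2r => //.
 by apply:(same_cell_powR v_adm Ux xy); exact:ln_level_sum.
have e2 : U j.+1 x `^ (v y - 1) <= rho ^+ H * U j.+1 y `^ (v y - 1).
 apply:(ratio_powR rho_ge1) => //; [exact:level_sum_transfer|exact:level_sum_transfer|].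
 have := adm_gt0 y v_adm; have := adm_le y v_adm => a1 a2; rewrite ler_norml; apply/andP; split.
  by rewrite lerNl opprB lerBlDr (le_trans hr_ge1)// lerDl.
 by rewrite lerBlDr (le_trans a1)// lerDl.
rewrite /smd split_rho; apply:ler_pM; rewrite//; first exact:max_powR_transfer.
by apply:le_trans e1 _; exact:ler_wpM2l.
Qed.

Let L : R := 2 / tk_level n D.
Let L_ge1 : 1 <= L.
by rewrite ler_pdivlMr// mul1r (le_trans tl_le1)// ler1n. Qed.
Let L_gt0 : 0 < L. by []. Qed.

Definition avg_cost : R := (tk_mass D)^-1 * rho ^+ H.+2 * (2 * X) ^+ d * ball_vol R d.
Local Notation C1 := avg_cost.

Let C1_ge0 : 0 <= C1.
have r0 := ltW rho_gt0; have b0 : 0 <= ball_vol R d by rewrite fine_ge0.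
apply:mulr_ge0 => //; apply:mulr_ge0.
Qed.

Lemma good_avg j (f : V -> R) : meas f -> (forall x, 0 <= f x) ->
 (forall x, 0 < f x -> 0 < B j x) -> (forall x y, cell j x = cell j y -> f x <= rho ^+ H.+2 * f y) ->
 (\int[mu]_x (f x)%:E <= C1%:E * \int[mu]_x (\1_(E j) x * f x)%:E)%E.
move=> mf f0 fB ft; apply:(@cell_avg R d X g X_gt0 j f (E j) (rho ^+ H.+2) (tk_mass D)) => //.
- exact:mbl_good_set.
- by move=> x /fB; exact:good_set_mass.
Qed.

Let rho_le : rho <= rho ^+ H.+2.
by rewrite exprS ler_peMr// exprn_ege1. Qed.

Lemma good_powR t j x : adm t -> \1_(E j) x * B j x `^ t x <= L ^+ H * F j x `^ t x.
move=> ta; rewrite indicE; have [/set_mem h|_] := boolP (x \in _); last first.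
 by rewrite mul0r.
rewrite mul1r; apply:(@le_trans _ _ ((L * F j x) `^ t x)).
 apply:ge0_ler_powR; rewrite ?nnegrE ?(ltW (adm_gt0 x ta))//.
 move:h; rewrite /good_set /= /L -ler_pdivlMl// => /le_trans; apply.
 by rewrite invf_div.
rewrite powRM//; apply:ler_wpM2r => //.
by apply:powR_exp_le => //; exact:adm_le.
Qed.

Let m1E j : meas (\1_(E j) : V -> R).
by apply:measurable_indic; exact:mbl_good_set. Qed.

Ltac done ::= basic_done.
Lemma cell_max_int j : (\int[mu]_x (B j x `^ p x)%:E <= (C1 * (L ^+ H * Q0))%:E)%E.
have mp : meas p by case:p_adm.
have mB : meas (fun x => B j x `^ p x) by apply:mbl_powR2 => //; exact:mbl_cell_max.
apply:le_trans (good_avg (j := j) mB (fun x => powR_ge0 _ _) _ _) _.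
- move=> x h; rewrite lt_neqAle cell_max_ge0 andbT eq_sym; apply:contraTneq h => ->.
 by rewrite powR0 ?ltxx// gt_eqF// adm_gt0.
- move=> x y xy; apply:le_trans (max_powR_transfer p_adm xy) _.
 by apply:ler_wpM2r => //; exact:powR_ge0.
rewrite [(C1 * _)%:E]EFinM; apply:lee_wpmul2l; first by rewrite lee_fin.
rewrite [(_ * Q0)%:E]EFinM; apply:le_trans (lee_wpmul2l _ (single_modular j)); last by rewrite lee_fin exprn_ge0// ltW.
have mF : meas (fun x => F j x `^ p x) by exact:mbl_powR2.
rewrite -ge0_integralZl_EFin//; first last.
- by rewrite exprn_ge0// ltW.
- by apply/measurable_EFinP.
- by move=> x _; rewrite lee_fin powR_ge0.
apply:ge0_le_integral => //.
- by move=> x _; rewrite lee_fin mulr_ge0 ?powR_ge0// indicE.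
- by apply/measurable_EFinP; exact:measurable_funM.
- by apply:measurable_funeM; apply/measurable_EFinP.
- by move=> x _; rewrite -EFinM lee_fin; exact:good_powR.
Qed.
Ltac done ::= extended_done.

Let mq : meas q. by case:q_adm. Qed.
Let mv : meas v. by case:v_adm. Qed.

Lemma mbl_cell_pow j : meas (b j).
by apply:mbl_powR2 => //. Qed.

Lemma mbl_level_sum J : meas (U J).
apply:measurable_funD; first exact:mbl_wt.
by apply:measurable_sum => i; exact:mbl_cell_pow.
Qed.
Hint Resolve mbl_level_sum : mble.

Lemma wt_powR x : wt A x `^ v x <= wt W x.
have w1 := onrm_gt0 x; rewrite /wt -!exprVn.
have u1 : (1 + `|x|)^-1 <= 1 by rewrite invf_le1// onrm_ge1.
rewrite -!powR_mulrn// -powRrM; apply:ger_powR => //.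
have [_ hv _] := v_adm; have /andP[v1 _] := hv x.
apply:(@le_trans _ _ (A%:R * hr^-1)); last exact:ler_wpM2l.
rewrite ler_pdivlMr// -natrM ler_nat; apply:leqW; exact:leq_pmulr.
Qed.

(** The bound behind this finiteness depends on [J]; it only serves to license the absorption in
    [level_sum_int]. *)
Lemma level_sum_fin J : (\int[mu]_x (U J x `^ v x)%:E < +oo)%E.
have mB i : meas (fun x => B i x `^ p x).
 by apply:mbl_powR2; case:p_adm.
apply:(@le_lt_trans _ _ (\int[mu]_x ((J.+1%:R ^+ H)%:E * ((wt W x)%:E + \sum_(i < J) (B i x `^ p x)%:E)))%E).
 apply:ge0_le_integral => //.
 - by apply/measurable_EFinP; apply:mbl_powR2 => //.
 - apply:measurable_funeM; apply:emeasurable_funD; first by apply/measurable_EFinP; exact:mbl_wt.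
  by apply:emeasurable_sum => i.
 move=> x _; rewrite sumEFin lee_fin.
 pose a (k : nat) := if k is k'.+1 then b k' x else wt A x.
 have -> : U J x = \sum_(k < J.+1) 1 * a k by rewrite big_ord_recl mul1r; congr (_ + _); apply:eq_bigr => i _; rewrite mul1r.
 apply:le_trans (powR_sum_le (Z := J.+1%:R) (adm_gt0 x v_adm) (adm_le x v_adm) _ _ (fun=> ler01) _) _; rewrite ?ler1n//.
 - by move=> [[|k] /= _].
 - by rewrite sumr_const card_ord.
 apply:ler_wpM2l => //.
 rewrite big_ord_recl; apply:lerD; first exact:wt_powR.
 by apply:ler_sum => i _; rewrite -powRrM qv.
rewrite ge0_integralZl_EFin//; first last.
- apply:emeasurable_funD; first by apply/measurable_EFinP; exact:mbl_wt.
 by apply:emeasurable_sum => i.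
- by move=> x _; rewrite sumEFin lee_fin addr_ge0 ?wt_ge0// => i _.
rewrite ge0_integralD//; first last.
- by apply:emeasurable_sum => i.
- by move=> x _; rewrite sumEFin// => i _.
- by apply/measurable_EFinP; exact:mbl_wt.
- by move=> x _; rewrite lee_fin wt_ge0.
rewrite ge0_integral_sum//; first last.
rewrite int_wtE// lte_mul_pinfty// lte_add_pinfty ?ltry//.
by apply:lte_sum_pinfty => i _; apply:le_lt_trans (cell_max_int i) _; rewrite ltry.
Qed.

Definition absorb_cost : R := 1 + hr * C1.
Local Notation C2 := absorb_cost.
Definition level_cost : R := 2 * (wt_mass R d W + C2 * ((hr + (2 * C2) ^+ H) * (L ^+ H) ^+ H * Q0)).

Lemma mbl_smd j : meas (G j).
apply:measurable_funM; first exact:mbl_cell_pow.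
by apply:mbl_powR2.
Qed.
Hint Resolve mbl_smd : mble.

Lemma smd_ge0 j x : 0 <= G j x.
by rewrite mulr_ge0. Qed.
Hint Resolve smd_ge0 : pos.

Let absorb_arith (Z m h C a : R) : 0 <= h -> 0 <= C -> 0 <= a -> 0 <= Z ->
 Z <= m + h * (C * ((2 * (1 + h * C))^-1 * Z + a)) -> Z <= 2 * (m + (1 + h * C) * a).
move=> h0 C0 a0 Z0 H1; have hC : 0 <= h * C by exact:mulr_ge0.
have e : h * C * ((2 * (1 + h * C))^-1 * Z) <= 2^-1 * Z.
 rewrite mulrA; apply:ler_wpM2r => //; rewrite invfM mulrCA -[leRHS]mulr1; apply:ler_wpM2l => //.
 by rewrite ler_pdivrMr// mul1r lerDr.
by move:H1 e; rewrite !mulrDl; nra.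
Qed.

Ltac done ::= basic_done.
(** An inequality of Fefferman-Stein type: [st1] splits the power of the sum into single levels,
    [st2] restricts each level to its good set, where the cell maximum is comparable to [F j], and
    [st3] puts the levels together again. The integral of [U J] on the right of [st3] has a small
    factor and is absorbed. *)
Theorem level_sum_int J : (\int[mu]_x (U J x `^ v x)%:E <= level_cost%:E)%E.
have fin := level_sum_fin J.
have C2_ge1 : 1 <= C2 by rewrite lerDl mulr_ge0// ltW.
have mU : meas (fun x => U J x `^ v x).
 by apply:mbl_powR2 => //; exact:mbl_level_sum.
have mG j : meas (fun x => \1_(E j) x * G j x).
 by apply:measurable_funM => //; exact:mbl_smd.
have G0 j x : 0 <= \1_(E j) x * G j x by rewrite mulr_ge0 ?smd_ge0// indicE.
pose M := (hr + (2 * C2) ^+ H) * (L ^+ H) ^+ H.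
have M0 : 0 <= M.
 by rewrite mulr_ge0 ?exprn_ge0 ?(ltW L_gt0)// addr_ge0 ?(ltW hr_gt0)// exprn_ge0// mulr_ge0// (le_trans ler01 C2_ge1).
have mS : meas (fun x => (\sum_(j < J) F j x `^ q x) `^ v x).
 by apply:mbl_powR2 => //; apply:measurable_sum => i; exact:mbl_powR2.
have st1 : (\int[mu]_x (U J x `^ v x)%:E <= (wt_mass R d W)%:E + hr%:E * \sum_(j < J) \int[mu]_x (G j x)%:E)%E.
 rewrite -int_wtE// -ge0_integral_sum//; first last.
 - by move=> j x _; rewrite lee_fin smd_ge0.
 - by move=> j; apply/measurable_EFinP; exact:mbl_smd.
 have mG' : meas (fun x => \sum_(j < J) (G j x)%:E)%E.
  by apply:emeasurable_sum => j; apply/measurable_EFinP; exact:mbl_smd.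
 have G0' x : (0 <= \sum_(j < J) (G j x)%:E)%E by apply:sume_ge0 => j _; rewrite lee_fin smd_ge0.
 rewrite -ge0_integralZl_EFin ?(ltW hr_gt0)// -ge0_integralD//; first last.
 - by apply:measurable_funeM.
 - by move=> x _; apply:mule_ge0 => //; rewrite lee_fin ltW.
 - by apply/measurable_EFinP; exact:mbl_wt.
 - by move=> x _; rewrite lee_fin wt_ge0.
 apply:ge0_le_integral => //.
 - by move=> x _; rewrite lee_fin powR_ge0.
 - by apply/measurable_EFinP.
 - apply:emeasurable_funD; last exact:measurable_funeM.
  by apply/measurable_EFinP; exact:mbl_wt.
 move=> x _; rewrite sumEFin -EFinM -EFinD lee_fin.
 apply:le_trans (tele_upper J (wt_gt0 A x) (adm_gt0 x v_adm) (fun j => cell_pow_ge0 j x)) _.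
 apply:lerD; first exact:wt_powR.
 apply:ler_wpM2r; first by apply:sumr_ge0 => j _; exact:smd_ge0.
 by rewrite ge_max hr_ge1 adm_le.
have st2 : (\sum_(j < J) \int[mu]_x (G j x)%:E <= C1%:E * \int[mu]_x (\sum_(j < J) (\1_(E j) x * G j x))%:E)%E.
 rewrite (_ : (fun x => (\sum_(j < J) _)%:E) = (fun x => \sum_(j < J) (\1_(E j) x * G j x)%:E)%E); last by apply/funext => x; rewrite sumEFin.
 rewrite ge0_integral_sum//; first last.
 - by move=> j x _; rewrite lee_fin.
 - by move=> j; apply/measurable_EFinP.
 rewrite ge0_sume_distrr; last by move=> j _; apply:integral_ge0 => x _; rewrite lee_fin.
 apply:lee_sum => j _; apply:good_avg.
 - exact:mbl_smd.
 - by move=> x; exact:smd_ge0.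
 - move=> x h; rewrite lt_neqAle cell_max_ge0 andbT eq_sym; apply:contraTneq h => h.
  by rewrite /smd /cell_pow h powR0 ?mul0r ?ltxx// gt_eqF// adm_gt0.
 - by move=> x y; exact:smd_transfer.
have st3 : (\int[mu]_x (\sum_(j < J) (\1_(E j) x * G j x))%:E <=
  ((2 * C2)^-1)%:E * \int[mu]_x (U J x `^ v x)%:E + (M * Q0)%:E)%E.
 have d0 : 0 < (2 * C2)^-1 by rewrite invr_gt0 mulr_gt0// (lt_le_trans ltr01 C2_ge1).
 apply:(@le_trans _ _ (\int[mu]_x (((2 * C2)^-1)%:E * (U J x `^ v x)%:E + M%:E * ((\sum_(j < J) F j x `^ q x) `^ v x)%:E))%E).
  apply:ge0_le_integral => //.
  - by move=> x _; rewrite lee_fin sumr_ge0.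
  - by apply/measurable_EFinP; apply:measurable_sum.
  - by apply:emeasurable_funD; apply:measurable_funeM; apply/measurable_EFinP.
  move=> x _; rewrite -!EFinM -EFinD lee_fin.
  rewrite (_ : \sum_(j < J) _ = \sum_(j < J) (\1_(E j) x * b j x) * U j.+1 x `^ (v x - 1)); last first.
   by apply:eq_bigr => j _; rewrite /smd mulrA.
  have e0 j : 0 <= \1_(E j) x * b j x by rewrite mulr_ge0 ?powR_ge0// indicE.
  have eb j : \1_(E j) x * b j x <= b j x by rewrite ler_piMl ?powR_ge0// indicE lern1 leq_b1.
  have vV : (v x)^-1 <= hr.
   have [_ hv _] := v_adm; have /andP[v1 _] := hv x.
   by rewrite -[hr]invrK lef_pV2 ?posrE ?invr_gt0// adm_gt0.
  have d1 : (2 * C2)^-1 <= 1 by rewrite invf_le1 ?mulr_gt0 ?(lt_le_trans ltr01 C2_ge1)//; move:C2_ge1; move:C2 => u; lra.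
  apply:le_trans (tele_absorb J (wt_gt0 A x) (adm_gt0 x v_adm) (ltW hr_gt0) (adm_le x v_adm) vV d0 d1 e0 eb) _.
  apply:lerD => //; rewrite invrK /hr powR_mulrn ?mulr_ge0 ?(le_trans ler01 C2_ge1)// /M -mulrA.
  apply:ler_wpM2l; first by rewrite addr_ge0// exprn_ge0// mulr_ge0// (le_trans ler01 C2_ge1).
  have LH : 1 <= L ^+ H by exact:exprn_ege1.
  apply:(@le_trans _ _ ((L ^+ H * \sum_(j < J) F j x `^ q x) `^ v x)).
   apply:ge0_ler_powR; rewrite ?nnegrE ?(ltW (adm_gt0 x v_adm)) ?sumr_ge0 ?mulr_ge0 ?(le_trans ler01 LH)//.
    by apply:sumr_ge0 => j _; exact:powR_ge0.
   by rewrite mulr_sumr; apply:ler_sum => j _; exact:good_powR.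
  rewrite powRM ?(le_trans ler01 LH)//; last by apply:sumr_ge0 => j _; exact:powR_ge0.
  by apply:ler_wpM2r; [exact:powR_ge0|apply:powR_exp_le => //; exact:adm_le].
 rewrite ge0_integralD//; first last.
 - by apply:measurable_funeM; apply/measurable_EFinP.
 - by move=> x _; rewrite -EFinM lee_fin mulr_ge0 ?powR_ge0.
 - by apply:measurable_funeM; apply/measurable_EFinP.
 - by move=> x _; rewrite -EFinM lee_fin mulr_ge0 ?powR_ge0// ltW.
 rewrite !ge0_integralZl_EFin ?(ltW d0)//; try by [apply/measurable_EFinP|move=> x _; rewrite lee_fin powR_ge0].
 apply:leeD => //; rewrite [(M * Q0)%:E]EFinM; apply:lee_wpmul2l; [by rewrite lee_fin|exact:F_modular].
have Z0 : (0 <= \int[mu]_x (U J x `^ v x)%:E)%E by apply:integral_ge0 => x _; rewrite lee_fin powR_ge0.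
have [Z ZE] : exists Z : R, (\int[mu]_x (U J x `^ v x)%:E = Z%:E)%E.
 by exists (fine (\int[mu]_x (U J x `^ v x)%:E)); rewrite fineK// ge0_fin_numE.
have hr0 : (0 <= hr%:E)%E by rewrite lee_fin ltW.
have C10 : (0 <= C1%:E)%E by rewrite lee_fin.
rewrite ZE in st1 st3 Z0 *.
have := le_trans st1 (leeD2l _ (lee_wpmul2l hr0 (le_trans st2 (lee_wpmul2l C10 st3)))).
rewrite lee_fin in Z0 *.
by move=> h; apply:absorb_arith => //; first [exact:ltW|exact:mulr_ge0].
Qed.
Ltac done ::= extended_done.

End peetre.
Hint Resolve cell_max_ge0 cell_pow_ge0 level_sum_gt0 smd_ge0 : pos.
Hint Resolve mbl_cell_max mbl_level_sum mbl_smd : mble.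

Lemma pow2_bracket (R : realType) (u : R) : 1 <= u -> exists k : nat, 2 ^+ k <= u /\ u <= 2 ^+ k.+1.
move=> u1; have ex : exists k, u < 2 ^+ k.+1.
 exists (Num.truncn u); apply:(lt_trans (truncnS_gt u)).
 by rewrite -natrX ltr_nat; exact:ltn_expl.
have [k ku kmin] := ex_minnP ex; exists k; split => //.
case:k ku kmin => [|k] _ kmin//.
by rewrite leNgt; apply/negP => /kmin; rewrite ltnn.
Qed.

Lemma double_sum_ge (R : realType) (I : finType) (t : nat -> I -> R) J k g : (k < J)%N ->
 (forall k g, 0 <= t k g) -> t k g <= \sum_(i < J) \sum_(j : I) t i j.
move=> kJ t0; rewrite (bigD1 (Ordinal kJ))//= (bigD1 g)//= -addrA lerDl//.
Qed.

(** * Polynomial growth of the cost in the cell size *)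

Section level_cost_gr.
Context (R : realType) (n H c : nat).
Local Notation d := n.+1.
Local Notation W := (d.*2).

(** [absorb_cost] has degree [cell_expo * H.+2 + d] in the cell size, and [level_cost] contains its
    power [H.+1]. *)
Definition gr_expo : nat := ((cell_expo n H c * H.+2 + d) * H.+1)%N.

Let geom_arith (m a2 h Y M Q C2 : R) : 0 <= m -> 1 <= a2 -> 0 <= h -> 1 <= Y -> 0 <= M -> 0 <= Q -> 0 <= C2 ->
 C2 <= a2 * Y ->
 2 * (m + C2 * ((h + (2 * C2) ^+ H) * M * Q)) <= 2 * (m + a2 * ((h + (2 * a2) ^+ H) * M * Q)) * Y ^+ H.+1.
move=> m0 a1 h0 Y1 M0 Q0 C0 CY; rewrite -[leRHS]mulrA; apply:ler_wpM2l => //.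
have YH : 1 <= Y ^+ H by exact:exprn_ege1.
rewrite [leRHS]mulrDl; apply:lerD; first by rewrite ler_peMr// exprn_ege1.
rewrite exprS [leRHS](_ : _ = (a2 * Y) * (((h + (2 * a2) ^+ H) * Y ^+ H) * M * Q)); last by ring.
apply:ler_pM => //.
do 2! apply:ler_wpM2r => //; rewrite [leRHS]mulrDl; apply:lerD; first by rewrite ler_peMr.
rewrite -exprMn; apply:lerXn2r; rewrite ?nnegrE//.
by rewrite -mulrA; apply:ler_wpM2l.
Qed.

Lemma level_cost_gr (D Q0 : R) : 0 <= D -> 0 <= Q0 ->
 exists2 al : R, 0 <= al & forall X, 1 <= X -> level_cost n H c D Q0 X <= al * (1 + X) ^+ gr_expo.
move=> D0 Q00.
have tm : 0 < tk_mass D by rewrite invr_gt0.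
have tl : 0 < tk_level n D by rewrite invr_gt0 mulr_gt0// ltr_wpDl// mulr_ge0// wt_mass_ge0.
have b0 : 0 <= ball_vol R d by rewrite fine_ge0.
have cc : 0 <= cell_cost0 n H c D Q0 by exact:expR_ge0.
pose a1 := (tk_mass D)^-1 * cell_cost0 n H c D Q0 ^+ H.+2 * 2 ^+ d * ball_vol R d.
have a10 : 0 <= a1.
 by apply:mulr_ge0 => //.
pose a2 := 1 + H%:R * a1; have a21 : 1 <= a2 by rewrite lerDl.
pose M := ((2 / tk_level n D) ^+ H) ^+ H.
have M0 : 0 <= M by rewrite !exprn_ge0.
exists (2 * (wt_mass R d W + a2 * ((H%:R + (2 * a2) ^+ H) * M * Q0))).
 rewrite mulr_ge0// addr_ge0 ?wt_mass_ge0//.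
move=> X X1; have X0 : 0 <= X by exact:le_trans X1.
have Y1 : 1 <= 1 + X by rewrite lerDl.
pose be := (cell_expo n H c * H.+2 + d)%N.
have YB : 1 <= (1 + X) ^+ be by exact:exprn_ege1.
have C1 : 0 <= avg_cost n H c D Q0 X <= a1 * (1 + X) ^+ be.
 rewrite /avg_cost /cell_cost /a1 /be; apply/andP; split => //.
 rewrite exprD exprM exprMn [(2 * X) ^+ d]exprMn.
 rewrite [leRHS](_ : _ = (tk_mass D)^-1 * (cell_cost0 n H c D Q0 ^+ H.+2 * ((1 + X) ^+ cell_expo n H c) ^+ H.+2) * (2 ^+ d * (1 + X) ^+ d) * ball_vol R d); last by ring.
 apply:ler_wpM2r => //; apply:ler_wpM2l => //.
 apply:ler_wpM2l => //.
 by apply:lerXn2r; rewrite ?nnegrE// lerDr.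
have /andP[C10 C1a] := C1.
have C2 : absorb_cost n H c D Q0 X <= a2 * (1 + X) ^+ be.
 rewrite mulrDl mul1r -mulrA; apply:lerD => //; exact:ler_wpM2l.
rewrite exprM; apply:geom_arith => //.
- by rewrite addr_ge0.
Qed.

End level_cost_gr.

(** * Peetre maximal functions, summed over distances *)

Section peetre_core.
Context (R : realType) (n : nat).
Local Notation d := n.+1.
Local Notation V := 'rV[R]_d.
Local Notation W := (d.*2).
Implicit Types (x y z : V).

Variables (p q v : V -> R) (H c : nat).
Hypothesis H_gt0 : (0 < H)%N.
Hypothesis qv : forall x, q x * v x = p x.
Hypotheses (p_adm : adm H c p) (q_adm : adm H c q) (v_adm : adm H c v).
Local Notation A := ((W * H * H).+1).
Local Notation I := {ffun 'I_d -> bool}.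

Let adm_gt0 t x : adm H c t -> 0 < t x.
by move=> [_ h _]; have /andP[+ _] := h x; apply:lt_le_trans; rewrite invr_gt0 ltr0n. Qed.
Let adm_le t x : adm H c t -> t x <= H%:R.
by move=> [_ h _]; have /andP[] := h x. Qed.
Let adm_ge t x : adm H c t -> H%:R^-1 <= t x.
by move=> [_ h _]; have /andP[] := h x. Qed.

(** At distance [2 ^ k] the decay [2 ^- (k a)], with [a = H * ptr_slope], is raised to a power at
    least [1 / H]. What is left beats the factor [2 ^ (k H)] and the growth of [level_cost], with
    [2 ^- k] to spare. *)
Definition ptr_slope : nat := (H + gr_expo n H c).+1.
Definition ptr_expo : nat := (H * ptr_slope)%N.
Local Notation a' := ptr_slope.
Local Notation a := ptr_expo.

Let decay k x : (2 ^+ k * (2^-1 ^+ (k * a)) `^ q x) `^ v x <= (2^-1 : R) ^+ (k * (gr_expo n H c).+1).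
rewrite powRM// -powRrM qv.
have s1 : (2 ^+ k) `^ v x <= (2 : R) ^+ (k * H).
 by rewrite exprM; apply:powR_exp_le => //; exact:adm_le.
have s2 : (2^-1 ^+ (k * a)) `^ p x <= (2^-1 : R) ^+ (k * a').
 have -> : (2^-1 : R) ^+ (k * a) = (2^-1 ^+ (k * a')) `^ H%:R.
  by rewrite powR_mulrn// -exprM; congr (_ ^+ _); rewrite /ptr_expo; ring.
 have u0 : 0 < (2^-1 : R) ^+ (k * a') <= 1 by rewrite exprn_gt0// exprn_ile1// invf_le1// ler1n.
 rewrite -powRrM -[leRHS]powRr1//; apply:ger_powR => //.
 by rewrite -ler_pdivrMl ?ltr0n// mulr1; exact:adm_ge.
apply:le_trans (ler_pM (powR_ge0 _ _) (powR_ge0 _ _) s1 s2) _.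
rewrite exprVn mulrC ler_pdivrMl// exprVn.
rewrite ler_pdivlMr// -exprD /ptr_slope; apply:eqW; congr (_ ^+ _); ring.
Qed.

Lemma geom_sum_le J : \sum_(k < J) (2^-1 : R) ^+ k <= 2.
suff : \sum_(k < J) (2^-1 : R) ^+ k <= 2 - 2 * 2^-1 ^+ J.
 have : 0 <= (2^-1 : R) ^+ J by rewrite exprn_ge0.
 by move:(_ ^+ _) (\sum_(k < J) _) => u w; lra.
elim:J => [|J IH]; first by rewrite big_ord0; lra.
by rewrite big_ord_recr/= exprS; move:IH; move:(_ ^+ _) (\sum_(k < J) _) => u w; lra.
Qed.

Section fixed_family.
Variables (D Q0 : R) (F : nat -> V -> R).
Hypothesis D_ge0 : 0 <= D.
Hypothesis Q0_ge0 : 0 <= Q0.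
Hypothesis F_mbl : forall j, meas (F j).
Hypothesis F_lower : forall j x, 2^-1 ^+ j * wt A x <= F j x.
Hypothesis F_bounded : forall j, exists K : R, forall x, F j x <= K.
Hypothesis F_modular : forall J,
 (\int[mu]_x ((\sum_(j < J) F j x `^ q x) `^ v x)%:E <= Q0%:E)%E.
Hypothesis F_smean : forall j, smean (a + W).+1 D j (F j).

Let r_ge0 : 0 <= tk_rad n D.
by rewrite mulr_ge0// addr_ge0// mulr_ge0// wt_mass_ge0. Qed.

Let F_gt0 j x : 0 < F j x.
by apply:lt_le_trans (F_lower j x); rewrite mulr_gt0// invr_gt0. Qed.

(** A cell of this size, chosen by [cell_cover] around [x], contains the neighbourhoods of all
    points at distance up to [2 ^ (k + 1)] in units of [2 ^- j]; the 8 is that of [cell_cover]. *)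
Definition cell_size k : R := 8 * 2 ^+ k * (2 + tk_rad n D).
Let size_ge1 k : 1 <= cell_size k.
rewrite /cell_size -[8 * _ * _]mulrA; apply:mulr_ege1; first by rewrite ler1n.
by apply:mulr_ege1 => //; rewrite (le_trans (_ : 1 <= 2))// lerDl.
Qed.

Local Notation U k g := (level_sum q H D F (cell_size k) g).
(** The factor [2 ^+ k] is undone by weights [2 ^- k], whose sum over [k] stays bounded as
    [powR_sum_le] requires. *)
Definition ptr_term k (g : I) J x : R := 2 ^+ k * (2^-1 ^+ (k * a)) `^ q x * U k g J x.
Local Notation tm := ptr_term.

Let tm_ge0 k g J x : 0 <= tm k g J x.
by rewrite !mulr_ge0 ?(ltW (level_sum_gt0 _ _ _ _ _ _ _ _)). Qed.

Let nI : R := #|I|%:R.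
Let nI_ge1 : 1 <= nI. by rewrite ler1n; apply/card_gt0P; exists [ffun=> false]. Qed.
Let Z : R := 2 ^+ H * (2 * nI).
Let Z_ge1 : 1 <= Z.
by apply:mulr_ege1 => //; apply:mulr_ege1 => //; rewrite ler1n.
Qed.

Definition ptr_sum J x : R := Z ^+ H * \sum_(k < J) \sum_(g : I) tm k g J x `^ v x.
Local Notation Ps := ptr_sum.

Let U_mono k g J J' x : (J <= J')%N -> U k g J x <= U k g J' x.
move=> JJ; rewrite lerD2l (big_ord_widen J' (fun i => cell_pow q D F (cell_size k) g i x) JJ).
rewrite [leRHS](bigID (fun i : 'I_J' => (i < J)%N)) lerDl sumr_ge0// => i _; exact:powR_ge0.
Qed.

Let tm_mono k g J J' x : (J <= J')%N -> tm k g J x <= tm k g J' x.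
move=> JJ; apply:ler_wpM2l; last exact:U_mono.
by [].
Qed.

Let Ps_mono x : {homo (fun J => (Ps J x)%:E) : J J' / (J <= J')%N >-> (J <= J')%E}.
move=> J J' JJ; rewrite lee_fin; apply:ler_wpM2l => //.
apply:(@le_trans _ _ (\sum_(k < J) \sum_(g : I) tm k g J' x `^ v x)).
 apply:ler_sum => k _; apply:ler_sum => g _; apply:ge0_ler_powR; rewrite ?nnegrE//.
  exact:ltW (adm_gt0 x v_adm).
 exact:tm_mono.
rewrite (big_ord_widen J' (fun k => \sum_(g : I) tm k g J' x `^ v x) JJ).
rewrite [leRHS](bigID (fun i : 'I_J' => (i < J)%N))/= lerDl.
by [].
Qed.

Let mtm k g J : meas (fun x => tm k g J x `^ v x).
have [mv _ _] := v_adm; have [mq _ _] := q_adm.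
apply:mbl_powR2 => //; apply:measurable_funM; last exact:(mbl_level_sum q_adm).
by apply:measurable_funM => //; exact:mbl_powR2.
Qed.

Let mPs J : meas (Ps J).
by apply:measurable_funM => //; apply:measurable_sum => k; apply:measurable_sum => g. Qed.

Lemma ptr_term_int al k g J : 0 <= al ->
 (forall X, 1 <= X -> level_cost n H c D Q0 X <= al * (1 + X) ^+ gr_expo n H c) ->
 (\int[mu]_x (tm k g J x `^ v x)%:E <= (al * (1 + 8 * (2 + tk_rad n D)) ^+ gr_expo n H c * 2^-1 ^+ k)%:E)%E.
move=> al0 hal; set be := gr_expo n H c.
have X1 := size_ge1 k; have h0 : 0 <= (2^-1 : R) ^+ (k * be.+1) by rewrite exprn_ge0.
have [mv _ _] := v_adm.
have mU : meas (fun x => U k g J x `^ v x).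
 by apply:mbl_powR2 => //; exact:(mbl_level_sum q_adm).
apply:(@le_trans _ _ (\int[mu]_x ((2^-1 ^+ (k * be.+1))%:E * (U k g J x `^ v x)%:E))%E).
 apply:ge0_le_integral => //.
 - by apply:measurable_funeM.
 move=> x _; rewrite lee_fin powRM//.
 by apply:ler_wpM2r.
rewrite ge0_integralZl_EFin//; first last.
have h0' : (0 <= (2^-1 ^+ (k * be.+1) : R)%:E)%E by rewrite lee_fin.
apply:le_trans (lee_wpmul2l h0' (level_sum_int H_gt0 qv p_adm q_adm v_adm D_ge0 Q0_ge0 F_mbl F_lower F_bounded F_modular g X1 J)) _.
rewrite -EFinM; apply:le_trans (ler_wpM2l h0 (hal _ X1)) _.
have E1 : 1 + cell_size k <= 2 ^+ k * (1 + 8 * (2 + tk_rad n D)).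
 rewrite mulrDr mulr1 /cell_size; apply:lerD => //.
 by apply:eqW; ring.
rewrite mulrCA -mulrA; apply:ler_wpM2l => //.
apply:(@le_trans _ _ (2^-1 ^+ (k * be.+1) * (2 ^+ k * (1 + 8 * (2 + tk_rad n D))) ^+ be)).
 apply:ler_wpM2l => //; apply:lerXn2r => //; rewrite ?nnegrE//.
rewrite exprMn mulrCA mulrC [leRHS]mulrC mulrAC; apply:ler_wpM2r => //.
rewrite !exprVn -exprM mulnS exprD invfM -mulrA mulVf ?mulr1; by [].
Qed.

Lemma ptr_sum_int al J : 0 <= al ->
 (forall X, 1 <= X -> level_cost n H c D Q0 X <= al * (1 + X) ^+ gr_expo n H c) ->
 (\int[mu]_x (Ps J x)%:E <= (Z ^+ H * (al * (1 + 8 * (2 + tk_rad n D)) ^+ gr_expo n H c * 2 * nI))%:E)%E.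
move=> al0 hal; have Z0 : 0 <= Z ^+ H by rewrite exprn_ge0.
set Q := al * _ ^+ _.
have Q00 : 0 <= Q by rewrite mulr_ge0.
rewrite (_ : (fun x => (Ps J x)%:E) = (fun x => (Z ^+ H)%:E * \sum_(k < J) \sum_(g : I) (tm k g J x `^ v x)%:E)%E); last first.
 by apply/funext => x; rewrite EFinM -sumEFin; congr (_ * _)%E; apply:eq_bigr => k _; rewrite sumEFin.
have s0 k x : (0 <= \sum_(g : I) (tm k g J x `^ v x)%:E)%E by apply:sume_ge0 => g _; rewrite lee_fin.
have ms (k : 'I_J) : meas (fun x => \sum_(g : I) (tm k g J x `^ v x)%:E)%E.
 by apply:emeasurable_sum => g.
rewrite ge0_integralZl_EFin//; first last.
- by apply:emeasurable_sum.
- by move=> x _; apply:sume_ge0.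
rewrite EFinM; apply:lee_wpmul2l => //.
rewrite ge0_integral_sum//.
apply:(@le_trans _ _ (\sum_(k < J) (Q * 2^-1 ^+ k * nI)%:E)%E).
 apply:lee_sum => k _; rewrite ge0_integral_sum//; first last.
 apply:le_trans (lee_sum _ (fun g _ => ptr_term_int k g J al0 hal)) _.
 by rewrite sumEFin sumr_const mulr_natr.
rewrite sumEFin -mulr_suml -mulr_sumr; apply:ler_wpM2r => //.
by apply:ler_wpM2l => //; exact:geom_sum_le.
Qed.

Lemma tk_choice : exists zeta : nat -> V -> V, forall j x, tk D j (F j) (zeta j x) /\
 forall y, F j y * nrm j (x - zeta j x) ^+ a <= 2 * F j (zeta j x) * nrm j (x - y) ^+ a.
have h (jx : nat * V) : exists z, tk D jx.1 (F jx.1) z /\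
  forall y, F jx.1 y * nrm jx.1 (jx.2 - z) ^+ a <= 2 * F jx.1 z * nrm jx.1 (jx.2 - y) ^+ a.
 have [K HK] := F_bounded jx.1.
 have K0 : 0 <= K by apply:le_trans (HK 0); by [].
 apply:(@tk_point R n a D jx.1 (F jx.1) jx.2 K) => // y.
 by apply:le_trans (HK y) _; rewrite ler_peMr// exprn_ege1.
have [f hf] := choice h; exists (fun j x => f (j, x)) => j x; exact:(hf (j, x)).
Qed.

(** Sort the near maximiser [zeta j x] by its distance [2 ^ k] from [x]. For a suitable shift it
    lies, with its neighbourhood, in the cell of [x], so the maximal function is at most of the
    order of [2 ^- (k a)] times the cell maximum. For [j < J] finitely many [k] occur, whence
    [J']. *)
Lemma ptr_pointwise : exists Fs : nat -> V -> R,
 (forall j x z, F j z <= Fs j x * nrm j (x - z) ^+ a) /\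
 forall J x, exists J', (\sum_(j < J) Fs j x `^ q x) `^ v x <= Ps J' x.
have [zeta hz] := tk_choice.
have np j (y : V) : 0 < nrm j y ^+ a by rewrite exprn_gt0.
pose Fs j x := 2 * F j (zeta j x) / nrm j (x - zeta j x) ^+ a.
have Fs0 j x : 0 <= Fs j x by rewrite mulr_ge0.
exists Fs; split => [j x z|J x].
 by have [_ h] := hz j x; rewrite mulrAC ler_pdivlMr.
have key j : exists kg : nat * I, Fs j x <= 2 * 2^-1 ^+ (kg.1 * a) * cell_max D F (cell_size kg.1) kg.2 j x.
 have [tz _] := hz j x.
 have [k [k1 k2]] := pow2_bracket (nrm_ge1 j (x - zeta j x)).
 have Xp : 0 < cell_size k by exact:lt_le_trans (size_ge1 k).
 have [g hg] := cell_cover j x Xp; exists (k, g) => /=.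
 have FB : F j (zeta j x) <= cell_max D F (cell_size k) g j x.
  apply:cell_max_ub => // y yz; apply:hg.
  have -> : x - y = (x - zeta j x) + (zeta j x - y) by rewrite addrA subrK.
  apply:le_trans (ler_normD _ _) _.
  have p0 := expr2_gt0 R j.
  have e1 : `|x - zeta j x| <= 2 ^+ k.+1 * 2^-1 ^+ j.
   rewrite exprVn ler_pdivlMr// mulrC; apply:le_trans k2.
   by rewrite /nrm normrZ (gtr0_norm p0) lerDr.
  apply:le_trans (lerD e1 yz) _.
  rewrite /cell_size [leRHS](_ : _ = 2 ^+ k * (2 + tk_rad n D) * 2^-1 ^+ j); last by field.
  rewrite -mulrDl; apply:ler_wpM2r => //.
  rewrite mulrDr exprS [2 * _]mulrC lerD2l ler_peMl//.
 rewrite /Fs -[2 * F _ _ / _]mulrA -[leRHS]mulrA; apply:ler_wpM2l => //.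
 rewrite mulrC; apply:ler_pM; rewrite//.
 rewrite exprM !exprVn lef_pV2 ?posrE//.
 by apply:lerXn2r; rewrite ?nnegrE ?nrm_ge0.
have [kg hkg] := choice key.
pose J' := maxn J (\max_(j < J) (kg j).1).+1.
exists J'.
have JJ' : (J <= J')%N by exact:leq_maxl.
have kJ (j : 'I_J) : ((kg j).1 < J')%N by rewrite leq_max; apply/orP; right; rewrite ltnS (leq_bigmax j).
have step (j : 'I_J) : Fs j x `^ q x <=
  \sum_(k < J') \sum_(g : I) 2 ^+ H * (2^-1 ^+ (k * a)) `^ q x * cell_pow q D F (cell_size k) g j x.
 have t0 k g : 0 <= 2 ^+ H * (2^-1 ^+ (k * a)) `^ q x * cell_pow q D F (cell_size k) g j x.
  by rewrite !mulr_ge0 ?powR_ge0.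
 apply:(@le_trans _ _ (2 ^+ H * (2^-1 ^+ ((kg j).1 * a)) `^ q x * cell_pow q D F (cell_size (kg j).1) (kg j).2 j x)).
  have q0 := ltW (adm_gt0 x q_adm).
  have B0 : 0 <= cell_max D F (cell_size (kg j).1) (kg j).2 j x.
   exact:(cell_max_ge0 D F_lower F_bounded).
  apply:(@le_trans _ _ ((2 * 2^-1 ^+ ((kg j).1 * a) * cell_max D F (cell_size (kg j).1) (kg j).2 j x) `^ q x)).
   by apply:ge0_ler_powR; rewrite ?nnegrE.
  rewrite !powRM//; apply:ler_wpM2r => //.
  apply:ler_wpM2r => //.
  by apply:powR_exp_le; [rewrite ler1n|exact:adm_le].
 exact:(double_sum_ge (kg j).2 (kJ j) t0).
apply:(@le_trans _ _ ((\sum_(kg : 'I_J' * I) (2 ^+ H * 2^-1 ^+ kg.1) * tm kg.1 kg.2 J' x) `^ v x)).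
 apply:ge0_ler_powR; rewrite ?nnegrE ?(ltW (adm_gt0 x v_adm))//.
 apply:le_trans (ler_sum (P := predT) _ (fun j _ => step j)) _.
 rewrite exchange_big -(pair_bigA _ (fun (k : 'I_J') (g : I) => 2 ^+ H * 2^-1 ^+ k * tm k g J' x))/=.
 apply:ler_sum => k _; rewrite exchange_big/=; apply:ler_sum => g _.
 rewrite -mulr_sumr /ptr_term.
 rewrite [leRHS](_ : _ = 2 ^+ H * (2^-1 ^+ (k * a)) `^ q x * U k g J' x); last first.
  rewrite exprVn; have := expr2_neq0 R k; move:(2 ^+ k : R) (_ `^ _) (U k g J' x) (2 ^+ H : R) => A1 A2 A3 A4 A5.
  by field.
 apply:ler_wpM2l => //.
 by apply:le_trans (U_mono k g x JJ'); rewrite lerDr wt_ge0.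
apply:le_trans (powR_sum_le (Z := Z) (adm_gt0 x v_adm) (adm_le x v_adm) Z_ge1 _ _ _) _ => //.
- rewrite -(pair_bigA _ (fun (k : 'I_J') (g : I) => 2 ^+ H * 2^-1 ^+ k))/=.
 rewrite (eq_bigr (fun k : 'I_J' => (2 ^+ H * nI) * 2^-1 ^+ k)); last first.
  by move=> k _; rewrite sumr_const; ring.
 rewrite -mulr_sumr /Z [2 * nI]mulrC mulrA; apply:ler_wpM2l; last exact:geom_sum_le.
 by [].
- by rewrite -(pair_bigA _ (fun (k : 'I_J') (g : I) => tm k g J' x `^ v x)).
Qed.

Lemma ptr_limit al : 0 <= al ->
 (forall X, 1 <= X -> level_cost n H c D Q0 X <= al * (1 + X) ^+ gr_expo n H c) ->
 exists (Psi : V -> \bar R) (Fs : nat -> V -> R), [/\ meas Psi, forall x, (0 <= Psi x)%E,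
  (\int[mu]_x Psi x <= (Z ^+ H * (al * (1 + 8 * (2 + tk_rad n D)) ^+ gr_expo n H c * 2 * nI))%:E)%E,
  forall j x z, F j z <= Fs j x * nrm j (x - z) ^+ a &
  forall J x, (((\sum_(j < J) Fs j x `^ q x) `^ v x)%:E <= Psi x)%E].
move=> al0 hal; have [Fs [h1 h2]] := ptr_pointwise.
have Ps0 J x : (0 <= (Ps J x)%:E)%E.
 rewrite lee_fin mulr_ge0//.
pose Psi x := limn (fun J => (Ps J x)%:E).
have cv x : cvgn (fun J => (Ps J x)%:E) by apply:ereal_nondecreasing_is_cvgn => J J'; exact:Ps_mono.
exists Psi, Fs; split=> //.
- apply:(emeasurable_fun_cvg (fun J x => (Ps J x)%:E)) => [J|x _]//.
- by move=> x; apply:lime_ge => //; apply:nearW.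
- rewrite (@monotone_convergence _ _ R mu setT measurableT (fun J x => (Ps J x)%:E))//.
 + apply:lime_le; last by apply:nearW => J; exact:ptr_sum_int.
  apply:ereal_nondecreasing_is_cvgn => J J' JJ; apply:ge0_le_integral => //.
  * by move=> x _; exact:Ps_mono.
move=> J x; have [J' h] := h2 J x; apply:(@le_trans _ _ (Ps J' x)%:E) => //.
apply:lime_ge => //; near=> m; apply:Ps_mono; near: m; exact:nbhs_infty_ge.
Unshelve. all: by end_near. Qed.

End fixed_family.
End peetre_core.

(** * The maximal estimate for blocks of polynomial growth *)

Section ptr_max.
Context (R : realType) (n : nat).
Local Notation d := n.+1.
Local Notation V := 'rV[R]_d.
Local Notation W := (d.*2).
Implicit Types (x y z : V).

Lemma ball_vol_gt0 : 0 < ball_vol R d.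
have := @leb_ball_gt0 R d 0 1 ltr01; rewrite leb_ballE// lte_fin.
by rewrite expr1n mul1r.
Qed.

Definition bgd A j x : R := 2^-1 ^+ j * wt A x.

Lemma bgd_gt0 A j x : 0 < bgd A j x.
by rewrite mulr_gt0// invr_gt0. Qed.
Hint Resolve bgd_gt0 : pos.

Lemma mbl_bgd A j : meas (bgd A j).
by apply:measurable_funM => //; exact:mbl_wt. Qed.
Hint Resolve mbl_bgd : mble.

(** The background changes by a bounded factor on the ball of radius [2 ^- j] around [x], and the
    mean over that ball is already large enough. *)
Lemma bgd_smean A M j : smean M (2 ^+ (M + A) / ball_vol R d) j (bgd A j).
move=> x; have bv := ball_vol_gt0; have p0 := expr2_gt0 R j.
have h0 : 0 < (2^-1 : R) by rewrite invr_gt0.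
have r0 : 0 < (2^-1 : R) ^+ j by exact:exprn_gt0.
pose k := (2 ^+ j) ^+ d * 2^-1 ^+ (M + A) * bgd A j x.
have k0 : 0 <= k by rewrite !mulr_ge0 ?(ltW (wt_gt0 _ _)).
have low : ((k * ((2^-1 ^+ j) ^+ d * ball_vol R d))%:E <= \int[mu]_z (eta M j (z - x) * bgd A j z)%:E)%E.
 have mb := mbl_ball_rV x (2^-1 ^+ j).
 apply:(@le_trans _ _ (\int[mu]_z (k%:E * (\1_(ball x (2^-1 ^+ j)) z)%:E))%E).
  rewrite ge0_integralZl_EFin//.
  by rewrite EFinM -(leb_ballE x r0) integral_indic// setIT.
 apply:ge0_le_integral => //.
 - by move=> z _; rewrite -EFinM.
 - by apply:measurable_funeM.
 - apply/measurable_EFinP; apply:measurable_funM => //; exact:mbl_eta.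
 move=> z _; rewrite lee_fin indicE; have [/set_mem|_] := boolP (z \in _); last first.
  by rewrite mulr0 mulr_ge0 ?eta_ge0.
 rewrite ball_rVE /= mulr1 => xz.
 have e1 : (2^-1 : R) ^+ M <= wt M (2 ^+ j *: (z - x)).
  rewrite exprVn lef_pV2 ?posrE//.
  apply:lerXn2r; rewrite ?nnegrE//.
  rewrite lerD2l normrZ (gtr0_norm p0) -ler_pdivlMl// mulr1 distrC -exprVn//.
 have e2 : 2^-1 ^+ A * wt A x <= wt A z.
  rewrite exprVn ler_pdivrMl//; apply:le_trans (wt_shift A x z) _.
  apply:ler_wpM2r; first exact:wt_ge0.
  apply:lerXn2r; rewrite ?nnegrE//.
  rewrite lerD2l; apply:le_trans (ltW xz) _.
  by rewrite exprn_ile1// invf_le1// ler1n.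
 rewrite /k /eta /bgd exprD.
 rewrite [leLHS](_ : _ = (2 ^+ j) ^+ d * 2^-1 ^+ M * (2^-1 ^+ j * (2^-1 ^+ A * wt A x))); last by ring.
 apply:ler_pM => //.
 - by rewrite !mulr_ge0 ?wt_ge0.
 - by apply:ler_wpM2l => //.
 - by apply:ler_wpM2l => //.
have c0 : (0 <= (2 ^+ (M + A) / ball_vol R d)%:E)%E by rewrite lee_fin.
apply:le_trans (lee_wpmul2l c0 low); rewrite /k; apply:eqW.
have u1 : (2 ^+ j) ^+ d * (2^-1 ^+ j) ^+ d = 1 :> R by rewrite -!exprMn mulfV// !expr1n.
have u2 : 2 ^+ (M + A) * 2^-1 ^+ (M + A) = 1 :> R by rewrite -exprMn mulfV// expr1n.
rewrite [RHS](_ : _ = ((2 ^+ j) ^+ d * (2^-1 ^+ j) ^+ d) * (2 ^+ (M + A) * 2^-1 ^+ (M + A)) * bgd A j x * (ball_vol R d / ball_vol R d)).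
 by rewrite u1 u2 !mul1r divff ?mulr1.
by move:((2 ^+ j) ^+ d) ((2^-1 ^+ j) ^+ d) (2 ^+ (M + A) : R) (2^-1 ^+ (M + A)) (bgd A j x) (ball_vol R d)^-1 => *; ring.
Qed.

Lemma smeanD M (D1 D2 : R) l (f g : V -> R) : 0 <= D1 -> 0 <= D2 ->
 meas f -> meas g -> (forall x, 0 <= f x) -> (forall x, 0 <= g x) ->
 smean M D1 l f -> smean M D2 l g -> smean M (D1 + D2) l (fun x => f x + g x).
move=> D10 D20 mf mg f0 g0 sf sg x.
have mono (h k : V -> R) : meas h -> meas k -> (forall z, 0 <= h z) -> (forall z, h z <= k z) ->
  (\int[mu]_z (eta M l (z - x) * h z)%:E <= \int[mu]_z (eta M l (z - x) * k z)%:E)%E.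
 move=> mh mk h0 hk; apply:ge0_le_integral => //.
 - by move=> z _; rewrite lee_fin mulr_ge0 ?eta_ge0.
 - by apply/measurable_EFinP; apply:measurable_funM => //; exact:mbl_eta.
 - by apply/measurable_EFinP; apply:measurable_funM => //; exact:mbl_eta.
 - by move=> z _; rewrite lee_fin; apply:ler_wpM2l => //; exact:eta_ge0.
rewrite EFinD [(D1 + D2)%:E]EFinD ge0_muleDl//; apply:leeD.
 apply:le_trans (sf x) _; apply:lee_wpmul2l; rewrite//.
 by apply:mono => // z; rewrite lerDl.
apply:le_trans (sg x) _; apply:lee_wpmul2l; rewrite//.
by apply:mono => // z; rewrite lerDr.
Qed.

Variables (p q v : V -> R) (H c : nat).
Hypothesis H_gt0 : (0 < H)%N.
Hypothesis qv : forall x, q x * v x = p x.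
Hypotheses (p_adm : adm H c p) (q_adm : adm H c q) (v_adm : adm H c v).
Local Notation A := ((W * H * H).+1).
Local Notation a := (ptr_expo n H c).

Let adm_gt0 t x : adm H c t -> 0 < t x.
by move=> [_ h _]; have /andP[+ _] := h x; apply:lt_le_trans; rewrite invr_gt0 ltr0n. Qed.
Let adm_le t x : adm H c t -> t x <= H%:R.
by move=> [_ h _]; have /andP[] := h x. Qed.
Let adm_ge t x : adm H c t -> H%:R^-1 <= t x.
by move=> [_ h _]; have /andP[] := h x. Qed.

Let ratio : R := 2^-1 `^ H%:R^-1.
Let ratio_lt1 : 0 <= ratio < 1.
rewrite /ratio powR_ge0; apply:(@lt_le_trans _ _ (1 `^ H%:R^-1)); last by rewrite powR1.
by apply:gt0_ltr_powR; rewrite ?invr_gt0 ?ltr0n ?nnegrE// invf_lt1// ltr1n.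
Qed.
Let geom : R := (1 - ratio)^-1.
Let geom_ge0 : 0 <= geom.
by have /andP[_ r] := ratio_lt1; rewrite invr_ge0 subr_ge0. Qed.

Let geom_sum J : \sum_(j < J) ratio ^+ j <= geom.
have /andP[r0 r1] := ratio_lt1; have u0 : 0 < 1 - ratio by rewrite subr_gt0.
rewrite -[leRHS]mul1r ler_pdivlMr//; elim:J => [|J IH]; first by rewrite big_ord0 mul0r.
suff : (\sum_(j < J.+1) ratio ^+ j) * (1 - ratio) = 1 - ratio ^+ J.+1.
 by move=> ->; rewrite gerBl.
elim:(J.+1) => [|k IHk]; first by rewrite big_ord0 mul0r subrr.
by rewrite big_ord_recr mulrDl IHk exprS; ring.
Qed.

Ltac done ::= basic_done.
Lemma bgd_powR j x : bgd A j x `^ q x <= ratio ^+ j * wt A x `^ q x.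
have h0 : 0 <= (2^-1 : R) by rewrite invr_ge0.
rewrite /bgd powRM ?wt_ge0 ?exprn_ge0//; apply:ler_wpM2r; first exact:powR_ge0.
rewrite /ratio -[2^-1 ^+ j]powR_mulrn// -[(_ `^ _) ^+ j]powR_mulrn ?powR_ge0// -!powRrM.
apply:ger_powR; first by rewrite invr_gt0 ltr0n invf_le1// ler1n.
by rewrite mulrC ler_pM// ?invr_ge0//; exact:adm_ge.
Qed.
Ltac done ::= extended_done.

Let Z : R := 2 ^+ H * (1 + geom).
Let Z_ge1 : 1 <= Z.
by apply:mulr_ege1 => //; rewrite lerDl. Qed.
Definition bgd_cost : R := Z ^+ H * (1 + wt_mass R d W).

Lemma bgd_modular (f : nat -> V -> R) J : (forall j, meas (f j)) ->
 (forall j x, 0 <= f j x) -> (\int[mu]_x ((\sum_(j < J) f j x `^ q x) `^ v x)%:E <= 1%:E)%E ->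
 (\int[mu]_x ((\sum_(j < J) (f j x + bgd A j x) `^ q x) `^ v x)%:E <= bgd_cost%:E)%E.
move=> mf f0 fJ; have [mv _ _] := v_adm; have [mq _ _] := q_adm.
have ms (g : nat -> V -> R) : (forall j, meas (g j)) -> meas (fun x => (\sum_(j < J) g j x `^ q x) `^ v x).
 by move=> mg; apply:mbl_powR2 => //; apply:measurable_sum => j.
apply:(@le_trans _ _ (\int[mu]_x ((Z ^+ H)%:E * (((\sum_(j < J) f j x `^ q x) `^ v x)%:E + (wt W x)%:E)))%E).
 apply:ge0_le_integral => //.
 - apply/measurable_EFinP; apply:(ms (fun j x => f j x + bgd A j x)) => j.
  by [].
 - apply:measurable_funeM; apply:emeasurable_funD; apply/measurable_EFinP => //; exact:mbl_wt.
 move=> x _; rewrite lee_fin.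
 pose w (i : bool) : R := if i then 2 ^+ H else 2 ^+ H * geom.
 pose t (i : bool) : R := if i then \sum_(j < J) f j x `^ q x else wt A x `^ q x.
 have q0 := adm_gt0 x q_adm.
 have two (u w' : R) : 0 <= u -> 0 <= w' -> (u + w') `^ q x <= 2 ^+ H * (u `^ q x + w' `^ q x).
  move=> u0 w0; have := @powR_sum_le R bool (fun i => if i then u else w') (fun=> 1) (q x) 2 H q0 (adm_le x q_adm).
  rewrite !big_bool !mul1r => -> //; first by rewrite ler1n.
  by case.
 apply:(@le_trans _ _ ((\sum_(i : bool) w i * t i) `^ v x)).
  apply:ge0_ler_powR; rewrite ?nnegrE ?(ltW (adm_gt0 x v_adm))//.
  - apply:sumr_ge0 => -[] _; rewrite /w /t//.
  rewrite big_bool /= mulr_sumr -mulrA [geom * _]mulrC mulrCA.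
  apply:(@le_trans _ _ (\sum_(j < J) (2 ^+ H * f j x `^ q x + 2 ^+ H * (wt A x `^ q x * ratio ^+ j)))).
   apply:ler_sum => j _; apply:le_trans (two _ _ (f0 j x) (ltW (bgd_gt0 _ _ _))) _.
   rewrite mulrDr lerD2l; apply:ler_wpM2l => //.
   by rewrite [leRHS]mulrC; exact:bgd_powR.
  rewrite big_split/= lerD2l -mulr_sumr -mulr_sumr [leRHS]mulrCA; apply:ler_wpM2l => //.
  by apply:ler_wpM2l => //; exact:geom_sum.
 apply:le_trans (powR_sum_le (Z := Z) (adm_gt0 x v_adm) (adm_le x v_adm) Z_ge1 _ _ _) _.
 - by case; rewrite /t.
 - by case; rewrite /w.
 - by rewrite big_bool /Z mulrDr mulr1.
 apply:ler_wpM2l => //; rewrite big_bool lerD2l -powRrM qv.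
 exact:(wt_powR H_gt0 p_adm).
rewrite ge0_integralZl_EFin//; first last.
- by apply:emeasurable_funD; apply/measurable_EFinP => //; exact:mbl_wt.
- by move=> x _; rewrite lee_fin addr_ge0 ?wt_ge0.
rewrite EFinM; apply:lee_wpmul2l => //.
rewrite ge0_integralD//; first last.
- by apply/measurable_EFinP; exact:mbl_wt.
- by move=> x _; rewrite lee_fin wt_ge0.
by rewrite int_wtE// EFinD; apply:leeD.
Qed.

Theorem ptr_max (Dm : nat -> R) : (forall M, 0 <= Dm M) -> exists2 C : R, 0 <= C &
 forall f : nat -> V -> R, (forall j, meas (f j)) -> (forall j x, 0 <= f j x) ->
 (forall j M, smean M (Dm M) j (f j)) ->
 (forall j, exists K : R, exists m : nat, forall x, f j x <= K * (1 + `|x|) ^+ m) ->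
 (forall J, (\int[mu]_x ((\sum_(j < J) f j x `^ q x) `^ v x)%:E <= 1%:E)%E) ->
 exists (Psi : V -> \bar R) (Fs : nat -> V -> R), [/\ meas Psi, forall x, (0 <= Psi x)%E,
  (\int[mu]_x Psi x <= C%:E)%E, forall j x z, f j z <= Fs j x * nrm j (x - z) ^+ a &
  forall J x, (((\sum_(j < J) Fs j x `^ q x) `^ v x)%:E <= Psi x)%E].
move=> Dm0; have bv := ball_vol_gt0.
pose Df M := Dm M + 2 ^+ (M + A) / ball_vol R d.
have Df0 M : 0 <= Df M by rewrite addr_ge0.
have Q0 : 0 <= bgd_cost.
 by rewrite mulr_ge0// addr_ge0// wt_mass_ge0.
have [al al0 hal] := level_cost_gr n H c (Df0 (a + W).+1) Q0.
pose C := (2 ^+ H * (2 * #|{ffun 'I_d -> bool}|%:R)) ^+ H * (al * (1 + 8 * (2 + tk_rad n (Df (a + W).+1))) ^+ gr_expo n H c * 2 * #|{ffun 'I_d -> bool}|%:R).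
have r0 : 0 <= tk_rad n (Df (a + W).+1).
 by apply:mulr_ge0 => //; rewrite addr_ge0// mulr_ge0// wt_mass_ge0.
exists C.
 apply:mulr_ge0 => //.
move=> f mf f0 fs fg fJ.
pose F j x := f j x + bgd A j x.
have mF j : meas (F j) by apply:measurable_funD => //; by [].
have F_gt0 j x : 0 < F j x by rewrite ltr_wpDl.
have F_low j x : 2^-1 ^+ j * wt A x <= F j x by rewrite lerDr.
have F_sub j M : smean M (Df M) j (F j).
 apply:smeanD => //; exact:bgd_smean.
have F_mod J : (\int[mu]_x ((\sum_(j < J) F j x `^ q x) `^ v x)%:E <= bgd_cost%:E)%E by exact:bgd_modular.
(* So far the blocks are only known to grow like [(1 + |x|) ^ m] with [m] depending on [f]. A thick
   point for the order [m] exists for every [x], and [tk_upper] bounds its value. Boundedness is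
   used only qualitatively, so the dependence on [m] is harmless. *)
have F_bnd j : exists K : R, forall x, F j x <= K.
 have [K [m hK]] := fg j.
 exists (2 * (tk_bnd n H (Df (m + W).+1) bgd_cost * 2 ^+ (j * d * H))) => x.
 have [|z [tz hz]] := @tk_point R n m (Df (m + W).+1) j (F j) x ((`|K| + 1) * (1 + `|x|) ^+ m) (Df0 _) (mF j) (F_gt0 j) (F_sub j _).
  move=> y; have n1 : 1 <= nrm j (x - y) ^+ m by rewrite exprn_ege1.
  have e1 : (1 + `|y|) ^+ m <= (1 + `|x|) ^+ m * nrm j (x - y) ^+ m.
   rewrite -exprMn; apply:lerXn2r; rewrite ?nnegrE//.
   have := nrm_tri 0 0 x (y); rewrite !sub0r !nrmN /nrm !scale1r => /le_trans; apply.
   apply:ler_wpM2l => //.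
   by rewrite lerD2l normrZ ler_peMl// ger0_norm.
  have b1 : bgd A j y <= 1.
   rewrite -[leRHS]mulr1; apply:ler_pM; rewrite ?invr_ge0//.
    by rewrite exprn_ile1// invf_le1// ler1n.
   by rewrite invf_le1// exprn_ege1// onrm_ge1.
  have x1 : 1 <= (1 + `|x|) ^+ m by exact:exprn_ege1.
  rewrite -mulrA mulrDl mul1r; apply:lerD; last by apply:le_trans b1 _; exact:mulr_ege1.
  apply:le_trans (hK y) _; apply:le_trans (ler_wpM2r _ (ler_norm K)) _ => //.
  exact:ler_wpM2l.
 have := hz x; rewrite subrr /nrm scaler0 normr0 addr0 expr1n mulr1 => h.
 have n1 : 1 <= nrm j (x - z) ^+ m by rewrite exprn_ege1.
 apply:(@le_trans _ _ (2 * F j z)).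
  by apply:le_trans h; rewrite ler_peMr.
 apply:ler_wpM2l => //.
 exact:(tk_upper H_gt0 qv p_adm q_adm v_adm (Df0 _) Q0 mF F_low F_mod tz).
have [Psi [Fs [h1 h2 h3 h4 h5]]] := ptr_limit H_gt0 qv p_adm q_adm v_adm (Df0 _) Q0 mF F_low F_bnd F_mod (fun j => F_sub j _) al0 hal.
exists Psi, Fs; split=> // j x z; apply:le_trans (h4 j x z).
by rewrite lerDl.
Qed.

End ptr_max.
Hint Resolve bgd_gt0 : pos.
Hint Resolve mbl_bgd : mble.

(** * Hardy's inequality over scales *)

Section discrete_hardy.
Context (R : realType).
Implicit Types (y Fs : nat -> R).

Let i0 m : 0 <= (2^-1 : R) ^+ m. by []. Qed.
Let i1 m : (2^-1 : R) ^+ m <= 1. by rewrite exprn_ile1// invf_le1// ler1n. Qed.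
Let ip m : 0 < (2^-1 : R) ^+ m. by []. Qed.

Lemma gap_select k y (s : R) : (forall l, 0 <= y l) -> (forall l, y l <= s) ->
 exists l0, forall l, 2^-1 ^+ gap k l * y l <= 2 * (2^-1 ^+ gap k l0 * y l0).
move=> y0 ys; have [[l1 h1]|no] := pselect (exists l, 0 < y l).
 apply:(@near_sup R nat (fun l => 2^-1 ^+ gap k l * y l) s l1); last by [].
 by move=> l; apply:le_trans (ys l); rewrite ler_piMl.
exists 0%N => l; have -> : y l = 0.
 by apply/le_anti; rewrite y0 andbT leNgt; apply/negP => h; apply:no; exists l.
by rewrite mulr0.
Qed.

Lemma gap_select_sum y (s : R) (lk : nat -> nat) K : (forall l, 0 <= y l) ->
 (forall J, \sum_(l < J) y l <= s) -> \sum_(k < K) 2^-1 ^+ gap k (lk k) * y (lk k) <= 3 * s.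
move=> y0 ys; pose J := (\max_(k < K) lk k).+1.
apply:(@le_trans _ _ (\sum_(k < K) \sum_(l < J) 2^-1 ^+ gap k l * y l)).
 apply:ler_sum => k _; have kJ : (lk k < J)%N by rewrite ltnS (leq_bigmax k).
 by rewrite (bigD1 (Ordinal kJ))//= lerDl// => l _.
rewrite exchange_big/=; apply:le_trans (ler_wpM2l _ (ys J)) => //.
rewrite mulr_sumr; apply:ler_sum => l _; rewrite -mulr_suml; apply:ler_wpM2r => //; exact:gap_sum.
Qed.

Lemma hardy (q D0 h y : R) Fs k (H : nat) : (0 < H)%N -> H%:R^-1 <= q -> q <= H%:R -> 0 <= D0 -> 0 <= h ->
 (forall l, 0 <= Fs l) ->
 (forall B, (forall J, \sum_(l < J) 2^-1 ^+ (gap k l * (H * H).+1) * Fs l <= B) -> h <= D0 * B) ->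
 (forall l, 2^-1 ^+ (gap k l * H) * Fs l `^ q <= y) -> h `^ q <= (3 * D0 + 1) ^+ H * y.
move=> H0 q1 q2 D00 h0 F0 hB hy.
have q0 : 0 < q by apply:lt_le_trans q1; rewrite invr_gt0 ltr0n.
have y0 : 0 <= y by apply:le_trans (hy 0%N); rewrite mulr_ge0.
have Fy l : Fs l <= 2 ^+ (gap k l * (H * H)) * y `^ q^-1.
 have : Fs l `^ q <= 2 ^+ (gap k l * H) * y by rewrite -ler_pdivrMl// -exprVn.
 move=> /(powR_leV q0 (F0 l)) /le_trans; apply.
 rewrite powRM//; apply:ler_wpM2r => //.
 rewrite mulnA [leRHS]exprM; apply:powR_exp_le => //.
 by rewrite -[leRHS]invrK lef_pV2 ?posrE ?invr_gt0 ?ltr0n.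
have {}hB : h <= D0 * (3 * y `^ q^-1).
 apply:hB => J; apply:le_trans (ler_wpM2r (powR_ge0 y q^-1) (gap_sum R k J)); rewrite mulr_suml.
 apply:ler_sum => l _; apply:le_trans (ler_wpM2l (i0 _) (Fy l)) _; rewrite mulrA; apply:ler_wpM2r => //.
 by rewrite mulnS exprD -mulrA -exprMn mulVf// expr1n mulr1 gapC.
have hq : h <= (3 * D0 + 1) * y `^ q^-1.
 by apply:le_trans hB _; rewrite mulrA [D0 * 3]mulrC; apply:ler_wpM2r; rewrite// lerDl.
have z1 : 1 <= 3 * D0 + 1 by rewrite lerDr.
apply:(@le_trans _ _ (((3 * D0 + 1) * y `^ q^-1) `^ q)).
 by apply:ge0_ler_powR; rewrite ?nnegrE.
rewrite powRM// -powRrM mulVf// powRr1//.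
by apply:ler_wpM2r => //; exact:powR_exp_le.
Qed.

End discrete_hardy.

(** * Modular estimates for the weighted blocks of the extension *)

Section extension_estimate.
Context (R : realType) (n : nat).
Local Notation d := n.+1.
Local Notation V := 'rV[R]_d.
Local Notation C := R[i].
Local Notation S := (schwartz R d).
Context (theta : nat -> S) (theta_Phi : Phi theta).
Implicit Types (x y z : V) (T : S -> C).

Variable c : R.
Hypothesis c_neq0 : c != 0.
Hypothesis c_inv : forall f : V -> R, rsch f -> \int[mu]_xi rfour false f xi = c * f 0.
Variable P : V -> R.
Hypothesis P_sch : rsch P.
Hypothesis P_mom : unit_mom P.
Local Notation extD := (extD P).

Definition ampl T l x : R := normc (block theta T l x).

Lemma ampl_ge0 T l x : 0 <= ampl T l x. exact:normc_ge0. Qed.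

Lemma ampl_slow T l : tempered T -> meas (ampl T l) /\
 exists K : R, exists m : nat, forall x, ampl T l x <= K * (1 + `|x|) ^+ m.
move=> tT; have [k [A A0 [[m1 b1 _] [m2 b2 _]]]] := ev_shift_cont tT (csch_kern (sch_csch (theta l))).
split; last first.
 exists (A + A), k => x; apply:le_trans (normc_le _) _; rewrite mulrDl; apply:lerD; [exact:b1|exact:b2].
rewrite (_ : ampl T l = @Num.sqrt R \o (fun z => Re (block theta T l z) ^+ 2 + Im (block theta T l z) ^+ 2)); last first.
 by apply/funext => z; rewrite /ampl /=; case:(block theta T l z).
apply:measurableT_comp; first by apply:continuous_measurable_fun; exact:sqrt_continuous.
by [].
Qed.

Lemma ampl_smean : exists Dm : nat -> R, (forall M, 0 <= Dm M) /\
 forall T l M, tempered T -> smean M (Dm M) l (ampl T l).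
have h M : exists D : R, 0 <= D /\ forall T l, tempered T -> smean M D l (ampl T l).
 have [D D0 HD] := block_smean theta_Phi c_neq0 c_inv M.
 by exists D; split=> // T l tT x; exact:HD.
have [Dm hDm] := choice h; exists Dm; split=> [M|T l M tT]; first by have [] := hDm M.
by have [_] := hDm M.
Qed.

(** The weights that the estimates tolerate: changing the point costs [b] orders of the Peetre
    weight and changing the level costs [S'] orders of decay in the gap. *)
Definition mult (E : R) (b S' : nat) (m : nat -> V -> R) := [/\ forall l, meas (m l),
 forall l x, 0 < m l x, forall l x y, m l x <= E * nrm l (x - y) ^+ b * m l y &
 forall k l x, m k x <= 2 ^+ (gap k l * S') * m l x].

Lemma wted_smean M b (D E : R) l (m g : V -> R) : 0 <= D -> 0 <= E ->
 meas m -> meas g -> (forall x, 0 <= g x) -> (forall x, 0 < m x) ->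
 (forall x y, m x <= E * nrm l (x - y) ^+ b * m y) -> smean (b + M) D l g ->
 smean M (E * D) l (fun x => m x * g x).
move=> D0 E0 mm mg g0 m0 mb sg x.
have me := @mbl_eta R n.
apply:(@le_trans _ _ ((m x)%:E * (D%:E * \int[mu]_z (eta (b + M) l (z - x) * g z)%:E))%E).
 by rewrite EFinM; apply:lee_wpmul2l => //.
rewrite muleCA [(E * D)%:E]EFinM [(E%:E * D%:E)%E]muleC -muleA; apply:lee_wpmul2l => //.
rewrite -!ge0_integralZl_EFin//; first last.
- by move=> z _; rewrite lee_fin mulr_ge0 ?eta_ge0.
- by move=> z _; rewrite lee_fin mulr_ge0 ?eta_ge0.
apply:ge0_le_integral => //.
- by move=> z _; rewrite lee_fin mulr_ge0// mulr_ge0 ?eta_ge0.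
- by apply:measurable_funeM.
- by apply:measurable_funeM.
move=> z _; rewrite lee_fin -(eta_nrm b M).
apply:le_trans (ler_wpM2r _ (mb x z)) _; first by rewrite mulr_ge0 ?eta_ge0.
rewrite -[nrm l (x - z)]nrmN opprB; apply:eqW.
by move:(nrm _ _ ^+ b) (eta _ _ _) (m z) (g z) => *; ring.
Qed.

Variables (p q v : V -> R) (H cc : nat).
Hypothesis H_gt0 : (0 < H)%N.
Hypothesis qv : forall x, q x * v x = p x.
Hypotheses (p_adm : adm H cc p) (q_adm : adm H cc q) (v_adm : adm H cc v).
Local Notation a := (ptr_expo n H cc).

Let adm_gt0 t x : adm H cc t -> 0 < t x.
by move=> [_ h _]; have /andP[+ _] := h x; apply:lt_le_trans; rewrite invr_gt0 ltr0n. Qed.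
Let adm_le t x : adm H cc t -> t x <= H%:R.
by move=> [_ h _]; have /andP[] := h x. Qed.
Let adm_ge t x : adm H cc t -> H%:R^-1 <= t x.
by move=> [_ h _]; have /andP[] := h x. Qed.

Variables (E : R) (b S' : nat).
Hypothesis E_ge0 : 0 <= E.

Lemma ext_powR : exists2 D : R, 1 <= D & forall T m x (Fs : nat -> R) k (y : R), tempered T -> mult E b S' m ->
 (forall l z, m l z * ampl T l z <= Fs l * nrm l (x - z) ^+ a) ->
 (forall l, 2^-1 ^+ (gap k l * H) * Fs l `^ q x <= y) ->
 (m k x * ampl (extD T) k x) `^ q x <= D * y.
have [D D0 HD] := extD_block_bnd theta_Phi c_neq0 c_inv P_sch P_mom (b + a) (S' + (H * H).+1).
have z1 : 1 <= 3 * (D * E) + 1 by rewrite lerDr.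
exists ((3 * (D * E) + 1) ^+ H) => [|T m x Fs k y tT [_ m0 mb mg] hF hy]; first exact:exprn_ege1.
have F0 l : 0 <= Fs l.
 have := hF l x; rewrite subrr /nrm scaler0 normr0 addr0 expr1n mulr1; apply:le_trans.
 by rewrite mulr_ge0 ?normc_ge0.
apply:(hardy (Fs := Fs) (k := k)) => //.
- exact:adm_ge. 
- exact:adm_le.
- by rewrite mulr_ge0 ?normc_ge0.
move=> B hB; rewrite mulrC -ler_pdivlMr// -!mulrA.
(* The multiplier is frozen at [x], which costs [nrm ^ b] and explains the Peetre order [b + a]. *)
apply:(HD T x k (fun l => E / m l x * Fs l)) => //.
 move=> l z; have nz : 0 <= nrm l (x - z) by exact:nrm_ge0.
 rewrite exprD -(ler_pM2l (m0 l z)); apply:le_trans (hF l z) _.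
 rewrite [leRHS](_ : _ = (E * nrm l (x - z) ^+ b * m l z / m l x) * (Fs l * nrm l (x - z) ^+ a)); last by ring.
 rewrite ler_peMl// ler_pdivlMr// mul1r; by [].
move=> J; apply:(@le_trans _ _ (\sum_(l < J) (E / m k x) * (2^-1 ^+ (gap k l * (H * H).+1) * Fs l))); last first.
 by rewrite -mulr_sumr -mulrA [B / _]mulrC; apply:ler_wpM2l => //; apply:ler_wpM2l.
apply:ler_sum => l _; rewrite mulnDr exprD.
rewrite [leLHS](_ : _ = (2^-1 ^+ (gap k l * S') / m l x) * (E * 2^-1 ^+ (gap k l * (H * H).+1) * Fs l)); last by ring.
rewrite [leRHS](_ : _ = (m k x)^-1 * (E * 2^-1 ^+ (gap k l * (H * H).+1) * Fs l)); last by ring.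
apply:ler_wpM2r => //.
rewrite ler_pdivrMr// ler_pdivlMl// exprVn ler_pdivrMr// [m l x * _]mulrC; by [].
Qed.

(** [L] selects the levels that enter: all of them for Triebel-Lizorkin spaces, a single one for
    Besov spaces. *)
Lemma mult_max : exists2 K : R, 0 <= K & forall T m (L : pred nat), tempered T -> mult E b S' m ->
 (forall l, exists M : R, forall x, m l x <= M) ->
 (forall J, (\int[mu]_x ((\sum_(j < J | L j) (m j x * ampl T j x) `^ q x) `^ v x)%:E <= 1%:E)%E) ->
 exists (Psi : V -> \bar R) (Fs : nat -> V -> R), [/\ meas Psi, forall x, (0 <= Psi x)%E,
  (\int[mu]_x Psi x <= K%:E)%E,
  forall l x z, L l -> m l z * ampl T l z <= Fs l x * nrm l (x - z) ^+ a &
  forall J x, (((\sum_(j < J) Fs j x `^ q x) `^ v x)%:E <= Psi x)%E].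
have [Dm [Dm0 HDm]] := ampl_smean.
have ED0 M : 0 <= E * Dm (b + M)%N by exact:mulr_ge0.
have [K K0 HK] := ptr_max H_gt0 qv p_adm q_adm v_adm ED0.
exists K => // T m L tT [mm m0 mb mg] mM fJ.
pose f j x := if L j then m j x * ampl T j x else 0.
have mf j : meas (f j).
 by rewrite /f; case:(L j) => //; apply:measurable_funM => //; have [] := ampl_slow j tT.
have [|||| Psi [Fs [h1 h2 h3 h4 h5]]] := HK f mf.
- by move=> j x; rewrite /f; case:(L j) => //; rewrite mulr_ge0 ?normc_ge0.
- move=> j M; rewrite /f; case:(L j) => [|x].
  apply:(wted_smean (b := b)) => //; [by have [] := ampl_slow j tT|exact:ampl_ge0].
 by rewrite mule_ge0//; apply:integral_ge0 => z _; rewrite mulr0.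
- move=> j; have [_ [A [k hA]]] := ampl_slow j tT; have [M hM] := mM j.
 exists (M * `|A|), k => x; have M0 : 0 <= M by apply:le_trans (hM x); by [].
 rewrite /f; case:(L j) => //.
 rewrite -mulrA; apply:ler_pM; rewrite ?normc_ge0//.
 by apply:le_trans (hA x) _; apply:ler_wpM2r => //; exact:ler_norm.
- move=> J; rewrite (_ : (fun x => _) = fun x => ((\sum_(j < J | L j) (m j x * ampl T j x) `^ q x) `^ v x)%:E); last first.
  apply/funext => x; congr ((_ `^ _)%:E); rewrite [RHS]big_mkcond; apply:eq_bigr => j _.
  by rewrite /f; case:(L j) => //; rewrite powR0// gt_eqF// adm_gt0.
 by [].
exists Psi, Fs; split=> // l x z Ll; have := h4 l x z; by rewrite /f Ll.
Qed.

Lemma TL_ext : exists2 K : R, 0 <= K & forall T m, tempered T -> mult E b S' m ->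
 (forall l, exists M : R, forall x, m l x <= M) ->
 (forall J, (\int[mu]_x ((\sum_(j < J) (m j x * ampl T j x) `^ q x) `^ v x)%:E <= 1%:E)%E) ->
 exists X : V -> \bar R, [/\ meas X, forall x, (0 <= X x)%E, (\int[mu]_x X x <= K%:E)%E &
  forall J x, (((\sum_(k < J) (m k x * ampl (extD T) k x) `^ q x) `^ v x)%:E <= X x)%E].
have [K K0 HK] := mult_max; have [D D1 HD] := ext_powR.
pose Z := (6 * D) ^+ H.
have z1 : 1 <= 6 * D by rewrite (le_trans D1)// ler_peMl// ler1n.
have Z0 : 0 <= Z by rewrite exprn_ge0.
exists (Z * K) => [|T m tT hm mM fJ]//.
have [Psi [Fs [h1 h2 h3 h4 h5]]] := HK T m xpredT tT hm mM fJ.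
exists (fun x => Z%:E * Psi x)%E; split.
- exact:measurable_funeM.
- by move=> x; rewrite mule_ge0.
- by rewrite ge0_integralZl_EFin// EFinM; apply:lee_wpmul2l.
move=> J x; have := h2 x; have {}h5 J' := h5 J' x; move:h5; case:(Psi x) => [psi|_ _|//]; last first.
 by rewrite gt0_muley ?leey// lte_fin exprn_gt0.
move=> hS; rewrite lee_fin => psi0; rewrite lee_fin.
have v0 := adm_gt0 x v_adm.
have Sle J' : \sum_(j < J') Fs j x `^ q x <= psi `^ (v x)^-1.
 by apply:powR_leV => //; rewrite -lee_fin.
have y0 l : 0 <= Fs l x `^ q x by exact:powR_ge0.
have yS l : Fs l x `^ q x <= psi `^ (v x)^-1.
 by apply:le_trans (Sle l.+1); rewrite big_ord_recr lerDr.
(* Near maximisers replace the supremum over [l], so that the sum over [k] falls under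
   [gap_select_sum]. *)
have [lk hlk] := choice (fun k => gap_select k y0 yS).
have hk k : (m k x * ampl (extD T) k x) `^ q x <= D * (2 * (2^-1 ^+ gap k (lk k) * Fs (lk k) x `^ q x)).
 apply:(HD T m x (Fs^~ x)) => // [l z|l]; first exact:h4.
 apply:le_trans (hlk k l); apply:ler_wpM2r => //.
 by apply:ler_wiXn2l; rewrite ?invf_le1 ?ler1n// leq_pmulr.
apply:(@le_trans _ _ ((6 * D * psi `^ (v x)^-1) `^ v x)).
 apply:ge0_ler_powR; rewrite ?nnegrE//.
 apply:(@le_trans _ _ (\sum_(k < J) D * (2 * (2^-1 ^+ gap k (lk k) * Fs (lk k) x `^ q x)))); first by apply:ler_sum => k _; by [].
 rewrite -mulr_sumr -mulr_sumr [leRHS](_ : _ = D * (2 * (3 * psi `^ (v x)^-1))); last by ring.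
 by do 2! apply:ler_wpM2l => //; exact:(gap_select_sum (y := fun l => Fs l x `^ q x)).
rewrite powRM// -powRrM mulVf// powRr1//.
by apply:ler_wpM2r => //; apply:powR_exp_le => //; exact:adm_le.
Qed.

(** The hypothesis bounds each level separately, so [mult_max] is used for one level at a time. The
    majorants obtained are added with weights [2 ^- gap k l], which keeps the integral below
    [3 K]. *)
Lemma Besov_ext : exists2 K : R, 0 <= K & forall T m, tempered T -> mult E b S' m ->
 (forall l, exists M : R, forall x, m l x <= M) ->
 (forall j, (\int[mu]_x ((m j x * ampl T j x) `^ p x)%:E <= 1%:E)%E) ->
 forall k, (\int[mu]_x ((m k x * ampl (extD T) k x) `^ p x)%:E <= K%:E)%E.
have [K K0 HK] := mult_max; have [D D1 HD] := ext_powR.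
exists (D ^+ H * (3 * K)) => [|T m tT hm mM fJ k]//.
have [mm m0 mb mg] := hm.
have h l : exists PF : (V -> \bar R) * (nat -> V -> R), [/\ meas PF.1, forall x, (0 <= PF.1 x)%E,
  (\int[mu]_x PF.1 x <= K%:E)%E, forall x z, m l z * ampl T l z <= PF.2 l x * nrm l (x - z) ^+ a &
  forall x, (((PF.2 l x `^ q x) `^ v x)%:E <= PF.1 x)%E].
 have [|Psi [Fs [h1 h2 h3 h4 h5]]] := HK T m (pred1 l) tT hm mM.
  move=> J; apply:le_trans (fJ l); apply:ge0_le_integral => //.
  - have [lJ|lJ] := ltnP l J; last first.
    rewrite (_ : (fun x => _) = cst 0%E)//; apply/funext => x; rewrite big1 ?powR0 ?gt_eqF ?adm_gt0//.
    by move=> i /eqP il; move:(ltn_ord i); rewrite il ltnNge lJ.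
   rewrite (_ : (fun x => _) = fun x => (((m l x * ampl T l x) `^ q x) `^ v x)%:E); last first.
    by apply/funext => x; rewrite (big_pred1 (Ordinal lJ)).
   apply/measurable_EFinP; apply:mbl_powR2; last by case:v_adm.
   apply:mbl_powR2; last by case:q_adm.
   by apply:measurable_funM => //; have [] := ampl_slow l tT.
  - apply/measurable_EFinP; apply:mbl_powR2; last by case:p_adm.
   by apply:measurable_funM => //; have [] := ampl_slow l tT.
  move=> x _; rewrite lee_fin; have [lJ|lJ] := ltnP l J.
   by rewrite (big_pred1 (Ordinal lJ))//= -powRrM qv.
  rewrite big1 ?powR0 ?gt_eqF ?adm_gt0//.
  by move=> i /eqP il; move:(ltn_ord i); rewrite il ltnNge lJ.
 exists (Psi, Fs); split=> //= [x z|x]; first by apply:h4 => /=.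
 apply:le_trans (h5 l.+1 x); rewrite lee_fin; apply:ge0_ler_powR; rewrite ?nnegrE ?(ltW (adm_gt0 x v_adm))//.
 by rewrite big_ord_recr lerDr// => j _.
have [PF hPF] := choice h.
pose u l x := ((2^-1 ^+ gap k l)%:E * (PF l).1 x)%E.
have u0 l x : (0 <= u l x)%E by have [_ h2 _ _ _] := hPF l; rewrite mule_ge0.
have mu_ l : meas (u l) by have [h1 _ _ _ _] := hPF l; exact:measurable_funeM.
pose X x := (\sum_(0 <= l <oo) u l x)%E.
have X0 x : (0 <= X x)%E by exact:nneseries_ge0.
have intX : (\int[mu]_x X x <= (3 * K)%:E)%E.
 rewrite integral_nneseries//; apply:lime_le.
  by apply:is_cvg_nneseries => l _ _; apply:integral_ge0.
 apply:nearW => J; rewrite big_mkord.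
 apply:(@le_trans _ _ (\sum_(l < J) (2^-1 ^+ gap k l * K)%:E)%E).
  apply:lee_sum => l _; have [h1 h2 h3 _ _] := hPF l; rewrite ge0_integralZl_EFin// EFinM.
  by apply:lee_wpmul2l => //.
 rewrite sumEFin -mulr_suml; apply:ler_wpM2r => //.
 by apply:le_trans (gap_sum R k J); apply:ler_sum => l _; rewrite gapC.
have mX : meas X by apply:ge0_emeasurable_sum.
apply:(@le_trans _ _ (\int[mu]_x ((D ^+ H)%:E * X x))%E); last first.
 by rewrite ge0_integralZl_EFin// EFinM; apply:lee_wpmul2l.
apply:ge0_le_integral => //.
- apply/measurable_EFinP; apply:mbl_powR2; last by case:p_adm.
 by apply:measurable_funM => //; have [] := ampl_slow k (extD_temp P_sch P_mom tT).
- exact:measurable_funeM.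
move=> x _; have uX l : (u l x <= X x)%E.
 rewrite /X (nneseries_split 0 l.+1)//= add0n big_mkord big_ord_recr/=.
 by rewrite -[leLHS]adde0 leeD ?leeDr ?nneseries_ge0 ?sume_ge0// => i _.
move:uX (X0 x); case:(X x) => [xi|_ _|//]; last by rewrite gt0_muley ?leey.
move=> uX; rewrite lee_fin => xi0; rewrite lee_fin.
have v0 := adm_gt0 x v_adm.
rewrite -qv powRrM.
have hk : (m k x * ampl (extD T) k x) `^ q x <= D * xi `^ (v x)^-1.
 apply:(HD T m x (fun l => (PF l).2 l x)) => // [l z|l]; first by have [_ _ _ h4 _] := hPF l.
 have [_ _ _ _ h5] := hPF l.
 have e1 : (((PF l).2 l x `^ q x) `^ v x) <= 2 ^+ gap k l * xi.
  rewrite -ler_pdivrMl// -exprVn -lee_fin; apply:le_trans (uX l).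
  by rewrite EFinM; apply:lee_wpmul2l.
 have := powR_leV v0 (powR_ge0 _ _) e1; rewrite powRM// => e2.
 rewrite exprVn ler_pdivrMl//; apply:le_trans e2 _; apply:ler_wpM2r => //.
 rewrite exprM; apply:powR_exp_le => //.
 by rewrite -[leRHS]invrK lef_pV2 ?posrE ?invr_gt0 ?ltr0n//; exact:adm_ge.
apply:(@le_trans _ _ ((D * xi `^ (v x)^-1) `^ v x)).
 by apply:ge0_ler_powR; rewrite ?nnegrE.
rewrite powRM// -powRrM mulVf// powRr1//.
by apply:ler_wpM2r => //; apply:powR_exp_le => //; exact:adm_le.
Qed.

End extension_estimate.

(** * From quasi-norms to modulars *)

Section modulars.
Context (R : realType).

(** The integral of a nonnegative function is a supremum over simple functions below it, hence
    monotone whether or not the functions are measurable. *)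
Lemma ge0_le_int_any dT (T : measurableType dT) (mu : {measure set T -> \bar R}) (f g : T -> \bar R) :
 (forall x, (0 <= f x)%E) -> (forall x, (f x <= g x)%E) -> (\int[mu]_x f x <= \int[mu]_x g x)%E.
move=> f0 fg; have g0 x : (0 <= g x)%E by exact:le_trans (fg x).
rewrite !ge0_integralTE//; apply:le_ereal_sup => _ [h hf <-]; exists h => // x.
exact:le_trans (hf x) (fg x).
Qed.

Variables (p q v : R).
Hypotheses (q_gt0 : 0 < q) (v_gt0 : 0 < v) (qv : q * v = p).

Local Notation series_root a := ((\sum_(0 <= j <oo) (a j `^ q)%:E) `^ q^-1)%E.

Let p_gt0 : 0 < p. by rewrite -qv. Qed.

Let part_le (a : nat -> R) J : ((\sum_(j < J) a j `^ q)%:E <= \sum_(0 <= j <oo) (a j `^ q)%:E)%E.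
rewrite -sumEFin -(big_mkord xpredT (fun j => (a j `^ q)%:E)); apply:nneseries_lim_ge => j _ _.
by [].
Qed.

Let scl_sum (a : nat -> R) (l : R) J : (forall j, 0 <= a j) -> 0 < l ->
 \sum_(j < J) (a j / l) `^ q = (\sum_(j < J) a j `^ q) * l^-1 `^ q.
move=> a0 l0; rewrite mulr_suml; apply:eq_bigr => j _.
by rewrite powRM.
Qed.

Let root_powR (s l : R) : 0 <= s -> 0 < l -> (s `^ q^-1 * l^-1) `^ p = (s * l^-1 `^ q) `^ v.
move=> s0 l0; have il : 0 <= l^-1 by rewrite ltW.
rewrite !powRM// -!powRrM -qv; congr (_ `^ _ * _ `^ _).
by rewrite mulKf.
Qed.

Lemma series_root_lower (a : nat -> R) (l : R) J : (forall j, 0 <= a j) -> 0 < l ->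
 (((\sum_(j < J) (a j / l) `^ q) `^ v)%:E <= (`|series_root a| * (l^-1)%:E) `^ p)%E.
move=> a0 l0; have := part_le a J; have : (0 <= \sum_(0 <= j <oo) (a j `^ q)%:E)%E.
 by apply:nneseries_ge0 => j _ _.
rewrite scl_sum//; case:(\sum_(0 <= j <oo) _)%E => [s|_ _|//]; last first.
 rewrite poweRyr// gt0_mulye//.
 by rewrite poweRyr// leey.
rewrite !lee_fin => s1 hs; rewrite ger0_norm// root_powR//.
by apply:ge0_ler_powR; rewrite ?nnegrE//; apply:ler_wpM2r.
Qed.

Lemma series_root_upper (a : nat -> R) (l G : R) (X : \bar R) : (forall j, 0 <= a j) -> 0 < l -> 0 < G -> (0 <= X)%E ->
 (forall J, (((\sum_(j < J) (a j / l) `^ q) `^ v)%:E <= X)%E) ->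
 ((`|series_root a| * ((G * l)^-1)%:E) `^ p <= (G^-1 `^ p)%:E * X)%E.
move=> a0 l0 G0; have Gp : 0 < G^-1 `^ p by rewrite powR_gt0.
case:X => [xi|_ _|//]; last by rewrite gt0_muley ?leey.
rewrite lee_fin => xi0 hX; have w0 : 0 < l^-1 `^ q by rewrite powR_gt0.
have sx J : \sum_(j < J) a j `^ q <= xi `^ v^-1 / l^-1 `^ q.
 rewrite ler_pdivlMr//; apply:powR_leV => //.
 by rewrite -scl_sum// -lee_fin.
have : (\sum_(0 <= j <oo) (a j `^ q)%:E <= (xi `^ v^-1 / l^-1 `^ q)%:E)%E.
 apply:lime_le; first by apply:is_cvg_nneseries => j _ _; rewrite lee_fin.
 by apply:nearW => J; rewrite big_mkord sumEFin lee_fin.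
have : (0 <= \sum_(0 <= j <oo) (a j `^ q)%:E)%E.
 by apply:nneseries_ge0 => j _ _.
case:(\sum_(0 <= j <oo) _)%E => [s|//|//]; rewrite !lee_fin => s0 hs.
rewrite ger0_norm// root_powR//.
have -> : (G * l)^-1 `^ q = G^-1 `^ q * l^-1 `^ q by rewrite invfM powRM.
rewrite mulrCA powRM// -powRrM qv.
apply:ler_wpM2l => //.
apply:(@le_trans _ _ ((xi `^ v^-1) `^ v)); last by rewrite -powRrM mulVf// powRr1.
apply:ge0_ler_powR; rewrite ?nnegrE//.
by rewrite -ler_pdivlMr.
Qed.

End modulars.

(** * The multipliers of the smoothness and of the Besov norms *)

Section multipliers.
Context (R : realType) (n : nat).
Local Notation d := n.+1.
Local Notation V := 'rV[R]_d.
Implicit Types (x y : V).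

Variables (s r : V -> R) (cs cr : R) (H : nat).
Hypotheses (s_meas : meas s) (r_meas : meas r).
Hypotheses (s_le : forall x, `|s x| <= H%:R) (r_le : forall x, `|r x| <= H%:R).
Hypothesis s_log : forall j x y, `|s x - s y| * ln (level j x) <= cs * (1 + ln (nrm j (x - y))).
Hypothesis r_log : forall j x y, `|r x - r y| * ln (level j x) <= cr * (1 + ln (nrm j (x - y))).

(** For Triebel-Lizorkin spaces [u] is 1. For Besov spaces [u l] is the inverse of a bound for the
    norm of level [l], entering with the exponent [r = 1 / q]. *)
Definition wt_mult (u : nat -> R) (lam : R) l x : R := (2 ^+ l) `^ s x * u l `^ r x / lam.

(** [2 ^+ l] and [u l] both lie, up to constants, between [level l x] and its inverse, so
    [slow_powR] with [A = 1] moves the exponent of either factor. Changing the level costs [H]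
    orders for the first and [2 H] for the second, whence [3 * H]. *)
Lemma wt_multP : exists E : R, exists b S' : nat, 0 <= E /\
 forall (u : nat -> R) (lam : R), 0 < lam -> (forall l, 2^-1 ^+ l.+2 <= u l <= 2 ^+ l.+2) ->
 (forall k l, u k <= 2 ^+ (gap k l * 2) * u l) ->
 mult E b S' (wt_mult u lam) /\ forall l, exists M : R, forall x, wt_mult u lam l x <= M.
pose b := (Num.truncn (`|cs| + `|cr|)).+1.
have hb : cs + cr <= b%:R.
 by rewrite ltW// (le_lt_trans _ (truncnS_gt _))// lerD// ler_norm.
exists (expR (1 * cs + (H%:R + H%:R) * 0) * expR (1 * cr + (H%:R + H%:R) * (2 * ln 2))), b, (3 * H)%N.
split=> [|u lam lam0 ub ug]//.
have ln20 : 0 <= ln (2 : R) by rewrite ln_ge0// ler1n.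
have p0 l := expr2_gt0 R l.
have u0 l : 0 < u l by have /andP[+ _] := ub l; apply:lt_le_trans; rewrite exprn_gt0.
split; last first.
 move=> l; exists ((2 ^+ l) ^+ H * (2 ^+ l.+2) ^+ H / lam) => x; apply:ler_wpM2r => //.
 apply:ler_pM; rewrite//.
  by apply:powR_exp_le => //; exact:le_trans (ler_norm _) (s_le x).
 have g1 := expr2_ge1 R l.+2.
 have := @ratio_powR R (2 ^+ l.+2) (r x) (u l) 1 H g1 (u0 l) ltr01.
 rewrite powR1 !mulr1; have /andP[ul uu] := ub l; apply => //.
 by rewrite mulrC -ler_pdivrMr// div1r -exprVn.
split.
- move=> l; apply:measurable_funM => //; apply:measurable_funM; apply:mbl_powR2 => //.
- by move=> l x; rewrite !mulr_gt0.
- move=> l x y; have n1 := nrm_ge1 l (x - y); have n0 : 0 < nrm l (x - y) by exact:lt_le_trans n1.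
 have L1 := ln_level_ge l x.
 have e1 := @slow_powR R n s cs H%:R 1 0 (2 ^+ l) l x y (p0 l) ler01 (lexx 0) s_le s_log.
 have {}e1 : (2 ^+ l) `^ s x <= expR (1 * cs + (H%:R + H%:R) * 0) * nrm l (x - y) `^ (1 * cs) * (2 ^+ l) `^ s y.
  by apply:e1; rewrite lnXn// -[ln 2 *+ l]mulr_natl ger0_norm// addr0 [leRHS]mul1r.
 have l20 : 0 <= 2 * ln (2 : R) by exact:mulr_ge0.
 have e2 := @slow_powR R n r cr H%:R 1 (2 * ln 2) (u l) l x y (u0 l) ler01 l20 r_le r_log.
 have {}e2 : u l `^ r x <= expR (1 * cr + (H%:R + H%:R) * (2 * ln 2)) * nrm l (x - y) `^ (1 * cr) * u l `^ r y.
  apply:e2; have /andP[ul uu] := ub l.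
  have h1 : ln (u l) <= l.+2%:R * ln 2.
   by rewrite mulr_natl -lnXn// ler_ln ?posrE.
  have h2 : - (l.+2%:R * ln 2) <= ln (u l).
   by rewrite mulr_natl -lnXn// -lnV ?posrE// ler_ln ?posrE// -exprVn.
  apply:(@le_trans _ _ (l.+2%:R * ln 2)); first by rewrite ler_norml.
  by rewrite -addn2 natrD mulrDl mul1r lerD2r.
 rewrite /wt_mult mulrA; apply:ler_wpM2r => //.
 apply:le_trans (ler_pM (powR_ge0 _ _) (powR_ge0 _ _) e1 e2) _.
 set E1 := expR _; set E2 := expR _.
 rewrite [leLHS](_ : _ = E1 * E2 * (nrm l (x - y) `^ (1 * cs) * nrm l (x - y) `^ (1 * cr)) * ((2 ^+ l) `^ s y * u l `^ r y)); last by ring.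
 apply:ler_wpM2r => //.
 apply:ler_wpM2l; first by rewrite mulr_ge0 ?expR_ge0.
 rewrite -powRD ?(gt_eqF n0) ?implybT// !mul1r; exact:powR_exp_le.
move=> k l x; rewrite mulrA; apply:ler_wpM2r => //.
have pg (i j : nat) : (2 : R) ^+ i <= 2 ^+ gap i j * 2 ^+ j.
 by rewrite -exprD ler_weXn2l ?ler1n /gap; lia.
have e1 : (2 ^+ k) `^ s x <= (2 ^+ gap k l) ^+ H * (2 ^+ l) `^ s x.
 by apply:ratio_powR => //; rewrite gapC.
have e2 : u k `^ r x <= (2 ^+ (gap k l * 2)) ^+ H * u l `^ r x.
 by apply:ratio_powR => //; rewrite gapC.
apply:le_trans (ler_pM (powR_ge0 _ _) (powR_ge0 _ _) e1 e2) _.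
rewrite [leLHS]mulrACA; apply:ler_wpM2r => //.
rewrite -!exprM -exprD; apply:eqW; congr (_ ^+ _); ring.
Qed.

End multipliers.

(** * Boundedness of the extension in the quasi-norms *)

Section quasinorms.
Context (R : realType) (n : nat).
Local Notation d := n.+1.
Local Notation V := 'rV[R]_d.
Local Notation C := R[i].
Local Notation S := (schwartz R d).
Implicit Types (x y z : V) (T : S -> C) (p q s : V -> R).

(** By continuity the essential lower bounds hold at every point; the constants of all exponents are
    then rounded up to [H] and [cc]. *)
Lemma expos p q s (N : nat) : (0 < N)%N -> Clog p -> Clog q -> Clog s ->
 ((N%:R^-1)%:E <= ess_inf mu (EFin \o p))%E -> ((N%:R^-1)%:E <= ess_inf mu (EFin \o q))%E ->
 exists H cc : nat, [/\ (0 < H)%N, adm H cc p, adm H cc q, adm H cc (fun x => p x / q x) &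
  (forall x, `|s x| <= H%:R) /\ (forall x, `|(q x)^-1| <= H%:R)].
move=> N0 Cp Cq Cs pN qN.
have cp := Clog_cont Cp; have cq := Clog_cont Cq.
have mp := cont_mbl_rV cp; have mq := cont_mbl_rV cq.
have {}pN := ess_inf_cont cp pN; have {}qN := ess_inf_cont cq qN.
have n0 : 0 < (N%:R : R) by rewrite ltr0n.
have p0 x : 0 < p x by apply:lt_le_trans (pN x); rewrite invr_gt0.
have q0 x : 0 < q x by apply:lt_le_trans (qN x); rewrite invr_gt0.
have [Kp Kp0 hKp] := Clog_bnd Cp; have [Kq Kq0 hKq] := Clog_bnd Cq; have [Ks Ks0 hKs] := Clog_bnd Cs.
have lp := Clog_logcont Cp; have lq := Clog_logcont Cq.
have lv : logcont (fun x => p x / q x).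
 by apply:(@logcont_div _ _ p q (N%:R^-1)) => //; [exists Kp|exists Kq].
case:lp lq lv => cp' cp0 lp [cq' cq0 lq] [cv cv0 lv].
pose B : R := N%:R + Kp + Kq + Ks + N%:R * Kq + Kp * N%:R.
pose H := (Num.truncn B).+1; have BH : B <= H%:R by rewrite ltW// truncnS_gt.
pose cc := (Num.truncn (cp' + cq' + cv)).+1; have hcc : cp' + cq' + cv <= cc%:R by rewrite ltW// truncnS_gt.
have B1 : [/\ N%:R <= B, Kp <= B, Kq <= B & Ks <= B] /\ (N%:R * Kq <= B /\ Kp * N%:R <= B).
 have := mulr_ge0 (ltW n0) Kq0; have := mulr_ge0 Kp0 (ltW n0); rewrite /B.
 by move:(N%:R * Kq) (Kp * N%:R) n0 Kp0 Kq0 Ks0 => *; repeat split; lra.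
case:B1 => -[BN BKp BKq BKs] [BNq BpN].
have H0 : 0 < (H%:R : R) by rewrite ltr0n.
have HN : (H%:R : R)^-1 <= N%:R^-1 by rewrite lef_pV2// (le_trans BN).
have ln0 j x y : 0 <= 1 + ln (nrm j (x - y)) by rewrite addr_ge0// ln_ge0.
exists H, cc; split=> //.
- split=> // [x|j x y].
  by rewrite (le_trans HN)//= (le_trans _ BH)// (le_trans _ BKp)// (le_trans (ler_norm _)).
 by apply:le_trans (lp j x y) _; apply:ler_wpM2r => //; apply:le_trans hcc; move:cq0 cv0; clear; lra.
- split=> // [x|j x y].
  by rewrite (le_trans HN)//= (le_trans _ BH)// (le_trans _ BKq)// (le_trans (ler_norm _)).
 by apply:le_trans (lq j x y) _; apply:ler_wpM2r => //; apply:le_trans hcc; move:cp0 cv0; clear; lra.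
- split=> [|x|j x y].
 + apply:measurable_funM => //; apply:cont_mbl_rV => x.
  by apply:continuousV => //; exact:cq.
 + have pK : p x <= Kp by apply:le_trans (ler_norm _) (hKp x).
  have qK : q x <= Kq by apply:le_trans (ler_norm _) (hKq x).
  apply/andP; split; last first.
   apply:le_trans BH; apply:le_trans BpN; apply:ler_pM; rewrite//.
   by rewrite -[leRHS]invrK lef_pV2 ?posrE.
  rewrite ler_pdivlMr// ler_pdivrMl//; apply:(@le_trans _ _ (N%:R * Kq * p x)).
   rewrite mulrAC; apply:le_trans qK _; rewrite ler_peMl// -ler_pdivrMl// mulr1; by [].
  by apply:ler_wpM2r => //; exact:le_trans BH.
 + by apply:le_trans (lv j x y) _; apply:ler_wpM2r => //; apply:le_trans hcc; move:cp0 cq0; clear; lra.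
split=> x; first by apply:le_trans (hKs x) _; exact:le_trans BH.
rewrite gtr0_norm//; apply:(@le_trans _ _ N%:R); last exact:le_trans BH.
by rewrite -[leRHS]invrK lef_pV2 ?posrE.
Qed.

Lemma inverse_powR (k t : R) (H : nat) : (0 < H)%N -> 1 <= k -> H%:R^-1 <= t -> (k ^+ H)^-1 `^ t <= k^-1.
move=> H0 k1 tH; have k0 : 0 < k by exact:lt_le_trans k1.
rewrite -exprVn -powR_mulrn// -powRrM -[leRHS]powRr1//.
apply:ger_powR; first by rewrite invf_le1.
by rewrite -ler_pdivrMl ?ltr0n// mulr1.
Qed.

Context (theta : nat -> S) (theta_Phi : Phi theta).
Variable c : R.
Hypothesis c_neq0 : c != 0.
Hypothesis c_inv : forall f : V -> R, rsch f -> \int[mu]_xi rfour false f xi = c * f 0.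
Variable P : V -> R.
Hypothesis P_sch : rsch P.
Hypothesis P_mom : unit_mom P.
Local Notation extD := (extD P).

Lemma normc_dyadic s T j x : tempered T ->
 normc (dyadic_blocks theta s T j x) = (2 ^+ j) `^ s x * ampl theta T j x.
move=> tT; rewrite normcM normcr ger0_norm powRrM powR_mulrn//.
by rewrite (dist_funE (bump_sch theta) (bump_ge0 theta) (bump0 theta_Phi) (bump_supp theta_Phi)).
Qed.

Variables (p q s : V -> R) (H cc : nat).
Hypothesis H_gt0 : (0 < H)%N.
Local Notation v := (fun x => p x / q x).
Hypotheses (p_adm : adm H cc p) (q_adm : adm H cc q) (v_adm : adm H cc v).
Hypotheses (s_le : forall x, `|s x| <= H%:R) (qV_le : forall x, `|(q x)^-1| <= H%:R).
Hypotheses (s_log : Clog s) (q_log : Clog q).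

Let adm_gt0 t x : adm H cc t -> 0 < t x.
by move=> [_ h _]; have /andP[+ _] := h x; apply:lt_le_trans; rewrite invr_gt0 ltr0n. Qed.
Let adm_le t x : adm H cc t -> t x <= H%:R.
by move=> [_ h _]; have /andP[] := h x. Qed.
Let adm_ge t x : adm H cc t -> H%:R^-1 <= t x.
by move=> [_ h _]; have /andP[] := h x. Qed.
Let qv x : q x * v x = p x.
by rewrite mulrC mulfVK// gt_eqF// adm_gt0. Qed.

Local Notation wm := (wt_mult s (fun x => (q x)^-1)).

Let mult_exists : exists E : R, exists b S' : nat, 0 <= E /\
 forall (u : nat -> R) (lam : R), 0 < lam -> (forall l, 2^-1 ^+ l.+2 <= u l <= 2 ^+ l.+2) ->
 (forall k l, u k <= 2 ^+ (gap k l * 2) * u l) ->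
 mult E b S' (wm u lam) /\ forall l, exists M : R, forall x, wm u lam l x <= M.
have [cs cs0 ls] := Clog_logcont s_log.
have [qm qb _] := q_adm.
have [cr cr0 lr] : logcont (fun x => (q x)^-1).
 have := @logcont_div R n (fun=> 1) q H%:R^-1; rewrite invr_gt0 ltr0n => /(_ H_gt0).
 rewrite (_ : (fun x => 1 / q x) = fun x => (q x)^-1)//.
 apply.
 - by move=> x; exact:adm_ge.
 - by exists 0 => // j x y; rewrite subrr normr0 !mul0r.
 - exact:Clog_logcont.
 - by exists 1 => x; rewrite normr1.
 - by exists H%:R => x; rewrite ger0_norm ?adm_le// ltW// adm_gt0.
apply:(wt_multP (cs := cs) (cr := cr)) => //.
- apply:cont_mbl_rV => x; apply:continuousV; first by rewrite gt_eqF// adm_gt0.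
 exact:Clog_cont.
Qed.

Let inf_ge0 (X : set R) : (0 <= ereal_inf [set l%:E | l in [set l : R | (0 < l)%R /\ X l]])%E.
by apply:le_ereal_inf_tmp => _ [l [l0 _] <-]. Qed.

Lemma TL_bnd : exists2 G : R, 0 < G & forall T (lam : R), tempered T ->
 (Lp_lq_quasinorm p q (dyadic_blocks theta s T) < lam%:E)%E ->
 (Lp_lq_quasinorm p q (dyadic_blocks theta s (extD T)) <= (G * lam)%:E)%E.
have [E [b [S' [E0 hE]]]] := mult_exists.
have [K K0 HK] := TL_ext theta_Phi c_neq0 c_inv P_sch P_mom H_gt0 qv p_adm q_adm v_adm b S' E0.
have K1 : 1 <= K + 1 by rewrite lerDr.
have G0 : 0 < (K + 1) ^+ H by rewrite exprn_gt0.
(* As [p >= 1 / H], enlarging the norm by [(K + 1) ^+ H] divides the modular by at least [K + 1]. *)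
exists ((K + 1) ^+ H) => // T lam tT /ereal_inf_lt[_ [l [l0 hl] <-]]; rewrite lte_fin => llam.
have [||mP mB] := hE (fun=> 1) l l0.
- move=> k; rewrite exprn_ege1 ?ler1n// exprn_ile1 ?invf_le1 ?ler1n//.
- by move=> k k'; rewrite mulr1; exact:expr2_ge1.
have wE T' j x : tempered T' -> wm (fun=> 1) l j x * ampl theta T' j x = normc (dyadic_blocks theta s T' j x) / l.
 by move=> tT'; rewrite normc_dyadic// /wt_mult powR1 mulr1 mulrAC.
have a0 T' x j : 0 <= normc (dyadic_blocks theta s T' j x) by exact:normc_ge0.
have [|X [mX X0 iX hX]] := HK T _ tT mP mB.
 move=> J; apply:le_trans hl; apply:ge0_le_int_any => x//.
 under eq_bigr do rewrite wE//.
 exact:(series_root_lower (adm_gt0 x q_adm) (adm_gt0 x v_adm) (qv x) J (a0 _ x) l0).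
apply:(@le_trans _ _ ((K + 1) ^+ H * l)%:E); last by rewrite lee_fin ler_pM2l.
apply:ereal_inf_lbound; exists ((K + 1) ^+ H * l) => //; split => //.
apply:(@le_trans _ _ (\int[mu]_x (((K + 1)^-1)%:E * X x))%E).
 apply:ge0_le_int_any => x; first exact:poweR_ge0.
 apply:le_trans (series_root_upper (X := X x) (adm_gt0 x q_adm) (adm_gt0 x v_adm) (qv x) (a0 _ x) l0 G0 (X0 x) _) _.
  by move=> J; have := hX J x; under eq_bigr do rewrite wE//.
 by apply:lee_wpmul2r => //; rewrite lee_fin; apply:inverse_powR => //; exact:adm_ge.
rewrite ge0_integralZl_EFin//; apply:le_trans (lee_wpmul2l _ iX) _ => //.
by rewrite lee_fin mulrC ler_pdivrMr// mul1r lerDl.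
Qed.

(** [nu] is made positive by a geometric sequence and replaced by its envelope under [2 ^- gap];
    neighbouring terms become comparable, so that the inverses are admissible as [u] in [wt_multP].
    The sum is at most [2 * 3 * 3]: a near maximum, two-sided geometric weights, and the total of
    [nu + 2 ^- j]. *)
Lemma Besov_wts (nu : nat -> R) : (forall j, 0 <= nu j) -> (forall J, \sum_(j < J) nu j <= 1) ->
 exists lam : nat -> R, [/\ forall j, nu j < lam j, forall j, 0 < lam j,
  forall l, 2^-1 ^+ l.+2 <= (lam l)^-1 <= 2 ^+ l.+2,
  forall k l, (lam k)^-1 <= 2 ^+ (gap k l * 2) * (lam l)^-1 & forall J, \sum_(j < J) lam j <= 18].
move=> nu0 nu1; have ip m : 0 < (2^-1 : R) ^+ m by rewrite exprn_gt0.
have i1 m : (2^-1 : R) ^+ m <= 1 by rewrite exprn_ile1// invf_le1// ler1n.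
pose y j := nu j + 2^-1 ^+ j.
have y0 j : 0 < y j by rewrite ltr_wpDl.
have nuj j : nu j <= 1 by apply:le_trans (nu1 j.+1); rewrite big_ord_recr lerDr.
have y2 j : y j <= 2 by rewrite lerD.
have [lk hlk] := choice (fun k => gap_select k (fun l => ltW (y0 l)) y2).
pose lam k := 2 * (2^-1 ^+ gap k (lk k) * y (lk k)).
have ylam j : y j <= lam j by have := hlk j j; rewrite /gap subnn mul1r.
have l0 j : 0 < lam j by exact:lt_le_trans (y0 j) (ylam j).
have gg k l : lam l <= 2 * 2 ^+ gap k l * lam k.
 rewrite -mulrA; apply:ler_wpM2l => //; rewrite exprVn ler_pdivrMl//.
 have := hlk k (lk l); rewrite exprVn ler_pdivrMl// -/(lam k) => /le_trans; apply.
 rewrite [leRHS]mulrA; apply:ler_wpM2r => //.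
 by rewrite -exprD ler_weXn2l ?ler1n// addnC (gapC k l); exact:gap_triangle.
exists lam; split=> //.
- by move=> j; apply:lt_le_trans (ylam j); rewrite ltrDl.
- move=> l; apply/andP; split.
  rewrite exprVn lef_pV2 ?posrE//; apply:(@le_trans _ _ 4).
   rewrite /lam; have : 2^-1 ^+ gap l (lk l) * y (lk l) <= 2.
    by apply:le_trans (y2 (lk l)); rewrite ler_piMl.
   by move:(_ * y _) => u; lra.
  by rewrite !exprS mulrA -[4]/((2 * 2)%N%:R) natrM ler_peMr// expr2_ge1.
 rewrite -[leRHS]invrK -exprVn lef_pV2 ?posrE//; apply:le_trans (ylam l).
 by rewrite /y !exprS; have := ip l; have := nu0 l; move:(_ ^+ l) (nu l) => u w; lra.
- move=> k l; have [->|kl] := eqVneq k l; first by rewrite /gap subnn mul1r.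
 rewrite ler_pdivlMr// mulrC ler_pdivrMr//; apply:le_trans (gg k l) _.
 apply:ler_wpM2r => //.
 rewrite muln2 -addnn exprD; apply:ler_wpM2r => //.
 by rewrite -[leLHS]expr1 ler_weXn2l ?ler1n; move:kl; rewrite /gap; lia.
move=> J; have ysum J' : \sum_(j < J') y j <= 3.
 rewrite big_split/= (_ : 3%:R = 1 + 2%:R :> R)//.
 by apply:lerD; [exact:nu1|exact:geom_sum_le].
rewrite -mulr_sumr; apply:le_trans (ler_wpM2l _ (gap_select_sum lk J (fun l => ltW (y0 l)) ysum)) _ => //.
lra.
Qed.

(** The Besov modular is a sum of norms of levels. Bounding the norm of level [j] by [la j] turns it
    into one integral inequality per level, in which [la j] to the power [- 1 / q(x)] becomes part
    of the multiplier. *)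
Lemma Besov_bnd : exists2 G : R, 0 < G & forall T (lam : R), tempered T ->
 (lq_Lp_quasinorm p q (dyadic_blocks theta s T) < lam%:E)%E ->
 (lq_Lp_quasinorm p q (dyadic_blocks theta s (extD T)) <= (G * lam)%:E)%E.
have [E [b [S' [E0 hE]]]] := mult_exists.
have [K K0 HK] := Besov_ext theta_Phi c_neq0 c_inv P_sch P_mom H_gt0 qv p_adm q_adm v_adm b S' E0.
(* 18 bounds the sum of the [la j]; normalising this sum costs [18 ^ (p / q)], at most [18 ^+ H]. *)
pose Z : R := 18 ^+ H * (K + 1).
have K1 : 1 <= K + 1 by rewrite lerDr.
have e18 : 1 <= (18 : R) ^+ H by rewrite exprn_ege1// ler1n.
have Z1 : 1 <= Z by exact:mulr_ege1.
have G0 : 0 < Z ^+ H by rewrite exprn_gt0.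
exists (Z ^+ H) => // T lam tT /ereal_inf_lt[_ [l [l0 hl] <-]]; rewrite lte_fin => llam.
have tE := extD_temp P_sch P_mom tT.
pose a T' j x := normc (dyadic_blocks theta s T' j x).
have a0 T' j x : 0 <= a T' j x by exact:normc_ge0.
set N := (fun j => Lp_quasinorm (fun x => p x / q x) (fun x => ((a T j x / l) `^ q x)%:E)) in hl.
have N0 j : (0 <= N j)%E by exact:inf_ge0.
have Npart J : (\sum_(j < J) N j <= 1)%E.
 apply:le_trans hl; rewrite -(big_mkord xpredT N); apply:nneseries_lim_ge => j _ _; by [].
have Nfin j : N j \is a fin_num.
 rewrite ge0_fin_numE//; apply:le_lt_trans (_ : (1 < +oo)%E); last by rewrite ltry.
 by apply:le_trans (Npart j.+1); rewrite big_ord_recr leeDr// sume_ge0.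
have [||la [h1 h2 h3 h4 h5]] := Besov_wts (nu := fun j => fine (N j)).
- by move=> j; rewrite fine_ge0.
- by move=> J; rewrite -lee_fin -sumEFin (eq_bigr (fun j : 'I_J => N j)); [exact:Npart|move=> j _; rewrite fineK].
have [mP mB] := hE (fun k => (la k)^-1) l l0 h3 h4.
have wE T' j x : tempered T' -> (wm (fun k => (la k)^-1) l j x * ampl theta T' j x) `^ p x =
  ((a T' j x / l) `^ q x * (la j)^-1) `^ (p x / q x).
 move=> tT'; have q0 := adm_gt0 x q_adm; have la0 : 0 <= (la j)^-1 by rewrite ltW.
 have -> : wm (fun k => (la k)^-1) l j x * ampl theta T' j x = a T' j x / l * (la j)^-1 `^ (q x)^-1.
  by rewrite /a normc_dyadic// /wt_mult; move:(_ `^ _) (_ `^ _) (ampl _ _ _ _) => *; ring.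
 by rewrite [LHS]powRM// [RHS]powRM// -!powRrM qv [_^-1 * _]mulrC.
have hT j : (\int[mu]_x ((wm (fun k => (la k)^-1) l j x * ampl theta T j x) `^ p x)%:E <= 1%:E)%E.
 have : (N j < (la j)%:E)%E by rewrite -(fineK (Nfin j)) lte_fin.
 move=> /ereal_inf_lt[_ [t [t0 ht] <-]]; rewrite lte_fin => tla.
 apply:le_trans ht; apply:ge0_le_int_any => x//.
 rewrite wE//.
 rewrite gee0_abs//.
 rewrite -EFinM.
 rewrite lee_fin.
 apply:ge0_ler_powR; rewrite ?nnegrE ?(ltW (adm_gt0 x v_adm))//.
 by apply:ler_wpM2l => //; rewrite lef_pV2 ?posrE.
have hk k := HK T _ tT mP mB hT k.
apply:(@le_trans _ _ (Z ^+ H * l)%:E); last by rewrite lee_fin ler_pM2l.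
apply:ereal_inf_lbound; exists (Z ^+ H * l); last reflexivity.
split; first exact:(mulr_gt0 G0 l0).
have block_le k : (Lp_quasinorm v (fun x => ((a (extD T) k x / (Z ^+ H * l)) `^ q x)%:E) <= (la k / 18)%:E)%E.
 apply:ereal_inf_lbound; exists (la k / 18) => //; split => //.
 apply:(@le_trans _ _ (\int[mu]_x (((K + 1)^-1)%:E * ((wm (fun k => (la k)^-1) l k x * ampl theta (extD T) k x) `^ p x)%:E))%E).
  apply:ge0_le_int_any => x; first exact:poweR_ge0.
  rewrite gee0_abs//.
  rewrite wE// lee_fin.
  have -> : (a (extD T) k x / (Z ^+ H * l)) `^ q x / (la k / 18) = ((Z ^+ H)^-1 `^ q x * 18) * ((a (extD T) k x / l) `^ q x * (la k)^-1).
   rewrite invfM mulrCA [_ `^ q x in LHS]powRM// invf_div; ring.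
  rewrite [leLHS]powRM//; apply:ler_wpM2r => //.
  rewrite powRM// -powRrM qv.
  apply:(@le_trans _ _ (Z^-1 * 18 ^+ H)).
   apply:ler_pM; rewrite//; first by apply:inverse_powR => //; exact:adm_ge.
   by apply:powR_exp_le; [rewrite ler1n|exact:(adm_le x v_adm)].
  rewrite invfM mulrC mulrA mulfV ?mul1r//.
 rewrite ge0_integralZl_EFin//; first last.
 - apply/measurable_EFinP; apply:mbl_powR2; last by case:p_adm.
  have [mm _ _ _] := mP; apply:measurable_funM; by case:(ampl_slow theta k tE).
 apply:le_trans (lee_wpmul2l _ (hk k)) _ => //.
 by rewrite lee_fin mulrC ler_pdivrMr// mul1r lerDl.
apply:lime_le; first by apply:is_cvg_nneseries => k _ _; exact:inf_ge0.
apply:nearW => J; rewrite big_mkord; apply:(@le_trans _ _ (\sum_(k < J) (la k / 18)%:E)%E).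
 by apply:lee_sum => k _; exact:block_le.
by rewrite sumEFin lee_fin -mulr_suml ler_pdivrMr// mul1r.
Qed.

Theorem quasinorm_bnd (A : scale) : exists2 G : R, 0 < G & forall T (lam : R), tempered T ->
 (A_quasinorm A theta s p q T < lam%:E)%E -> (A_quasinorm A theta s p q (extD T) <= (G * lam)%:E)%E.
by case:A; [exact:Besov_bnd|exact:TL_bnd]. Qed.

End quasinorms.

(** * Locality: restriction to the half space *)

Section half_space_extension.
Context (R : realType) (n : nat).
Local Notation d := n.+1.
Local Notation V := 'rV[R]_d.
Local Notation C := R[i].
Local Notation S := (schwartz R d).
Local Notation Om := (half_space R n).
Implicit Types (f : V -> R) (x y z : V) (T : S -> C) (t : (V -> R) -> R).

Lemma rtempB t t' : rtemp t -> rtemp t' -> rtemp (fun f => t f - t' f).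
move=> [lt [k [A A0 HA]]] [lt' [k' [A' A'0 HA']]]; split.
 by move=> a f g Hf Hg; rewrite lt// lt'//; ring.
exists (maxn k k'), (A + A') => //.
move=> f B Hf HB; apply:le_trans (ler_normB _ _) _; rewrite mulrDl; apply:lerD.
 by apply:HA => //; apply:rbnd_le HB; rewrite ?leq_maxl.
by apply:HA' => //; apply:rbnd_le HB; rewrite ?leq_maxr.
Qed.
Hint Resolve rtempB : fn.

Lemma temp0 : tempered (0 : S -> C).
split; first by move=> a f g; rewrite mulr0 addr0.
by exists 0, 0%N => phi; rewrite mul0r ComplexField.Normc.normc0.
Qed.

Variable b : V -> R.
Hypothesis b_sch : rsch b.
Hypothesis b0 : b 0 = 1.
Hypothesis b_supp : forall x, b x != 0 -> `|x| <= 2.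

Lemma cutoff_testfun f (r e : R) : rsch f -> 0 < r -> 0 < e -> (forall x, lastc x < r -> f x = 0) ->
 test_function Om (toC (fun x => f x * b (e *: x))).
move=> Hf r0 e0 fr.
have Hb : rsch (fun x => b (e *: x)).
 have -> : (fun x => b (e *: x)) = b \o aff e 0 by apply/funext => y; rewrite /= /aff addr0.
 by [].
have sub : supp (toC (fun x => f x * b (e *: x))) `<=` [set x : V | `|x| <= 2 / e] `&` [set x | r <= lastc x].
 have cl : closed ([set x : V | `|x| <= 2 / e] `&` [set x | r <= lastc x]).
  apply:closedI.
   by apply:(@closed_comp _ _ (fun x : V => `|x|) [set y | y <= 2 / e]) => [x _|] //; exact:norm_continuous.
  by apply:(@closed_comp _ _ (@lastc R n) [set y | r <= y]) => [x _|] //; exact:coord_continuous.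
 apply:subset_trans cl; apply:closureS => x /= nz; split.
  rewrite ler_pdivlMr// mulrC -[X in X * _]gtr0_norm// -normrZ; apply:b_supp.
  by apply:contra nz => /eqP bz; rewrite /toC bz mulr0.
 by rewrite leNgt; apply:contra nz => /fr fz; rewrite /toC fz mul0r.
split.
- by have /asboolP[] := schwartzP (to_schwartz (toC (fun x => f x * b (e *: x)))); rewrite to_schE.
- apply:bounded_closed_compact; last exact:closed_closure.
 exists (2 / e); split=> [|M /ltW hM]; first exact:num_real.
 by move=> x /sub[ + _] => /le_trans; apply.
- by move=> x /sub[_]; rewrite /=; exact:lt_le_trans.
Qed.

(** [f] need not have compact support, so the distributions on the half space cannot be applied to
    it; its cut-offs are test functions there, and [cutoff_temp] passes to the limit. *)
Lemma tpart_local (T T1 T2 : S -> C) c f (r : R) : tempered T -> tempered T1 -> tempered T2 ->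
 restrict_dist Om T = restrict_dist Om T1 - restrict_dist Om T2 ->
 rsch f -> 0 < r -> (forall x, lastc x < r -> f x = 0) ->
 tpart c T f = tpart c T1 f - tpart c T2 f.
move=> tT tT1 tT2 E Hf r0 fr; apply/eqP; rewrite -subr_eq0; apply/eqP.
pose t g := tpart c T g - (tpart c T1 g - tpart c T2 g).
rewrite -[LHS]/(t f); apply:(cutoff_temp b_sch b0) => //.
 by apply:rtempB.
move=> e e0; have tf := cutoff_testfun Hf r0 e0 fr; rewrite /t /tpart /ev.
have tp : toC (fun x => f x * b (e *: x)) \in @testfun_pred R d Om by exact/asboolP.
have -> : to_schwartz (toC (fun x => f x * b (e *: x))) = schwartz_of_testfun (Testfun tp).
 apply/val_inj; rewrite insubdK//; apply/asboolP; exact:test_function_schwartz tf.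
set u := Testfun _; rewrite -[T _]/(restrict_dist Om T u) E.
rewrite -[T1 _]/(restrict_dist Om T1 u) -[T2 _]/(restrict_dist Om T2 u).
rewrite [(_ - _ : _ -> _) u]/(restrict_dist Om T1 u - restrict_dist Om T2 u).
by case:c {t}; rewrite raddfB subrr.
Qed.

Variable P : V -> R.
Hypothesis P_sch : rsch P.
Hypothesis P_supp : usupp P.
Hypothesis P_mom : unit_mom P.

Lemma extB t t' chi : rtemp t -> rtemp t' -> rsch chi ->
 extension P (fun f => t f - t' f) chi = extension P t chi - extension P t' chi.
move=> ht ht' Hc; have H := ext_cvg P_sch P_mom (rtempB ht ht') Hc.
apply:(cvg_unique _ H) => //.
have -> : (fun J => \sum_(j < J) ext_term P (fun f => t f - t' f) j chi) =
  (fun J => (\sum_(j < J) ext_term P t j chi) - \sum_(j < J) ext_term P t' j chi).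
 apply/funext => J; rewrite -sumrB; apply:eq_bigr => j _; rewrite /ext_term -RintB.
 - by apply:eq_Rintegral => y _; ring.
 - exact:rint_half (rint_term P_sch P_mom j ht Hc).
 - exact:rint_half (rint_term P_sch P_mom j ht' Hc).
by apply:cvgB; exact:ext_cvg.
Qed.

(** Stated for a difference so that it yields uniqueness, with [T2 = 0], as well as the extension of
    a difference needed for continuity. *)
Lemma extD_local (T T1 T2 : S -> C) : tempered T -> tempered T1 -> tempered T2 ->
 restrict_dist Om T = restrict_dist Om T1 - restrict_dist Om T2 ->
 extD P T = extD P T1 - extD P T2.
move=> tT tT1 tT2 E; apply/funext => phi.
have [p1 p2] := sch_csch phi.
have H c (h : V -> R) : rsch h -> extension P (tpart c T) h = extension P (tpart c T1) h - extension P (tpart c T2) h.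
 move=> Hh; rewrite -extB//; try exact:tpart_temp.
 by congr (_ h); apply:ext_local => // f r Hf r0 fr; exact:(tpart_local c tT tT1 tT2 E Hf r0 fr).
rewrite -[RHS]/(extD P T1 phi - extD P T2 phi) /extD /ofparts !H//.
by apply:ceqP; rewrite raddfB /=; ring.
Qed.

Lemma extD_unique (T1 T2 : S -> C) : tempered T1 -> tempered T2 ->
 restrict_dist Om T1 = restrict_dist Om T2 -> extD P T1 = extD P T2.
move=> t1 t2 E; have r0 : restrict_dist Om (0 : S -> C) = 0 by apply/funext.
have := extD_local temp0 t2 t2; rewrite !subrr => /(_ erefl) e0.
have := extD_local t1 t2 temp0; rewrite r0 e0 !subr0; exact.
Qed.

Lemma restrict_extD T : tempered T -> restrict_dist Om (extD P T) = restrict_dist Om T.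
move=> tT; apply/funext => phi; set u := schwartz_of_testfun phi.
have /asboolP[_ _ sO] := testfunP phi.
have [p1 p2] := sch_csch u.
have z x : lastc x <= 0 -> phi x = 0.
 move=> x0; apply/eqP; apply:contrapT => /negP nz.
 have px : supp phi x by exact:subset_closure.
 by have := sO x px; rewrite /half_space /= ltNge x0.
rewrite /restrict_dist /= -/u /extD /ofparts !ext_upper//; try exact:tpart_temp;
 try by move=> x /z; rewrite /= => ->.
rewrite -ev_parts//; [|by case:tT].
by rewrite /ev; congr T; apply/val_inj; rewrite /= to_schE.
Qed.

End half_space_extension.
Hint Resolve rtempB : fn.

Lemma half_space_ker (R : realType) (n : nat) (b : 'rV[R]_n.+1 -> R) : rsch b -> (forall x, 0 <= b x) ->
 b 0 = 1 -> (forall x, b x != 0 -> `|x| <= 2) ->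
 exists P : 'rV[R]_n.+1 -> R, [/\ rsch P, usupp P & unit_mom P].
(* The bump has radius at most 2, so its translate by 4 along the last axis vanishes below height
   2. *)
move=> Hb bge b0 b_supp; pose v : 'rV[R]_n.+1 := 4 *: delta_mx 0 ord_max.
have Hc : rsch (fun x => b (x - v)) by exact:rsch_shift.
have cs x : lastc x < 2 -> b (x - v) = 0.
 move=> x2; apply/eqP; apply:contrapT => /negP/b_supp; apply/negP; rewrite -ltNge.
 apply:lt_le_trans (coord_le_norm (x - v) ord_max); rewrite /lastc in x2.
 by rewrite !mxE eqxx mulr1 ltr_normr; apply/orP; right; lra.
have ci : \int[lebesgue_rV R n.+1]_y b (y - v) != 0.
 rewrite gt_eqF// Rint_transl; last exact:rsch_rint.
 apply:(@Rint_gt0 _ _ _ 0) => //; [exact:rsch_rint|by rewrite b0].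
exists (kerP Hc cs ci).
by split => //; [exact:kerP_supp|exact:kerP_mom].
Qed.

Theorem theorem6p8 (R : realType) (n : nat)
    (theta : nat -> schwartz R n.+1) (theta_Phi : Phi theta)
    (A : scale) (N : nat) (N_gt0 : (0 < N)%N) :
  exists Ext : (testfun (half_space R n) -> R[i]) -> (schwartz R n.+1 -> R[i]),
  forall p q s : 'rV[R]_n.+1 -> R,
    Clog p -> P0 p -> Clog q -> P0 q -> Clog s ->
    ((N%:R^-1)%:E <= ess_inf (lebesgue_rV R n.+1) (EFin \o p))%E ->
    ((N%:R^-1)%:E <= ess_inf (lebesgue_rV R n.+1) (EFin \o q))%E ->
    (ess_sup (lebesgue_rV R n.+1) (EFin \o s) <= N%:R%:E)%E ->
    continuous_between
      (A_space_half A theta s p q) (A_quasinorm_half A theta s p q)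
      (A_space A theta s p q) (A_quasinorm A theta s p q) Ext
    /\
    forall f, A_space_half A theta s p q f ->
      restrict_dist (half_space R n) (Ext f) = f.
Proof.
have Sb := bump_sch theta; have b0 := bump0 theta_Phi; have sb := bump_supp theta_Phi.
have [P [PS Ps Pm]] := half_space_ker Sb (bump_ge0 theta) b0 sb.
have [c c0 cE] := inv_constant theta_Phi.
pose rep f := [set T : schwartz R n.+1 -> R[i] | tempered T /\ restrict_dist (half_space R n) T = f].
(* Any tempered representative is chosen, without reference to a space or to exponents; [ExtE] then
   allows a better one to be substituted. *)
exists (fun f => extD P (xget 0 (rep f))) => p q s Cp _ Cq _ Cs pN qN _.
have ExtE T : tempered T -> extD P (xget 0 (rep (restrict_dist (half_space R n) T))) = extD P T.
 move=> tT; have [t0 r0] : rep (restrict_dist (half_space R n) T) (xget 0 (rep (restrict_dist (half_space R n) T))).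
  by apply:(xgetPex 0); exists T.
 exact:(extD_unique Sb b0 sb PS Ps Pm t0 tT r0).
have [H [cc [H0 ap aq av [sH qH]]]] := expos N_gt0 Cp Cq Cs pN qN.
have [G G0 HG] := quasinorm_bnd theta_Phi c0 cE PS Pm H0 ap aq av sH qH Cs Cq A.
split; last by move=> _ [_ [T [tT _] ->]]; rewrite (ExtE T tT); exact:(restrict_extD PS Ps Pm tT).
split=> [_ [_ [T [tT qT] ->]]|_ [_ [T [tT _] ->]] e e0].
 rewrite (ExtE T tT); split; first exact:(extD_temp PS Pm tT).
 have [lam ql] : exists lam : R, (A_quasinorm A theta s p q T < lam%:E)%E.
  move:qT; case:(A_quasinorm _ _ _ _ _ _) => [r _|//|_]; last by exists 0; rewrite ltNyr.
  by exists (r + 1); rewrite lte_fin ltrDl.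
 by apply:le_lt_trans (HG T lam tT ql) _; rewrite ltry.
(* [quasinorm_bnd] concludes with a weak inequality; the factor 2 restores strictness. *)
exists (e / (2 * G)) => //.
(* The difference of the representatives [T'] and [T] need not be small. A nearly optimal
   representative [h] of the difference on the half space is, and by locality it has the same
   extension. *)
move=> _ [_ [T' [tT' _] ->]] /ereal_inf_lt[_ [h [[th _] hE] <-]] hlt; rewrite (ExtE T' tT') (ExtE T tT).
rewrite -(extD_local Sb b0 sb PS Ps Pm th tT' tT (esym hE)).
apply:le_lt_trans (HG h _ th hlt) _; rewrite lte_fin.
have -> : G * (e / (2 * G)) = e / 2 by field; rewrite gt_eqF.
by rewrite gtr_pMr// invf_lt1// ltr1n.
Qed.
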